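(* Let $d\in\{2,3\}$, let $D\subset\mathbb R^d$ be a bounded domain, and let $f$ be a $\mathbb C$-valued centered GMIG random field of order $-m$ in $D$, whose covariance and relation operators have principal symbols $a^c(x)|\xi|^{-m}$ and $a^r(x)|\xi|^{-m}$, respectively, with $a^c,a^r\in C_0^\infty(D)$, and $m\in(d-4,d]$. Let $$u^\infty(\hat x,\kappa)=-C_d\,\kappa^{\frac{d-3}2}\int_{\mathbb R^d}e^{-{\rm i}\kappa\hat x\cdot y}f(y)\,dy .$$ Then for all $\hat x\in\mathbb S^{d-1}$ and $\tau\ge0$, it holds almost surely that $$\lim_{Q\to\infty}\frac1Q\int_Q^{2Q}\kappa^{m+3-d}\,u^\infty(\hat x,\kappa+\tau)\overline{u^\infty(\hat x,\kappa)}\,d\kappa=|C_d|^2\,\widehat{a^c}(\tau\hat x),$$ $$\lim_{Q\to\infty}\frac1Q\int_Q^{2Q}\kappa^{m+3-d}\,u^\infty(\hat x,\kappa+\tau)u^\infty(-\hat x,\kappa)\,d\kappa=C_d^2\,\widehat{a^r}(\tau\hat x).$$ Moreover, for any nonempty open set $\Theta\subset\mathbb R_+\times\mathbb S^{d-1}$, the functions $a^c$ and $a^r$ are uniquely determined by the values of the first and, respectively, the second of these limits for $(\tau,\hat x)\in\Theta$.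
   Context: Constants: $C_2=\frac{e^{{\rm i}\pi/4}}{\sqrt{8\pi}}$, $C_3=\frac1{4\pi}$. $\mathbb R_+=(0,\infty)$. Fourier transform: $\hat\varphi(\xi)=\int_{\mathbb R^d}e^{-{\rm i}x\cdot\xi}\varphi(x)\,dx$. The function $u^\infty$ is the far-field pattern of the radiating solution $u$ of $\Delta u+\kappa^2u=f$ in $\mathbb R^d$ (with $f$ independent of $\kappa>0$), i.e. $u(x,\kappa)=\frac{e^{{\rm i}\kappa|x|}}{|x|^{(d-1)/2}}\left(u^\infty(\hat x,\kappa)+O(|x|^{-1})\right)$ as $|x|\to\infty$, $\hat x=x/|x|$. The integral defining $u^\infty$ is the pairing of the compactly supported distribution $f$ with the smooth function $y\mapsto e^{-{\rm i}\kappa\hat x\cdot y}$. Random fields. $(\Omega,\mathcal F,\mathbb P)$ is a complete probability space; $\mathcal D(\mathbb R^d)=C_0^\infty(\mathbb R^d;\mathbb C)$ and $\mathcal D'(\mathbb R^d)$ is the space of distributions, with bilinear pairing $\langle\cdot,\cdot\rangle$. A $\mathbb C$-valued generalized Gaussian random field is a map $f:\Omega\to\mathcal D'(\mathbb R^d)$ such that $\langle f,\psi\rangle$ is a $\mathbb C$-valued Gaussian random variable for every $\psi\in\mathcal D(\mathbb R^d)$; it is centered if $\mathbb E\langle f,\psi\rangle=0$ for all $\psi$. For centered $f$, the covariance operator $\mathcal C_f$ and relation operator $\mathcal R_f$, both $\mathcal D(\mathbb R^d)\to\mathcal D'(\mathbb R^d)$, are defined by $\langle\mathcal C_f\varphi,\psi\rangle=\mathbb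 E[\langle\overline f,\varphi\rangle\langle f,\psi\rangle]$ and $\langle\mathcal R_f\varphi,\psi\rangle=\mathbb E[\langle f,\varphi\rangle\langle f,\psi\rangle]$. Symbols: $\mathcal S^{-m}(\mathbb R^d\times\mathbb R^d)$ is the set of $\sigma\in C^\infty(\mathbb R^d\times\mathbb R^d)$ with $|\partial_\xi^{\gamma_1}\partial_x^{\gamma_2}\sigma(x,\xi)|\le C_{\gamma_1,\gamma_2}(1+|\xi|)^{-m-|\gamma_1|}$ for all multi-indices $\gamma_1,\gamma_2$. GMIG (generalized microlocally isotropic Gaussian) of order $-m$ in $D$: $\mathcal C_f$ and $\mathcal R_f$ are pseudo-differential operators, $\mathcal C_f\varphi(x)=(2\pi)^{-d}\int e^{{\rm i}x\cdot\xi}\sigma^c(x,\xi)\hat\varphi(\xi)\,d\xi$ and $\mathcal R_f\varphi(x)=(2\pi)^{-d}\int e^{{\rm i}x\cdot\xi}\sigma^r(x,\xi)\hat\varphi(\xi)\,d\xi$, and for $\eta\in\{c,r\}$: $\sigma^\eta\in\mathcal S^{-m}$, $\sigma^\eta(\cdot,\xi)\in C_0^\infty(D)$ for every $\xi$, and $\sigma^\eta(x,\xi)=a^\eta(x)|\xi|^{-m}+b^\eta(x,\xi)$ for $|\xi|\ge1$, with $a^\eta\in C_0^\infty(D)$, $b^\eta\in\mathcal S^{-m-1}$, $b^\eta(\cdot,\xi)\in C_0^\infty(D)$. In particular $f$ is almost surely a distribution supported in $\overline D$. *)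

(* Defs.v *)
From HB Require Import structures.
From mathcomp Require Import all_boot all_order all_algebra.
From mathcomp Require Import all_classical all_reals all_analysis.
From mathcomp Require Import complex.
Set Implicit Arguments.
Unset Strict Implicit.
Unset Printing Implicit Defensive.
Import Order.TTheory GRing.Theory Num.Theory numFieldNormedType.Exports.
Local Open Scope classical_set_scope.
Local Open Scope ring_scope.

Section product_power.
Variables (R : realType) (disp : measure_display) (T : measurableType disp).
Variable mu : {sigma_finite_measure set T -> \bar R}.

Definition tuple_cons n (p : T * n.-tuple T) : n.+1.-tuple T :=
  [tuple of p.1 :: p.2].

Lemma measurable_tuple_cons n : measurable_fun setT (@tuple_cons n).
Proof. exact: (measurable_cons measurable_fst measurable_snd). Qed.

Section step.
Variables (n : nat) (nu : {sigma_finite_measure set n.-tuple T -> \bar R}).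

Definition product_step : set (n.+1.-tuple T) -> \bar R :=
  pushforward (mu \x nu)%E (@tuple_cons n).

Let prod_measure : {measure set (T * n.-tuple T)%type -> \bar R} :=
  (mu \x nu)%E.

Let step_measure :
    {measure set (n.+1.-tuple T) -> \bar R} :=
  measure_function_pushforward__canonical__measure_function_Measure
    prod_measure (@measurable_tuple_cons n).

Let step0 : product_step set0 = 0%E.
Proof. exact: (measure0 step_measure). Qed.

Let step_ge0 A : (0 <= product_step A)%E.
Proof. exact: (measure_ge0 step_measure). Qed.

Let step_sigma_additive : semi_sigma_additive product_step.
Proof. exact: (@measure_semi_sigma_additive _ _ _ step_measure). Qed.

HB.instance Definition _ := isMeasure.Build _ _ _ product_step
  step0 step_ge0 step_sigma_additive.

Let step_sigma_finite : sigma_finite setT product_step.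
Proof.
have /sigma_finiteP[F [TF ndF Foo]] := sigma_finiteT mu.
have /sigma_finiteP[G [TG ndG Goo]] := sigma_finiteT nu.
pose u (t : n.+1.-tuple T) := (thead t, [tuple of behead t]).
have uK : u \o @tuple_cons n = id.
  apply/funext => -[a t]; rewrite /u /tuple_cons /= theadE.
  by congr pair; exact: val_inj.
have mu_u : measurable_fun setT u.
  apply/measurable_fun_pairP; split; first exact: (measurable_tnth ord0).
  exact: measurable_behead.
exists (fun k => u @^-1` (F k `*` G k)).
  apply/esym; rewrite -subTset => t _.
  have [i _ Fi] : (\bigcup_i F i) (u t).1 by rewrite -TF.
  have [j _ Gj] : (\bigcup_i G i) (u t).2 by rewrite -TG.
  exists (maxn i j) => //; split.
  - by move: Fi; exact/subsetPset/ndF/leq_maxl.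
  - by move: Gj; exact/subsetPset/ndG/leq_maxr.
move=> k; have [mF Fk] := Foo k; have [mG Gk] := Goo k; split.
  by rewrite -[X in measurable X]setTI; apply: mu_u => //; exact: measurableX.
rewrite /product_step /pushforward -comp_preimage uK preimage_id.
by rewrite product_measure1E// lte_mul_pinfty// ge0_fin_numE.
Qed.

HB.instance Definition _ := Measure_isSigmaFinite.Build _ _ _ product_step
  step_sigma_finite.

End step.

(* The n-fold product measure, on n-tuples. *)
Fixpoint product_power n : {sigma_finite_measure set n.-tuple T -> \bar R} :=
  match n with
  | 0 => \d_ [tuple]
  | k.+1 => product_step (product_power k)
  end.

End product_power.

Section complex_valued.
Variable R : realType.
Local Notation C := R[i].

Definition cis (t : R) : C := (cos t +i* sin t)%C.

Definition cintegral (disp : measure_display) (T : measurableType disp)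
    (mu : {measure set T -> \bar R}) (A : set T) (g : T -> C) : C :=
  (Rintegral mu A (fun t => complex.Re (g t)) +i*
   Rintegral mu A (fun t => complex.Im (g t)))%C.

Definition cexpectation (disp : measure_display) (T : measurableType disp)
    (P : probability T R) (Z : T -> C) : C :=
  (fine 'E_P[fun w => complex.Re (Z w)] +i*
   fine 'E_P[fun w => complex.Im (Z w)])%C.

Section smooth.
Variable V : normedModType R.
Implicit Types (g : V -> C) (v : V).

Definition ccontinuous g :=
  continuous (fun x => complex.Re (g x)) /\
  continuous (fun x => complex.Im (g x)).

Definition cderivable g x v :=
  derivable (fun y => complex.Re (g y)) x v /\
  derivable (fun y => complex.Im (g y)) x v.

Definition cderive v g : V -> C := fun x =>
  ('D_v (fun y => complex.Re (g y)) x +i*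
   'D_v (fun y => complex.Im (g y)) x)%C.

Definition cderives (s : seq V) g : V -> C := foldr cderive g s.

(* In finite dimension this is C^oo: the directional derivatives of all orders,
   along all tuples of directions, exist and are continuous. *)
Definition smooth g :=
  forall s : seq V, ccontinuous (cderives s g) /\
    forall x v, cderivable (cderives s g) x v.

End smooth.

Definition gaussian_rv (disp : measure_display) (T : measurableType disp)
    (P : probability T R) (X : T -> R) :=
  measurable_fun setT X /\
  ((exists (mu sigma : R), 0 < sigma /\
      forall A, measurable A -> P (X @^-1` A) = normal_prob mu sigma A) \/
   (exists mu : R, {ae P, forall w, X w = mu})).

(* Joint Gaussianity of the real and imaginary parts, degenerate laws
   included. *)
Definition cgaussian_rv (disp : measure_display) (T : measurableType disp)
    (P : probability T R) (Z : T -> C) :=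
  forall a b : R,
    gaussian_rv P (fun w => a * complex.Re (Z w) + b * complex.Im (Z w)).

End complex_valued.

Section euclidean.
Variables (R : realType) (d : nat).
Local Notation C := R[i].
Local Notation E := 'rV[R]_d.
Implicit Types (x y xi : E) (phi psi : E -> C).

Definition dotv x y : R := \sum_i x 0 i * y 0 i.

(* The canonical norm on matrices is the sup norm. *)
Definition enorm x : R := Num.sqrt (dotv x x).

Definition unit_sphere : set E := [set x | enorm x = 1].

Definition bounded_domain (D : set E) :=
  [/\ open D, connected D, D !=set0 & bounded_set D].

Definition basis_vec (i : 'I_d) : E := delta_mx 0 i.

(* The multi-index derivative; a multi-index is listed as a sequence of
   coordinate directions, so its order is the size of the list. *)
Definition mderive (s : seq 'I_d) phi : E -> C :=
  cderives [seq basis_vec i | i <- s] phi.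

Definition Rd_integral phi : C :=
  cintegral (product_power (@lebesgue_measure R) d) setT
    (fun t : d.-tuple (measurableTypeR R) => phi (\row_i tnth t i)).

Definition fourier phi : E -> C := fun xi =>
  Rd_integral (fun x => cis (- dotv x xi) * phi x).

(* The space C_0^oo(D). *)
Definition test_function (D : set E) phi :=
  smooth phi /\
  exists K : set E, [/\ compact K, K `<=` D & forall x, ~ K x -> phi x = 0].

(* Only the values of a functional on C_0^oo(R^d) are meaningful. *)
Definition is_distribution (T : (E -> C) -> C) :=
  (forall (a : C) phi psi,
     test_function setT phi -> test_function setT psi ->
     T (fun x => a * phi x + psi x) = a * T phi + T psi) /\
  (forall K : set E, compact K ->
     exists (N : nat) (B : R), forall phi (M : R),
       smooth phi -> (forall x, ~ K x -> phi x = 0) ->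
       (forall s, (size s <= N)%N -> forall x, `|mderive s phi x| <= M%:C%C) ->
       `|T phi| <= (B * M)%:C%C).

Record distributions := Distribution {
  pairing :> (E -> C) -> C ;
  _ : is_distribution pairing }.

Definition supported_in (T : distributions) (K : set E) :=
  forall phi, test_function (~` K) phi -> T phi = 0.

(* The pairing of a compactly supported distribution with a smooth function g:
   <T, chi g> for any cutoff chi equal to 1 near a compact set supporting T.
   The value does not depend on chi; it is 0 by convention if T does not have
   compact support. *)
Definition compact_pairing (T : distributions) (g : E -> C) : C :=
  xget 0 [set z | exists (K U : set E) (chi : E -> C),
    [/\ compact K /\ supported_in T K,
        open U /\ K `<=` U,
        test_function setT chi,
        forall x, U x -> chi x = 1 &
        z = T (fun x => chi x * g x)]].

(* The class S^r. *)
Definition symbol_class (r : R) (sigma : E -> E -> C) :=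
  let s2 : E * E -> C := fun p => sigma p.1 p.2 in
  smooth s2 /\
  forall g1 g2 : seq 'I_d, exists K : R, forall x xi,
    `|cderives ([seq ((0 : E), basis_vec i) | i <- g1] ++
                [seq (basis_vec i, (0 : E)) | i <- g2]) s2 (x, xi)|
      <= (K * (1 + enorm xi) `^ (r - (size g1)%:R))%:C%C.

Definition psido (sigma : E -> E -> C) phi : E -> C := fun x =>
  (((2 * pi) ^- d)%:C)%C *
  Rd_integral (fun xi => cis (dotv x xi) * sigma x xi * fourier phi xi).

Definition isotropic_symbol (m : R) (D : set E) (a : E -> C)
    (sigma : E -> E -> C) :=
  [/\ symbol_class (- m) sigma,
      forall xi, test_function D (sigma ^~ xi),
      test_function D a &
      exists b : E -> E -> C,
        [/\ symbol_class (- m - 1) b,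
            forall xi, test_function D (b ^~ xi) &
            forall x xi, 1 <= enorm xi ->
              sigma x xi = a x * ((enorm xi `^ (- m))%:C)%C + b x xi]].

Section random_fields.
Variables (disp : measure_display) (Omega : measurableType disp).
Variable P : probability Omega R.
Implicit Type f : Omega -> distributions.

Definition gaussian_field f :=
  forall psi, test_function setT psi -> cgaussian_rv P (fun w => f w psi).

Definition centered_field f :=
  forall psi, test_function setT psi -> cexpectation P (fun w => f w psi) = 0.

(* conj f is the distribution phi |-> conj <f, conj phi>. *)
Definition covariance_op f phi psi : C :=
  cexpectation P (fun w => (f w (fun x => (phi x)^*))^* * f w psi).

Definition relation_op f phi psi : C :=
  cexpectation P (fun w => f w phi * f w psi).

(* The operator A : D(R^d) -> D'(R^d), given by its values <A phi, psi>, is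
   the pseudo-differential operator of symbol sigma. *)
Definition is_psido (A : (E -> C) -> (E -> C) -> C) (sigma : E -> E -> C) :=
  forall phi psi, test_function setT phi -> test_function setT psi ->
    A phi psi = Rd_integral (fun x => psido sigma phi x * psi x).

(* Centered GMIG fields of order -m in D, with principal symbols
   ac(x) |xi|^-m and ar(x) |xi|^-m. *)
Definition GMIG (m : R) (D : set E) (ac ar : E -> C) f :=
  [/\ gaussian_field f, centered_field f,
      exists sigma, isotropic_symbol m D ac sigma /\
                    is_psido (covariance_op f) sigma &
      exists sigma, isotropic_symbol m D ar sigma /\
                    is_psido (relation_op f) sigma].

End random_fields.

(* C_2 and C_3; only d = 2, 3 are used. *)
Definition Cst : C :=
  if d == 2%N then ((Num.sqrt (8 * pi))^-1)%:C%C * cis (pi / 4)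
  else ((4 * pi)^-1)%:C%C.

Definition far_field (f : distributions) (xhat : E) (kappa : R) : C :=
  - Cst * (kappa `^ ((d%:R - 3) / 2))%:C%C *
  compact_pairing f (fun y => cis (- (kappa * dotv xhat y))).

Definition weighted_mean (m Q : R) (g : R -> C) : C :=
  (Q^-1)%:C%C *
  cintegral (@lebesgue_measure R) `[Q, 2 * Q]
    (fun kappa => (kappa `^ (m + 3 - d%:R))%:C%C * g kappa).

Definition covariance_mean (m : R) (f : distributions) xhat (tau Q : R) : C :=
  weighted_mean m Q (fun kappa =>
    far_field f xhat (kappa + tau) * (far_field f xhat kappa)^*).

Definition relation_mean (m : R) (f : distributions) xhat (tau Q : R) : C :=
  weighted_mean m Q (fun kappa =>
    far_field f xhat (kappa + tau) * far_field f (- xhat) kappa).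

Definition relatively_open (A : set (R * E)) (Theta : set (R * E)) :=
  exists U : set (R * E), open U /\ Theta = U `&` A.

End euclidean.
Arguments Cst : clear implicits.

(* Main.v *)
(* A packet is e_k(y) = exp(-i k xhat.y) cut off outside a neighbourhood of D, and
   Z(k) = <f, e_k> for real k; almost surely f is supported in a fixed ball, and
   then the far fields in the directions xhat and -xhat at frequency k are Z(k)
   and Z(-k) up to explicit factors. Expanding the symbols to first order, with
   Fourier inversion for the cutoff,
     E[Z(k1) Z(k2)]      = |k2|^-m (ar)^((k1 + k2) xhat) + O(|k2|^(-m-1)),
     E[Z(k1) conj Z(k2)] = |k2|^-m (ac)^((k1 - k2) xhat) + O(|k2|^(-m-1)).
   One integration by parts makes these transforms O(1 / (1 + |k1 +- k2|)), so the
   weighted real and imaginary parts are centered jointly Gaussian processes whose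
   covariances C(k, k') are bounded by 1 / (1 + |k - k'|) + 1/k + 1/k'. A product is
   a difference of squares, Cov(A^2, B^2) = 2 E[AB]^2, hence the integral over
   [1, Q] of A^2 - E A^2 has variance O(Q); it is o(Q) almost surely, first along
   Q = n^2, where the second moments of the means are summable, and then for all Q
   by monotonicity of the integral of A^2.
   Uniqueness: the limits determine the Fourier transform of a compactly supported
   function on an open set; its Taylor coefficients at a point of this set are the
   integrals of the function against polynomials times a fixed wave, and suitable
   polynomials concentrate at any given point. *)

Require Import Defs.
From HB Require Import structures.
From mathcomp Require Import all_boot all_order all_algebra.
From mathcomp Require Import all_classical all_reals all_analysis.
From mathcomp Require Import complex measurable_realfun.
From mathcomp Require Import ring lra.
Import Order.TTheory GRing.Theory Num.Theory numFieldNormedType.Exports.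
Set Implicit Arguments.
Unset Strict Implicit.
Unset Printing Implicit Defensive.
Local Open Scope classical_set_scope.
Local Open Scope ring_scope.

(** * Smooth functions and cutoffs *)

Section smooth_calculus.
Variables (R : realType) (V : normedModType R).
Implicit Types (g h : V -> R).

(** The field is complex, so conj Z(k) and Z(-k) are different variables, and the covariances of Re
    Z and Im Z are determined only by the covariance and the relation kernel together: each mixed
    moment is half a sum or difference of the two. Both limits are therefore treated at once, with a
    sign in the second frequency telling them apart. The decay 1 / (1 + |k - k'|) is not integrable,
    but its square is, and the Gaussian identity for squares brings in precisely the square; this is
    why one integration by parts suffices. The weight is shared evenly: once the far-field powers
    are cancelled, each frequency carries k^(m/2), which keeps the variances bounded. The almost
    sure support is not immediate. Each test function vanishing on D pairs to 0 outside a null set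
    of its own, and there are uncountably many of them; a countable family approximating them in
    every C^N norm leaves a single null set. The cutoff is a product of one-variable functions, so
    that transforms, inversion and domination all factor into coordinates; on the line, inversion is
    Abel summation with the Poisson kernel. *)

Definition derivs (s : seq V) g : V -> R :=
  foldr (fun v h x => 'D_v h x) g s.

Record rsmooth g : Prop := Rsmooth { rsmoothP :
  forall s, continuous (derivs s g) /\ forall x v, derivable (derivs s g) x v }.

Lemma cderivesE (s : seq V) (g : V -> R[i]) :
  cderives s g = fun x => (derivs s (fun y => complex.Re (g y)) x +i*
                           derivs s (fun y => complex.Im (g y)) x)%C.
Proof.
elim: s => [|v s IH] /=; first by apply/funext => x; case: (g x).
by rewrite IH.
Qed.

Lemma smoothE (g : V -> R[i]) : smooth g <->
  rsmooth (fun x => complex.Re (g x)) /\ rsmooth (fun x => complex.Im (g x)).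
Proof.
split=> [sg|[[sr] [si]] s].
  split; split=> s; have := sg s; rewrite cderivesE => -[[c1 c2] d].
    by split=> [|x v]; [exact: c1|exact: (d x v).1].
  by split=> [|x v]; [exact: c2|exact: (d x v).2].
rewrite cderivesE; have [c1 d1] := sr s; have [c2 d2] := si s.
by split=> [|x v]; split=> //=.
Qed.

Lemma rsmooth_continuous g : rsmooth g -> continuous g.
Proof. by move=> [/(_ [::])[]]. Qed.

Lemma rsmooth_derivable g x v : rsmooth g -> derivable g x v.
Proof. by move=> [/(_ [::])[]]. Qed.

Lemma derivs_cat s1 s2 g : derivs (s1 ++ s2) g = derivs s1 (derivs s2 g).
Proof. by rewrite /derivs foldr_cat. Qed.

Lemma rsmooth_derivs s g : rsmooth g -> rsmooth (derivs s g).
Proof. by move=> [sg]; split=> t; rewrite -derivs_cat. Qed.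

Lemma rsmooth_derive v g : rsmooth g -> rsmooth (fun x => 'D_v g x).
Proof. exact: (@rsmooth_derivs [:: v]). Qed.

(** Smoothness as a greatest fixed point. It replaces inductions on the order of differentiation:
    only first derivatives are ever computed, and no formula for higher ones is needed. *)
Lemma rsmooth_coind (S : (V -> R) -> Prop) :
  (forall h, S h -> continuous h /\
     forall v, exists2 h', S h' & forall x, is_derive x v h (h' x)) ->
  forall h, S h -> rsmooth h.
Proof.
move=> HS h Sh.
have Sd s : S (derivs s h).
  elim: s => //= v s /HS[_ /(_ v)[h' Sh' dh']].
  suff -> : (fun x => 'D_v (derivs s h) x) = h' by [].
  by apply/funext => x; exact: derive_val.
split=> s; have [c d] := HS _ (Sd s); split=> // x v.
by have [h' _ /(_ x)[]] := d v.
Qed.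

(** Chain rule asking only for a directional derivative of [g]: restrict [g] to the line through [x]
    with direction [v] and apply the one-variable rule at 0. *)
Lemma is_derive_comp_line (phi : R -> R) g (x v : V) (a b : R) :
  is_derive (g x) 1 phi a -> is_derive x v g b ->
  is_derive x v (phi \o g) (a * b).
Proof.
move=> dphi dg.
pose l := fun t : R => g (t *: v + x).
have l0 : l 0 = g x by rewrite /l scale0r add0r.
have lE : forall h : R, l (h *: 1 + 0) = g (h *: v + x).
  by move=> h; rewrite /l addr0 /GRing.scale/= mulr1.
have dvl : derivable l (0 : R) (1 : R).
  by have /derivable1P := @ex_derive _ _ _ _ _ _ _ dg.
have dl : is_derive (0 : R) (1 : R) l b.
  apply: DeriveDef; first exact: dvl.
  rewrite -(@derive_val _ _ _ x v g b).
  have E : (fun h : R => h^-1 *: ((l \o shift 0) (h *: (1 : R)) - l 0)) =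
           (fun h : R => h^-1 *: ((g \o shift x) (h *: v) - g x)).
    by apply/funext => h; rewrite /= lE l0.
  by rewrite /derive E.
have dpl : is_derive (0 : R) (1 : R) (phi \o l) (a * b).
  by apply: is_derive1_comp; rewrite l0.
have dpg : derivable (phi \o g) x v.
  exact: ((derivable1P (phi \o g) x v).2 (@ex_derive _ _ _ _ _ _ _ dpl)).
apply: DeriveDef => //.
rewrite -(@derive_val _ _ _ _ _ _ _ dpl).
have E : (fun h : R => h^-1 *: (((phi \o l) \o shift 0) (h *: (1 : R)) - (phi \o l) 0)) =
           (fun h : R => h^-1 *: (((phi \o g) \o shift x) (h *: v) - (phi \o g) x)).
  by apply/funext => h; rewrite /= lE l0.
by rewrite /derive E.
Qed.

Lemma rsmooth_cst (c : R) : rsmooth (fun=> c).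
Proof.
apply: (@rsmooth_coind (fun h => exists k, h = fun=> k)); last by exists c.
move=> _ [k ->]; split=> [|v]; first exact: cst_continuous.
by exists (fun=> 0) => [|x]; [exists 0|exact: is_derive_cst].
Qed.

End smooth_calculus.

Section smooth_operations.
Variables (R : realType) (V : normedModType R).
Implicit Types (g h : V -> R).

(** All operations are closed off together because the derivative of a product, a composite or an
    inverse mixes them: the class as a whole is stable under derivation, so [rsmooth_coind] applies
    to it. *)
Inductive smooth_closure : (V -> R) -> Prop :=
| smooth_base g : rsmooth g -> smooth_closure g
| smooth_add g h : smooth_closure g -> smooth_closure h ->
    smooth_closure (fun x => g x + h x)
| smooth_mul g h : smooth_closure g -> smooth_closure h ->
    smooth_closure (fun x => g x * h x)
| smooth_comp (phi : R -> R) g : rsmooth phi -> smooth_closure g ->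
    smooth_closure (phi \o g)
| smooth_inv g : smooth_closure g -> (forall x, g x != 0) ->
    smooth_closure (fun x => (g x)^-1).

Lemma smooth_closure_rsmooth g : smooth_closure g -> rsmooth g.
Proof.
apply: rsmooth_coind => {}g.
elim=> {g}.
- move=> g sg; split; first exact: rsmooth_continuous.
  move=> v; exists (fun x => 'D_v g x).
    by apply: smooth_base; exact: rsmooth_derive.
  by move=> x; apply/derivableP; exact: rsmooth_derivable.
- move=> g h Sg [cg dg] Sh [ch dh]; split; first by move=> x; apply: cvgD; [exact: cg|exact: ch].
  move=> v; have [g' Sg' gg'] := dg v; have [h' Sh' hh'] := dh v.
  by exists (fun x => g' x + h' x) => [|x]; [exact: smooth_add|exact: is_deriveD].
- move=> g h Sg [cg dg] Sh [ch dh]; split; first by move=> x; apply: cvgM; [exact: cg|exact: ch].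
  move=> v; have [g' Sg' gg'] := dg v; have [h' Sh' hh'] := dh v.
  exists (fun x => g x * h' x + h x * g' x) => [|x].
    by apply: smooth_add; apply: smooth_mul.
  exact: is_deriveM.
- move=> phi g sphi Sg [cg dg]; split.
    move=> x; apply: continuous_comp; first exact: cg.
    exact: rsmooth_continuous.
  move=> v; have [g' Sg' gg'] := dg v.
  exists (fun x => ((fun t => 'D_1 phi t) \o g) x * g' x) => [|x].
    by apply: smooth_mul => //; apply: smooth_comp => //; exact: rsmooth_derive.
  apply: is_derive_comp_line => //; apply/derivableP; exact: rsmooth_derivable.
- move=> g Sg [cg dg] g0; split; first by move=> x; apply: cvgV => //; exact: cg.
  move=> v; have [g' Sg' gg'] := dg v.
  exists (fun x => (-1) * ((g x)^-1 * (g x)^-1) * g' x) => [|x].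
    apply: smooth_mul => //; apply: smooth_mul.
      by apply: smooth_base; exact: rsmooth_cst.
    by apply: smooth_mul; apply: smooth_inv.
  apply: (@is_derive_comp_line _ _ (@GRing.inv R) g) => //.
  rewrite mulN1r -invrM ?unitfE// -expr2 -scaleN1r.
  have := @is_deriveV R id (g x) 1 1 (g0 x) (is_derive_id _ _).
  by rewrite /= scaleN1r -[- _ *: _]mulr1 /GRing.scale/= !mulr1.
Qed.

Lemma rsmoothD g h : rsmooth g -> rsmooth h -> rsmooth (fun x => g x + h x).
Proof.
by move=> sg sh; apply/smooth_closure_rsmooth/smooth_add; exact: smooth_base.
Qed.

Lemma rsmoothM g h : rsmooth g -> rsmooth h -> rsmooth (fun x => g x * h x).
Proof.
by move=> sg sh; apply/smooth_closure_rsmooth/smooth_mul; exact: smooth_base.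
Qed.

Lemma rsmoothN g : rsmooth g -> rsmooth (fun x => - g x).
Proof.
move=> sg; under eq_fun do rewrite -mulN1r.
by apply: rsmoothM => //; exact: rsmooth_cst.
Qed.

Lemma rsmoothB g h : rsmooth g -> rsmooth h -> rsmooth (fun x => g x - h x).
Proof. by move=> sg sh; apply: rsmoothD => //; exact: rsmoothN. Qed.

Lemma rsmoothV g : rsmooth g -> (forall x, g x != 0) ->
  rsmooth (fun x => (g x)^-1).
Proof.
by move=> sg g0; apply/smooth_closure_rsmooth/smooth_inv => //; exact: smooth_base.
Qed.

Lemma rsmooth_sum (I : Type) (r : seq I) (F : I -> V -> R) :
  (forall i, rsmooth (F i)) -> rsmooth (fun x => \sum_(i <- r) F i x).
Proof.
move=> sF; elim: r => [|i r IH].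
  by under eq_fun do rewrite big_nil; exact: rsmooth_cst.
by under eq_fun do rewrite big_cons; exact: rsmoothD.
Qed.

Lemma rsmooth_prod (I : Type) (r : seq I) (F : I -> V -> R) :
  (forall i, rsmooth (F i)) -> rsmooth (fun x => \prod_(i <- r) F i x).
Proof.
move=> sF; elim: r => [|i r IH].
  by under eq_fun do rewrite big_nil; exact: rsmooth_cst.
by under eq_fun do rewrite big_cons; exact: rsmoothM.
Qed.

Lemma rsmooth_linear (L : V -> R) :
  (forall a x y, L (a *: x + y) = a * L x + L y) -> continuous L -> rsmooth L.
Proof.
move=> lL cL.
have L0 : L 0 = 0.
  by have := lL (-1) 0 0; rewrite scaler0 addr0 mulN1r addNr.
apply: (@rsmooth_coind _ _ (fun h => rsmooth h \/ h = L)); last by right.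
move=> h [sh|->].
  split=> [|v]; first exact: rsmooth_continuous.
  exists (fun x => 'D_v h x); first by left; exact: rsmooth_derive.
  by move=> x; apply/derivableP; exact: rsmooth_derivable.
split=> // v; exists (fun=> L v); first by left; exact: rsmooth_cst.
move=> x.
have E : forall t : R, t != 0 -> t^-1 *: ((L \o shift x) (t *: v) - L x) = L v.
  by move=> t t0 /=; rewrite lL addrK /GRing.scale/= mulrA mulVf// mul1r.
have C : t^-1 *: ((L \o shift x) (t *: v) - L x) @[t --> 0^'] --> L v.
  apply: cvg_near_cst; near=> t; apply: E; near: t.
  exact: nbhs_dnbhs_neq.
apply: DeriveDef; first by apply/cvg_ex; exists (L v).
exact: cvg_lim C.
Unshelve. all: by end_near.
Qed.

Lemma rsmooth_comp (phi : R -> R) g :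
  rsmooth phi -> rsmooth g -> rsmooth (phi \o g).
Proof.
move=> sphi sg; apply/smooth_closure_rsmooth/smooth_comp => //.
exact: smooth_base.
Qed.

End smooth_operations.

Section elementary_smooth.
Variable R : realType.

Lemma is_derive1_continuous (f : R -> R) (x a : R) :
  is_derive x 1 f a -> {for x, continuous f}.
Proof. by case=> + _; move=> /derivable1_diffP/differentiable_continuous. Qed.

(** On the line the derivative along v is v times the derivative along 1, which is why the class has
    to be stable under scalar multiples. *)
Lemma rsmooth1_coind (S : (R -> R) -> Prop) :
  (forall h, S h -> exists2 h', S h' & forall x : R, is_derive x (1 : R) h (h' x)) ->
  (forall h (c : R), S h -> S (fun x => c * h x)) ->
  forall h, S h -> rsmooth h.
Proof.
move=> HS SZ; apply: rsmooth_coind => h Sh; have [h' Sh' dh] := HS _ Sh.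
split=> [x|v]; first exact: is_derive1_continuous (dh x).
exists (fun x => v * h' x) => [|x]; first exact: SZ.
have [dx vx] := dh x.
have dv : differentiable h x by apply/derivable1_diffP.
apply: DeriveDef; first exact: diff_derivable.
have {1}-> : v = v *: (1 : R) by rewrite /GRing.scale/= mulr1.
by rewrite deriveE// linearZ -deriveE// vx.
Qed.

Lemma rsmooth_trig (a b : R) : rsmooth (fun x : R => a * cos x + b * sin x).
Proof.
apply: (@rsmooth1_coind (fun h => exists a b, h = fun x => a * cos x + b * sin x));
  last by exists a, b.
- move=> _ [c [d ->]]; exists (fun x => d * cos x + (- c) * sin x); first by exists d, (- c).
  move=> x; apply: (is_derive_eq (is_deriveD (is_deriveZ c (is_derive_cos x))
    (is_deriveZ d (is_derive_sin x)))).
  by rewrite /GRing.scale/=; ring.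
- move=> _ k [c [d ->]]; exists (k * c), (k * d); apply/funext => x; ring.
Qed.

Lemma rsmooth_cos : rsmooth (@cos R).
Proof.
have := rsmooth_trig 1 0; congr rsmooth; apply/funext => x.
by rewrite mul1r mul0r addr0.
Qed.

Lemma rsmooth_sin : rsmooth (@sin R).
Proof.
have := rsmooth_trig 0 1; congr rsmooth; apply/funext => x.
by rewrite mul1r mul0r add0r.
Qed.

Lemma rsmooth_affine (a b : R) : rsmooth (fun x : R => a * x + b).
Proof.
apply: rsmoothD; last exact: rsmooth_cst.
apply: rsmooth_linear => [c x y|]; first by rewrite mulrDr /GRing.scale/= mulrCA.
by move=> x; apply: cvgM; [exact: cvg_cst|exact: cvg_id].
Qed.

End elementary_smooth.
Section cutoff.
Variable R : realType.

Lemma expn_le_expR (n : nat) (u : R) : 0 <= u -> u ^+ n <= n`!%:R * expR u.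
Proof.
case: n => [|n] u0; first by rewrite expr0 fact0 mul1r -expR0 ler_expR.
have H := expR_ge1Dxn n u0.
rewrite mulrC -ler_pdivrMr ?ltr0n ?fact_gt0//.
by apply: le_trans H; rewrite lerDr.
Qed.

Lemma horner_le_expR (p : {poly R}) :
  exists2 C : R, 0 <= C & forall u, 0 <= u -> `|p.[u]| <= C * expR u.
Proof.
exists (\sum_(i < size p) `|p`_i| * i`!%:R).
  by apply: sumr_ge0 => i _; rewrite mulr_ge0.
move=> u u0; rewrite horner_coef mulr_suml.
apply: le_trans (ler_norm_sum _ _ _) _; apply: ler_sum => i _.
rewrite normrM -mulrA ler_wpM2l// ger0_norm ?exprn_ge0//.
exact: expn_le_expR.
Qed.

(* Closed under differentiation: the derivative of p(1/t) exp(-1/t) has the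
   same form. *)
Definition flat (p : {poly R}) (t : R) : R :=
  if 0 < t then p.[t^-1] * expR (- t^-1) else 0.

(** With u = 1/t this says that u^2 p(u) exp(-u) is bounded for u > 0. The spare factor |t| on the
    right gives the derivative 0 at the origin. *)
Lemma flat_le (p : {poly R}) : exists2 C : R, 0 <= C &
  forall t, `|flat p t / t| <= C * `|t|.
Proof.
have [C C0 HC] := horner_le_expR ('X^2 * p); exists C => // t.
rewrite /flat; case: ifPn => [t0|_]; last by rewrite mul0r normr0 mulr_ge0.
have ti0 : 0 <= t^-1 by rewrite invr_ge0 ltW.
have := HC _ ti0; rewrite hornerM hornerXn normrM ger0_norm ?exprn_ge0// => H.
rewrite !normrM (gtr0_norm t0) (ger0_norm ti0) (ger0_norm (expR_ge0 _)).
rewrite expRN.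
have -> : `|p.[t^-1]| * (expR t^-1)^-1 * t^-1 =
    t * (t^-1 ^+ 2 * `|p.[t^-1]|) / expR t^-1.
  by field; rewrite !gt_eqF ?expR_gt0.
by rewrite ler_pdivrMr ?expR_gt0//; have := ler_wpM2l (ltW t0) H;
  rewrite [t * (C * _)]mulrA (mulrC t C).
Qed.

Lemma flat_le0 p t : t <= 0 -> flat p t = 0.
Proof. by move=> t0; rewrite /flat ltNge t0. Qed.

Lemma is_derive_flat (p : {poly R}) (t : R) :
  is_derive t (1 : R) (flat p) (flat ('X^2 * (p - p^`()))%R t).
Proof.
have [t0|t0|->] := ltrgtP t 0.
- have -> : flat ('X^2 * (p - p^`()))%R t = 0 by rewrite /flat ltNge ltW.
  have E : \near t, (cst (0 : R)) t = flat p t.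
    by near=> x; rewrite flat_le0//; apply: ltW; near: x; exact: lt_nbhsl.
  exact: (near_eq_is_derive E (is_derive_cst (0 : R) t (1 : R))).
- have tn0 : t != 0 by rewrite gt_eqF.
  have dV : is_derive t (1 : R) (fun x : R => x^-1) (- t ^- 2).
    apply: is_derive_eq (is_deriveV _ (is_derive_id _ _)) _ => //.
    by rewrite /GRing.scale/= mulr1.
  have dp := is_derive1_comp (is_derive_poly p t^-1) dV.
  have dN : is_derive t (1 : R) (fun x : R => - x^-1) (t ^- 2).
    by apply: is_derive_eq (is_deriveN dV) _; rewrite opprK.
  have de := @is_derive1_comp _ expR (fun x : R => - x^-1) t _ _ (is_derive_expR _) dN.
  have E : \near t, ((horner p \o (fun x : R => x^-1)) *
      (expR \o (fun x : R => - x^-1))) t = flat p t.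
    by near=> x; rewrite /flat ifT//; near: x; exact: lt_nbhsr.
  apply: near_eq_is_derive E _; apply: is_derive_eq (is_deriveM dp de) _.
  rewrite /flat t0 !hornerE /GRing.scale/=.
  by rewrite !exprVn ; ring.
(* At the origin Caratheodory's criterion is used: the quotient is [flat p z / z], which equals 0 at
   z = 0 and is O(|z|) by [flat_le], hence continuous there. *)
- have -> : flat ('X^2 * (p - p^`()))%R 0 = 0 by rewrite /flat ltxx.
  apply/is_derive1_caratheodory; exists (fun z => flat p z / z).
  have f0 : flat p 0 = 0 by rewrite /flat ltxx.
  split=> [z||]; last by rewrite f0 mul0r.
    rewrite f0 !subr0; have [->|z0] := eqVneq z 0; first by rewrite mulr0 f0.
    by rewrite mulfVK.
  rewrite /prop_for /continuous_at/= f0 mul0r.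
  have [C C0 HC] := flat_le p.
  apply/cvgr0Pnorm_le => e e0.
  near=> z; apply: le_trans (HC z) _.
  apply: (@le_trans _ _ ((C + 1) * `|z|)); first by rewrite ler_wpM2r// lerDl.
  rewrite mulrC -ler_pdivlMr ?ltr_wpDl//.
  near: z; apply/nbhs_normP; exists (e / (C + 1)); first by rewrite /= divr_gt0// ltr_wpDl.
  by move=> z /=; rewrite sub0r normrN => /ltW.
Unshelve. all: by end_near. Qed.

Lemma rsmooth_flat p : rsmooth (flat p).
Proof.
apply: (@rsmooth1_coind _ (fun h => exists q, h = flat q)); last by exists p.
- by move=> _ [q ->]; exists (flat ('X^2 * (q - q^`()))%R) => [|x];
    [eexists|exact: is_derive_flat].
- move=> _ c [q ->]; exists (c *: q); apply/funext => x.
  by rewrite /flat; case: ifP => _; rewrite ?mulr0// hornerZ mulrA.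
Qed.

Definition smooth_step (t : R) : R := flat 1 t / (flat 1 t + flat 1 (1 - t)).

Lemma flat1_gt0 t : 0 < t -> 0 < flat 1 t.
Proof. by move=> t0; rewrite /flat t0 hornerC mul1r expR_gt0. Qed.

Lemma flat1_ge0 t : 0 <= flat 1 t.
Proof. by have [/flat1_gt0/ltW|/(flat_le0 1)->] := ltP 0 t. Qed.

Lemma smooth_step_den t : flat 1 t + flat 1 (1 - t) != 0.
Proof.
have [t0|t0] := ltP 0 t.
  by rewrite gt_eqF// ltr_pwDl ?flat1_gt0// flat1_ge0.
by rewrite gt_eqF// ltr_wpDl ?flat1_ge0// flat1_gt0// subr_gt0 (le_lt_trans t0).
Qed.

Lemma rsmooth_step : rsmooth smooth_step.
Proof.
apply: rsmoothM; first exact: rsmooth_flat.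
apply: rsmoothV; last exact: smooth_step_den.
apply: rsmoothD; first exact: rsmooth_flat.
apply: (rsmooth_comp (phi := flat 1) (g := fun t : R => 1 - t)).
  exact: rsmooth_flat.
have -> : (fun t : R => 1 - t) = (fun t => -1 * t + 1).
  by apply/funext => t; rewrite mulN1r addrC.
exact: rsmooth_affine.
Qed.

Lemma smooth_step1 t : 1 <= t -> smooth_step t = 1.
Proof.
move=> t1; have := smooth_step_den t.
by rewrite /smooth_step (@flat_le0 1 (1 - t)) ?subr_le0// addr0; exact: divff.
Qed.

Lemma smooth_step0 t : t <= 0 -> smooth_step t = 0.
Proof. by move=> t0; rewrite /smooth_step flat_le0// mul0r. Qed.

Lemma exists_plateau (L : R) : exists c : R -> R, [/\ rsmooth c,
  forall x, `|x| <= L -> c x = 1 & forall x, L + 1 <= `|x| -> c x = 0].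
Proof.
exists (fun x => smooth_step (1 * x + (L + 1)) * smooth_step (-1 * x + (L + 1))).
split=> [|x|x].
- by apply: rsmoothM;
    apply: (rsmooth_comp (phi := smooth_step)); first [exact: rsmooth_step | exact: rsmooth_affine].
- by rewrite ler_norml => /andP[x1 x2]; rewrite !smooth_step1 ?mulr1//; lra.
- rewrite ler_normr => /orP[x1|x1].
    by rewrite [X in _ * X]smooth_step0 ?mulr0//; lra.
  by rewrite [X in X * _]smooth_step0 ?mul0r//; lra.
Qed.

End cutoff.

Section test_functions.
Variables (R : realType) (d : nat).
Local Notation C := R[i].
Local Notation E := 'rV[R]_d.

Lemma coord_le_norm (x : E) i : `|x 0 i| <= `|x|.
Proof. by rewrite -[`|x|]/(mx_norm x) mx_normrE; apply: (le_bigmax _ (fun ij => `|x ij.1 ij.2|) (0, i)). Qed.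

Lemma norm_le_coord (x : E) (M : R) : 0 <= M -> (forall i, `|x 0 i| <= M) -> `|x| <= M.
Proof.
by move=> M0 H; rewrite -[`|x|]/(mx_norm x) mx_normrE; apply/bigmax_leP; split=> //= -[i j] _; rewrite ord1.
Qed.

Lemma rsmooth_coord (i : 'I_d) : rsmooth (fun x : E => x 0 i).
Proof.
apply: rsmooth_linear => [a x y|]; first by rewrite !mxE.
exact: coord_continuous.
Qed.

Lemma rsmooth_dotv (x : E) : rsmooth (dotv x).
Proof.
apply: rsmooth_sum => i; apply: rsmoothM; first exact: rsmooth_cst.
exact: rsmooth_coord.
Qed.

Lemma compact_norm_le (M : R) : compact [set x : E | `|x| <= M].
Proof.
apply: bounded_closed_compact.
  exists M; split; first exact: num_real.
  by move=> y My x /= /le_trans; apply; exact: ltW.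
have -> : [set x : E | `|x| <= M] = (fun x : E => `|x|) @^-1` [set r | r <= M] by [].
by apply: closed_comp => [x _|]; [exact: norm_continuous|exact: closed_le].
Qed.

Lemma compact_norm_bound (K : set E) : compact K ->
  exists2 M : R, 0 <= M & forall x, K x -> `|x| <= M.
Proof.
move=> /compact_bounded[M [_ HM]]; exists (`|M| + 1); first by rewrite addr_ge0.
by move=> x Kx; apply: HM Kx; rewrite (le_lt_trans (ler_norm M))// ltrDl.
Qed.

Lemma rsmooth_cutoff (c : R -> R) :
  rsmooth c -> rsmooth (fun x : E => \prod_i c (x 0 i)).
Proof.
move=> sc; apply: rsmooth_prod => i.
by apply: (rsmooth_comp (phi := c)) => //; exact: rsmooth_coord.
Qed.

Lemma cutoff_eq1 (c : R -> R) (L : R) (x : E) : (forall t, `|t| <= L -> c t = 1) ->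
  `|x| <= L -> \prod_i c (x 0 i) = 1.
Proof.
by move=> c1 xL; rewrite big1// => i _; apply: c1; exact: le_trans (coord_le_norm _ _) xL.
Qed.

Lemma smooth_real (g : E -> R) : rsmooth g -> smooth (fun x => (g x)%:C%C).
Proof. by move=> sg; apply/smoothE; split=> //=; exact: rsmooth_cst. Qed.

Lemma smooth_cis (g : E -> R) : rsmooth g -> smooth (fun x => cis (g x)).
Proof.
move=> sg; apply/smoothE; split=> /=.
  by apply: (rsmooth_comp (phi := @cos R)) => //; exact: rsmooth_cos.
by apply: (rsmooth_comp (phi := @sin R)) => //; exact: rsmooth_sin.
Qed.

Lemma smoothM (g h : E -> C) : smooth g -> smooth h -> smooth (fun x => g x * h x).
Proof.
move=> /smoothE[g1 g2] /smoothE[h1 h2]; apply/smoothE; split.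
  have -> : (fun x => complex.Re (g x * h x)) = fun x =>
      complex.Re (g x) * complex.Re (h x) - complex.Im (g x) * complex.Im (h x).
    by apply/funext => x; case: (g x) => ? ?; case: (h x).
  by apply: rsmoothB; exact: rsmoothM.
have -> : (fun x => complex.Im (g x * h x)) = fun x =>
    complex.Re (g x) * complex.Im (h x) + complex.Im (g x) * complex.Re (h x).
  by apply/funext => x; case: (g x) => ? ?; case: (h x).
by apply: rsmoothD; exact: rsmoothM.
Qed.

Lemma smoothD (g h : E -> C) : smooth g -> smooth h -> smooth (fun x => g x + h x).
Proof.
move=> /smoothE[g1 g2] /smoothE[h1 h2]; apply/smoothE; split.
  have -> : (fun x => complex.Re (g x + h x)) = fun x =>
      complex.Re (g x) + complex.Re (h x).
    by apply/funext => x; case: (g x) => ? ?; case: (h x).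
  exact: rsmoothD.
have -> : (fun x => complex.Im (g x + h x)) = fun x =>
    complex.Im (g x) + complex.Im (h x).
  by apply/funext => x; case: (g x) => ? ?; case: (h x).
exact: rsmoothD.
Qed.

Lemma smooth_cst (c : C) : smooth (fun _ : E => c).
Proof. by apply/smoothE; split; exact: rsmooth_cst. Qed.

Lemma smooth_conj (g : E -> C) : smooth g -> smooth (fun x => (g x)^*).
Proof.
move=> /smoothE[g1 g2]; apply/smoothE; split.
  by have -> : (fun x => complex.Re (g x)^*) = fun x => complex.Re (g x)
    by apply/funext => x; case: (g x).
have -> : (fun x => complex.Im (g x)^*) = fun x => - complex.Im (g x)
  by apply/funext => x; case: (g x).
exact: rsmoothN.
Qed.

Lemma test_functionM (D : set E) (g h : E -> C) :
  test_function D g -> smooth h -> test_function D (fun x => g x * h x).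
Proof.
move=> [sg [K [cK KD K0]]] sh; split; first exact: smoothM.
by exists K; split=> // x /K0 ->; rewrite mul0r.
Qed.

Lemma test_functionD (D : set E) (g h : E -> C) :
  test_function D g -> test_function D h -> test_function D (fun x => g x + h x).
Proof.
move=> [sg [K [cK KD K0]]] [sh [L [cL LD L0]]]; split; first exact: smoothD.
exists (K `|` L); split; first exact: compactU.
  by rewrite subUset.
by move=> x /not_orP[/K0 -> /L0 ->]; rewrite addr0.
Qed.

End test_functions.

(** * Measurability through grids *)

Section grid_approximation.
Variable R : realType.

Lemma near_invr_le (e : R) : 0 < e -> \forall n \near \oo, n.+1%:R^-1 <= e.
Proof.
move=> e0; have /cvgrPdist_le/(_ _ e0) := @cvg_harmonic R.
by apply: filterS => n; rewrite sub0r normrN ger0_norm// invr_ge0.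
Qed.

Definition grid (n : nat) (r : R) : int := Num.floor (n.+1%:R * r).

Definition gridR (n : nat) (k : int) : R := k%:~R / n.+1%:R.

Lemma grid_dist n r : `|r - gridR n (grid n r)| <= n.+1%:R^-1.
Proof.
have /andP[h1 h2] := floor_itv (n.+1%:R * r); rewrite intrD in h2.
have n0 : (0 : R) < n.+1%:R by rewrite ltr0n.
have -> : r - gridR n (grid n r) = (n.+1%:R * r - (grid n r)%:~R) / n.+1%:R.
  by rewrite /gridR; field; rewrite gt_eqF.
rewrite normrM [`|_^-1|]gtr0_norm ?invr_gt0// ler_piMl ?invr_ge0 ?ltW//.
by rewrite /grid ger0_norm; lra.
Qed.

Lemma cvg_grid r : gridR n (grid n r) @[n --> \oo] --> r.
Proof.
apply/cvgrPdist_le => e e0; near=> n.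
apply: le_trans (grid_dist _ _) _; near: n.
exact: near_invr_le.
Unshelve. all: by end_near. Qed.

Lemma measurable_grid n (k : int) : measurable [set r : R | grid n r = k].
Proof.
have n0 : (0 : R) < n.+1%:R by rewrite ltr0n.
suff -> : [set r : R | grid n r = k] = `[k%:~R / n.+1%:R, (k + 1)%:~R / n.+1%:R[%classic by [].
apply/seteqP; split=> r /=; rewrite in_itv/= ler_pdivrMr// ltr_pdivlMr// [r * _]mulrC.
  by move=> <-; exact: floor_itv.
by move=> /floor_def.
Qed.

Definition gridrow (d n : nat) (k : {ffun 'I_d -> int}) : 'rV[R]_d :=
  \row_i gridR n (k i).

Lemma cvg_gridrow d (x : 'rV[R]_d) :
  gridrow n [ffun i => grid n (x 0 i)] @[n --> \oo] --> x.
Proof.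
apply/cvgrPdist_le => e e0; near=> n.
have : n.+1%:R^-1 <= e.
  near: n.
  exact: near_invr_le.
apply: le_trans; apply: norm_le_coord; first by rewrite invr_ge0.
by move=> i; rewrite !mxE ffunE; exact: grid_dist.
Unshelve. all: by end_near. Qed.

End grid_approximation.

Section measurability.
Context (R : realType) (disp : measure_display) (T : measurableType disp).

(** Nothing is asked of [h]: since [k] takes countably many values, every preimage is a countable
    union of its fibres. *)
Lemma measurable_countable_factor (K : countType) (k : T -> K) (h : K -> R) :
  (forall c, measurable [set t | k t = c]) -> measurable_fun setT (h \o k).
Proof.
move=> mk _ A mA; rewrite setTI.
have -> : (h \o k) @^-1` A = \bigcup_(c in [set: K]) ([set t | k t = c] `&` [set t | A (h c)]).
  apply/seteqP; split=> [t /= At|t [c _ [/= <-]]//].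
  by exists (k t).
apply: countable_bigcupT_measurable => [|c]; first exact: countableP.
apply: measurableI => //.
have [Ac|Ac] := pselect (A (h c)).
  by have -> : [set t : T | A (h c)] = setT by apply/seteqP; split.
by have -> : [set t : T | A (h c)] = set0 by apply/seteqP; split.
Qed.

Lemma measurable_grid_ffun d n (u : T -> 'rV[R]_d) (c : {ffun 'I_d -> int}) :
  (forall i, measurable_fun setT (fun t => u t 0 i)) ->
  measurable [set t | [ffun i => grid n (u t 0 i)] = c].
Proof.
move=> mu.
have -> : [set t | [ffun i => grid n (u t 0 i)] = c] =
    \bigcap_(i in [set: 'I_d]) ((fun t => u t 0 i) @^-1` [set r | grid n r = c i]).
  apply/seteqP; split=> t /=; first by move=> <- i _ /=; rewrite ffunE.
  by move=> H; apply/ffunP => i; rewrite ffunE; exact: H.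
apply: fin_bigcap_measurable => [|i _]; first exact: finite_finset.
by rewrite -[X in measurable X]setTI; apply: mu => //; exact: measurable_grid.
Qed.

(** No sigma-algebra on row vectors is involved, only coordinates. The value of [g] at the grid
    point below depends on countably many cells, and by continuity it converges pointwise as the
    mesh tends to 0. *)
Lemma measurable_continuous2 (d e : nat) (g : 'rV[R]_d * 'rV[R]_e -> R)
    (u : T -> 'rV[R]_d) (v : T -> 'rV[R]_e) :
  continuous g -> (forall i, measurable_fun setT (fun t => u t 0 i)) ->
  (forall i, measurable_fun setT (fun t => v t 0 i)) ->
  measurable_fun setT (fun t => g (u t, v t)).
Proof.
move=> cg mu mv.
pose k n t := ([ffun i => grid n (u t 0 i)], [ffun i => grid n (v t 0 i)]).
pose h n (kl : {ffun 'I_d -> int} * {ffun 'I_e -> int}) :=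
  g (gridrow R n kl.1, gridrow R n kl.2).
apply: (@measurable_fun_cvg _ _ _ _ (fun n => h n \o k n)) => [n|t _].
  apply: measurable_countable_factor => -[c1 c2].
  have -> : [set t | k n t = (c1, c2)] =
    [set t | [ffun i => grid n (u t 0 i)] = c1] `&`
    [set t | [ffun i => grid n (v t 0 i)] = c2].
    by apply/seteqP; split=> s /=; rewrite /k => -[-> ->].
  by apply: measurableI; exact: measurable_grid_ffun.
apply: (@cvg_comp _ _ _ (fun n => (gridrow R n (k n t).1, gridrow R n (k n t).2)) g _
  (nbhs (u t, v t))); last exact: cg.
exact: (cvg_pair (@cvg_gridrow R d (u t)) (@cvg_gridrow R e (v t))).
Qed.

Lemma measurable_continuous_row (d : nat) (g : 'rV[R]_d -> R) (u : T -> 'rV[R]_d) :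
  continuous g -> (forall i, measurable_fun setT (fun t => u t 0 i)) ->
  measurable_fun setT (fun t => g (u t)).
Proof.
move=> cg mu; apply: (@measurable_continuous2 d d (g \o fst) u u) => // x.
by apply: continuous_comp; [exact: cvg_fst|exact: cg].
Qed.

(** Joint measurability of a process with continuous paths: the path is read at the grid point below
    the second variable, and the mesh tends to 0. *)
Lemma measurable_caratheodory (F : T -> R -> R) :
  (forall r, measurable_fun setT (F ^~ r)) -> (forall t, continuous (F t)) ->
  measurable_fun setT (fun p : T * R => F p.1 p.2).
Proof.
move=> mF cF.
apply: (@measurable_fun_cvg _ _ _ _ (fun n p => F p.1 (gridR R n (grid n p.2)))) => [n|p _].
  move=> _ A mA; rewrite setTI.
  have -> : (fun p : T * R => F p.1 (gridR R n (grid n p.2))) @^-1` A =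
    \bigcup_(k in [set: int]) ((F ^~ (gridR R n k) @^-1` A) `*` [set r | grid n r = k]).
    apply/seteqP; split=> [p Ap|p [k _ [/= Ak gk]]]; last by rewrite /= gk.
    by exists (grid n p.2).
  apply: countable_bigcupT_measurable => [|k]; first exact: countableP.
  apply: measurableX; last exact: measurable_grid.
  by rewrite -[X in measurable X]setTI; exact: mF.
apply: (@cvg_comp _ _ _ (fun n => gridR R n (grid n p.2)) (F p.1) _ (nbhs p.2)).
  exact: cvg_grid.
exact: cF.
Qed.

End measurability.

(** * Iterated integrals over tuples *)

Section tuples.
Variable R : realType.
Local Notation C := R[i].
Local Notation mu := (@lebesgue_measure R).
Local Notation muT := (product_power mu).

Definition rowt d (t : d.-tuple (measurableTypeR R)) : 'rV[R]_d := \row_i tnth t i.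

Lemma rowt_coord d i : measurable_fun setT (fun t => @rowt d t 0 i).
Proof.
have -> : (fun t : d.-tuple (measurableTypeR R) => @rowt d t 0 i) = fun t => tnth t i.
  by apply/funext => t; rewrite mxE.
exact: measurable_tnth.
Qed.

Lemma measurable_rowt d (g : 'rV[R]_d -> R) : continuous g ->
  measurable_fun setT (fun t : d.-tuple (measurableTypeR R) => g (rowt t)).
Proof. by move=> cg; apply: measurable_continuous_row => // i; exact: rowt_coord. Qed.

Lemma ge0_integral_tuple n (f : n.+1.-tuple (measurableTypeR R) -> \bar R) :
  measurable_fun setT f -> (forall t, 0 <= f t)%E ->
  (\int[muT n.+1]_t f t = \int[mu]_a \int[muT n]_t f (tuple_cons (a, t)))%E.
Proof.
move=> mf f0.
have mcons := @measurable_tuple_cons _ (measurableTypeR R) n.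
transitivity (\int[pushforward (mu \x muT n)%E (@tuple_cons _ _ n)]_t f t)%E.
  exact: eq_measure_integral.
rewrite ge0_integral_pushforward//.
rewrite preimage_setT fubini_tonelli1//; last by move=> x; exact: f0.
exact: measurableT_comp.
Qed.

Lemma integrable_tuple n (f : n.+1.-tuple (measurableTypeR R) -> \bar R) :
  measurable_fun setT f ->
  (muT n.+1).-integrable setT f <->
  (mu \x muT n)%E.-integrable setT (f \o @tuple_cons _ _ n).
Proof.
move=> mf.
have mcons := @measurable_tuple_cons _ (measurableTypeR R) n.
have E : (\int[muT n.+1]_t `|f t| = \int[(mu \x muT n)%E]_t `|f (tuple_cons t)|)%E.
  rewrite ge0_integral_tuple//; last exact: measurableT_comp.
  rewrite fubini_tonelli1//; apply: measurableT_comp => //.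
  exact: measurableT_comp.
split=> /integrableP[_ fi]; apply/integrableP; split=> //.
- exact: measurableT_comp.
- by rewrite -E.
- by rewrite E.
Qed.

Lemma integral_tuple n (f : n.+1.-tuple (measurableTypeR R) -> \bar R) :
  (muT n.+1).-integrable setT f ->
  (\int[muT n.+1]_t f t = \int[mu]_a \int[muT n]_t f (tuple_cons (a, t)))%E.
Proof.
move=> fi.
have mf : measurable_fun setT f by case/integrableP : fi.
have mcons := @measurable_tuple_cons _ (measurableTypeR R) n.
transitivity (\int[pushforward (mu \x muT n)%E (@tuple_cons _ _ n)]_t f t)%E.
  exact: eq_measure_integral.
have fi' := (integrable_tuple mf).1 fi.
rewrite integral_pushforward// preimage_setT.
by rewrite -integral12_prod_meas1.
Qed.

End tuples.

(** * Integrals over the real line *)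

Section real_line_integrals.
Variable R : realType.
Local Notation mu := (@lebesgue_measure R).

Lemma Rintegral_FTC (F f : R -> R) (a b : R) :
  (forall x : R, is_derive x (1 : R) F (f x)) -> continuous f -> a <= b ->
  \int[mu]_(x in `[a, b]) f x = F b - F a.
Proof.
move=> dF cf; rewrite le_eqVlt => /predU1P[->|ab].
  by rewrite subrr set_itv1 Rintegral_set1.
have cF : continuous F by move=> x; exact: is_derive1_continuous (dF x).
rewrite /Rintegral (@continuous_FTC2 _ _ F)//.
- exact: continuous_subspaceT.
- split=> [x _||].
  + exact: ex_derive.
  + by apply: cvg_at_right_filter; exact: cF.
  + by apply: cvg_at_left_filter; exact: cF.
- by move=> x _; rewrite derive1E; exact: derive_val.
Qed.

Lemma continuous_integrable_itv (f : R -> R) (a b : R) : continuous f ->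
  mu.-integrable `[a, b] (EFin \o f).
Proof.
move=> cf; apply: continuous_compact_integrable; first exact: segment_compact.
exact: continuous_subspaceT.
Qed.

Lemma nat_itv_bigcup : \bigcup_n `[(- n%:R)%R, n%:R%R]%classic = [set: R].
Proof.
apply/seteqP; split=> // x _; exists (Num.truncn `|x|).+1 => //=.
rewrite in_itv/= -ler_norml.
exact: ltW (truncnS_gt _).
Qed.

Lemma nat_itv_homo : {homo (fun n : nat => `[(- n%:R)%R, n%:R%R]%classic : set R) :
  n m / (n <= m)%N >-> (n <= m)%O}.
Proof.
move=> n m nm; apply/subsetPset; apply: subset_itv; rewrite bnd_simp ?lerN2 ler_nat//.
Qed.

Lemma ge0_integral_FTC_T (F f : R -> R) (l : R) :
  (forall x : R, is_derive x (1 : R) F (f x)) -> continuous f ->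
  (forall x, 0 <= f x) ->
  F n%:R - F (- n%:R) @[n --> \oo] --> l ->
  (\int[mu]_x (f x)%:E = l%:E)%E.
Proof.
move=> dF cf f0 Fl.
have mf : measurable_fun setT (EFin \o f).
  by apply/measurable_EFinP; exact: continuous_measurable_fun.
have H := @ge0_nondecreasing_set_cvg_integral _ _ _ _ _ mu nat_itv_homo
  (fun i => measurable_itv _) (fun i => measurable_funTS mf)
  (fun i x _ => f0 x).
rewrite nat_itv_bigcup in H.
apply: (cvg_unique _ H) => //.
have -> : (fun n : nat => \int[mu]_(x in `[(- n%:R)%R, n%:R%R]) (EFin \o f) x)%E =
   (fun n : nat => (F n%:R - F (- n%:R))%:E).
  apply/funext => n; rewrite -(@Rintegral_FTC F f)//; last first.
    by rewrite (@le_trans _ _ 0)// oppr_le0.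
  rewrite /Rintegral fineK//; apply: integrable_fin_num => //.
  exact: continuous_integrable_itv.
by apply/fine_cvgP; split; [exact: nearW|exact: Fl].
Qed.

Lemma Rintegral_cvg_itv (f : R -> R) : mu.-integrable setT (EFin \o f) ->
  \int[mu]_(x in `[- n%:R, n%:R]) f x @[n --> \oo] --> \int[mu]_x f x.
Proof.
move=> fi.
have [mf _] := integrableP _ _ _ fi.
apply: fine_cvg; rewrite fineK; last exact: integrable_fin_num.
under eq_fun do rewrite integral_mkcond.
apply: (@dominated_cvg _ _ _ mu setT _ _ _ (fun x => `|f x|%:E)) => //.
- move=> n; apply/(measurable_restrictT _ _).1 => //.
  exact: measurable_funTS.
- move=> x _; apply: cvg_near_cst.
  exists (Num.truncn `|x|).+1 => // n /= xn; rewrite patchE mem_set//= in_itv/= -ler_norml.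
  by apply/ltW/(lt_le_trans (truncnS_gt _)); rewrite ler_nat.
- exact: integrable_abse fi.
- by move=> n x _; rewrite patchE; case: ifP => _; rewrite ?abse0 ?lee_fin.
Qed.

(** As [f] is assumed integrable, the limit over the symmetric intervals [-n, n] determines the
    integral. *)
Lemma Rintegral_FTC_T (F f : R -> R) (l : R) :
  (forall x : R, is_derive x (1 : R) F (f x)) -> continuous f ->
  mu.-integrable setT (EFin \o f) ->
  F n%:R - F (- n%:R) @[n --> \oo] --> l ->
  \int[mu]_x f x = l.
Proof.
move=> dF cf fi Fl; apply: (cvg_unique _ (Rintegral_cvg_itv fi)) => //.
have -> : (fun n : nat => \int[mu]_(x in `[- n%:R, n%:R]) f x) = (fun n : nat => F n%:R - F (- n%:R)).
  apply/funext => n; apply: Rintegral_FTC => //.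
  by rewrite (@le_trans _ _ 0)// oppr_le0.
exact: Fl.
Qed.

Lemma Rintegral_supp_itv (f : R -> R) (M : R) : (forall x, M < `|x| -> f x = 0) ->
  \int[mu]_x f x = \int[mu]_(x in `[- M, M]) f x.
Proof.
move=> f0; rewrite [RHS]Rintegral_mkcond; apply: eq_Rintegral => x _.
rewrite patchE; case: ifPn => //; rewrite notin_setE /= in_itv/= -ler_norml.
by move=> /negP; rewrite -ltNge => /f0.
Qed.

Lemma integrable_supp_itv (f : R -> R) (M : R) : continuous f ->
  (forall x, M < `|x| -> f x = 0) -> mu.-integrable setT (EFin \o f).
Proof.
move=> cf f0.
have -> : EFin \o f = (EFin \o f) \_ `[- M, M].
  apply/funext => x; rewrite patchE; case: ifPn => //.
  rewrite notin_setE /= in_itv/= -ler_norml.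
  by move=> /negP; rewrite -ltNge => /f0 ->.
by apply/(integrable_mkcond _ _).1 => //; exact: continuous_integrable_itv.
Qed.

(** The Cauchy density without its factor 1/pi. It is the common integrable majorant of the whole
    proof: its integral is pi for every center [a]. *)
Definition cauchy_kernel (a x : R) : R := (1 + (x - a) ^+ 2)^-1.

Lemma cauchy_kernel_ge0 a x : 0 <= cauchy_kernel a x.
Proof. by rewrite invr_ge0 addr_ge0// sqr_ge0. Qed.

Lemma continuous_cauchy_kernel a : continuous (cauchy_kernel a).
Proof.
move=> x; apply: cvgV; first by rewrite gt_eqF// ltr_pwDl// sqr_ge0.
apply: cvgD; first exact: cvg_cst.
rewrite expr2; under eq_fun do rewrite expr2.
by apply: cvgM; apply: cvgB; [exact: cvg_id|exact: cvg_cst|exact: cvg_id|exact: cvg_cst].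
Qed.

Lemma cvg_atan_nat (s a : R) : 0 < s ->
  atan (s * (n%:R - a)) - atan (s * (- n%:R - a)) @[n --> \oo] --> (pi : R).
Proof.
move=> s0.
have y (b : R) : atan (s * (n%:R - b)) @[n --> \oo] --> (pi / 2 : R).
  have H : atan (s * (r - b)) @[r --> +oo] --> (pi / 2 : R).
    apply: (@cvg_comp _ _ _ (fun r => s * (r - b)) atan _ +oo); last exact: cvgy_atan.
    by apply: gt0_cvgMry => //; exact: cvg_addrr.
  exact: (@cvg_comp _ _ _ (fun n : nat => n%:R : R) (fun r => atan (s * (r - b))) _ +oo _ (@cvgr_idn R) H).
have -> : (pi : R) = pi / 2 + pi / 2 by rewrite -splitr.
have -> : (fun n : nat => atan (s * (n%:R - a)) - atan (s * (- n%:R - a))) =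
          (fun n : nat => atan (s * (n%:R - a)) + atan (s * (n%:R - (- a)))).
  by apply/funext => n; rewrite -atanN; congr (_ + atan _); ring.
by apply: cvgD; exact: y.
Qed.

Lemma is_derive_atan_affine (s a x : R) :
  is_derive x (1 : R) (fun x => atan (s * (x - a))) (s / (1 + (s * (x - a)) ^+ 2)).
Proof.
have da : is_derive x (1 : R) (fun x => s * (x - a)) s.
  have := is_deriveZ s (is_deriveB (is_derive_id x (1 : R)) (is_derive_cst a x (1 : R))).
  by rewrite subr0 [s *: 1]mulr1.
have := @is_derive1_comp _ atan _ x _ _ (is_derive1_atan _) da.
by rewrite mulrC.
Qed.

Lemma integral_cauchy_kernel a : (\int[mu]_x (cauchy_kernel a x)%:E = (pi : R)%:E)%E.
Proof.
apply: (@ge0_integral_FTC_T (fun x => atan (1 * (x - a)))) => [x|||].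
- by apply: is_derive_eq (is_derive_atan_affine 1 a x) _; rewrite !mul1r.
- exact: continuous_cauchy_kernel.
- exact: cauchy_kernel_ge0.
- exact: cvg_atan_nat.
Qed.

Lemma integrable_cauchy_kernel a : mu.-integrable setT (EFin \o cauchy_kernel a).
Proof.
apply/integrableP; split.
  by apply/measurable_EFinP; apply: continuous_measurable_fun; exact: continuous_cauchy_kernel.
under eq_integral do rewrite /= ger0_norm ?cauchy_kernel_ge0//.
by rewrite integral_cauchy_kernel ltry.
Qed.

End real_line_integrals.

(** * Complex-valued integrals *)

Section complex_norm.
Variable R : realType.
Local Notation C := R[i].
Implicit Types (z w : C) (r t : R).

(** The modulus as a real number; the norm on [R[i]] takes its values in [R[i]]. *)
Definition cn z : R := complex.Re `|z|.

Lemma cnE z : cn z = Num.sqrt (complex.Re z ^+ 2 + complex.Im z ^+ 2).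
Proof. by case: z. Qed.

Lemma normcE z : `|z| = ((cn z)%:C)%C.
Proof. by rewrite cnE; case: z. Qed.

Lemma cn_ge0 z : 0 <= cn z. Proof. by rewrite cnE sqrtr_ge0. Qed.

Lemma lec_cn z r : (`|z| <= (r%:C)%C) = (cn z <= r).
Proof. by rewrite normcE lecR. Qed.

Lemma cn_sqr z : cn z ^+ 2 = complex.Re z ^+ 2 + complex.Im z ^+ 2.
Proof. by rewrite cnE sqr_sqrtr// addr_ge0// sqr_ge0. Qed.

Lemma cnM z w : cn (z * w) = cn z * cn w.
Proof. by rewrite /cn normrM !normcE -rmorphM. Qed.

Lemma cn_triangle z w : cn (z + w) <= cn z + cn w.
Proof. by rewrite -lec_cn rmorphD/= -!normcE ler_normD. Qed.

Lemma cnN z : cn (- z) = cn z.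
Proof. by rewrite /cn normrN. Qed.

Lemma cn_real r : cn (r%:C)%C = `|r|.
Proof. by rewrite cnE/= expr0n addr0 sqrtr_sqr. Qed.

Lemma cn_cis t : cn (cis t) = 1.
Proof. by rewrite cnE/= cos2Dsin2 sqrtr1. Qed.

Lemma cn0 : cn 0 = 0.
Proof. by rewrite /cn normr0. Qed.

Lemma le_Re_cn z : `|complex.Re z| <= cn z.
Proof.
by rewrite -ler_sqr ?nnegrE ?cn_ge0// cn_sqr real_normK ?num_real// lerDl sqr_ge0.
Qed.

Lemma le_Im_cn z : `|complex.Im z| <= cn z.
Proof.
by rewrite -ler_sqr ?nnegrE ?cn_ge0// cn_sqr real_normK ?num_real// lerDr sqr_ge0.
Qed.

Lemma cn_le z : cn z <= `|complex.Re z| + `|complex.Im z|.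
Proof.
rewrite -ler_sqr ?nnegrE ?cn_ge0 ?addr_ge0// cn_sqr sqrrD !real_normK ?num_real//.
by rewrite -addrA lerD2l lerDr mulrn_wge0// mulr_ge0.
Qed.

Lemma cisD s t : cis (s + t) = cis s * cis t.
Proof. by rewrite /cis cosD sinD; congr (_ +i* _)%C; rewrite addrC mulrC. Qed.

Lemma cis0 : cis (0 : R) = 1.
Proof. by rewrite /cis cos0 sin0. Qed.

Lemma conj_cis t : (cis t)^* = cis (- t).
Proof. by rewrite /cis cosN sinN. Qed.

Lemma ReM z w : complex.Re (z * w) =
  complex.Re z * complex.Re w - complex.Im z * complex.Im w.
Proof. by case: z; case: w. Qed.

Lemma ImM z w : complex.Im (z * w) =
  complex.Re z * complex.Im w + complex.Im z * complex.Re w.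
Proof. by case: z; case: w. Qed.

Lemma ReD z w : complex.Re (z + w) = complex.Re z + complex.Re w.
Proof. by case: z; case: w. Qed.

Lemma ImD z w : complex.Im (z + w) = complex.Im z + complex.Im w.
Proof. by case: z; case: w. Qed.

Lemma ReN z : complex.Re (- z) = - complex.Re z. Proof. by case: z. Qed.
Lemma ImN z : complex.Im (- z) = - complex.Im z. Proof. by case: z. Qed.
Lemma Re_conj z : complex.Re z^* = complex.Re z. Proof. by case: z. Qed.
Lemma Im_conj z : complex.Im z^* = - complex.Im z. Proof. by case: z. Qed.

Lemma eq_complex_parts z w :
  complex.Re z = complex.Re w -> complex.Im z = complex.Im w -> z = w.
Proof. by case: z => a b; case: w => c e /= -> ->. Qed.

End complex_norm.

Section complex_integral.
Context (R : realType) (disp : measure_display) (T : measurableType disp).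
Variable mu : {measure set T -> \bar R}.
Local Notation C := R[i].
Implicit Types (g h : T -> C).

Definition cmeasurable g :=
  measurable_fun setT (fun t => complex.Re (g t)) /\
  measurable_fun setT (fun t => complex.Im (g t)).

Definition cintegrable g :=
  mu.-integrable setT (EFin \o (fun t => complex.Re (g t))) /\
  mu.-integrable setT (EFin \o (fun t => complex.Im (g t))).

Lemma cintegrable_measurable g : cintegrable g -> cmeasurable g.
Proof. by move=> [/integrableP[/measurable_EFinP ? _] /integrableP[/measurable_EFinP ? _]]. Qed.

Lemma cmeasurable_cst (c : C) : cmeasurable (fun=> c).
Proof. by split; exact: measurable_cst. Qed.

Lemma cmeasurableM g h : cmeasurable g -> cmeasurable h -> cmeasurable (fun t => g t * h t).
Proof.
move=> [g1 g2] [h1 h2]; split.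
  by under eq_fun do rewrite ReM; apply: measurable_funB; exact: measurable_funM.
by under eq_fun do rewrite ImM; apply: measurable_funD; exact: measurable_funM.
Qed.

Lemma cmeasurableD g h : cmeasurable g -> cmeasurable h -> cmeasurable (fun t => g t + h t).
Proof.
move=> [g1 g2] [h1 h2]; split.
  by under eq_fun do rewrite ReD; exact: measurable_funD.
by under eq_fun do rewrite ImD; exact: measurable_funD.
Qed.

Lemma cmeasurableN g : cmeasurable g -> cmeasurable (fun t => - g t).
Proof.
move=> [g1 g2]; split.
  by under eq_fun do rewrite ReN; exact: measurableT_comp.
by under eq_fun do rewrite ImN; exact: measurableT_comp.
Qed.

Lemma cmeasurable_real (f : T -> R) : measurable_fun setT f -> cmeasurable (fun t => (f t)%:C%C).
Proof. by move=> mf; split=> //=; exact: measurable_cst. Qed.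

Lemma cmeasurable_cis (f : T -> R) : measurable_fun setT f -> cmeasurable (fun t => cis (f t)).
Proof.
move=> mf; split=> /=; apply: measurableT_comp => //; apply: continuous_measurable_fun.
  exact: continuous_cos.
exact: continuous_sin.
Qed.

Lemma measurable_cn g : cmeasurable g -> measurable_fun setT (fun t => cn (g t)).
Proof.
move=> [g1 g2]; under eq_fun do rewrite cnE.
apply: (measurableT_comp (f := @Num.sqrt R)).
  by apply: continuous_measurable_fun; exact: sqrt_continuous.
by apply: measurable_funD; exact: measurable_funX.
Qed.

Lemma cintegrable_le g (h : T -> R) : cmeasurable g ->
  mu.-integrable setT (EFin \o h) -> (forall t, cn (g t) <= h t) -> cintegrable g.
Proof.
move=> [g1 g2] hi gh; split; apply: le_integrable hi => //.
- exact/measurable_EFinP.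
- move=> t _ /=; rewrite lee_fin; apply: le_trans (ler_norm _).
  exact: le_trans (le_Re_cn _) (gh t).
- exact/measurable_EFinP.
- move=> t _ /=; rewrite lee_fin; apply: le_trans (ler_norm _).
  exact: le_trans (le_Im_cn _) (gh t).
Qed.

Lemma integrable_cn g : cintegrable g -> mu.-integrable setT (EFin \o (fun t => cn (g t))).
Proof.
move=> ig; have mg := cintegrable_measurable ig; have [g1 g2] := ig.
apply: (@le_integrable _ _ _ mu setT _ _
   (fun t => `|complex.Re (g t)|%:E + `|complex.Im (g t)|%:E)%E) => //.
- by apply/measurable_EFinP; exact: measurable_cn.
- move=> t _ /=; rewrite lee_fin (ger0_norm (cn_ge0 _)).
  by apply: le_trans (cn_le _) _; rewrite [leRHS]ger0_norm ?addr_ge0.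
- apply: integrableD => //; [exact: (integrable_abse g1)|exact: (integrable_abse g2)].
Qed.

Lemma cintegralD g h : cintegrable g -> cintegrable h ->
  cintegral mu setT (fun t => g t + h t) = cintegral mu setT g + cintegral mu setT h.
Proof.
move=> [g1 g2] [h1 h2]; apply: eq_complex_parts; rewrite ?ReD ?ImD/=.
  by under eq_Rintegral do rewrite ReD; exact: RintegralD.
by under eq_Rintegral do rewrite ImD; exact: RintegralD.
Qed.

Lemma cintegrableZ (a : C) g : cintegrable g -> cintegrable (fun t => a * g t).
Proof.
move=> ig; have mg := cintegrable_measurable ig.
apply: (@cintegrable_le _ (fun t => cn a * cn (g t))) => [||t]; last by rewrite cnM.
  by apply: cmeasurableM => //; exact: cmeasurable_cst.
exact: (integrableZl measurableT (cn a) (integrable_cn ig)).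
Qed.

Lemma cintegrableD g h : cintegrable g -> cintegrable h -> cintegrable (fun t => g t + h t).
Proof.
move=> ig ih; apply: (@cintegrable_le _ (fun t => cn (g t) + cn (h t))) => [||t].
- by apply: cmeasurableD; exact: cintegrable_measurable.
- by apply: (integrableD measurableT (integrable_cn ig) (integrable_cn ih)).
- exact: cn_triangle.
Qed.

Lemma cintegralZ (a : C) g : cintegrable g ->
  cintegral mu setT (fun t => a * g t) = a * cintegral mu setT g.
Proof.
move=> [g1 g2]; apply: eq_complex_parts; rewrite ?ReM ?ImM/=.
  under eq_Rintegral do rewrite ReM.
  rewrite RintegralB//; last 2 first.
    exact: (integrableZl measurableT (complex.Re a) g1).
    exact: (integrableZl measurableT (complex.Im a) g2).
  by rewrite !RintegralZl.
under eq_Rintegral do rewrite ImM.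
rewrite RintegralD//; last 2 first.
  exact: (integrableZl measurableT (complex.Re a) g2).
  exact: (integrableZl measurableT (complex.Im a) g1).
by rewrite !RintegralZl.
Qed.

Lemma cintegralB g h : cintegrable g -> cintegrable h ->
  cintegral mu setT (fun t => g t - h t) = cintegral mu setT g - cintegral mu setT h.
Proof.
move=> ig ih; under eq_fun do rewrite -mulN1r.
by rewrite cintegralD ?cintegralZ ?mulN1r//; exact: cintegrableZ.
Qed.

(* The constant 2 is not sharp: the real and imaginary parts are bounded
   separately. *)
Lemma cn_cintegral_le g (h : T -> R) : cmeasurable g ->
  mu.-integrable setT (EFin \o h) -> (forall t, cn (g t) <= h t) ->
  cn (cintegral mu setT g) <= 2 * \int[mu]_t h t.
Proof.
move=> mg ih gh; have [g1 g2] := cintegrable_le mg ih gh.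
apply: le_trans (cn_le _) _; rewrite mulrC mulr_natr mulr2n/=; apply: lerD.
  apply: le_trans (le_normr_Rintegral _ g1) _ => //.
  apply: le_Rintegral => //; first exact: (integrable_norm g1).
  by move=> t _; apply: le_trans (gh t); exact: le_Re_cn.
apply: le_trans (le_normr_Rintegral _ g2) _ => //.
apply: le_Rintegral => //; first exact: (integrable_norm g2).
by move=> t _; apply: le_trans (gh t); exact: le_Im_cn.
Qed.

Lemma eq_cintegral g h : g =1 h -> cintegral mu setT g = cintegral mu setT h.
Proof. by move=> /funext ->. Qed.

End complex_integral.

Section complex_fubini.
Context (R : realType) (d1 d2 : measure_display)
  (T1 : measurableType d1) (T2 : measurableType d2).
Variables (m1 : {sigma_finite_measure set T1 -> \bar R})
  (m2 : {sigma_finite_measure set T2 -> \bar R}).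
Local Notation C := R[i].

(** All slices, not only almost all, are assumed integrable: inner real integrals are obtained
    through [fine], which is faithful on finite values only. *)
Lemma Rintegral_fubini (f : T1 * T2 -> R) :
  (m1 \x m2)%E.-integrable setT (EFin \o f) ->
  (forall x, m2.-integrable setT (fun y => (f (x, y))%:E)) ->
  \int[(m1 \x m2)%E]_p f p = \int[m1]_x \int[m2]_y f (x, y).
Proof.
move=> fi f2; rewrite /Rintegral; congr fine.
rewrite -integral12_prod_meas1//; apply: eq_integral => x _.
by rewrite fineK//; exact: integrable_fin_num.
Qed.

Lemma Rintegral_fubini_swap (f : T1 * T2 -> R) :
  (m1 \x m2)%E.-integrable setT (EFin \o f) ->
  (forall x, m2.-integrable setT (fun y => (f (x, y))%:E)) ->
  (forall y, m1.-integrable setT (fun x => (f (x, y))%:E)) ->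
  \int[m1]_x \int[m2]_y f (x, y) = \int[m2]_y \int[m1]_x f (x, y).
Proof.
move=> fi f2 f1; rewrite -Rintegral_fubini// /Rintegral; congr fine.
rewrite -integral21_prod_meas1//; apply: eq_integral => y _.
by rewrite fineK//; exact: integrable_fin_num.
Qed.

Lemma cfubini_swap (f : T1 * T2 -> C) :
  cintegrable (m1 \x m2)%E f ->
  (forall x, cintegrable m2 (fun y => f (x, y))) ->
  (forall y, cintegrable m1 (fun x => f (x, y))) ->
  cintegral m1 setT (fun x => cintegral m2 setT (fun y => f (x, y))) =
  cintegral m2 setT (fun y => cintegral m1 setT (fun x => f (x, y))).
Proof.
move=> [r i] h2 h1; apply: eq_complex_parts => /=.
  by apply: (Rintegral_fubini_swap (f := fun p => complex.Re (f p))) => // x;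
    [have [] := h2 x|have [] := h1 x].
by apply: (Rintegral_fubini_swap (f := fun p => complex.Im (f p))) => // x;
    [have [] := h2 x|have [] := h1 x].
Qed.

Lemma cfubini (f : T1 * T2 -> C) :
  cintegrable (m1 \x m2)%E f ->
  (forall x, cintegrable m2 (fun y => f (x, y))) ->
  cintegral (m1 \x m2)%E setT f =
  cintegral m1 setT (fun x => cintegral m2 setT (fun y => f (x, y))).
Proof.
move=> [r i] h2; apply: eq_complex_parts => /=.
  by apply: (Rintegral_fubini (f := fun p => complex.Re (f p))) => // x;
    have [] := h2 x.
by apply: (Rintegral_fubini (f := fun p => complex.Im (f p))) => // x;
    have [] := h2 x.
Qed.

Lemma measurable_Rintegral_param (f : T1 * T2 -> R) :
  (m1 \x m2)%E.-integrable setT (EFin \o f) ->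
  measurable_fun setT (fun x => \int[m2]_y f (x, y)).
Proof.
move=> fi; rewrite /Rintegral.
by apply: measurableT_comp => //; exact: (measurable_fubini_F fi).
Qed.

Lemma cmeasurable_param (f : T1 * T2 -> C) :
  cintegrable (m1 \x m2)%E f ->
  cmeasurable (fun x => cintegral m2 setT (fun y => f (x, y))).
Proof.
move=> [r i]; split.
  exact: (measurable_Rintegral_param (f := fun p => complex.Re (f p))).
exact: (measurable_Rintegral_param (f := fun p => complex.Im (f p))).
Qed.

Lemma integrable_tensor (g : T1 -> R) (h : T2 -> R) :
  m1.-integrable setT (EFin \o g) -> m2.-integrable setT (EFin \o h) ->
  (m1 \x m2)%E.-integrable setT (EFin \o (fun p => g p.1 * h p.2)).
Proof.
move=> /integrableP[mg gi] /integrableP[mh hi].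
have mgh : measurable_fun setT (EFin \o (fun p : T1 * T2 => g p.1 * h p.2)).
  apply/measurable_EFinP; apply: measurable_funM.
    by apply: (measurableT_comp (f := g)) => //; exact/measurable_EFinP.
  by apply: (measurableT_comp (f := h)) => //; exact/measurable_EFinP.
have [_ H] := @integrable12ltyP _ _ _ _ R m1 m2 _ mgh; apply: H => /=.
have E x : (\int[m2]_y `|g x * h y|%:E = `|g x|%:E * \int[m2]_y `|(h y)%:E|)%E.
  rewrite -ge0_integralZl//; first by apply: eq_integral => y _; rewrite normrM EFinM.
  exact: measurableT_comp.
under eq_integral do rewrite E.
rewrite ge0_integralZr//.
- rewrite lte_mul_pinfty//; first exact: integral_ge0.
  rewrite ge0_fin_numE//; exact: integral_ge0.
- apply/measurable_EFinP; apply: measurableT_comp => //; exact/measurable_EFinP.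
- exact: integral_ge0.
Qed.

Lemma cintegrable_tensor (g : T1 -> C) (h : T2 -> C) :
  cintegrable m1 g -> cintegrable m2 h ->
  cintegrable (m1 \x m2)%E (fun p => g p.1 * h p.2).
Proof.
move=> ig ih.
have [[g1 g2] [h1 h2]] := (cintegrable_measurable ig, cintegrable_measurable ih).
apply: (@cintegrable_le _ _ _ _ _ (fun p => cn (g p.1) * cn (h p.2))).
- apply: cmeasurableM; split.
  + exact: (measurableT_comp (f := fun t => complex.Re (g t))).
  + exact: (measurableT_comp (f := fun t => complex.Im (g t))).
  + exact: (measurableT_comp (f := fun t => complex.Re (h t))).
  + exact: (measurableT_comp (f := fun t => complex.Im (h t))).
- exact: (integrable_tensor (integrable_cn ig) (integrable_cn ih)).
- by move=> p; rewrite cnM.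
Qed.

Lemma cintegral_tensor (g : T1 -> C) (h : T2 -> C) :
  cintegrable m1 g -> cintegrable m2 h ->
  cintegral (m1 \x m2)%E setT (fun p => g p.1 * h p.2) =
  cintegral m1 setT g * cintegral m2 setT h.
Proof.
move=> ig ih; rewrite cfubini/=; first last.
- by move=> x; exact: cintegrableZ.
- exact: cintegrable_tensor.
under eq_cintegral do rewrite cintegralZ// mulrC.
by rewrite cintegralZ// mulrC.
Qed.

End complex_fubini.

Section tuple_products.
Variable R : realType.
Local Notation C := R[i].
Local Notation mu := (@lebesgue_measure R).
Local Notation muT := (product_power mu).

Lemma cintegrable_tuple n (f : n.+1.-tuple (measurableTypeR R) -> C) : cmeasurable f ->
  cintegrable (muT n.+1) f <->
  cintegrable (mu \x muT n)%E (fun p => f (tuple_cons p)).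
Proof.
move=> [f1 f2]; split=> -[i1 i2]; split.
- by apply/(integrable_tuple (f := EFin \o (fun t => complex.Re (f t)))) => //; exact/measurable_EFinP.
- by apply/(integrable_tuple (f := EFin \o (fun t => complex.Im (f t)))) => //; exact/measurable_EFinP.
- by apply/(integrable_tuple (f := EFin \o (fun t => complex.Re (f t)))) => //; exact/measurable_EFinP.
- by apply/(integrable_tuple (f := EFin \o (fun t => complex.Im (f t)))) => //; exact/measurable_EFinP.
Qed.

Lemma Rintegral_tuple n (f : n.+1.-tuple (measurableTypeR R) -> R) :
  (muT n.+1).-integrable setT (EFin \o f) ->
  \int[muT n.+1]_t f t = \int[(mu \x muT n)%E]_p f (tuple_cons p).
Proof.
move=> fi; have mf : measurable_fun setT (EFin \o f) by case/integrableP : fi.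
have fi' := (integrable_tuple mf).1 fi.
by rewrite /Rintegral (integral_tuple fi) -integral12_prod_meas1.
Qed.

Lemma cintegral_tuple n (f : n.+1.-tuple (measurableTypeR R) -> C) :
  cintegrable (muT n.+1) f ->
  cintegral (muT n.+1) setT f = cintegral (mu \x muT n)%E setT (fun p => f (tuple_cons p)).
Proof. by move=> [f1 f2]; apply: eq_complex_parts => /=; exact: Rintegral_tuple. Qed.

Lemma prod_tuple_cons n (g : nat -> R -> C) (p : R * n.-tuple (measurableTypeR R)) :
  \prod_(i < n.+1) g i (tnth (tuple_cons p) i) =
  g 0%N p.1 * \prod_(i < n) g i.+1 (tnth p.2 i).
Proof.
rewrite big_ord_recl; congr (g 0%N _ * _).
apply: eq_bigr => i _; congr (g _ _).
by rewrite [tuple_cons p]/tuple_cons tnthS.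
Qed.

Lemma cmeasurable_prod_tuple n (g : nat -> R -> C) : (forall i, cmeasurable (g i)) ->
  cmeasurable (fun t : n.-tuple (measurableTypeR R) => \prod_(i < n) g i (tnth t i)).
Proof.
move=> mg.
have : forall s : seq 'I_n, cmeasurable
   (fun t : n.-tuple (measurableTypeR R) => \prod_(i <- s) g i (tnth t i)).
  elim=> [|i s IH]; first by under eq_fun do rewrite big_nil; exact: cmeasurable_cst.
  under eq_fun do rewrite big_cons; apply: cmeasurableM => //.
  have [m1 m2] := mg i; split.
    exact: (measurableT_comp m1 (@measurable_tnth _ (measurableTypeR R) n i)).
  exact: (measurableT_comp m2 (@measurable_tnth _ (measurableTypeR R) n i)).
exact.
Qed.

Lemma cintegral_prod_tuple n (g : nat -> R -> C) : (forall i, cintegrable mu (g i)) ->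
  cintegrable (muT n) (fun t => \prod_(i < n) g i (tnth t i)) /\
  cintegral (muT n) setT (fun t => \prod_(i < n) g i (tnth t i)) =
    \prod_(i < n) cintegral mu setT (g i).
Proof.
elim: n g => [|n IH] g ig.
  under eq_fun do rewrite big_ord0; rewrite big_ord0; split.
    split; apply/integrableP; split; rewrite ?integral_dirac//=;
      try exact/measurable_EFinP/measurable_cst; by rewrite diracT mul1e ltry.
  have m0 : muT 0 setT = 1%E by exact: diracT.
  apply: eq_complex_parts; rewrite [LHS]Rintegral_cst//.
    by rewrite (_ : fine _ = 1) ?mulr1// -[RHS]/(fine 1%E) -m0.
  by rewrite mul0r.
have [i1 e1] := IH (fun k => g k.+1) (fun k => ig k.+1).
have mp := cmeasurable_prod_tuple n.+1 (fun i => cintegrable_measurable (ig i)).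
have E : (fun p => \prod_(i < n.+1) g i (tnth (tuple_cons p) i)) =
    (fun p : R * n.-tuple (measurableTypeR R) => g 0%N p.1 * \prod_(i < n) g i.+1 (tnth p.2 i)).
  by apply/funext => p; exact: prod_tuple_cons.
have it : cintegrable (muT n.+1) (fun t => \prod_(i < n.+1) g i (tnth t i)).
  by apply/cintegrable_tuple => //; rewrite E; exact: (cintegrable_tensor (ig 0%N) i1).
split=> //; rewrite cintegral_tuple// E.
by rewrite (cintegral_tensor (ig 0%N) i1) e1 big_ord_recl.
Qed.

Lemma Rintegral_prod_tuple n (g : nat -> R -> R) :
  (forall i, mu.-integrable setT (EFin \o g i)) ->
  (muT n).-integrable setT (EFin \o (fun t => \prod_(i < n) g i (tnth t i))) /\
  \int[muT n]_t \prod_(i < n) g i (tnth t i) = \prod_(i < n) \int[mu]_x g i x.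
Proof.
move=> ig.
have icg i : cintegrable mu (fun x => (g i x)%:C%C).
  by split => //=; exact: integrable0.
have [[h _] /(congr1 (@complex.Re R)) e] := cintegral_prod_tuple n icg.
have E t : \prod_(i < n) ((g i (tnth t i))%:C)%C = ((\prod_(i < n) g i (tnth t i))%:C)%C.
  by rewrite rmorph_prod.
split; first by move: h; under eq_fun do rewrite E.
move: e => /=; under eq_Rintegral do rewrite E/=; move=> ->.
have E2 i : cintegral mu setT (fun x => (g i x)%:C%C) = ((\int[mu]_x g i x)%:C)%C.
  by apply: eq_complex_parts => //=; rewrite /Rintegral integral0.
by under eq_bigr do rewrite E2; rewrite -rmorph_prod.
Qed.

End tuple_products.

(** * Fourier inversion in one variable *)

Section fourier_line.
Variable R : realType.
Local Notation C := R[i].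
Local Notation mu := (@lebesgue_measure R).
Implicit Types (phi : R -> R) (M : R).

Definition ft phi (xi : R) : C :=
  cintegral mu setT (fun y => cis (- (y * xi)) * (phi y)%:C%C).

Lemma continuous_cosM (a : R) : continuous (fun y : R => cos (y * a)).
Proof.
move=> y; apply: (@continuous_comp _ _ _ (fun y : R => y * a) cos).
  by apply: cvgM; [exact: cvg_id|exact: cvg_cst].
exact: continuous_cos.
Qed.

Lemma continuous_sinM (a : R) : continuous (fun y : R => sin (y * a)).
Proof.
move=> y; apply: (@continuous_comp _ _ _ (fun y : R => y * a) sin).
  by apply: cvgM; [exact: cvg_id|exact: cvg_cst].
exact: continuous_sin.
Qed.

Lemma continuous_mul (f g : R -> R) : continuous f -> continuous g ->
  continuous (fun y => f y * g y).
Proof. by move=> cf cg y; apply: cvgM; [exact: cf|exact: cg]. Qed.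

Lemma ftE phi xi :
  mu.-integrable setT (EFin \o (fun y => sin (y * xi) * phi y)) -> ft phi xi =
  (\int[mu]_y (cos (y * xi) * phi y) +i* - \int[mu]_y (sin (y * xi) * phi y))%C.
Proof.
move=> hi; apply: eq_complex_parts => /=.
  by apply: eq_Rintegral => y _; rewrite mulr0 subr0 cosN.
under eq_Rintegral do rewrite mulr0 add0r sinN mulNr -mulN1r.
by rewrite RintegralZl// mulN1r.
Qed.

Definition bump_on M phi := rsmooth phi /\ forall x, M < `|x| -> phi x = 0.

Section decay.
Variables (M : R).
Hypothesis M0 : 0 <= M.

Lemma bump_derive phi : bump_on M phi -> bump_on M (fun x : R => 'D_1 phi x).
Proof.
move=> [sphi phi0]; split; first exact: rsmooth_derive.
move=> x Mx; apply: derive_val.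
have E : \near x, (cst (0 : R)) x = phi x.
  have : {for x, continuous (fun y : R => `|y|)} by exact: norm_continuous.
  move=> /(_ _ (lt_nbhsr Mx)) H; near=> y; rewrite phi0//; near: y; exact: H.
exact: (near_eq_is_derive E (is_derive_cst (0 : R) x (1 : R))).
Unshelve. all: by end_near. Qed.

Lemma bump_continuous phi : bump_on M phi -> continuous phi.
Proof. by move=> [/rsmooth_continuous]. Qed.

Lemma Rintegral_bump_FTC (F f : R -> R) :
  (forall x : R, is_derive x (1 : R) F (f x)) -> continuous f ->
  (forall x, M < `|x| -> F x = 0) -> (forall x, M < `|x| -> f x = 0) ->
  \int[mu]_x f x = 0.
Proof.
move=> dF cf F0 f0.
rewrite (@Rintegral_supp_itv _ _ (M + 1)); last first.
  by move=> x Mx; apply: f0; apply: lt_trans Mx; rewrite ltrDl.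
have M1 : 0 <= M + 1 by rewrite addr_ge0.
rewrite (Rintegral_FTC dF cf) ?(le_trans _ M1) ?oppr_le0//.
by rewrite !F0 ?subrr// ?normrN ger0_norm// ltrDl.
Qed.

Lemma ft_derive phi (xi : R) : bump_on M phi ->
  \int[mu]_y (cos (y * xi) * 'D_1 phi y) = xi * \int[mu]_y (sin (y * xi) * phi y) /\
  \int[mu]_y (sin (y * xi) * 'D_1 phi y) = - (xi * \int[mu]_y (cos (y * xi) * phi y)).
Proof.
move=> bphi; have bphi' := bump_derive bphi.
have [sphi phi0] := bphi; have [_ phi0'] := bphi'.
have c1 := bump_continuous bphi; have c2 := bump_continuous bphi'.
have dphi (x : R) : is_derive x (1 : R) phi ('D_1 phi x).
  by apply/derivableP; exact: rsmooth_derivable.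
have dm (x : R) : is_derive x (1 : R) (fun x => x * xi) xi.
  by apply: is_derive_eq (is_deriveM (is_derive_id x 1) (is_derive_cst xi x (1 : R))) _;
    rewrite /GRing.scale/= mulr0 add0r mulr1.
have dc (x : R) : is_derive x (1 : R) (fun x => cos (x * xi)) (- sin (x * xi) * xi).
  exact: (@is_derive1_comp _ cos _ x _ _ (is_derive_cos _) (dm x)).
have ds (x : R) : is_derive x (1 : R) (fun x => sin (x * xi)) (cos (x * xi) * xi).
  exact: (@is_derive1_comp _ sin _ x _ _ (is_derive_sin _) (dm x)).
have ii (f g : R -> R) : continuous f -> continuous g -> (forall x, M < `|x| -> g x = 0) ->
    mu.-integrable setT (EFin \o (fun y => f y * g y)).
  move=> cf cg g0; apply: (@integrable_supp_itv _ _ M); first exact: continuous_mul.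
  by move=> x /g0 ->; rewrite mulr0.
have cC := @continuous_cosM xi; have cS := @continuous_sinM xi.
split.
  have : \int[mu]_y (cos (y * xi) * 'D_1 phi y - xi * (sin (y * xi) * phi y)) = 0.
    apply: (@Rintegral_bump_FTC (fun y => cos (y * xi) * phi y)).
    - move=> x; apply: is_derive_eq (is_deriveM (dc x) (dphi x)) _.
      by rewrite /GRing.scale/=; ring.
    - move=> x; apply: cvgB; first exact: (continuous_mul cC c2).
      by apply: cvgM; [exact: cvg_cst|exact: (continuous_mul cS c1)].
    - by move=> x /phi0 ->; rewrite mulr0.
    - by move=> x Mx; rewrite phi0// phi0'// !mulr0 subrr.
  rewrite RintegralB//; [|exact: ii|exact: (integrableZl measurableT xi (ii _ _ cS c1 phi0))].
  by rewrite RintegralZl//; [move/eqP; rewrite subr_eq0 => /eqP|exact: ii].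
have : \int[mu]_y (sin (y * xi) * 'D_1 phi y + xi * (cos (y * xi) * phi y)) = 0.
  apply: (@Rintegral_bump_FTC (fun y => sin (y * xi) * phi y)).
  - move=> x; apply: is_derive_eq (is_deriveM (ds x) (dphi x)) _.
    by rewrite /GRing.scale/=; ring.
  - move=> x; apply: cvgD; first exact: (continuous_mul cS c2).
    by apply: cvgM; [exact: cvg_cst|exact: (continuous_mul cC c1)].
  - by move=> x /phi0 ->; rewrite mulr0.
  - by move=> x Mx; rewrite phi0// phi0'// !mulr0 addr0.
rewrite RintegralD//; [|exact: ii|exact: (integrableZl measurableT xi (ii _ _ cC c1 phi0))].
by rewrite RintegralZl//; [move/eqP; rewrite addr_eq0 => /eqP|exact: ii].
Qed.

(** The operator 1 - d^2/dx^2 preserves bumps and multiplies the transform by 1 + xi^2; iterating it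
    in [ft_decay] gives decay against every power of this weight. *)
Lemma ft_helmholtz phi (xi : R) : bump_on M phi ->
  ft (fun x => phi x - 'D_1 (fun y : R => 'D_1 phi y) x) xi = ((1 + xi ^+ 2)%:C)%C * ft phi xi.
Proof.
move=> bphi; have bphi' := bump_derive bphi; have bphi'' := bump_derive bphi'.
have [e1 e2] := ft_derive xi bphi; have [e3 e4] := ft_derive xi bphi'.
have ii (f g : R -> R) : continuous f -> bump_on M g ->
    mu.-integrable setT (EFin \o (fun y => f y * g y)).
  move=> cf [/rsmooth_continuous cg g0].
  apply: (@integrable_supp_itv _ _ M); first exact: continuous_mul.
  by move=> x /g0 ->; rewrite mulr0.
have bd : bump_on M (fun x => phi x - 'D_1 (fun y : R => 'D_1 phi y) x).
  split; first by apply: rsmoothB; [case: bphi|case: bphi''].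
  by move=> x Mx; rewrite (bphi.2 _ Mx) (bphi''.2 _ Mx) subrr.
rewrite !ftE; [|exact: ii _ _ (@continuous_sinM xi) bphi|exact: ii _ _ (@continuous_sinM xi) bd].
apply: eq_complex_parts; rewrite ?ReM ?ImM/= mul0r ?subr0 ?addr0.
  under eq_Rintegral do rewrite mulrBr.
  rewrite RintegralB//; [|exact: ii _ _ (@continuous_cosM xi) bphi|exact: ii _ _ (@continuous_cosM xi) bphi''].
  by rewrite e3 e2; ring.
under eq_Rintegral do rewrite mulrBr.
rewrite RintegralB//; [|exact: ii _ _ (@continuous_sinM xi) bphi|exact: ii _ _ (@continuous_sinM xi) bphi''].
by rewrite e4 e1; ring.
Qed.

Lemma ft_decay phi (k : nat) : bump_on M phi ->
  exists2 K, 0 <= K & forall xi, (1 + xi ^+ 2) ^+ k * cn (ft phi xi) <= K.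
Proof.
elim: k phi => [|k IH] phi bphi.
  have [sphi phi0] := bphi.
  have iphi : mu.-integrable setT (EFin \o (fun y => `|phi y|)).
    apply: (@integrable_supp_itv _ _ M) => [x|x /phi0 ->]; last by rewrite normr0.
    by apply: (cvg_norm (bump_continuous bphi (x := x))).
  exists (2 * \int[mu]_y `|phi y|); first by rewrite mulr_ge0// Rintegral_ge0.
  move=> xi; rewrite expr0 mul1r; apply: cn_cintegral_le => // [|t].
    apply: cmeasurableM; last first.
      apply: cmeasurable_real; apply: continuous_measurable_fun.
      exact: bump_continuous.
    apply: cmeasurable_cis; apply: measurableT_comp => //.
    exact: measurable_funM.
  by rewrite cnM cn_cis mul1r cn_real.
have bphi'' := bump_derive (bump_derive bphi).
have [|K K0 HK] := IH (fun x => phi x - 'D_1 (fun y : R => 'D_1 phi y) x).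
  split; first by apply: rsmoothB; [case: bphi|case: bphi''].
  by move=> x Mx; rewrite (bphi.2 _ Mx) (bphi''.2 _ Mx) subrr.
exists K => // xi; have := HK xi; rewrite ft_helmholtz// cnM cn_real.
rewrite [`|1 + _|]ger0_norm; last by rewrite addr_ge0 ?sqr_ge0.
by rewrite mulrA -exprSr.
Qed.

End decay.

(** The Poisson kernel e / (e^2 + (y - x)^2), without its factor 1/pi. *)
Definition poisson (e x y : R) : R := e^-1 / (1 + (e^-1 * (y - x)) ^+ 2).

Lemma continuous_poisson (e x : R) : continuous (poisson e x).
Proof.
move=> y; apply: cvgM; first exact: cvg_cst.
apply: cvgV; first by rewrite gt_eqF// ltr_pwDl// sqr_ge0.
apply: cvgD; first exact: cvg_cst.
rewrite expr2; under eq_fun do rewrite expr2.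
by apply: cvgM; (apply: cvgM; [exact: cvg_cst|apply: cvgB; [exact: cvg_id|exact: cvg_cst]]).
Qed.

Lemma poisson_ge0 (e x y : R) : 0 < e -> 0 <= poisson e x y.
Proof. by move=> e0; rewrite divr_ge0 ?invr_ge0 ?(ltW e0)// addr_ge0// sqr_ge0. Qed.

Lemma integral_poisson (e x : R) : 0 < e -> (\int[mu]_y (poisson e x y)%:E = (pi : R)%:E)%E.
Proof.
move=> e0.
apply: (@ge0_integral_FTC_T _ (fun y => atan (e^-1 * (y - x)))) => [y|||].
- exact: is_derive_atan_affine.
- exact: continuous_poisson.
- by move=> y; exact: poisson_ge0.
- by apply: cvg_atan_nat; rewrite invr_gt0.
Qed.

Lemma integrable_poisson (e x : R) : 0 < e -> mu.-integrable setT (EFin \o poisson e x).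
Proof.
move=> e0; apply/integrableP; split.
  by apply/measurable_EFinP; apply: continuous_measurable_fun; exact: continuous_poisson.
under eq_integral do rewrite /= ger0_norm ?poisson_ge0//.
by rewrite integral_poisson// ltry.
Qed.

Lemma poisson_le (e x y dl : R) : 0 < e -> 0 < dl -> dl <= `|y - x| ->
  poisson e x y <= e * (1 + dl ^- 2) * cauchy_kernel x y.
Proof.
move=> e0 dl0 yx.
have D2 : dl ^+ 2 <= (y - x) ^+ 2.
  by rewrite -[leRHS]real_normK ?num_real// ler_sqr ?nnegrE// ltW.
have y0 : 0 < (y - x) ^+ 2 by apply: lt_le_trans D2; rewrite exprn_gt0.
have -> : poisson e x y = e / (e ^+ 2 + (y - x) ^+ 2).
  rewrite /poisson; field; rewrite !gt_eqF//=.
  by rewrite ltr_pwDl ?exprn_gt0 ?sqr_ge0.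
rewrite -mulrA ler_pM2l// /cauchy_kernel ler_pdivlMr ?ltr_pwDl ?sqr_ge0//.
rewrite mulrC ler_pdivrMr ?ltr_wpDl ?sqr_ge0//.
have : 1 <= dl ^- 2 * (y - x) ^+ 2 by rewrite mulrC ler_pdivlMr ?exprn_gt0// mul1r.
have : 0 <= e ^+ 2 * (1 + dl ^- 2) by rewrite mulr_ge0 ?sqr_ge0// addr_ge0// invr_ge0 sqr_ge0.
set a := dl ^- 2; set b := (y - x) ^+ 2; lra.
Qed.

Lemma expRN_le_cauchy (e xi : R) : 0 < e -> e <= 1 ->
  expR (- (e * `|xi|)) <= 2 * e ^- 2 * cauchy_kernel 0 xi.
Proof.
move=> e0 e1; set s := e * `|xi|.
have s0 : 0 <= s by rewrite mulr_ge0// ltW.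
have H := expR_ge1Dxn 1 s0.
have xi2 : 0 <= xi ^+ 2 by rewrite sqr_ge0.
have s2 : s ^+ 2 = e ^+ 2 * xi ^+ 2 by rewrite exprMn real_normK ?num_real.
rewrite expRN /cauchy_kernel subr0 -[leLHS]mul1r ler_pdivrMr ?expR_gt0//.
apply: (@le_trans _ _ (2 * e ^- 2 / (1 + xi ^+ 2) * (1 + s ^+ 2 / 2`!%:R))); last first.
  by rewrite ler_wpM2l// mulr_ge0 ?mulr_ge0 ?invr_ge0 ?sqr_ge0 ?addr_ge0.
rewrite s2 mulrAC ler_pdivlMr ?ltr_pwDl// mul1r mulrDr mulr1.
have -> : 2 * e ^- 2 * (e ^+ 2 * xi ^+ 2 / 2`!%:R) = xi ^+ 2.
  by rewrite (_ : 2`! = 2)%N//; field; rewrite gt_eqF.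
rewrite lerD2r; apply: (@le_trans _ _ (2 * 1)); first by rewrite mulr1 ler1n.
by rewrite ler_wpM2l// invf_ge1 ?exprn_gt0// exprn_ile1// ltW.
Qed.

Lemma continuous_expRN_norm (e : R) : continuous (fun xi : R => expR (- (e * `|xi|))).
Proof.
move=> x; apply: (@continuous_comp _ _ _ (fun xi : R => - (e * `|xi|)) expR).
  by apply: cvgN; apply: cvgM; [exact: cvg_cst|exact: norm_continuous].
exact: continuous_expR.
Qed.

Lemma integrable_expRN_norm (e : R) : 0 < e -> e <= 1 ->
  mu.-integrable setT (EFin \o (fun xi : R => expR (- (e * `|xi|)))).
Proof.
move=> e0 e1.
apply: (@le_integrable _ _ _ mu setT _ _
    (EFin \o (fun xi : R => 2 * e ^- 2 * cauchy_kernel 0 xi))) => //.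
- apply/measurable_EFinP; apply: continuous_measurable_fun; exact: continuous_expRN_norm.
- move=> t _ /=; rewrite lee_fin ger0_norm ?expR_ge0//.
  by apply: le_trans (ler_norm _); exact: expRN_le_cauchy.
- exact: (integrableZl measurableT (2 * e ^- 2) (integrable_cauchy_kernel (0 : R))).
Qed.

End fourier_line.

Section laplace.
Variable R : realType.
Local Notation mu := (@lebesgue_measure R).

Lemma is_derive_expR_linear (a x : R) :
  is_derive x (1 : R) (fun x => expR (a * x)) (a * expR (a * x)).
Proof.
have dm : is_derive x (1 : R) (fun x => a * x) a.
  by apply: is_derive_eq (is_deriveZ a (is_derive_id x (1 : R))) _; rewrite [_ *: _]mulr1.
by have := @is_derive1_comp _ expR _ x _ _ (is_derive_expR _) dm; rewrite mulrC.
Qed.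

Lemma is_derive_damped_trig (a u p q x : R) :
  is_derive x (1 : R) (fun x => expR (a * x) * (p * cos (x * u) + q * sin (x * u)))
    (expR (a * x) * ((a * p + q * u) * cos (x * u) + (a * q - p * u) * sin (x * u))).
Proof.
have dm : is_derive x (1 : R) (fun x => x * u) u.
  by apply: is_derive_eq (is_deriveM (is_derive_id x 1) (is_derive_cst u x (1 : R))) _;
    rewrite /GRing.scale/= mulr0 add0r mulr1.
have dc : is_derive x (1 : R) (fun x => cos (x * u)) (- sin (x * u) * u).
  exact: (@is_derive1_comp _ cos _ x _ _ (is_derive_cos _) dm).
have ds : is_derive x (1 : R) (fun x => sin (x * u)) (cos (x * u) * u).
  exact: (@is_derive1_comp _ sin _ x _ _ (is_derive_sin _) dm).
apply: is_derive_eq (is_deriveM (is_derive_expR_linear a x)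
  (is_deriveD (is_deriveZ p dc) (is_deriveZ q ds))) _.
rewrite [X in X *: (a * _)](_ : _ = p * cos (x * u) + q * sin (x * u))//.
by rewrite /GRing.scale/=; ring.
Qed.

Lemma continuous_damped_trig (a u p q : R) :
  continuous (fun x : R => expR (a * x) * (p * cos (x * u) + q * sin (x * u))).
Proof. by move=> x; exact: is_derive1_continuous (is_derive_damped_trig a u p q x). Qed.

Lemma Rintegral_split0 (f : R -> R) (n : nat) : continuous f ->
  \int[mu]_(x in `[- n%:R, n%:R]) f x =
  \int[mu]_(x in `[- n%:R, 0]) f x + \int[mu]_(x in `[0, n%:R]) f x.
Proof.
move=> cf; have fi := continuous_integrable_itv (- n%:R) n%:R cf.
have := Rintegral_itvB fi (_ : (BLeft (- n%:R) <= BRight 0)%O) (_ : (BRight 0 <= BRight n%:R)%O).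
rewrite !bnd_simp oppr_le0 ler0n => /(_ isT isT) /eqP; rewrite subr_eq => /eqP ->.
rewrite addrC; congr (_ + _).
rewrite Rintegral_itv_obnd_cbnd//.
by apply: integrableS fi => //; apply: subset_itvr; rewrite bnd_simp oppr_le0.
Qed.

Variables (e u : R).
Hypotheses (e0 : 0 < e) (e1 : e <= 1).
Let den := e ^+ 2 + u ^+ 2.

Let den0 : den != 0.
Proof. by rewrite gt_eqF// ltr_pwDl ?exprn_gt0// sqr_ge0. Qed.

(* Splitting at 0 avoids differentiating the antiderivative of a function of
   |xi| there. *)
Lemma Rintegral_damped_trig (p q : R) :
  \int[mu]_xi (expR (- (e * `|xi|)) * (p * cos (xi * u) + q * sin (xi * u))) =
  p * (2 * e) / den.
Proof.
have cn : continuous (fun xi : R => expR (- (e * `|xi|)) * (p * cos (xi * u) + q * sin (xi * u))).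
  apply: continuous_mul; first exact: continuous_expRN_norm.
  move=> x; apply: cvgD; (apply: cvgM; first exact: cvg_cst).
    exact: (@continuous_cosM R u).
  exact: (@continuous_sinM R u).
have fi : mu.-integrable setT
   (EFin \o (fun xi : R => expR (- (e * `|xi|)) * (p * cos (xi * u) + q * sin (xi * u)))).
  apply: (@le_integrable _ _ _ mu setT _ _
    (EFin \o (fun xi : R => (`|p| + `|q|) * expR (- (e * `|xi|))))) => //.
  - by apply/measurable_EFinP; exact: continuous_measurable_fun.
  - move=> t _ /=; rewrite lee_fin normrM mulrC [leRHS]normrM.
    rewrite ler_wpM2r// [leRHS]ger0_norm ?addr_ge0//.
    apply: le_trans (ler_normD _ _) _; rewrite !normrM.
    by apply: lerD; rewrite ler_piMr// ?cos_max ?sin_max.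
  - exact: (integrableZl measurableT (`|p| + `|q|) (integrable_expRN_norm e0 e1)).
apply: (cvg_unique _ (Rintegral_cvg_itv fi)) => //.
(* Coefficients of the antiderivatives, found by inverting the action of derivation on the pair (p,
   q) in [is_derive_damped_trig]: rate -e on the right half line for [A] and [B], rate e on the left
   one for [A'] and [B']. *)
pose A := (p * - e - q * u) / den; pose B := (q * - e + p * u) / den.
pose A' := (p * e - q * u) / den; pose B' := (q * e + p * u) / den.
have E n : \int[mu]_(x in `[- n%:R, n%:R])
      (expR (- (e * `|x|)) * (p * cos (x * u) + q * sin (x * u))) =
    (A' - expR (e * - n%:R) * (A' * cos (- n%:R * u) + B' * sin (- n%:R * u))) +
    (expR (- e * n%:R) * (A * cos (n%:R * u) + B * sin (n%:R * u)) - A).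
  rewrite Rintegral_split0//; congr (_ + _).
    have := @Rintegral_FTC R _ _ (- n%:R) 0 (is_derive_damped_trig e u A' B')
      (@continuous_damped_trig e u (e * A' + B' * u) (e * B' - A' * u)).
    rewrite oppr_le0 ler0n => /(_ isT).
    rewrite mulr0 expR0 mul0r cos0 sin0 mulr0 mulr1 addr0 mul1r => <-.
    apply: eq_Rintegral => x; rewrite inE/= in_itv/= => /andP[_ x0].
    rewrite ler0_norm// mulrN opprK; congr (_ * (_ * _ + _ * _)).
      by rewrite /A' /B' /den; field.
    by rewrite /A' /B' /den; field.
  have := @Rintegral_FTC R _ _ 0 n%:R (is_derive_damped_trig (- e) u A B)
    (@continuous_damped_trig (- e) u (- e * A + B * u) (- e * B - A * u)).
  rewrite ler0n => /(_ isT).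
  rewrite mulr0 expR0 mul0r cos0 sin0 mulr0 mulr1 addr0 mul1r => <-.
  apply: eq_Rintegral => x; rewrite inE/= in_itv/= => /andP[x0 _].
  rewrite ger0_norm// -mulNr; congr (_ * (_ * _ + _ * _)).
    by rewrite /A /B /den; field.
  by rewrite /A /B /den; field.
rewrite (funext E).
have D (a b v : R) : expR (- e * n%:R) * (a * cos (n%:R * v) + b * sin (n%:R * v)) @[n --> \oo] --> (0 : R).
  have k1 : 0 < `|a| + `|b| + 1 by rewrite ltr_wpDl// addr_ge0.
  have k2 : 0 < 1 + e^-1 by rewrite ltr_pwDl// invr_ge0 ltW.
  apply/cvgr0Pnorm_le => eps eps0; near=> n.
  have : n.+1%:R^-1 <= eps / ((`|a| + `|b| + 1) * (1 + e^-1)).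
    near: n; apply: near_invr_le; by rewrite divr_gt0// mulr_gt0.
  move=> Hn.
  rewrite normrM (ger0_norm (expR_ge0 _)).
  have H1 : `|a * cos (n%:R * v) + b * sin (n%:R * v)| <= `|a| + `|b| + 1.
    apply: le_trans (ler_normD _ _) _; rewrite !normrM -[leLHS]addr0.
    by apply: lerD => //; apply: lerD; rewrite ler_piMr// ?cos_max ?sin_max.
  (* From n + 1 <= (1 + 1/e) (1 + e n) and 1 + e n <= exp(e n). *)
  have H2 : expR (- e * n%:R) <= (1 + e^-1) * n.+1%:R^-1.
    rewrite mulNr expRN -[leLHS]mul1r ler_pdivrMr ?expR_gt0//.
    apply: (@le_trans _ _ ((1 + e^-1) * n.+1%:R^-1 * (1 + e * n%:R))).
      rewrite mulrAC ler_pdivlMr ?ltr0n// mul1r -natr1.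
      have -> : (1 + e^-1) * (1 + e * n%:R) = 1 + e^-1 + e * n%:R + n%:R.
        by field; rewrite gt_eqF.
      have : 0 <= e^-1 + e * n%:R by rewrite addr_ge0 ?invr_ge0 ?mulr_ge0 ?(ltW e0).
      lra.
    by rewrite ler_wpM2l ?expR_ge1Dx// mulr_ge0 ?invr_ge0// ltW.
  apply: le_trans (ler_pM (expR_ge0 _) (normr_ge0 _) H2 H1) _.
  move: Hn; rewrite ler_pdivlMr; last by rewrite mulr_gt0.
  by apply: le_trans; rewrite le_eqVlt; apply/orP; left; apply/eqP; ring.
have -> : p * (2 * e) / den = (A' - 0) + (0 - A) by rewrite /A /A' /den; field.
apply: cvgD; apply: cvgB.
- exact: cvg_cst.
- have := D A' (- B') u; apply: cvg_trans.
  apply: near_eq_cvg; near=> n; rewrite mulrN mulNr; congr (_ * _).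
    by rewrite mulNr.
  by rewrite cosN sinN mulNr mulrN.
- exact: D.
- exact: cvg_cst.
Unshelve. all: by end_near. Qed.

End laplace.

Section inversion.
Variable R : realType.
Local Notation C := R[i].
Local Notation mu := (@lebesgue_measure R).
Implicit Types (phi : R -> R) (M : R).

Lemma poisson_fourier (e x y : R) : 0 < e -> e <= 1 ->
  cintegral mu setT (fun xi => (expR (- (e * `|xi|)))%:C%C * cis ((x - y) * xi)) =
  ((2 * poisson e x y)%:C)%C.
Proof.
move=> e0 e1; apply: eq_complex_parts => /=.
  transitivity (\int[mu]_xi (expR (- (e * `|xi|)) *
      (1 * cos (xi * (x - y)) + 0 * sin (xi * (x - y))))).
    by apply: eq_Rintegral => xi _; rewrite mul0r subr0 mul0r addr0 mul1r mulrC [_ * xi]mulrC mulrC.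
  rewrite Rintegral_damped_trig// mul1r /poisson.
  have d0 : e ^+ 2 + (x - y) ^+ 2 != 0.
    by rewrite gt_eqF// ltr_pwDl ?exprn_gt0// sqr_ge0.
  have E : (y - x) ^+ 2 = (x - y) ^+ 2 by rewrite -sqrrN opprB.
  rewrite exprMn E.
  have d1 : 1 + e^-1 ^+ 2 * (x - y) ^+ 2 != 0.
    by rewrite gt_eqF// ltr_pwDl// mulr_ge0 ?sqr_ge0.
  move: d1; set z := (x - y) ^+ 2 in d0 *; rewrite exprVn => d1; field.
  by rewrite gt_eqF//= d0.
transitivity (\int[mu]_xi (expR (- (e * `|xi|)) *
    (0 * cos (xi * (x - y)) + 1 * sin (xi * (x - y))))).
  by apply: eq_Rintegral => xi _; rewrite mul0r addr0 mul0r add0r mul1r [_ * xi]mulrC.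
by rewrite Rintegral_damped_trig// !mul0r.
Qed.

Section bump.
Variables (phi : R -> R) (M : R).
Hypotheses (M0 : 0 <= M) (bphi : bump_on M phi).

Let cphi : continuous phi := bump_continuous bphi.

Let mphi : measurable_fun setT phi.
Proof. exact: continuous_measurable_fun. Qed.

Let iphi : mu.-integrable setT (EFin \o (fun y => `|phi y|)).
Proof.
apply: (@integrable_supp_itv _ _ M) => [x|x /bphi.2 ->]; last by rewrite normr0.
by apply: (cvg_norm (cphi (x := x))).
Qed.

Lemma cintegrable_ft xi : cintegrable mu (fun y => cis (- (y * xi)) * (phi y)%:C%C).
Proof.
apply: cintegrable_le iphi _ => [|t]; last by rewrite cnM cn_cis mul1r cn_real.
apply: cmeasurableM; last exact: cmeasurable_real.
apply: cmeasurable_cis; apply: measurableT_comp => //.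
exact: measurable_funM.
Qed.

Let kern (e x : R) (p : measurableTypeR R * measurableTypeR R) : C :=
  (expR (- (e * `|p.1|)))%:C%C * (cis ((x - p.2) * p.1) * (phi p.2)%:C%C).

Let mkern e x : cmeasurable (kern e x).
Proof.
have m1 : measurable_fun setT (fun p : measurableTypeR R * measurableTypeR R => p.1 : R).
  exact: measurable_fst.
have m2 : measurable_fun setT (fun p : measurableTypeR R * measurableTypeR R => p.2 : R).
  exact: measurable_snd.
apply: cmeasurableM; last apply: cmeasurableM.
- apply: cmeasurable_real.
  apply: (measurableT_comp (f := fun xi : R => expR (- (e * `|xi|)))) => //.
  by apply: continuous_measurable_fun; exact: continuous_expRN_norm.
- apply: cmeasurable_cis; apply: measurable_funM => //.
  exact: measurable_funB.
- by apply: cmeasurable_real; exact: (measurableT_comp mphi).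
Qed.

Let ikern e x : 0 < e -> e <= 1 -> cintegrable (mu \x mu)%E (kern e x).
Proof.
move=> e0 e1; apply: cintegrable_le (mkern e x) _ _.
  exact: (integrable_tensor (integrable_expRN_norm e0 e1) iphi).
by move=> p; rewrite !cnM cn_cis mul1r !cn_real ger0_norm// expR_ge0.
Qed.

Let ikern1 e x y : 0 < e -> e <= 1 -> cintegrable mu (fun xi => kern e x (xi, y)).
Proof.
move=> e0 e1; apply: (cintegrable_le (h := fun xi : measurableTypeR R => `|phi y| * expR (- (e * `|xi|)))).
- split.
    exact: (measurableT_comp (mkern e x).1 (pair2_measurable y)).
  exact: (measurableT_comp (mkern e x).2 (pair2_measurable y)).
- exact: (integrableZl measurableT `|phi y| (integrable_expRN_norm e0 e1)).
- by move=> xi; rewrite /kern !cnM cn_cis mul1r !cn_real ger0_norm ?expR_ge0// mulrC.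
Qed.

Let ikern2 e x xi : cintegrable mu (fun y => kern e x (xi, y)).
Proof.
apply: (cintegrable_le (h := fun y : measurableTypeR R => expR (- (e * `|xi|)) * `|phi y|)).
- split.
    exact: (measurableT_comp (mkern e x).1 (pair1_measurable xi)).
  exact: (measurableT_comp (mkern e x).2 (pair1_measurable xi)).
- exact: (integrableZl measurableT (expR (- (e * `|xi|))) iphi).
- by move=> y; rewrite /kern !cnM cn_cis mul1r !cn_real ger0_norm ?expR_ge0.
Qed.

(** The factor exp(-e |xi|) makes the double integral in xi and y absolutely convergent, so the
    integrals may be exchanged; the one in xi is then twice the Poisson kernel. *)
Lemma damped_inversion (e x : R) : 0 < e -> e <= 1 ->
  cintegral mu setT (fun xi => (expR (- (e * `|xi|)))%:C%C * (cis (x * xi) * ft phi xi)) =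
  ((2 * \int[mu]_y (phi y * poisson e x y))%:C)%C.
Proof.
move=> e0 e1.
transitivity (cintegral mu setT (fun xi => cintegral mu setT (fun y => kern e x (xi, y)))).
  apply: eq_cintegral => xi; rewrite /ft mulrA -cintegralZ; last exact: cintegrable_ft.
  apply: eq_cintegral => y; rewrite /kern/= !mulrA; congr (_ * _).
  by rewrite -mulrA -cisD; congr (_ * cis _); ring.
rewrite (cfubini_swap (ikern x e0 e1)); [|exact: ikern2|by move=> y; exact: ikern1].
transitivity (cintegral mu setT (fun y => ((2 * (phi y * poisson e x y))%:C)%C)).
  apply: eq_cintegral => y.
  have -> : (fun xi => kern e x (xi, y)) = fun xi => (phi y)%:C%C *
     ((expR (- (e * `|xi|)))%:C%C * cis ((x - y) * xi)).
    by apply/funext => xi; rewrite /kern/= mulrA mulrC.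
  rewrite cintegralZ.
    by rewrite poisson_fourier// -rmorphM; congr ((_%:C)%C); ring.
  apply: cintegrable_le (integrable_expRN_norm e0 e1) _.
    apply: cmeasurableM.
      apply: cmeasurable_real; apply: continuous_measurable_fun.
      exact: continuous_expRN_norm.
    by apply: cmeasurable_cis; exact: measurable_funM.
  by move=> xi; rewrite !cnM cn_cis mulr1 !cn_real ger0_norm// expR_ge0.
apply: eq_complex_parts => /=; last by rewrite /Rintegral integral0.
rewrite RintegralZl//; apply: (@integrable_supp_itv _ _ M).
  by apply: continuous_mul => //; exact: continuous_poisson.
by move=> y /bphi.2 ->; rewrite mul0r.
Qed.

Lemma bump_bounded : exists2 B, 0 <= B & forall y, `|phi y| <= B.
Proof.
have /compact_bounded[B0 [B0r HB]] : compact (phi @` `[- M, M]).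
  apply: continuous_compact; last exact: segment_compact.
  exact: continuous_subspaceT.
exists (`|B0| + 1) => [|y]; first by rewrite addr_ge0.
have [yM|My] := leP `|y| M; last by rewrite bphi.2// normr0 addr_ge0.
apply: HB; first by rewrite (le_lt_trans (ler_norm _))// ltrDl.
by exists y => //=; rewrite in_itv/= -ler_norml.
Qed.

(** Within distance [dl] of [x] the function varies by at most eta, against a kernel of mass pi.
    Farther away it varies by at most 2 B, while the kernel is at most e (1 + dl^-2) times the
    Cauchy kernel. *)
Lemma poisson_approx (x eta : R) : 0 < eta -> exists2 K, 0 <= K & forall e, 0 < e ->
  `|\int[mu]_y (phi y * poisson e x y) - pi * phi x| <= eta * pi + e * K.
Proof.
move=> eta0; have [B B0 HB] := bump_bounded.
have := cphi (x := x); move/cvgrPdist_le => /(_ _ eta0)/nbhs_normP[dl /= dl0 Hdl].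
pose A := 2 * B * (1 + dl ^- 2).
have A0 : 0 <= A by rewrite mulr_ge0 ?mulr_ge0// addr_ge0// invr_ge0 sqr_ge0.
exists (A * pi) => [|e e0]; first by rewrite mulr_ge0// pi_ge0.
have ip := integrable_poisson x e0.
have i1 : mu.-integrable setT (EFin \o (fun y => phi y * poisson e x y)).
  apply: (@integrable_supp_itv _ _ M).
    by apply: continuous_mul => //; exact: continuous_poisson.
  by move=> y /bphi.2 ->; rewrite mul0r.
have i2 : mu.-integrable setT (EFin \o (fun y => phi x * poisson e x y)).
  exact: (integrableZl measurableT (phi x) ip).
have Rp : \int[mu]_y poisson e x y = pi by rewrite /Rintegral integral_poisson.
have Rc : \int[mu]_y cauchy_kernel x y = pi by rewrite /Rintegral integral_cauchy_kernel.
have -> : \int[mu]_y (phi y * poisson e x y) - pi * phi x =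
    \int[mu]_y (phi y * poisson e x y - phi x * poisson e x y).
  by rewrite RintegralB// RintegralZl// Rp [pi * _]mulrC.
have i3 : mu.-integrable setT (EFin \o (fun y => phi y * poisson e x y - phi x * poisson e x y)).
  exact: (integrableB measurableT i1 i2).
apply: le_trans (le_normr_Rintegral _ i3) _ => //.
have i4 : mu.-integrable setT (EFin \o (fun y => eta * poisson e x y)).
  exact: (integrableZl measurableT eta ip).
have i5 : mu.-integrable setT (EFin \o (fun y => (e * A) * cauchy_kernel x y)).
  exact: (integrableZl measurableT (e * A) (integrable_cauchy_kernel x)).
apply: (@le_trans _ _ (\int[mu]_y (eta * poisson e x y + (e * A) * cauchy_kernel x y))).
  apply: le_Rintegral => //; first exact: (integrable_norm i3).
    exact: (integrableD measurableT i4 i5).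
  move=> y _; rewrite -mulrBl normrM (ger0_norm (poisson_ge0 _ _ e0)).
  have p0 := poisson_ge0 x y e0; have c0 := cauchy_kernel_ge0 x y.
  have [yx|yx] := ltP `|x - y| dl.
    apply: (@le_trans _ _ (eta * poisson e x y)).
      by rewrite ler_wpM2r// distrC; exact: Hdl.
    by rewrite lerDl mulr_ge0// mulr_ge0// ltW.
  apply: (@le_trans _ _ ((2 * B) * poisson e x y)).
    rewrite ler_wpM2r// (le_trans (ler_normB _ _))// mulr_natl mulr2n.
    exact: lerD.
  apply: (@le_trans _ _ (e * A * cauchy_kernel x y)); last by rewrite lerDr mulr_ge0// ltW.
  rewrite distrC in yx; have := poisson_le e0 dl0 yx.
  have B2 : 0 <= 2 * B by rewrite mulr_ge0.
  move=> /(ler_wpM2l B2) /le_trans; apply.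
  by rewrite /A le_eqVlt; apply/orP; left; apply/eqP; ring.
rewrite RintegralD// RintegralZl// [X in _ + X]RintegralZl//; last first.
  exact: (integrable_cauchy_kernel x).
by rewrite Rp Rc mulrA.
Qed.

(** Measurability of a parameter integral is drawn from joint integrability. The damping exp(-|xi|)
    supplies the latter and is divided out afterwards. *)
Lemma cmeasurable_ft : cmeasurable (ft phi).
Proof.
have := cmeasurable_param (ikern 0 ltr01 (lexx 1)).
have -> : (fun xi => cintegral mu setT (fun y => kern 1 0 (xi, y))) =
    fun xi => (expR (- `|xi|))%:C%C * ft phi xi.
  apply/funext => xi; rewrite /ft -cintegralZ; last exact: cintegrable_ft.
  by apply: eq_cintegral => y; rewrite /kern/= mul1r sub0r mulNr.
move=> H.
have -> : ft phi = fun xi => (expR `|xi|)%:C%C * ((expR (- `|xi|))%:C%C * ft phi xi).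
  by apply/funext => xi; rewrite mulrA -rmorphM -expRD subrr expR0 mul1r.
apply: cmeasurableM H; apply: cmeasurable_real.
by apply: (measurableT_comp (f := expR)).
Qed.

Lemma ft_cauchy_bound (k : nat) : exists2 K, 0 <= K &
  forall xi, (1 + xi ^+ 2) ^+ k * cn (ft phi xi) <= K * cauchy_kernel 0 xi.
Proof.
have [K K0 HK] := ft_decay M0 k.+1 bphi; exists K => // xi.
have x0 : 0 < 1 + xi ^+ 2 by rewrite ltr_pwDl// sqr_ge0.
rewrite /cauchy_kernel subr0 ler_pdivlMr//.
by apply: le_trans (HK xi); rewrite mulrAC -exprSr.
Qed.

Lemma cintegrable_cis_ft (x : R) : cintegrable mu (fun xi => cis (x * xi) * ft phi xi).
Proof.
have [K K0 HK] := ft_cauchy_bound 0.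
apply: (cintegrable_le (h := fun xi : measurableTypeR R => K * cauchy_kernel 0 xi)).
- apply: cmeasurableM; last exact: cmeasurable_ft.
  by apply: cmeasurable_cis; exact: measurable_funM.
- exact: (integrableZl measurableT K (integrable_cauchy_kernel (0 : R))).
- by move=> xi; rewrite cnM cn_cis -[1]/((1 + xi ^+ 2) ^+ 0).
Qed.

Lemma ft_inversion (x : R) :
  cintegral mu setT (fun xi => cis (x * xi) * ft phi xi) = ((2 * pi * phi x)%:C)%C.
Proof.
have [K K0 HK] := ft_cauchy_bound 1.
have idf := cintegrable_cis_ft x.
set L := cintegral _ _ _.
suff : cn (L - ((2 * pi * phi x)%:C)%C) <= 0.
  move=> cn0'; apply/eqP; rewrite -subr_eq0 -normr_eq0 normcE.
  suff -> : cn (L - ((2 * pi * phi x)%:C)%C) = 0 by [].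
  by apply/eqP; rewrite eq_le cn0' cn_ge0.
apply/ler_addgt0Pr => eps eps0; rewrite add0r.
have pi0 := pi_gt0 R.
have eta0 : 0 < eps / (4 * pi) by rewrite divr_gt0// mulr_gt0.
have [K2 K20 HK2] := poisson_approx x eta0.
(* The total error is e A + eps/2: removing the damping costs 2 e K pi, and twice the error of
   [poisson_approx] is eps/2 + 2 e K2. *)
pose A := 2 * (K * pi) + 2 * K2.
have A0 : 0 <= A by rewrite addr_ge0 ?mulr_ge0// ltW.
pose e := Num.min 1 (eps / (2 * (A + 1))).
have e0 : 0 < e by rewrite lt_min ltr01 divr_gt0// mulr_gt0// ltr_wpDl.
have e1 : e <= 1 by rewrite ge_min lexx.
have eA : e * A <= eps / 2.
  apply: (@le_trans _ _ (eps / (2 * (A + 1)) * A)).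
    by rewrite ler_wpM2r// ge_min lexx orbT.
  rewrite mulrAC ler_pdivrMr ?mulr_gt0 ?ltr_wpDl// mulrA mulfVK//.
  by rewrite ler_pM2l// lerDl.
have idmp : cintegrable mu (fun xi => (expR (- (e * `|xi|)))%:C%C * (cis (x * xi) * ft phi xi)).
  apply: cintegrable_le (integrable_cn idf) _.
    apply: cmeasurableM; last exact: (cintegrable_measurable idf).
    apply: cmeasurable_real; apply: continuous_measurable_fun; exact: continuous_expRN_norm.
  move=> xi; rewrite cnM cn_real ger0_norm ?expR_ge0// ler_piMl ?cn_ge0//.
  by rewrite -expR0 ler_expR oppr_le0 mulr_ge0// ltW.
have D := damped_inversion x e0 e1.
have -> : L - ((2 * pi * phi x)%:C)%C =
    cintegral mu setT (fun xi => cis (x * xi) * ft phi xi -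
                         (expR (- (e * `|xi|)))%:C%C * (cis (x * xi) * ft phi xi)) +
    ((2 * (\int[mu]_y (phi y * poisson e x y) - pi * phi x))%:C)%C.
  rewrite cintegralB// D -/L -addrA; congr (_ + _).
  by apply: eq_complex_parts; rewrite ?ReD ?ImD ?ReN ?ImN/=; ring.
apply: le_trans (cn_triangle _ _) _.
(* Here 0 <= 1 - exp(-s) <= s with s = e |xi|, and |xi| <= 1 + xi^2 is absorbed by one power of the
   decay of the transform beyond integrability. *)
have H1 : cn (cintegral mu setT (fun xi => cis (x * xi) * ft phi xi -
        (expR (- (e * `|xi|)))%:C%C * (cis (x * xi) * ft phi xi))) <= 2 * (e * K * pi).
  have ic := integrable_cauchy_kernel (0 : R).
  have -> : e * K * pi = \int[mu]_xi (e * K * cauchy_kernel 0 xi).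
    by rewrite RintegralZl// /Rintegral integral_cauchy_kernel.
  apply: cn_cintegral_le.
  - apply: cmeasurableD; first exact: (cintegrable_measurable idf).
    exact: (cmeasurableN (cintegrable_measurable idmp)).
  - exact: (integrableZl measurableT (e * K) ic).
  - move=> xi; rewrite -[X in X - _]mul1r -mulrBl cnM [X in _ * X]cnM cn_cis mul1r.
    rewrite -(rmorph1 (real_complex R)) -rmorphN -rmorphD/= cn_real.
    have s0 : 0 <= e * `|xi| by rewrite mulr_ge0// ltW.
    have h1 : expR (- (e * `|xi|)) <= 1 by rewrite -expR0 ler_expR oppr_le0.
    have h2 : 1 - e * `|xi| <= expR (- (e * `|xi|)) by exact: expR_ge1Dx.
    rewrite ger0_norm ?subr_ge0//.
    apply: (@le_trans _ _ ((e * `|xi|) * cn (ft phi xi))).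
      by rewrite ler_wpM2r ?cn_ge0//; lra.
    rewrite -mulrA -mulrA ler_wpM2l ?(ltW e0)//.
    apply: le_trans (HK xi); rewrite expr1 ler_wpM2r ?cn_ge0//.
    rewrite -[xi ^+ 2]real_normK ?num_real//.
    have := sqr_ge0 (`|xi| - 1); rewrite sqrrB mulr1 expr1n.
    have := normr_ge0 xi; set z := `|xi|; set z2 := z ^+ 2; lra.
have H2 := HK2 _ e0.
rewrite cn_real normrM (ger0_norm (_ : 0 <= 2))//.
apply: le_trans (lerD H1 (ler_wpM2l _ H2)) _ => //.
have -> : 2 * (e * K * pi) + 2 * (eps / (4 * pi) * pi + e * K2) = e * A + eps / 2.
  have -> : eps / (4 * pi) * pi = eps / 4.
    by rewrite invfM mulrA mulfVK ?gt_eqF.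
  by rewrite /A; field.
by rewrite [leRHS](splitr eps) lerD2r.
Qed.

End bump.

Lemma bump_onM M phi psi : bump_on M phi -> rsmooth psi -> bump_on M (fun x => phi x * psi x).
Proof.
move=> [sphi phi0] spsi; split; first exact: rsmoothM.
by move=> x /phi0 ->; rewrite mul0r.
Qed.

(** A shift of the transform is a modulation by exp(i a y). As [ft] takes real bumps, the modulated
    function is split into its cosine and sine parts, which are again bumps. *)
Lemma ft_shift phi M (a xi : R) : 0 <= M -> bump_on M phi ->
  ft phi (xi - a) = ft (fun y => phi y * cos (a * y)) xi +
                    'i%C * ft (fun y => phi y * sin (a * y)) xi.
Proof.
move=> M0 bphi.
have sa : rsmooth (fun y : R => a * y).
  by have := rsmooth_affine a 0; under eq_fun do rewrite addr0.
have b1 : bump_on M (fun y => phi y * cos (a * y)).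
  apply: bump_onM => //; apply: (rsmooth_comp (phi := @cos R)) => //; exact: rsmooth_cos.
have b2 : bump_on M (fun y => phi y * sin (a * y)).
  apply: bump_onM => //; apply: (rsmooth_comp (phi := @sin R)) => //; exact: rsmooth_sin.
have i1 := cintegrable_ft b1 xi; have i2 := cintegrable_ft b2 xi.
rewrite /ft -cintegralZ// -cintegralD//; last exact: cintegrableZ.
apply: eq_cintegral => y; rewrite mulrBr opprB addrC cisD -mulrA.
have -> : cis (y * a) = (cos (a * y))%:C%C + 'i%C * (sin (a * y))%:C%C.
  by apply: eq_complex_parts; rewrite ?ReD ?ImD ?ReM ?ImM /cis [y * a]mulrC /=; ring.
by rewrite !rmorphM; ring.
Qed.

Lemma ft_shift_inversion phi M (a x : R) : 0 <= M -> bump_on M phi ->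
  cintegral mu setT (fun xi => cis (x * xi) * ft phi (xi - a)) =
  ((2 * pi * phi x)%:C)%C * cis (a * x).
Proof.
move=> M0 bphi.
have sa : rsmooth (fun y : R => a * y).
  by have := rsmooth_affine a 0; under eq_fun do rewrite addr0.
have b1 : bump_on M (fun y => phi y * cos (a * y)).
  apply: bump_onM => //; apply: (rsmooth_comp (phi := @cos R)) => //; exact: rsmooth_cos.
have b2 : bump_on M (fun y => phi y * sin (a * y)).
  apply: bump_onM => //; apply: (rsmooth_comp (phi := @sin R)) => //; exact: rsmooth_sin.
have i1 := cintegrable_cis_ft M0 b1 x; have i2 := cintegrable_cis_ft M0 b2 x.
under eq_cintegral do rewrite (ft_shift _ _ M0 bphi) mulrDr mulrCA.
rewrite cintegralD//; last exact: cintegrableZ.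
rewrite cintegralZ// (ft_inversion M0 b1) (ft_inversion M0 b2).
by apply: eq_complex_parts; rewrite ?ReD ?ImD ?ReM ?ImM /cis /=; ring.
Qed.

End inversion.

(** * Peetre's inequality and increments of symbols *)

Section euclidean_facts.
Variables (R : realType) (d : nat).
Local Notation E := 'rV[R]_d.
Implicit Types (x y a p xi : E).

Lemma dotvC x y : dotv x y = dotv y x.
Proof. by apply: eq_bigr => i _; rewrite mulrC. Qed.

Lemma dotvZr (s : R) x y : dotv x (s *: y) = s * dotv x y.
Proof. by rewrite /dotv mulr_sumr; apply: eq_bigr => i _; rewrite !mxE mulrCA. Qed.

Lemma dotvNr x y : dotv x (- y) = - dotv x y.
Proof. by rewrite -scaleN1r dotvZr mulN1r. Qed.

Lemma dotvv_ge0 x : 0 <= dotv x x.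
Proof. by apply: sumr_ge0 => i _; rewrite -expr2 sqr_ge0. Qed.

Lemma enorm_ge0 x : 0 <= enorm x. Proof. exact: sqrtr_ge0. Qed.

Lemma enormZ (s : R) x : enorm (s *: x) = `|s| * enorm x.
Proof.
by rewrite /enorm dotvZr dotvC dotvZr mulrA -expr2 sqrtrM ?sqr_ge0// sqrtr_sqr.
Qed.

Lemma coord_le_enorm x i : `|x 0 i| <= enorm x.
Proof.
rewrite -ler_sqr ?nnegrE ?enorm_ge0// sqr_sqrtr ?dotvv_ge0// real_normK ?num_real//.
rewrite /dotv (bigD1 i)//= -expr2 lerDl; apply: sumr_ge0 => j _.
by rewrite -expr2 sqr_ge0.
Qed.

Lemma norm_le_enorm x : `|x| <= enorm x.
Proof. by apply: norm_le_coord => [|i]; [exact: enorm_ge0|exact: coord_le_enorm]. Qed.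

Lemma enorm_le_norm x : enorm x <= d.+1%:R * `|x|.
Proof.
rewrite -ler_sqr ?nnegrE ?enorm_ge0 ?mulr_ge0// sqr_sqrtr ?dotvv_ge0// exprMn.
apply: (@le_trans _ _ (d%:R * `|x| ^+ 2)).
  have -> : d%:R * `|x| ^+ 2 = \sum_(i < d) `|x| ^+ 2 by rewrite sumr_const card_ord mulr_natl.
  apply: ler_sum => i _; rewrite -expr2 -real_normK ?num_real//.
  by rewrite ler_sqr ?nnegrE//; exact: coord_le_norm.
rewrite ler_wpM2r ?sqr_ge0// -natrX ler_nat.
by rewrite (leq_trans (leqnSn d))// leq_pmulr.
Qed.

(** Peetre's inequality in logarithmic form: both quotients of u and v are at most s, so |ln u - ln
    v| <= ln s, and a factor r of either sign costs at most N ln s. *)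
Lemma peetre (r u v s : R) (N : nat) : 1 <= u -> 1 <= v -> 1 <= s ->
  u <= v * s -> v <= u * s -> `|r| <= N%:R -> u `^ r <= v `^ r * s ^+ N.
Proof.
move=> u1 v1 s1 uvs vus rN.
have u0 : 0 < u by apply: lt_le_trans u1.
have v0 : 0 < v by apply: lt_le_trans v1.
have s0 : 0 < s by apply: lt_le_trans s1.
have h1 : ln u <= ln v + ln s by rewrite -lnM ?posrE// ler_ln ?posrE ?mulr_gt0.
have h2 : ln v <= ln u + ln s by rewrite -lnM ?posrE// ler_ln ?posrE ?mulr_gt0.
have ls0 : 0 <= ln s by rewrite ln_ge0.
rewrite -powR_mulrn ?(ltW s0)// /powR !gt_eqF// -expRD ler_expR.
rewrite -lerBlDl -mulrBr.
apply: (le_trans (ler_norm _)); rewrite normrM ler_pM//.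
by rewrite ler_norml; apply/andP; split; lra.
Qed.

(* A product weight, so that its inverse is integrable by Fubini. *)
Definition jweight (x : E) : R := \prod_(i < d) (1 + x 0 i ^+ 2).

Lemma jweight_ge1 x : 1 <= jweight x.
Proof. rewrite /jweight; elim/big_ind: _ => // [a b a1 b1|i _]; first exact: mulr_ege1.
by rewrite lerDl sqr_ge0. Qed.

Lemma coord_le_jweight x i : `|x 0 i| <= jweight x.
Proof.
rewrite /jweight (bigD1 i)//=.
apply: (@le_trans _ _ ((1 + x 0 i ^+ 2) * 1)).
  rewrite mulr1 -[x 0 i ^+ 2]real_normK ?num_real//.
  have := sqr_ge0 (`|x 0 i| - 1); rewrite sqrrB mulr1 expr1n.
  have := normr_ge0 (x 0 i); set z := `|x 0 i|; set z2 := z ^+ 2; lra.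
rewrite ler_wpM2l ?addr_ge0 ?sqr_ge0//.
elim/big_ind: _ => // [a b a1 b1|j _]; first exact: mulr_ege1.
by rewrite lerDl sqr_ge0.
Qed.

Lemma symbol_weight_bound (r : R) : exists2 C : R, 0 <= C & exists N : nat, forall a xi p,
  (forall i, `|p 0 i - a 0 i| <= `|xi 0 i - a 0 i|) ->
  (1 + enorm p) `^ r <= C * (1 + enorm a) `^ r * jweight (xi - a) ^+ N.
Proof.
pose N := (Num.truncn `|r|).+1.
pose k : R := d.+1%:R.
have k1 : 1 <= k by rewrite ler1n.
exists ((2 * k) ^+ N); first by rewrite exprn_ge0// mulr_ge0.
exists N => a xi p pa.
set W := jweight _; have W1 : 1 <= W by exact: jweight_ge1.
have pW : `|p - a| <= W.
  apply: norm_le_coord => [|i]; first exact: le_trans W1.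
  rewrite !mxE; apply: le_trans (pa i) _.
  by have := coord_le_jweight (xi - a) i; rewrite !mxE.
have P (x y : E) : `|x - y| <= W -> 1 + enorm x <= (1 + enorm y) * (2 * k * W).
  move=> xyW.
  apply: (@le_trans _ _ (1 + k * (enorm y + W))).
    rewrite lerD2l; apply: le_trans (enorm_le_norm x) _; rewrite ler_wpM2l//.
    rewrite -[x in `|x|](subrK y) (le_trans (ler_normD _ _))// addrC lerD//.
    exact: norm_le_enorm.
  have ey := enorm_ge0 y.
  have kW : 1 <= k * W by exact: mulr_ege1.
  have ekW : enorm y * k <= enorm y * (k * W).
    by rewrite ler_wpM2l// -[leLHS]mulr1 ler_wpM2l// (le_trans _ k1).
  have -> : (1 + enorm y) * (2 * k * W) = 2 * (k * W) + 2 * (enorm y * (k * W)) by ring.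
  have -> : k * (enorm y + W) = enorm y * k + k * W by ring.
  have : 0 <= enorm y * (k * W) by rewrite mulr_ge0// (le_trans _ kW).
  move: kW ekW; set A := k * W; set B := enorm y * A; lra.
have := @peetre r (1 + enorm p) (1 + enorm a) (2 * k * W) N.
rewrite !lerDl !enorm_ge0 => /(_ isT isT).
move=> /(_ _ (P _ _ pW) _ _) H.
rewrite -mulrA mulrCA -exprMn; apply: H.
- by rewrite -mulrA mulr_ege1 ?ler1n// mulr_ege1.
- by apply: P; rewrite distrC.
- exact: ltW (truncnS_gt _).
Qed.

End euclidean_facts.

Section mean_value.
Variables (R : realType) (V : normedModType R).

Lemma is_derive_line (G : V -> R) (q v : V) (t : R) :
  derivable G (q + t *: v) v ->
  is_derive t (1 : R) (fun s : R => G (q + s *: v)) ('D_v G (q + t *: v)).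
Proof.
move=> dG.
have E : (fun h : R => h^-1 *: (((fun s : R => G (q + s *: v)) \o shift t) (h *: (1 : R)) -
      G (q + t *: v))) =
   (fun h : R => h^-1 *: ((G \o shift (q + t *: v)) (h *: v) - G (q + t *: v))).
  apply/funext => h /=; congr (_ *: (G _ - _)).
  by rewrite [h *: 1]mulr1 scalerDl addrCA.
apply: DeriveDef; first by rewrite /derivable E.
by rewrite /derive E.
Qed.

Lemma mean_value_bound (g g' : R -> R) (h B : R) :
  (forall t : R, is_derive t (1 : R) g (g' t)) ->
  (forall t, `|t| <= `|h| -> `|g' t| <= B) -> `|g h - g 0| <= B * `|h|.
Proof.
move=> dg gB.
have cg : continuous g by move=> x; exact: is_derive1_continuous (dg x).
have [h0|h0] := leP 0 h.
  have [|c cI ->] := MVT_segment h0 (fun x _ => dg x); first exact: continuous_subspaceT.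
  rewrite subr0 normrM ler_wpM2r// gB//.
  by move: cI; rewrite in_itv/= => /andP[c0 ch]; rewrite !ger0_norm.
have [|c cI E] := MVT_segment (ltW h0) (fun x _ => dg x); first exact: continuous_subspaceT.
rewrite distrC E sub0r normrM normrN ler_wpM2r// gB//.
by move: cI; rewrite in_itv/= => /andP[ch c0]; rewrite !ler0_norm ?lerN2// ltW.
Qed.

End mean_value.

Section symbol_difference.
Variables (R : realType) (d : nat).
Local Notation C := R[i].
Local Notation E := 'rV[R]_d.

(** Vertices of a path from [a] to [xi] along which one coordinate changes at a time, so that each
    increment of a symbol is controlled by a single partial derivative, of order r - 1. *)
Let hybrid (a xi : E) (j : nat) : E := \row_i (if (i < j)%N then xi 0 i else a 0 i).

Lemma symbol_class_bound (r : R) (sigma : E -> E -> C) : symbol_class r sigma ->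
  exists2 K, 0 <= K & forall x xi, cn (sigma x xi) <= K * (1 + enorm xi) `^ r.
Proof.
move=> [_ /(_ [::] [::])[K HK]]; exists `|K| => // x xi.
rewrite -lec_cn; apply: le_trans (HK x xi) _.
by rewrite subr0 lecR ler_wpM2r ?powR_ge0// ler_norm.
Qed.

Lemma symbol_difference (r : R) (sigma : E -> E -> C) : symbol_class r sigma ->
  exists2 K, 0 <= K & exists N : nat, forall x a xi,
    cn (sigma x xi - sigma x a) <= K * (1 + enorm a) `^ (r - 1) * jweight (xi - a) ^+ N.
Proof.
move=> [/smoothE[sr si] Hs].
have HK (i : 'I_d) : exists K, forall x xi,
   `|cderives [seq ((0 : E), basis_vec R j) | j <- [:: i]] (fun p => sigma p.1 p.2) (x, xi)| <=
   (K * (1 + enorm xi) `^ (r - 1))%:C%C.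
  by have [K HK] := Hs [:: i] [::]; exists K => x xi; have := HK x xi; rewrite cats0.
have /choice[K {}HK] := HK.
have [C0 C00 [N HN]] := @symbol_weight_bound R d (r - 1).
pose K0 : R := \sum_i `|K i|.
have K00 : 0 <= K0 by apply: sumr_ge0.
(* Every coordinate step counts twice, for the real and the imaginary part, since the mean value
   theorem is applied to each separately. The weight has exponent N from [symbol_weight_bound] and
   one more from the length of the step. *)
exists (\sum_(i < d) 2 * (K0 * C0)).
  by apply: sumr_ge0 => i _; rewrite !mulr_ge0.
exists N.+1 => x a xi; set W := jweight (xi - a).
have W1 : 1 <= W by exact: jweight_ge1.
have W0 : 0 <= W by apply: le_trans W1.
pose v (j : 'I_d) : E * E := (0, basis_vec R j).
pose D := C0 * (1 + enorm a) `^ (r - 1) * W ^+ N.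
have D0 : 0 <= D by rewrite !mulr_ge0 ?powR_ge0 ?exprn_ge0.
have step (part : C -> R) (sp : rsmooth (fun p : E * E => part (sigma p.1 p.2)))
    (partE : forall i p, `|'D_(v i) (fun p : E * E => part (sigma p.1 p.2)) p| <=
       K0 * (1 + enorm p.2) `^ (r - 1)) :
    `|part (sigma x xi) - part (sigma x a)| <= \sum_(j < d) K0 * D * W.
  have h0 : hybrid a xi 0 = a by apply/rowP => i; rewrite !mxE.
  have hd : hybrid a xi d = xi by apply/rowP => i; rewrite !mxE ltn_ord.
  have -> : part (sigma x xi) - part (sigma x a) =
    \sum_(0 <= j < d) (part (sigma x (hybrid a xi j.+1)) - part (sigma x (hybrid a xi j))).
    by rewrite telescope_sumr// hd h0.
  rewrite big_mkord; apply: le_trans (ler_norm_sum _ _ _) _; apply: ler_sum => j _.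
  pose h := xi 0 j - a 0 j.
  have hj (t : R) (i : 'I_d) : (hybrid a xi j + t *: basis_vec R j) 0 i =
      (if (i < j)%N then xi 0 i else a 0 i) + (if i == j then t else 0).
    by rewrite !mxE eqxx/=; case: eqP => _; rewrite ?mulr1 ?mulr0.
  have E1 : hybrid a xi j.+1 = hybrid a xi j + h *: basis_vec R j.
    apply/rowP => i; rewrite hj mxE ltnS leq_eqVlt.
    have [->|ij] := eqVneq i j; first by rewrite eqxx/= ltnn /h addrC subrK.
    by rewrite -val_eqE/= in ij; rewrite (negbTE ij) addr0.
  pose g (t : R) := part (sigma x (hybrid a xi j + t *: basis_vec R j)).
  have gE t : g t = (fun p : E * E => part (sigma p.1 p.2)) ((x, hybrid a xi j) + t *: v j).
    by rewrite /g /= scaler0 addr0.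
  have := @mean_value_bound R g
    (fun t => 'D_(v j) (fun p : E * E => part (sigma p.1 p.2)) ((x, hybrid a xi j) + t *: v j)) h (K0 * D).
  have -> : g h = part (sigma x (hybrid a xi j.+1)) by rewrite /g -E1.
  have -> : g 0 = part (sigma x (hybrid a xi j)) by rewrite /g scale0r addr0.
  move=> H.
  apply: le_trans (H _ _) _ => [t|t th|].
  - rewrite (_ : g = fun t => (fun p : E * E => part (sigma p.1 p.2)) ((x, hybrid a xi j) + t *: v j)).
      by apply: is_derive_line; exact: rsmooth_derivable.
    by apply/funext => s; exact: gE.
  - apply: le_trans (partE j _) _; rewrite ler_wpM2l//.
    apply: HN => i; rewrite [X in X 0 i - _]/= hj.
    case: ltnP => ij.
      by rewrite -val_eqE/= ltn_eqF// addr0.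
    by case: eqP => [->|_]; rewrite ?addr0 ?subrr ?normr0// addrC addKr.
  - apply: ler_wpM2l; first by apply: mulr_ge0.
    by have := coord_le_jweight (xi - a) j; rewrite !mxE.
have KE (i : 'I_d) (x' xi' : E) : K i * (1 + enorm xi') `^ (r - 1) <= K0 * (1 + enorm xi') `^ (r - 1).
  rewrite ler_wpM2r ?powR_ge0// (le_trans (ler_norm _))// /K0 (bigD1 i)//= lerDl.
  exact: sumr_ge0.
have partRe i p : `|'D_(v i) (fun p : E * E => complex.Re (sigma p.1 p.2)) p| <=
     K0 * (1 + enorm p.2) `^ (r - 1).
  case: p => x' xi'; have := HK i x' xi'; rewrite lec_cn => /(le_trans (le_Re_cn _)) H.
  exact: le_trans H (KE _ _ _).
have partIm i p : `|'D_(v i) (fun p : E * E => complex.Im (sigma p.1 p.2)) p| <=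
     K0 * (1 + enorm p.2) `^ (r - 1).
  case: p => x' xi'; have := HK i x' xi'; rewrite lec_cn => /(le_trans (le_Im_cn _)) H.
  exact: le_trans H (KE _ _ _).
clearbody K0.
apply: le_trans (cn_le _) _; rewrite ReD ImD ReN ImN.
apply: le_trans (lerD (step _ sr partRe) (step _ si partIm)) _.
rewrite -big_split/= !mulr_suml; apply: ler_sum => j _.
by rewrite /D exprS le_eqVlt; apply/orP; left; apply/eqP; ring.
Qed.

End symbol_difference.

(** * Symbols acting on wave packets *)

Section tuple_space.
Variables (R : realType) (d : nat).
Local Notation C := R[i].
Local Notation E := 'rV[R]_d.
Local Notation mu := (@lebesgue_measure R).
Local Notation muT := (product_power mu).
Local Notation TT := (d.-tuple (measurableTypeR R)).

Lemma Rd_integralE (g : E -> C) :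
  Rd_integral g = cintegral (muT d) setT (fun t => g (rowt t)).
Proof. by []. Qed.

Lemma cmeasurable_rowt (g : E -> C) : ccontinuous g ->
  cmeasurable (fun t : TT => g (rowt t)).
Proof.
move=> [c1 c2]; split.
  exact: (measurable_rowt (g := fun x => complex.Re (g x))).
exact: (measurable_rowt (g := fun x => complex.Im (g x))).
Qed.

Lemma smooth_ccontinuous (V : normedModType R) (g : V -> C) : smooth g -> ccontinuous g.
Proof. by move=> /(_ [::])[]. Qed.

(** Coordinates indexed by all naturals, with default 0, because the product formulas for tuples
    take families indexed by [nat]. *)
Definition coordn (x : E) (j : nat) : R :=
  if insub j is Some i then x 0 (i : 'I_d) else 0.

Lemma coordnE x (i : 'I_d) : coordn x i = x 0 i.
Proof. by rewrite /coordn valK. Qed.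

Lemma cis_sum (I : Type) (r : seq I) (F : I -> R) :
  cis (\sum_(i <- r) F i) = \prod_(i <- r) cis (F i).
Proof. exact: (big_morph _ (@cisD R) (@cis0 R)). Qed.

Lemma cn_prod (I : Type) (r : seq I) (F : I -> C) :
  cn (\prod_(i <- r) F i) = \prod_(i <- r) cn (F i).
Proof. by apply: (big_morph _ (@cnM R)); rewrite -(rmorph1 (real_complex R)) cn_real normr1. Qed.

End tuple_space.

Section partial_continuity.
Variables (R : realType) (U V : normedModType R).

Lemma continuous_pairl (f : U * V -> R) (x : U) : continuous f -> continuous (fun y => f (x, y)).
Proof.
move=> cf y; apply: (@cvg_comp _ _ _ (pair x) f (nbhs y) (nbhs (x, y))); last exact: cf.
exact: (cvg_pair (cvg_cst x) (@cvg_id _ (nbhs y))).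
Qed.

End partial_continuity.

Section wave_packets.
Variables (R : realType) (d : nat).
Local Notation C := R[i].
Local Notation E := 'rV[R]_d.
Local Notation mu := (@lebesgue_measure R).
Local Notation muT := (product_power mu).
Local Notation TT := (d.-tuple (measurableTypeR R)).
Variables (c : R -> R) (M : R) (xhat : E).
Hypotheses (M0 : 0 <= M) (bc : bump_on M c).

(** A product of one-variable cutoffs, so that the Fourier transform of a packet is a product of
    one-variable transforms. *)
Definition chi (x : E) : C := ((\prod_i c (x 0 i))%:C)%C.
Definition wave (k : R) (y : E) : C := cis (- (k * dotv xhat y)).

Lemma smooth_chi : smooth chi.
Proof. by apply: smooth_real; apply: rsmooth_cutoff; case: bc. Qed.

Lemma smooth_wave k : smooth (wave k).
Proof.
apply: smooth_cis; apply: rsmoothN; apply: rsmoothM; first exact: rsmooth_cst.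
exact: rsmooth_dotv.
Qed.

Lemma cn_chi x : cn (chi x) = \prod_i `|c (x 0 i)|.
Proof. by rewrite /chi cn_real normr_prod. Qed.

Lemma cn_wave k x : cn (wave k x) = 1. Proof. exact: cn_cis. Qed.

Lemma waveD k l x : wave (k + l) x = wave k x * wave l x.
Proof. by rewrite /wave mulrDl opprD cisD. Qed.

Let ic : mu.-integrable setT (EFin \o (fun y => `|c y|)).
Proof.
apply: (@integrable_supp_itv _ _ M) => [x|x /bc.2 ->]; last by rewrite normr0.
by apply: (cvg_norm (bump_continuous bc (x := x))).
Qed.

Lemma integrable_cn_chi : (muT d).-integrable setT (EFin \o (fun t => cn (chi (rowt t)))).
Proof.
have [+ _] := @Rintegral_prod_tuple R d (fun _ y => `|c y|) (fun _ => ic).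
by congr integrable; apply/funext => t /=; rewrite cn_chi; congr EFin;
  apply: eq_bigr => i _; rewrite mxE.
Qed.

Lemma fourier_wave k xi : fourier (fun x => chi x * wave k x) xi =
  \prod_i ft c ((xi - (- k) *: xhat) 0 i).
Proof.
have [_ e] := @cintegral_prod_tuple R d
  (fun j y => cis (- (y * coordn (xi - (- k) *: xhat) j)) * (c y)%:C%C)
  (fun j => cintegrable_ft bc _).
rewrite /fourier Rd_integralE.
transitivity (\prod_(i < d) ft c (coordn (xi - (- k) *: xhat) i)); last first.
  by apply: eq_bigr => i _; rewrite coordnE.
rewrite -[RHS]e; apply: eq_cintegral => t.
rewrite big_split/= -cis_sum /chi rmorph_prod.
rewrite [X in _ * X]mulrC mulrA /wave -cisD; congr (_ * _); last first.
  by apply: eq_bigr => i _; rewrite mxE.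
congr cis; rewrite /dotv mulr_sumr -!sumrN -big_split/=; apply: eq_bigr => i _.
by rewrite coordnE !mxE; ring.
Qed.

(** The frequency around which the transform of the wave packet is concentrated. *)
Let center (k : R) : E := (- k) *: xhat.

(** The Fourier transform of the wave packet, by [fourier_wave]. *)
Let packet (k : R) (xi : E) : C := \prod_i ft c ((xi - center k) 0 i).

Let cmeasurable_packet k : cmeasurable (fun t : TT => packet k (rowt t)).
Proof.
have := @cmeasurable_prod_tuple R d (fun j y => ft c (y - coordn (center k) j)).
have -> : (fun t : TT => packet k (rowt t)) =
    fun t => \prod_(i < d) ft c (tnth t i - coordn (center k) i).
  by apply/funext => t; apply: eq_bigr => i _; rewrite coordnE !mxE.
apply=> j; have [m1 m2] := cmeasurable_ft bc.
have ms : measurable_fun setT (fun y : R => y - coordn (center k) j).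
  exact: measurable_funB.
by split; [exact: (measurableT_comp m1 ms)|exact: (measurableT_comp m2 ms)].
Qed.

(** Rapid decay of the transform of [c] in every coordinate absorbs any power of the weight and
    still leaves a product of Cauchy kernels, integrable with a mass independent of k. *)
Let packet_bound (N : nat) : exists2 K, 0 <= K & forall k xi,
  cn (packet k xi) * jweight (xi - center k) ^+ N <=
  \prod_i (K * cauchy_kernel (center k 0 i) (xi 0 i)).
Proof.
have [K K0 HK] := ft_cauchy_bound M0 bc N; exists K => // k xi.
rewrite /packet cn_prod /jweight -prodrXl -big_split/=; apply: ler_prod => i _.
rewrite mulr_ge0 ?cn_ge0 ?exprn_ge0 ?addr_ge0 ?sqr_ge0//= mulrC.
apply: le_trans (HK _) _.
by rewrite /cauchy_kernel !mxE subr0.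
Qed.

Let cauchy_product (K : R) (k : R) :
  (muT d).-integrable setT
    (EFin \o (fun t => \prod_(i < d) (K * cauchy_kernel (center k 0 i) (rowt t 0 i)))) /\
  \int[muT d]_t \prod_(i < d) (K * cauchy_kernel (center k 0 i) (rowt t 0 i)) = (K * pi) ^+ d.
Proof.
have iK j : mu.-integrable setT (EFin \o (fun y => K * cauchy_kernel (coordn (center k) j) y)).
  exact: (integrableZl measurableT K (integrable_cauchy_kernel (coordn (center k) j))).
have [h1 h2] := Rintegral_prod_tuple d iK.
have E : (fun t : TT => \prod_(i < d) (K * cauchy_kernel (center k 0 i) (rowt t 0 i))) =
   (fun t => \prod_(i < d) (K * cauchy_kernel (coordn (center k) i) (tnth t i))).
  by apply/funext => t; apply: eq_bigr => i _; rewrite coordnE [rowt t 0 i]mxE.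
rewrite E; split => //; rewrite [LHS]h2.
under eq_bigr => i _.
  rewrite RintegralZl//; last exact: (integrable_cauchy_kernel (coordn (center k) i)).
  rewrite {1}/Rintegral integral_cauchy_kernel/=.
  over.
by rewrite prodr_const card_ord.
Qed.

Section symbol.
Variables (r : R) (sigma : E -> E -> C).
Hypothesis Hs : symbol_class r sigma.

Lemma csmooth_symbol : ccontinuous (fun p : E * E => sigma p.1 p.2).
Proof. by case: Hs => s _; exact: smooth_ccontinuous. Qed.

Lemma ccontinuous_symbol x : ccontinuous (sigma x).
Proof.
by have [c1 c2] := csmooth_symbol; split; [exact: (continuous_pairl c1)|exact: (continuous_pairl c2)].
Qed.

Let amplitude (k : R) (x xi : E) : C := cis (dotv x xi) * sigma x xi * packet k xi.

Let ccontinuous_cis_dotv x : ccontinuous (fun xi : E => cis (dotv x xi)).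
Proof. by apply: smooth_ccontinuous; apply: smooth_cis; exact: rsmooth_dotv. Qed.

Let packet_center_bound (f : C) (k : R) (xi : E) (K1 K2 : R) (N : nat) :
  0 <= K1 -> cn f <= K1 * jweight (xi - center k) ^+ N ->
  cn (packet k xi) * jweight (xi - center k) ^+ N <= K2 -> cn (f * packet k xi) <= K1 * K2.
Proof.
move=> K10 h1 h2; rewrite cnM.
apply: le_trans (ler_wpM2r (cn_ge0 _) h1) _.
by rewrite -mulrA ler_wpM2l// mulrC.
Qed.

Let amplitude_bound : exists2 B, 0 <= B & exists2 K, 0 <= K & forall k x xi,
  cn (amplitude k x xi) <= B * (1 + enorm (center k)) `^ r *
     \prod_i (K * cauchy_kernel (center k 0 i) (xi 0 i)).
Proof.
have [K1 K10 HK1] := symbol_class_bound Hs.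
have [C0 C00 [N HN]] := @symbol_weight_bound R d r.
have [K K0 HK] := packet_bound N.
exists (K1 * C0); first exact: mulr_ge0.
exists K => // k x xi; rewrite /amplitude -mulrA cnM cn_cis mul1r.
apply: packet_center_bound (HK _ _); first by rewrite mulr_ge0 ?powR_ge0// mulr_ge0.
apply: le_trans (HK1 _ _) _; rewrite -!mulrA ler_wpM2l//.
by rewrite mulrA; exact: HN.
Qed.

Let cmeasurable_amplitude2 k :
  cmeasurable (fun p : TT * TT => amplitude k (rowt p.1) (rowt p.2)).
Proof.
have c1 i : measurable_fun setT (fun p : TT * TT => rowt p.1 0 i).
  exact: (measurableT_comp (@rowt_coord R d i) measurable_fst).
have c2 i : measurable_fun setT (fun p : TT * TT => rowt p.2 0 i).
  exact: (measurableT_comp (@rowt_coord R d i) measurable_snd).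
have mcomp (g : E * E -> C) : ccontinuous g -> cmeasurable (fun p : TT * TT => g (rowt p.1, rowt p.2)).
  move=> [g1 g2]; split.
    exact: (measurable_continuous2 (g := fun q => complex.Re (g q)) g1 c1 c2).
  exact: (measurable_continuous2 (g := fun q => complex.Im (g q)) g2 c1 c2).
apply: cmeasurableM; first apply: cmeasurableM.
- apply: cmeasurable_cis; apply: measurable_sum => i.
  exact: measurable_funM (c1 i) (c2 i).
- exact: (mcomp (fun q => sigma q.1 q.2) csmooth_symbol).
- have [m1 m2] := cmeasurable_packet k; split.
    exact: (measurableT_comp m1 measurable_snd).
  exact: (measurableT_comp m2 measurable_snd).
Qed.

Let cmeasurable_amplitude k x : cmeasurable (fun t : TT => amplitude k x (rowt t)).
Proof.
apply: cmeasurableM; first apply: cmeasurableM.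
- exact: (cmeasurable_rowt (@ccontinuous_cis_dotv x)).
- exact: (cmeasurable_rowt (ccontinuous_symbol x)).
- exact: cmeasurable_packet.
Qed.

Let cintegrable_amplitude k x : cintegrable (muT d) (fun t : TT => amplitude k x (rowt t)).
Proof.
have [B B0 [K K0 HK]] := amplitude_bound.
apply: (cintegrable_le (h := fun t : TT => B * (1 + enorm (center k)) `^ r *
   \prod_i (K * cauchy_kernel (center k 0 i) (rowt t 0 i)))).
- exact: cmeasurable_amplitude.
- exact: (integrableZl measurableT _ (cauchy_product K k).1).
- by move=> t; exact: HK.
Qed.

Let twopi : C := (((2 * pi) ^- d)%:C)%C.

Lemma psido_wave k x : psido sigma (fun y => chi y * wave k y) x =
  twopi * cintegral (muT d) setT (fun t => amplitude k x (rowt t)).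
Proof.
rewrite /psido Rd_integralE; congr (_ * _); apply: eq_cintegral => t.
by rewrite fourier_wave.
Qed.

Lemma inversion_wave k x :
  twopi * cintegral (muT d) setT (fun t => cis (dotv x (rowt t)) * packet k (rowt t)) =
  chi x * wave k x.
Proof.
have ij j : cintegrable mu (fun xi => cis (coordn x j * xi) * ft c (xi - coordn (center k) j)).
  have b1 : bump_on M (fun y => c y * cos (coordn (center k) j * y)).
    apply: bump_onM => //; apply: (rsmooth_comp (phi := @cos R)); first exact: rsmooth_cos.
    by have := rsmooth_affine (coordn (center k) j) 0; under eq_fun do rewrite addr0.
  have b2 : bump_on M (fun y => c y * sin (coordn (center k) j * y)).
    apply: bump_onM => //; apply: (rsmooth_comp (phi := @sin R)); first exact: rsmooth_sin.
    by have := rsmooth_affine (coordn (center k) j) 0; under eq_fun do rewrite addr0.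
  under eq_fun do rewrite (ft_shift _ _ M0 bc) mulrDr mulrCA.
  apply: cintegrableD; first exact: (cintegrable_cis_ft M0 b1).
  by apply: cintegrableZ; exact: (cintegrable_cis_ft M0 b2).
have [_ e] := cintegral_prod_tuple d ij.
have -> : cintegral (muT d) setT (fun t => cis (dotv x (rowt t)) * packet k (rowt t)) =
   \prod_(i < d) cintegral mu setT
      (fun xi => cis (coordn x i * xi) * ft c (xi - coordn (center k) i)).
  rewrite -e; apply: eq_cintegral => t.
  rewrite big_split/= -cis_sum /dotv /packet; congr (cis _ * _).
    by apply: eq_bigr => i _; rewrite coordnE mxE.
  by apply: eq_bigr => i _; rewrite coordnE !mxE.
under eq_bigr do rewrite (ft_shift_inversion _ _ M0 bc).
rewrite big_split/= -cis_sum -(rmorph_prod (real_complex R)) mulrA.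
congr (_ * _).
  rewrite /twopi /chi -rmorphM; congr ((_%:C)%C).
  rewrite big_split/= prodr_const card_ord mulrA mulVf ?mul1r.
    by apply: eq_bigr => i _; rewrite coordnE.
  by rewrite expf_neq0// mulf_neq0// gt_eqF// pi_gt0.
rewrite /wave; congr cis; rewrite /dotv mulr_sumr -sumrN.
by apply: eq_bigr => i _; rewrite !coordnE /center !mxE; ring.
Qed.

Let cintegrable_flat k x (z : C) :
  cintegrable (muT d) (fun t : TT => z * (cis (dotv x (rowt t)) * packet k (rowt t))).
Proof.
apply: cintegrableZ; have [K K0 HK] := packet_bound 0.
apply: (cintegrable_le (h := fun t : TT =>
   \prod_i (K * cauchy_kernel (center k 0 i) (rowt t 0 i)))).
- apply: cmeasurableM; last exact: cmeasurable_packet.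
  exact: (cmeasurable_rowt (@ccontinuous_cis_dotv x)).
- exact: (cauchy_product K k).1.
- by move=> t; have := HK k (rowt t); rewrite expr0 mulr1 cnM cn_cis mul1r.
Qed.

Lemma psido_wave_approx : exists2 K, 0 <= K & forall k x,
  cn (psido sigma (fun y => chi y * wave k y) x - sigma x (center k) * (chi x * wave k x)) <=
  K * (1 + enorm (center k)) `^ (r - 1).
Proof.
have [K1 K10 [N HN]] := symbol_difference Hs.
have [K K0 HK] := packet_bound N.
exists (cn twopi * (2 * (K1 * (K * pi) ^+ d))).
  by rewrite mulr_ge0 ?cn_ge0// mulr_ge0// mulr_ge0// exprn_ge0// mulr_ge0// pi_ge0.
move=> k x; rewrite psido_wave -inversion_wave mulrCA -mulrBr cnM -!mulrA.
apply: ler_wpM2l; first exact: cn_ge0.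
rewrite -cintegralZ; last first.
  by have := cintegrable_flat k x 1; under eq_fun do rewrite mul1r.
rewrite -cintegralB; [|exact: cintegrable_amplitude|exact: cintegrable_flat].
set A := (1 + enorm (center k)) `^ (r - 1).
have A0 : 0 <= A by exact: powR_ge0.
have [iK eK] := cauchy_product K k.
have -> : K1 * ((K * pi) ^+ d * A) = \int[muT d]_t (K1 * A *
     \prod_i (K * cauchy_kernel (center k 0 i) (rowt t 0 i))).
  by rewrite RintegralZl// eK; ring.
apply: cn_cintegral_le.
- apply: cmeasurableD; first exact: cmeasurable_amplitude.
  by apply: cmeasurableN; exact: (cintegrable_measurable (cintegrable_flat k x _)).
- exact: (integrableZl measurableT (K1 * A) iK).
- move=> t; rewrite /amplitude.
  have -> : cis (dotv x (rowt t)) * sigma x (rowt t) * packet k (rowt t) -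
       sigma x (center k) * (cis (dotv x (rowt t)) * packet k (rowt t)) =
      cis (dotv x (rowt t)) * ((sigma x (rowt t) - sigma x (center k)) * packet k (rowt t)).
    by rewrite mulrBl mulrBr !mulrA; congr (_ - _); rewrite mulrAC [_ * sigma _ _]mulrC mulrAC.
  rewrite cnM cn_cis mul1r; apply: packet_center_bound (HK _ _).
    exact: mulr_ge0.
  exact: HN.
Qed.

Lemma cintegrable_psido_wave k (g : E -> C) : ccontinuous g ->
  (muT d).-integrable setT (EFin \o (fun t => cn (g (rowt t)))) ->
  cintegrable (muT d) (fun t => psido sigma (fun y => chi y * wave k y) (rowt t) * g (rowt t)).
Proof.
move=> cg ig.
have [B B0 [K K0 HK]] := amplitude_bound.
set A := (1 + enorm (center k)) `^ r in HK.
have A0 : 0 <= A by exact: powR_ge0.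
have [iK eK] := cauchy_product K k.
have mg := cmeasurable_rowt cg.
pose f (p : TT * TT) := g (rowt p.1) * amplitude k (rowt p.1) (rowt p.2).
have iff : cintegrable (muT d \x muT d)%E f.
  apply: (cintegrable_le (h := fun p : TT * TT => cn (g (rowt p.1)) *
     (B * (1 + enorm (center k)) `^ r * \prod_i (K * cauchy_kernel (center k 0 i) (rowt p.2 0 i))))).
  - apply: cmeasurableM; last exact: cmeasurable_amplitude2.
    by have [m1 m2] := mg; split;
      [exact: (measurableT_comp m1 measurable_fst)|exact: (measurableT_comp m2 measurable_fst)].
  - exact: (integrable_tensor ig (integrableZl measurableT (B * (1 + enorm (center k)) `^ r) iK)).
  - by move=> p; rewrite cnM ler_wpM2l ?cn_ge0//; exact: HK.
have E1 : (fun t => psido sigma (fun y => chi y * wave k y) (rowt t) * g (rowt t)) =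
    fun t => twopi * cintegral (muT d) setT (fun s => f (t, s)).
  apply/funext => t; rewrite psido_wave -mulrA; congr (_ * _).
  by rewrite /f/= cintegralZ 1?mulrC//; exact: cintegrable_amplitude.
rewrite E1; apply: cintegrableZ.
apply: (cintegrable_le (h := fun t : TT => (2 * (B * A * (K * pi) ^+ d)) * cn (g (rowt t)))).
- exact: (cmeasurable_param iff).
- exact: (integrableZl measurableT _ ig).
- move=> t; rewrite /f/= cintegralZ; last exact: cintegrable_amplitude.
  rewrite cnM mulrC ler_wpM2r ?cn_ge0//.
  have -> : B * A * (K * pi) ^+ d = \int[muT d]_s (B * A *
     \prod_i (K * cauchy_kernel (center k 0 i) (rowt s 0 i))).
    by rewrite RintegralZl// eK.
  apply: cn_cintegral_le.
  - exact: cmeasurable_amplitude.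
  - exact: (integrableZl measurableT (B * A) iK).
  - by move=> s; exact: HK.
Qed.

End symbol.
End wave_packets.

(** * Integration by parts and decay of Fourier transforms *)

Section integration_by_parts.
Variable R : realType.
Local Notation mu := (@lebesgue_measure R).
Local Notation muT := (product_power mu).
Local Notation TT n := (n.-tuple (measurableTypeR R)).

(** On the box each factor (1 + M^2) / (1 + t_i^2) is at least 1, so a multiple of a product of
    Cauchy kernels dominates [f]. *)
Lemma integrable_box n (f : TT n -> R) (B M : R) : 0 <= B ->
  measurable_fun setT f -> (forall t, `|f t| <= B) ->
  (forall t j, M < `|tnth t j| -> f t = 0) ->
  (muT n).-integrable setT (EFin \o f).
Proof.
move=> B0 mf fB f0.
have [iK _] := Rintegral_prod_tuple n
   (fun _ : nat => integrableZl measurableT (1 + M ^+ 2) (integrable_cauchy_kernel (0 : R))).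
apply: (@le_integrable _ _ _ _ _ _ _
   (EFin \o (fun t : TT n => B * \prod_(i < n) ((1 + M ^+ 2) * cauchy_kernel 0 (tnth t i))))) => //.
- exact/measurable_EFinP.
- move=> t _ /=; rewrite lee_fin; apply: le_trans (ler_norm _).
  have p0 (x : R) : 0 <= (1 + M ^+ 2) * cauchy_kernel 0 x.
    by rewrite mulr_ge0 ?cauchy_kernel_ge0// addr_ge0// sqr_ge0.
  have [tM|] := pselect (forall j, `|tnth t j| <= M); last first.
    move=> /existsNP[j] /negP; rewrite -ltNge => /f0 ->.
    by rewrite normr0 mulr_ge0// prodr_ge0.
  apply: le_trans (fB t) _; rewrite -[leLHS]mulr1 ler_wpM2l//.
  apply: (@le_trans _ _ (\prod_(i < n) 1)); first by rewrite big1.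
  apply: ler_prod => i _; rewrite ler01/= /cauchy_kernel subr0.
  rewrite ler_pdivlMr ?ltr_pwDl ?sqr_ge0// mul1r lerD2l.
  have := tM i; rewrite -[_ ^+ 2]real_normK ?num_real// => tiM.
  by rewrite ler_sqr ?nnegrE// (le_trans _ tiM).
- exact: (integrableZl measurableT B iK).
Qed.

Definition upd n (t : TT n) (i : 'I_n) (s : R) : TT n :=
  [tuple (if j == i then s else tnth t j) | j < n].

Lemma upd_cons0 n (a s : R) (t : TT n) :
  upd (tuple_cons (a, t)) ord0 s = tuple_cons (s, t) :> TT n.+1.
Proof.
apply: eq_from_tnth => j; rewrite tnth_mktuple.
by case: (unliftP ord0 j) => [k ->|->]; rewrite ?eqxx ?[tuple_cons _]/tuple_cons ?tnthS ?tnth0.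
Qed.

Lemma upd_consS n (a s : R) (t : TT n) (i : 'I_n) :
  upd (tuple_cons (a, t)) (lift ord0 i) s = tuple_cons (a, upd t i s) :> TT n.+1.
Proof.
apply: eq_from_tnth => j; rewrite tnth_mktuple.
case: (unliftP ord0 j) => [k ->|->].
  by rewrite (inj_eq (@lift_inj _ _)) ![tuple_cons _]/tuple_cons !tnthS tnth_mktuple.
by rewrite ![tuple_cons _]/tuple_cons !tnth0.
Qed.

(** Induction on the number of coordinates. If the differentiated coordinate is the first one, the
    integrals are exchanged and it is integrated first, by the fundamental theorem; otherwise the
    first coordinate is frozen and the induction hypothesis applies. *)
Lemma Rintegral_partial_derivative n (i : 'I_n) (h h' : TT n -> R) (B M : R) :
  0 <= B -> 0 <= M -> measurable_fun setT h' -> (forall t, `|h' t| <= B) ->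
  (forall t j, M < `|tnth t j| -> h t = 0) ->
  (forall t j, M < `|tnth t j| -> h' t = 0) ->
  (forall t, continuous (fun s => h' (upd t i s))) ->
  (forall t (s : R), is_derive s (1 : R) (fun s => h (upd t i s)) (h' (upd t i s))) ->
  \int[muT n]_t h' t = 0.
Proof.
move=> B0 M0; elim: n i h h' => [[]//|n IH] i h h' mh' h'B h0 h'0 ch dh.
have ih' := integrable_box B0 mh' h'B h'0.
rewrite Rintegral_tuple//.
have icons : (mu \x muT n)%E.-integrable setT (EFin \o (fun p => h' (tuple_cons p))).
  by apply/(integrable_tuple (f := EFin \o h')) => //; exact/measurable_EFinP.
have tn0 (a : R) (t : TT n) : tnth (tuple_cons (a, t)) ord0 = a.
  by rewrite [tuple_cons _]/tuple_cons tnth0.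
have tnS (a : R) (t : TT n) k : tnth (tuple_cons (a, t)) (lift ord0 k) = tnth t k.
  by rewrite [tuple_cons _]/tuple_cons tnthS.
have ma (t : TT n) : measurable_fun setT (fun a : measurableTypeR R => h' (tuple_cons (a, t))).
  apply: (measurableT_comp mh'); apply: (measurableT_comp (@measurable_tuple_cons _ (measurableTypeR R) n)).
  exact: (pair2_measurable t).
have mt (a : R) : measurable_fun setT (fun t : TT n => h' (tuple_cons (a, t))).
  apply: (measurableT_comp mh'); apply: (measurableT_comp (@measurable_tuple_cons _ (measurableTypeR R) n)).
  exact: (@pair1_measurable _ _ (measurableTypeR R) _ a).
have i2 (a : measurableTypeR R) : (muT n).-integrable setT (fun t => (h' (tuple_cons (a, t)))%:E).
  apply: (@integrable_box _ (fun t => h' (tuple_cons (a, t))) B M B0 (mt a)) => [t|t j Mt].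
    exact: h'B.
  by apply: (h'0 _ (lift ord0 j)); rewrite tnS.
case: (unliftP ord0 i) => [j|] ij; last first.
  have i1 (t : TT n) : mu.-integrable setT (fun a => (h' (tuple_cons (a, t)))%:E).
    apply: (@integrable_supp_itv _ (fun a => h' (tuple_cons (a, t))) M).
      have -> : (fun a => h' (tuple_cons (a, t))) =
          fun s => h' (upd (tuple_cons ((0 : measurableTypeR R), t)) i s).
        by apply/funext => s; rewrite ij upd_cons0.
      exact: ch.
    by move=> a Ma; apply: (h'0 _ ord0); rewrite tn0.
  rewrite Rintegral_fubini// (Rintegral_fubini_swap (f := fun p => h' (tuple_cons p)))//.
  rewrite -[RHS](_ : \int[muT n]_t 0 = 0); last by rewrite /Rintegral integral0.
  apply: eq_Rintegral => t _.
  apply: (@Rintegral_bump_FTC _ _ M0 (fun a => h (tuple_cons (a, t)))).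
  - move=> a; have := dh (tuple_cons (a, t)) a; rewrite ij upd_cons0.
    by congr is_derive; apply/funext => s; rewrite upd_cons0.
  - have -> : (fun a => h' (tuple_cons (a, t))) =
        fun s => h' (upd (tuple_cons ((0 : measurableTypeR R), t)) i s).
      by apply/funext => s; rewrite ij upd_cons0.
    exact: ch.
  - by move=> a Ma; apply: (h0 _ ord0); rewrite tn0.
  - by move=> a Ma; apply: (h'0 _ ord0); rewrite tn0.
rewrite Rintegral_fubini//.
rewrite -[RHS](_ : \int[mu]_a 0 = 0); last by rewrite /Rintegral integral0.
apply: eq_Rintegral => a _.
apply: (IH j (fun t => h (tuple_cons (a, t)))) => //.
- exact: mt.
- by move=> t k Mt; apply: (h0 _ (lift ord0 k)); rewrite tnS.
- by move=> t k Mt; apply: (h'0 _ (lift ord0 k)); rewrite tnS.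
- move=> t; have -> : (fun s => h' (tuple_cons (a, upd t j s))) =
      fun s => h' (upd (tuple_cons (a, t)) i s).
    by apply/funext => s; rewrite ij upd_consS.
  exact: ch.
- move=> t s; have := dh (tuple_cons (a, t)) s; rewrite ij upd_consS.
  by congr is_derive; apply/funext => u; rewrite upd_consS.
Qed.

End integration_by_parts.

Section compact_support.
Variables (R : realType) (d : nat).
Local Notation C := R[i].
Local Notation E := 'rV[R]_d.
Local Notation mu := (@lebesgue_measure R).
Local Notation muT := (product_power mu).
Local Notation TT := (d.-tuple (measurableTypeR R)).

Lemma bounded_support_bound (g : E -> R) (M : R) : continuous g ->
  (forall x, M < `|x| -> g x = 0) -> exists2 B, 0 <= B & forall x, `|g x| <= B.
Proof.
move=> cg g0.
have /compact_bounded[B0 [_ HB]] : compact (g @` [set x : E | `|x| <= M]).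
  apply: continuous_compact; last exact: compact_norm_le.
  exact: continuous_subspaceT.
exists (`|B0| + 1) => [|x]; first by rewrite addr_ge0.
have [xM|Mx] := leP `|x| M; last by rewrite g0// normr0 addr_ge0.
by apply: HB; [rewrite (le_lt_trans (ler_norm _))// ltrDl|exists x].
Qed.

Lemma Rintegral_derive_rowt (g : E -> R) (M : R) (i : 'I_d) : 0 <= M -> rsmooth g ->
  (forall x, M < `|x| -> g x = 0) ->
  \int[muT d]_t 'D_(basis_vec R i) g (rowt t) = 0.
Proof.
move=> M0 sg g0.
pose g' x := 'D_(basis_vec R i) g x.
have sg' : rsmooth g' by exact: rsmooth_derive.
have g'0 x : M < `|x| -> g' x = 0.
  move=> Mx; apply: derive_val.
  have H : \near x, (cst (0 : R)) x = g x.
    have : {for x, continuous (fun y : E => `|y|)} by exact: norm_continuous.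
    by move=> /(_ _ (lt_nbhsr Mx)) H; near=> y; rewrite g0//; near: y; exact: H.
  exact: (near_eq_is_derive H (is_derive_cst (0 : R) x (basis_vec R i))).
have [B B0 HB] := bounded_support_bound (rsmooth_continuous sg') g'0.
have lt_norm (t : TT) j : M < `|tnth t j| -> M < `|rowt t|.
  by move/lt_le_trans; apply; have := coord_le_norm (rowt t) j; rewrite mxE.
have updE (t : TT) s : rowt (upd t i s) = rowt (upd t i 0) + s *: basis_vec R i.
  apply/rowP => j; rewrite !mxE !tnth_mktuple eqxx/=.
  by case: eqP => _; rewrite ?mulr1 ?mulr0 ?add0r ?addr0.
apply: (@Rintegral_partial_derivative _ _ i (fun t => g (rowt t)) _ B M) => //.
- exact: (measurable_rowt (rsmooth_continuous sg')).
- by move=> t; exact: HB.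
- by move=> t j /lt_norm/g0.
- by move=> t j /lt_norm/g'0.
- move=> t s.
  have -> : (fun s => 'D_(basis_vec R i) g (rowt (upd t i s))) =
      fun s => g' (rowt (upd t i 0) + s *: basis_vec R i).
    by apply/funext => u; rewrite updE.
  by apply: is_derive1_continuous; apply: is_derive_line; exact: rsmooth_derivable.
- move=> t s.
  have -> : (fun s => g (rowt (upd t i s))) = fun s => g (rowt (upd t i 0) + s *: basis_vec R i).
    by apply/funext => u; rewrite updE.
  by rewrite (updE t s); apply: is_derive_line; exact: rsmooth_derivable.
Unshelve. all: by end_near. Qed.

Lemma integrable_rowt_bounded (g : E -> C) (B M : R) : 0 <= B -> ccontinuous g ->
  (forall x, cn (g x) <= B) -> (forall x, M < `|x| -> g x = 0) ->
  (muT d).-integrable setT (EFin \o (fun t => cn (g (rowt t)))) /\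
  cintegrable (muT d) (fun t => g (rowt t)).
Proof.
move=> B0 cg gB g0.
have mg := cmeasurable_rowt cg.
have i1 : (muT d).-integrable setT (EFin \o (fun t => cn (g (rowt t)))).
  apply: (@integrable_box _ _ _ B M B0); first exact: measurable_cn.
    by move=> t; rewrite ger0_norm ?cn_ge0.
  move=> t j tj; rewrite g0 ?cn0//; apply: lt_le_trans tj _.
  by have := coord_le_norm (rowt t) j; rewrite mxE.
by split=> //; apply: cintegrable_le i1 _.
Qed.

Lemma test_function_support (D : set E) (a : E -> C) : test_function D a ->
  exists2 M, 0 <= M & forall x, M < `|x| -> a x = 0.
Proof.
move=> [_ [K [cK _ K0]]]; have [M M0 HM] := compact_norm_bound cK.
by exists M => // x Mx; apply: K0 => Kx; move: Mx; rewrite ltNge HM.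
Qed.

Lemma test_function_bounded (D : set E) (a : E -> C) : test_function D a ->
  exists2 B, 0 <= B & forall x, cn (a x) <= B.
Proof.
move=> ta; have [M _ aM] := test_function_support ta.
have [/smooth_ccontinuous[c1 c2] _] := ta.
have [|B1 B10 HB1] := @bounded_support_bound _ M c1; first by move=> x /aM ->.
have [|B2 B20 HB2] := @bounded_support_bound _ M c2; first by move=> x /aM ->.
exists (B1 + B2) => [|x]; first exact: addr_ge0.
by apply: le_trans (cn_le _) _; exact: lerD.
Qed.

Lemma cintegrable_test (D : set E) (a : E -> C) (g : E -> C) : test_function D a ->
  smooth g -> cintegrable (muT d) (fun t => a (rowt t) * g (rowt t)).
Proof.
move=> ta sg; have tag := test_functionM ta sg.
have [M _ aM] := test_function_support tag.
have [B B0 aB] := test_function_bounded tag.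
have [/smooth_ccontinuous cag _] := tag.
exact: (integrable_rowt_bounded B0 cag aB aM).2.
Qed.

Lemma cintegral_derive_test (D : set E) (g : E -> C) (i : 'I_d) : test_function D g ->
  cintegral (muT d) setT (fun t => cderive (basis_vec R i) g (rowt t)) = 0.
Proof.
move=> tg; have [M M0 gM] := test_function_support tg.
have [/smoothE[s1 s2] _] := tg.
apply: eq_complex_parts => /=; apply: (@Rintegral_derive_rowt _ M) => // x /gM -> //.
Qed.

Lemma fourier_wave_test (a : E -> C) (xhat : E) (s : R) :
  fourier a (s *: xhat) = cintegral (muT d) setT (fun t => a (rowt t) * wave xhat s (rowt t)).
Proof.
rewrite /fourier Rd_integralE; apply: eq_cintegral => t.
by rewrite /wave mulrC dotvZr dotvC.
Qed.

Lemma cderive_wave (a : E -> C) (xhat : E) (s : R) (i : 'I_d) x : smooth a ->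
  cderive (basis_vec R i) (fun y => a y * wave xhat s y) x =
  cderive (basis_vec R i) a x * wave xhat s x +
  (0 +i* - (s * xhat 0 i))%C * (a x * wave xhat s x).
Proof.
move=> /smoothE[s1 s2].
pose th (y : E) : R := - (s * dotv xhat y).
have dth : is_derive x (basis_vec R i) th (- (s * xhat 0 i)).
  have lin : forall (c : R) y z, th (c *: y + z) = c * th y + th z.
    move=> c y z; rewrite /th /dotv !mulr_sumr -!sumrN mulr_sumr -big_split/=.
    by apply: eq_bigr => j _; rewrite !mxE; ring.
  have E : th (basis_vec R i) = - (s * xhat 0 i).
    rewrite /th /dotv (bigD1 i)//= !mxE !eqxx/= mulr1 big1 ?addr0// => j ji.
    by rewrite !mxE (negbTE ji) mulr0.
  rewrite -E.
  have G (t : R) : t != 0 -> t^-1 *: ((th \o shift x) (t *: basis_vec R i) - th x) = th (basis_vec R i).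
    by move=> t0 /=; rewrite lin addrK [_ *: _]mulrA mulVf// mul1r.
  have H : t^-1 *: ((th \o shift x) (t *: basis_vec R i) - th x) @[t --> 0^'] --> th (basis_vec R i).
    apply: cvg_near_cst; near=> t; apply: G; near: t; exact: nbhs_dnbhs_neq.
  by apply: DeriveDef; [apply/cvg_ex; exists (th (basis_vec R i))|exact: cvg_lim H].
have dc : is_derive x (basis_vec R i) (fun y => cos (th y)) (- sin (th x) * - (s * xhat 0 i)).
  exact: (is_derive_comp_line (is_derive_cos _) dth).
have ds : is_derive x (basis_vec R i) (fun y => sin (th y)) (cos (th x) * - (s * xhat 0 i)).
  exact: (is_derive_comp_line (is_derive_sin _) dth).
have d1 : is_derive x (basis_vec R i) (fun y => complex.Re (a y)) (complex.Re (cderive (basis_vec R i) a x)).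
  by apply/derivableP; exact: rsmooth_derivable.
have d2 : is_derive x (basis_vec R i) (fun y => complex.Im (a y)) (complex.Im (cderive (basis_vec R i) a x)).
  by apply/derivableP; exact: rsmooth_derivable.
apply: eq_complex_parts.
  rewrite [LHS]/= (_ : (fun y => complex.Re (a y * wave xhat s y)) =
     ((fun y => complex.Re (a y)) * (fun y => cos (th y)) -
      (fun y => complex.Im (a y)) * (fun y => sin (th y)))); last first.
    by apply/funext => y; rewrite ReM.
  rewrite (@derive_val _ _ _ _ _ _ _ (is_deriveB (is_deriveM d1 dc) (is_deriveM d2 ds))).
  rewrite ReD !ReM !ImM /GRing.scale/= -/(th x).
  by set u := 'D_ _ _ _; set v := 'D_ _ _ _; ring.
rewrite [LHS]/= (_ : (fun y => complex.Im (a y * wave xhat s y)) =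
   ((fun y => complex.Re (a y)) * (fun y => sin (th y)) +
    (fun y => complex.Im (a y)) * (fun y => cos (th y)))); last first.
  by apply/funext => y; rewrite ImM.
rewrite (@derive_val _ _ _ _ _ _ _ (is_deriveD (is_deriveM d1 ds) (is_deriveM d2 dc))).
rewrite ImD !ImM !ReM /GRing.scale/= -/(th x).
by set u := 'D_ _ _ _; set v := 'D_ _ _ _; ring.
Unshelve. all: by end_near. Qed.

Lemma cderive_test (D : set E) (a : E -> C) (i : 'I_d) : test_function D a ->
  test_function setT (cderive (basis_vec R i) a).
Proof.
move=> ta; have [M M0 aM] := test_function_support ta.
have [/smoothE[s1 s2] _] := ta.
split; first by apply/smoothE; split; exact: rsmooth_derive.
exists [set x : E | `|x| <= M]; split=> //; first exact: compact_norm_le.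
move=> x /negP; rewrite -ltNge => Mx.
have H (part : C -> R) : part 0 = 0 -> 'D_(basis_vec R i) (fun y => part (a y)) x = 0.
  move=> p0; apply: derive_val.
  have N : \near x, (cst (0 : R)) x = part (a x).
    have : {for x, continuous (fun y : E => `|y|)} by exact: norm_continuous.
    by move=> /(_ _ (lt_nbhsr Mx)) N; near=> y; rewrite aM ?p0//; near: y; exact: N.
  exact: (near_eq_is_derive N (is_derive_cst (0 : R) x (basis_vec R i))).
by apply: eq_complex_parts; rewrite /cderive/=; [exact: (H (@complex.Re R))|exact: (H (@complex.Im R))].
Unshelve. all: by end_near. Qed.

(** A unit vector has a nonzero coordinate i; integrating by parts along it brings out the factor s
    xhat_i. Adding the trivial bound covers small s. *)
Lemma fourier_decay (D : set E) (a : E -> C) (xhat : E) : test_function D a ->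
  enorm xhat = 1 -> exists2 K, 0 <= K & forall s, cn (fourier a (s *: xhat)) <= K / (1 + `|s|).
Proof.
move=> ta x1.
have [i xi0] : exists i, xhat 0 i != 0.
  apply: contrapT => /forallNP H; move: x1; rewrite /enorm /dotv big1 ?sqrtr0.
    by move/eqP; rewrite eq_sym oner_eq0.
  by move=> i _; have /negP := H i; rewrite negbK => /eqP ->; rewrite mulr0.
have sw s : smooth (wave xhat s) by exact: smooth_wave.
have ta' := cderive_test i ta.
have sc1 : smooth (fun _ : E => 1 : C) by exact: smooth_cst.
have I (D' : set E) (b : E -> C) : test_function D' b ->
    (muT d).-integrable setT (EFin \o (fun t => cn (b (rowt t)))).
  move=> tb; have := cintegrable_test tb sc1; under eq_fun do rewrite mulr1.
  exact: integrable_cn.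
have bnd (D' : set E) (b : E -> C) s : test_function D' b ->
    cn (cintegral (muT d) setT (fun t => b (rowt t) * wave xhat s (rowt t))) <=
    2 * \int[muT d]_t cn (b (rowt t)).
  move=> tb; apply: cn_cintegral_le; last by move=> t; rewrite cnM cn_wave mulr1.
    exact: (cintegrable_measurable (cintegrable_test tb (sw s))).
  exact: I tb.
pose A := 2 * \int[muT d]_t cn (a (rowt t)).
pose A' := 2 * \int[muT d]_t cn (cderive (basis_vec R i) a (rowt t)).
have A0 : 0 <= A by rewrite mulr_ge0// Rintegral_ge0// => t _; exact: cn_ge0.
have A'0 : 0 <= A' by rewrite mulr_ge0// Rintegral_ge0// => t _; exact: cn_ge0.
exists (A + A' / `|xhat 0 i|) => [|s]; first by rewrite addr_ge0// divr_ge0.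
rewrite ler_pdivlMr ?ltr_pwDl// mulrDr mulr1 fourier_wave_test.
set F := cintegral _ _ _.
apply: lerD; first exact: bnd ta.
rewrite ler_pdivlMr ?normr_gt0//.
have := cintegral_derive_test i (test_functionM ta (sw s)).
under eq_cintegral do rewrite (cderive_wave _ _ _ _ ta.1).
rewrite cintegralD; last 2 first.
- exact: cintegrable_test ta' (sw s).
- by apply: cintegrableZ; exact: cintegrable_test ta (sw s).
rewrite cintegralZ; last exact: cintegrable_test ta (sw s).
rewrite -/F => /eqP; rewrite addr_eq0 => /eqP E.
have := bnd _ _ s ta'; rewrite E cnN cnM.
have -> : cn (0 +i* - (s * xhat 0 i))%C = `|s| * `|xhat 0 i|.
  by rewrite cnE/= expr0n/= add0r sqrrN sqrtr_sqr normrM.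
by move=> H; rewrite -mulrA mulrC.
Qed.

End compact_support.

(** * Asymptotics of the kernels on packets *)

Section kernel_asymptotics.
Variables (R : realType) (d : nat).
Local Notation C := R[i].
Local Notation E := 'rV[R]_d.
Local Notation mu := (@lebesgue_measure R).
Local Notation muT := (product_power mu).
Local Notation TT := (d.-tuple (measurableTypeR R)).
Variables (c : R -> R) (M : R) (xhat : E) (D : set E).
Hypotheses (M0 : 0 <= M) (bc : bump_on M c) (x1 : enorm xhat = 1).
Hypothesis cD : forall x, D x -> chi c x = 1.

Lemma test_function_chi (g : E -> C) : test_function D g -> forall x, g x = g x * chi c x.
Proof.
move=> [_ [K [_ KD K0]]] x; have [Kx|nKx] := pselect (K x).
  by rewrite cD ?mulr1//; exact: KD.
by rewrite K0// mul0r.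
Qed.

Lemma one_plus_powR (r : R) : exists2 K, 0 <= K & forall k : R, 1 <= `|k| ->
  (1 + `|k|) `^ r <= K * `|k| `^ r.
Proof.
pose N := (Num.truncn `|r|).+1.
exists (2 ^+ N) => [|k k1]; first exact: exprn_ge0.
rewrite mulrC; apply: peetre => //.
- by rewrite lerDl.
- by rewrite ler1n.
- lra.
- by have : 0 <= `|k| by []; lra.
- exact: ltW (truncnS_gt _).
Qed.

(** The center of the packet has norm |k2| >= 1, where the symbol is a |k2|^-m + b. The two waves
    multiply to one of frequency k1 + k2, and [a] integrated against it is its Fourier transform.
    Freezing the symbol and dropping [b] cost one order each. *)
Lemma kernel_asymptotics (m : R) (a : E -> C) (sigma : E -> E -> C) :
  isotropic_symbol m D a sigma ->
  exists2 K, 0 <= K & forall k2 k1, 1 <= `|k2| ->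
    cn (Rd_integral (fun x => psido sigma (fun y => chi c y * wave xhat k2 y) x *
                              (chi c x * wave xhat k1 x)) -
        ((`|k2| `^ (- m))%:C)%C * fourier a ((k2 + k1) *: xhat)) <=
    K * `|k2| `^ (- m - 1).
Proof.
move=> [Hs ts ta [b [Hb tb sE]]].
have [K1 K10 HK1] := psido_wave_approx xhat M0 bc Hs.
have [K2 K20 HK2] := symbol_class_bound Hb.
have [K3 K30 HK3] := one_plus_powR (- m - 1).
pose I := \int[muT d]_t cn (chi c (rowt t)).
have iI : (muT d).-integrable setT (EFin \o (fun t : TT => cn (chi c (rowt t)))) by exact: (@integrable_cn_chi R d c M bc).
have I0 : 0 <= I by apply: Rintegral_ge0 => t _; exact: cn_ge0.
exists (2 * ((K1 + K2) * K3 * I)).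
  by rewrite mulr_ge0// mulr_ge0// mulr_ge0// addr_ge0.
move=> k2 k1 k21.
pose a0 : E := (- k2) *: xhat.
have na0 : enorm a0 = `|k2| by rewrite enormZ x1 mulr1 normrN.
pose w := wave xhat (k2 + k1).
have sw : smooth w by exact: smooth_wave.
have smc : smooth (@chi R d c) by exact: (@smooth_chi R d c M bc).
pose A (t : TT) := psido sigma (fun y => chi c y * wave xhat k2 y) (rowt t) *
   (chi c (rowt t) * wave xhat k1 (rowt t)).
have iA : cintegrable (muT d) A.
  have cg : ccontinuous (fun x : E => chi c x * wave xhat k1 x).
    by apply: smooth_ccontinuous; apply: smoothM; [exact: smc|exact: smooth_wave].
  have ig : (muT d).-integrable setT
      (EFin \o (fun t : TT => cn (chi c (rowt t) * wave xhat k1 (rowt t)))).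
    have -> : (fun t : TT => cn (chi c (rowt t) * wave xhat k1 (rowt t))) =
        fun t => cn (chi c (rowt t)).
      by apply/funext => t; rewrite cnM cn_wave mulr1.
    exact: iI.
  exact: (cintegrable_psido_wave xhat M0 bc Hs k2 cg ig).
have iS : cintegrable (muT d) (fun t => sigma (rowt t) a0 * w (rowt t)).
  exact: cintegrable_test (ts a0) sw.
have ia : cintegrable (muT d) (fun t => a (rowt t) * w (rowt t)) by exact: cintegrable_test ta sw.
have ib : cintegrable (muT d) (fun t => b (rowt t) a0 * w (rowt t)).
  exact: cintegrable_test (tb a0) sw.
rewrite Rd_integralE fourier_wave_test -/w -/A.
have -> : ((`|k2| `^ (- m))%:C)%C * cintegral (muT d) setT (fun t => a (rowt t) * w (rowt t)) =
   cintegral (muT d) setT (fun t => sigma (rowt t) a0 * w (rowt t)) -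
   cintegral (muT d) setT (fun t => b (rowt t) a0 * w (rowt t)).
  rewrite -cintegralZ// -cintegralB//; apply: eq_cintegral => t.
  by rewrite sE ?na0//; ring.
rewrite opprB addrCA -cintegralB// -cintegralD//; last first.
  have := cintegrableD iA (cintegrableZ (-1) iS).
  by congr cintegrable; apply/funext => t; rewrite mulN1r.
set X := (1 + `|k2|) `^ (- m - 1) in HK3.
have X0 : 0 <= X by exact: powR_ge0.
apply: (@le_trans _ _ (2 * ((K1 + K2) * X * I))); last first.
  have -> : 2 * ((K1 + K2) * K3 * I) * `|k2| `^ (- m - 1) =
      2 * ((K1 + K2) * (K3 * `|k2| `^ (- m - 1)) * I) by ring.
  by rewrite ler_wpM2l// ler_wpM2r// ler_wpM2l ?addr_ge0//; exact: HK3.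
rewrite -RintegralZl//; apply: cn_cintegral_le.
- apply: cmeasurableD; first exact: (cintegrable_measurable ib).
  apply: cmeasurableD; first exact: (cintegrable_measurable iA).
  exact: (cmeasurableN (cintegrable_measurable iS)).
- exact: (integrableZl measurableT ((K1 + K2) * X) iI).
- move=> t; apply: le_trans (cn_triangle _ _) _; rewrite addrC -mulrA mulrDl.
  set x := rowt t; apply: lerD; last first.
    rewrite (test_function_chi (tb a0)) -mulrA [X in _ * X]mulrC cnM.
    rewrite [cn (w x * _)]cnM cn_wave mul1r mulrA ler_wpM2r ?cn_ge0//.
    by have := HK2 x a0; rewrite na0.
  have -> : A t - sigma x a0 * w x =
     (psido sigma (fun y => chi c y * wave xhat k2 y) x - sigma x a0 * (chi c x * wave xhat k2 x)) *
     (chi c x * wave xhat k1 x).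
    rewrite mulrBl /A; congr (_ - _).
    (* One cutoff is inserted for each of the two packets; both are 1 wherever the symbol does not
       vanish. *)
    rewrite {1}(test_function_chi (ts a0)) {1}(test_function_chi (ts a0)) /w waveD.
    by ring.
  rewrite cnM [cn (chi c x * _)]cnM cn_wave mulr1 [leRHS]mulrA ler_wpM2r ?cn_ge0//.
  by have := HK1 k2 x; rewrite -/a0 na0.
Qed.

End kernel_asymptotics.

(** * Uniqueness from the Fourier transform near a point *)

Section concentration.
Variables (R : realType) (d : nat).
Local Notation C := R[i].
Local Notation E := 'rV[R]_d.
Local Notation mu := (@lebesgue_measure R).
Local Notation muT := (product_power mu).
Local Notation TT := (d.-tuple (measurableTypeR R)).

Definition box_indic (y : E) (r : R) (x : E) : R := (`[< forall i, `|x 0 i - y 0 i| <= r >])%:R.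

Lemma integral_box_indic (y : E) (r : R) : 0 < r ->
  (muT d).-integrable setT (EFin \o (fun t => box_indic y r (rowt t))) /\
  0 < \int[muT d]_t box_indic y r (rowt t).
Proof.
move=> r0.
pose I (j : nat) : set R := `[coordn y j - r, coordn y j + r]%classic.
pose g (j : nat) (u : R) : R := \1_(I j) u.
have mI j : mu (I j) = (r + r)%:E.
  rewrite lebesgue_measure_itv/= lte_fin ltrBlDr -addrA ltrDl addr_gt0//.
  by rewrite -EFinD; congr EFin; ring.
have ig j : mu.-integrable setT (EFin \o g j).
  by apply: integrable_indic_itv.
have inI j u : (u \in I j) = (`|u - coordn y j| <= r).
  by rewrite ler_distl; apply/idP/idP; rewrite inE /I/= in_itv.
have [h1 h2] := Rintegral_prod_tuple d ig.
have E0 : (fun t : TT => box_indic y r (rowt t)) = fun t => \prod_(i < d) g i (tnth t i).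
  apply/funext => t; rewrite /box_indic /g; case: asboolP => [H|H].
    by rewrite big1// => i _; have := H i; rewrite indicE inI coordnE mxE => ->.
  have [i Hi] : exists i, ~ `|rowt t 0 i - y 0 i| <= r by apply/existsNP.
  by move/negP/negbTE: Hi; rewrite (bigD1 i)//= indicE inI coordnE mxE => ->; rewrite mul0r.
rewrite E0; split => //; rewrite [ltRHS]h2 prodr_gt0// => i _.
rewrite /Rintegral integral_indic//; last exact: measurable_itv.
by rewrite setIT; have /= -> := mI i; rewrite addr_gt0.
Qed.

(** A polynomial equal to 1 at [y] and decreasing with the distance to it; s will be so small that
    it stays nonnegative on the ball carrying the function under study. *)
Definition hump (s : R) (y x : E) : R := 1 - s * dotv (x - y) (x - y).

Lemma rsmooth_humpX s y n : rsmooth (fun x => hump s y x ^+ n).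
Proof.
have sh : rsmooth (hump s y).
  apply: rsmoothB; first exact: rsmooth_cst.
  apply: rsmoothM; first exact: rsmooth_cst.
  have sc i : rsmooth (fun x : E => (x - y) 0 i).
    have -> : (fun x : E => (x - y) 0 i) = fun x => x 0 i - y 0 i.
      by apply/funext => x; rewrite !mxE.
    by apply: rsmoothB; [exact: rsmooth_coord|exact: rsmooth_cst].
  by apply: (@rsmooth_sum R _ 'I_d _ (fun i x => (x - y) 0 i * (x - y) 0 i)) => i; exact: rsmoothM (sc i) (sc i).
elim: n => [|n IH]; first exact: rsmooth_cst.
have -> : (fun x => hump s y x ^+ n.+1) = fun x => hump s y x * hump s y x ^+ n.
  by apply/funext => x; rewrite exprS.
exact: rsmoothM.
Qed.

(* Multiplying by high powers of the hump concentrates the integral at y. *)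
Lemma hump_concentration (g : E -> R) (y : E) (M : R) : continuous g -> 0 < g y ->
  (forall x, M < `|x| -> g x = 0) ->
  exists s n, 0 < \int[muT d]_t (g (rowt t) * hump s y (rowt t) ^+ n).
Proof.
move=> cg gy gM.
have subE (u v : E) i : (u - v) 0 i = u 0 i - v 0 i by rewrite !mxE.
have [B B0 HB] := bounded_support_bound cg gM.
have yM : `|y| <= M by rewrite leNgt; apply/negP => /gM g0; move: gy; rewrite g0 ltxx.
have M0 : 0 <= M := le_trans (normr_ge0 _) yM.
pose e := g y / 2; have e0 : 0 < e by rewrite divr_gt0.
have : \forall x \near y, e < g x.
  have /cvgr_gt/(_ e) H := cg y.
  by apply: H; rewrite /e ltr_pdivrMr// mulr_natr mulr2n ltrDl.
move=> /nbhs_ballP[del' /= del0' Hdel'].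
pose del := Num.min del' 1.
have del0 : 0 < del by rewrite lt_min del0' ltr01.
have del1 : del <= 1 by rewrite ge_min lexx orbT.
have Hdel x : `|x - y| < del -> e < g x.
  move=> xy; apply: Hdel'; rewrite -ball_normE/= distrC.
  by apply: lt_le_trans xy _; rewrite ge_min lexx.
(* The first term bounds the squared Euclidean distance to [y] on the ball of radius M, so that s =
   1/L makes the hump nonnegative there; the summand 1 also gives s del^2 <= 1. *)
pose L := d%:R * (M + `|y|) ^+ 2 + 1.
have L1 : 1 <= L by rewrite lerDr mulr_ge0// sqr_ge0.
have L0 : 0 < L := lt_le_trans ltr01 L1.
pose s := L^-1; have s0 : 0 < s by rewrite invr_gt0.
pose r := del / (2 * d.+1%:R).
have r0 : 0 < r by rewrite divr_gt0// mulr_gt0.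
have rdel : d%:R * r ^+ 2 <= del ^+ 2 / 4.
  rewrite /r expr_div_n exprMn mulrA ler_pdivrMr ?mulr_gt0 ?exprn_gt0//.
  rewrite [leRHS](_ : _ = del ^+ 2 * d.+1%:R ^+ 2); last by field.
  rewrite mulrC ler_wpM2l ?sqr_ge0// -natrX ler_nat.
  by rewrite (leq_trans (leqnSn d))// leq_pmulr.
have rlt : r < del.
  rewrite /r ltr_pdivrMr ?mulr_gt0// ltr_pMr// -natrM ltr1n//.
  by rewrite mulnS.
(* The hump is at least [p1] on the box of half-side [r] around [y] and at most [p0] < [p1] at
   distance at least [del] from [y]. For large n the ratio of the n-th powers outweighs the
   constants. *)
pose p1 := 1 - s * (del ^+ 2 / 4); pose p0 := 1 - s * del ^+ 2.
have sd : s * del ^+ 2 <= 1.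
  rewrite /s mulrC ler_pdivrMr// mul1r (le_trans _ L1)//.
  by rewrite exprn_ile1// ltW.
have p00 : 0 <= p0 by rewrite subr_ge0.
have p01 : p0 < p1.
  rewrite ltrD2l ltrN2 ltr_pM2l// ltr_pdivrMr// ltr_pMr ?exprn_gt0//.
  by rewrite ltr1n.
have p10 : 0 < p1 := le_lt_trans p00 p01.
have [i1 V1] := integral_box_indic y r0.
have M1 : 0 < M + 1 by rewrite ltr_wpDl.
have [i2 V2] := integral_box_indic 0 M1.
set W1 := \int[_]_t _ in V1; set W2 := \int[_]_t _ in V2.
have [n Hn] : exists n, B * W2 * (p0 / p1) ^+ n < e * W1.
  have q1 : `|p0 / p1| < 1 by rewrite ger0_norm ?divr_ge0// ?ltr_pdivrMr ?mul1r// ltW.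
  have : B * W2 * (p0 / p1) ^+ n @[n --> \oo] --> B * W2 * 0.
    by apply: cvgMr; exact: cvg_expr.
  rewrite mulr0 => /cvgr_lt/(_ (e * W1)) H.
  have /H[N _ HN] : 0 < e * W1 by rewrite mulr_gt0.
  by exists N; exact: HN (leqnn N).
exists s, n.
have humpge x : `|x| <= M -> 0 <= hump s y x.
  move=> xM; rewrite subr_ge0 mulrC ler_pdivrMr// mul1r.
  apply: (@le_trans _ _ (d%:R * (M + `|y|) ^+ 2)); last by rewrite lerDl.
  rewrite -[d in d%:R]card_ord mulr_natl -sumr_const; apply: ler_sum => i _.
  rewrite -expr2 -real_normK ?num_real// ler_sqr ?nnegrE ?addr_ge0//.
  apply: le_trans (coord_le_norm _ _) _; apply: le_trans (ler_normB _ _) _.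
  by rewrite lerD2r.
have cint : (muT d).-integrable setT
    (EFin \o (fun t => g (rowt t) * hump s y (rowt t) ^+ n)).
  have ch : continuous (fun x => g x * hump s y x ^+ n).
    by move=> x; exact: cvgM (cg x) (rsmooth_continuous (rsmooth_humpX s y n) (x := x)).
  have [B' B'0 HB'] : exists2 B', 0 <= B' & forall x, `|g x * hump s y x ^+ n| <= B'.
    by apply: (@bounded_support_bound _ _ _ M) ch _ => x /gM ->; rewrite mul0r.
  apply: (@integrable_box _ _ _ B' M B'0).
  - exact: (measurable_rowt ch).
  - by move=> t; exact: HB'.
  - move=> t j tj; rewrite gM ?mul0r//; apply: lt_le_trans tj _.
    by have := coord_le_norm (rowt t) j; rewrite mxE.
apply: (@lt_le_trans _ _ (\int[muT d]_t
   (e * p1 ^+ n * box_indic y r (rowt t) - B * p0 ^+ n * box_indic 0 (M + 1) (rowt t)))).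
  rewrite RintegralB//; last 2 first.
    exact: (integrableZl measurableT (e * p1 ^+ n) i1).
    exact: (integrableZl measurableT (B * p0 ^+ n) i2).
  rewrite !RintegralZl// subr_gt0 -/W1 -/W2.
  have := Hn; rewrite expr_div_n mulrA ltr_pdivrMr ?exprn_gt0//.
  by rewrite mulrAC [ltRHS]mulrAC.
apply: le_Rintegral => //.
  exact: (integrableB measurableT (integrableZl measurableT (e * p1 ^+ n) i1)
    (integrableZl measurableT (B * p0 ^+ n) i2)).
move=> t _; set x := rowt t.
have b2 : `|x| <= M -> box_indic 0 (M + 1) x = 1.
  rewrite /box_indic => xM; case: asboolP => //; case => i.
  rewrite [(0 : E) 0 i]mxE subr0.
  by apply: le_trans (coord_le_norm _ _) _; rewrite (le_trans xM)// lerDl.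
have b2ge : 0 <= B * p0 ^+ n * box_indic 0 (M + 1) x.
  by rewrite !mulr_ge0// exprn_ge0.
have [xy|xy] := ltP `|x - y| del.
  have gx := Hdel _ xy.
  have xM : `|x| <= M.
    by rewrite leNgt; apply/negP => /gM g0; move: gx; rewrite g0 ltNge ltW.
  apply: (@le_trans _ _ (e * p1 ^+ n * box_indic y r x)); first by rewrite gerBl.
  rewrite /box_indic; case: asboolP => [H|_]; last first.
    by rewrite mulr0 mulr_ge0 ?exprn_ge0 ?humpge// ltW// (lt_trans e0).
  rewrite mulr1 ler_pM ?exprn_ge0 ?(ltW e0) ?(ltW p10) ?(ltW gx)//.
  apply: lerXn2r; rewrite ?nnegrE ?humpge ?(ltW p10)//.
  rewrite lerD2l lerN2 ler_pM2l//; apply: le_trans rdel.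
  rewrite -[d in d%:R]card_ord mulr_natl -sumr_const; apply: ler_sum => i _.
  rewrite subE.
  by rewrite -expr2 -real_normK ?num_real// ler_sqr ?nnegrE ?(ltW r0)//; exact: H.
have -> : box_indic y r x = 0.
  rewrite /box_indic; case: asboolP => // H; move: xy; rewrite leNgt => /negP[].
  apply: le_lt_trans rlt; apply: norm_le_coord => [|i]; first exact: ltW.
  by rewrite subE.
rewrite mulr0 sub0r.
have [xM|/gM ->] := leP `|x| M; last by rewrite mul0r oppr_le0.
rewrite b2// mulr1 lerNl; apply: le_trans (ler_norm _) _; rewrite normrN normrM.
rewrite ler_pM// normrX; apply: lerXn2r; rewrite ?nnegrE// ger0_norm ?humpge//.
rewrite lerD2l lerN2 ler_pM2l//.
apply: (@le_trans _ _ (`|x - y| ^+ 2)); first by rewrite ler_sqr ?nnegrE// ltW.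
rewrite -(@sqr_sqrtr _ (dotv _ _)) ?dotvv_ge0// ler_sqr ?nnegrE ?sqrtr_ge0//.
exact: norm_le_enorm.
Qed.

End concentration.

Section uniqueness.
Variables (R : realType) (d : nat).
Local Notation C := R[i].
Local Notation E := 'rV[R]_d.
Local Notation muT := (product_power (@lebesgue_measure R)).

Lemma cis_linear_bound (u : R) : cn (cis u - 1 - (0 +i* u)%C) <= 2 * u ^+ 2.
Proof.
have trig (f f' : R -> R) v : (forall t : R, is_derive t (1 : R) f (f' t)) ->
    (forall t, `|f' t| <= 1) -> `|f v - f 0| <= `|v|.
  by move=> df f1; have := mean_value_bound df (h := v) (fun t _ => f1 t); rewrite mul1r.
have s1 (v : R) : `|sin v| <= `|v|.
  have := trig _ _ v (@is_derive_sin R); rewrite sin0 subr0; apply=> t.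
  by rewrite ler_norml cos_geN1 cos_le1.
have c1 (v : R) : `|cos v - 1| <= `|v|.
  have := trig _ _ v (@is_derive_cos R); rewrite cos0; apply=> t.
  by rewrite normrN ler_norml sin_geN1 sin_le1.
have -> : cis u - 1 - (0 +i* u)%C = ((cos u - 1)%R +i* (sin u - u)%R)%C.
  by apply: eq_complex_parts => /=; ring.
apply: le_trans (cn_le _) _ => /=.
rewrite mulr_natl mulr2n -[u ^+ 2]ger0_norm ?sqr_ge0// normrX expr2; apply: lerD.
  have := @mean_value_bound R (@cos R) (fun t => - sin t) u `|u| (@is_derive_cos R).
  rewrite cos0; apply=> t tu; rewrite normrN; exact: le_trans (s1 t) tu.
have dsu (t : R) : is_derive t (1 : R) (fun t => sin t - t) (cos t - 1) by apply: is_deriveB.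
have := @mean_value_bound R _ _ u `|u| dsu.
by rewrite sin0 !subr0; apply=> t tu; exact: le_trans (c1 t) tu.
Qed.

Variables (D : set E) (a : E -> C) (U : set E).
Hypotheses (ta : test_function D a) (oU : open U).

Let plane (xi x : E) : C := cis (- dotv xi x).

Let smooth_plane xi : smooth (plane xi).
Proof. by apply: smooth_cis; apply: rsmoothN; exact: rsmooth_dotv. Qed.

Let moment (q : E -> R) xi :=
  cintegral (muT d) setT (fun t => a (rowt t) * ((q (rowt t))%:C%C * plane xi (rowt t))).

(** This class contains 1 by hypothesis and is stable under linear combinations and multiplication
    by coordinates, hence contains every polynomial, in particular the powers of the hump. *)
Let vanishing q := rsmooth q /\ forall xi, U xi -> moment q xi = 0.

Let integrable_moment q xi : rsmooth q ->
  cintegrable (muT d) (fun t => a (rowt t) * ((q (rowt t))%:C%C * plane xi (rowt t))).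
Proof.
move=> sq; apply: (cintegrable_test ta (g := fun x => (q x)%:C%C * plane xi x)).
exact: smoothM (smooth_real sq) (smooth_plane xi).
Qed.

Let vanishingD p q : vanishing p -> vanishing q -> vanishing (fun x => p x + q x).
Proof.
move=> [sp p0] [sq q0]; split=> [|xi Uxi]; first exact: rsmoothD.
rewrite /moment -[RHS]addr0 -{1}(p0 xi Uxi) -(q0 xi Uxi) -cintegralD; [|exact: integrable_moment..].
by apply: eq_cintegral => t; rewrite rmorphD/= mulrDl mulrDr.
Qed.

Let vanishingZ (s : R) q : vanishing q -> vanishing (fun x => s * q x).
Proof.
move=> [sq q0]; split=> [|xi Uxi]; first by apply: rsmoothM => //; exact: rsmooth_cst.
rewrite /moment -[RHS](mulr0 (s%:C)%C) -(q0 xi Uxi) -cintegralZ; last exact: integrable_moment.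
by apply: eq_cintegral => t; rewrite rmorphM/=; ring.
Qed.

(* Differentiating the vanishing integrals in the direction of the i-th
   coordinate of xi produces a factor x_i. *)
Let vanishing_coord i q : vanishing q -> vanishing (fun x => q x * x 0 i).
Proof.
move=> [sq q0]; have sqi : rsmooth (fun x : E => q x * x 0 i).
  by apply: rsmoothM => //; exact: rsmooth_coord.
split=> // xi Uxi.
have [M M0 aM] := test_function_support ta.
have iW : (muT d).-integrable setT (EFin \o (fun t => cn (a (rowt t) * (q (rowt t))%:C%C))).
  by apply: integrable_cn; exact: (cintegrable_test ta (smooth_real sq)).
set I0 := \int[muT d]_t cn (a (rowt t) * (q (rowt t))%:C%C).
have I00 : 0 <= I0 by apply: Rintegral_ge0 => t _; exact: cn_ge0.
have near0 : \forall h \near (0 : R), U (xi + h *: basis_vec R i).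
  have : (fun h : R => xi + h *: basis_vec R i) x @[x --> (0 : R)] --> xi + 0 *: basis_vec R i.
    by apply: cvgD; [exact: cvg_cst|apply: cvgZr_tmp; exact: cvg_id].
  rewrite scale0r addr0; apply; exact: open_nbhs_nbhs.
have [del /= del0 Hdel] : exists2 del : R, 0 < del & forall h, `|h| < del ->
    U (xi + h *: basis_vec R i).
  move: near0 => /nbhs_ballP[del /= del0 H]; exists del => // h hd; apply: H.
  by rewrite -ball_normE/= sub0r normrN.
set J := moment _ _.
(* The moments of [q] vanish at both frequencies, so h J is, up to a factor of modulus 1, only the
   integrated second-order Taylor error of exp(-i h x_i), which is O(h^2). Letting h tend to 0
   forces J = 0. *)
have Jh (h : R) : `|h| < del -> `|h| * cn J <= 4 * (M ^+ 2 * I0) * `|h| ^+ 2.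
  move=> hdel.
  have sxih := integrable_moment (xi + h *: basis_vec R i) sq.
  have sxi := integrable_moment xi sq.
  have sJ := cintegrableZ (0 +i* - h)%C (integrable_moment xi sqi).
  rewrite -(normrN h).
  have -> : `|- h| * cn J = cn ((0 +i* - h)%C * J).
    by rewrite cnM; congr (_ * _); rewrite cnE/= expr0n add0r sqrtr_sqr.
  have <- : - cintegral (muT d) setT (fun t =>
      a (rowt t) * ((q (rowt t))%:C%C * plane (xi + h *: basis_vec R i) (rowt t)) -
      a (rowt t) * ((q (rowt t))%:C%C * plane xi (rowt t)) -
      (0 +i* - h)%C * (a (rowt t) * ((q (rowt t) * rowt t 0 i)%:C%C * plane xi (rowt t)))) =
      (0 +i* - h)%C * J.
    rewrite cintegralB//; last first.
      have := cintegrableD sxih (cintegrableZ (-1) sxi).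
      by congr cintegrable; apply/funext => t; rewrite mulN1r.
    rewrite cintegralB// (cintegralZ _ (integrable_moment xi sqi)).
    have := q0 _ (Hdel _ hdel); have := q0 _ Uxi; rewrite /moment => -> ->.
    by rewrite subrr sub0r opprK.
  rewrite cnN.
  have -> : 4 * (M ^+ 2 * I0) * `|- h| ^+ 2 = 2 * (2 * `|h| ^+ 2 * M ^+ 2 * I0).
    by rewrite normrN; ring.
  rewrite /I0 -RintegralZl//; apply: cn_cintegral_le.
  - have := cintegrable_measurable (cintegrableD (cintegrableD sxih (cintegrableZ (-1) sxi))
      (cintegrableZ (-1) sJ)).
    by congr cmeasurable; apply/funext => t; rewrite !mulN1r.
  - exact: (integrableZl measurableT (2 * `|h| ^+ 2 * M ^+ 2) iW).
  - move=> t; set x := rowt t.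
    have [xM|/aM ->] := leP `|x| M; last by rewrite !mul0r mulr0 !subr0 cn0 mulr0.
    have -> : a x * ((q x)%:C%C * plane (xi + h *: basis_vec R i) x) -
        a x * ((q x)%:C%C * plane xi x) -
        (0 +i* - h)%C * (a x * ((q x * x 0 i)%:C%C * plane xi x)) =
      a x * (q x)%:C%C * plane xi x * (cis (- (h * x 0 i)) - 1 - (0 +i* - (h * x 0 i))%C).
      have -> : plane (xi + h *: basis_vec R i) x = plane xi x * cis (- (h * x 0 i)).
        rewrite /plane -cisD; congr cis; rewrite -opprD; congr (- _).
        rewrite dotvC; have -> : dotv x (xi + h *: basis_vec R i) = dotv x xi + h * x 0 i.
          rewrite /dotv (bigD1 i)//= [in RHS](bigD1 i)//= !mxE !eqxx/= mulr1 mulrDr.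
          rewrite -!addrA; congr (_ + _); rewrite [RHS]addrC mulrC; congr (_ + _).
          by apply: eq_bigr => j /negbTE ji; rewrite !mxE ji andbF mulr0 addr0.
        by rewrite dotvC.
      have -> : (0 +i* - (h * x 0 i))%C = (0 +i* - h)%C * (x 0 i)%:C%C :> C.
        by apply/eqP; rewrite eq_complex/=; apply/andP; split; apply/eqP; ring.
      by rewrite rmorphM/=; ring.
    rewrite cnM [cn (_ * plane xi x)]cnM /plane cn_cis mulr1 mulrC ler_wpM2r ?cn_ge0//.
    apply: le_trans (cis_linear_bound _) _; rewrite sqrrN exprMn -mulrA ler_wpM2l//.
    rewrite real_normK ?num_real// ler_wpM2l ?sqr_ge0// -real_normK ?num_real//.
    rewrite ler_sqr ?nnegrE//; exact: le_trans (coord_le_norm _ _) xM.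
apply/eqP; rewrite -[J == 0]negbK; apply/negP => J0.
have cJ : 0 < cn J.
  rewrite lt_neqAle cn_ge0 andbT eq_sym; apply: contra J0 => /eqP cJ.
  by rewrite -normr_eq0 normcE cJ.
set A := 4 * (M ^+ 2 * I0) in Jh.
have A0 : 0 <= A by rewrite !mulr_ge0// sqr_ge0.
pose h := Num.min (del / 2) (cn J / (A + 1)).
have h0 : 0 < h by rewrite lt_min !divr_gt0// ltr_wpDl.
have := Jh h; rewrite (gtr0_norm h0) => /(_ _)/wrap[|].
  rewrite /h gt_min; apply/orP; left; rewrite ltr_pdivrMr// mulr_natr mulr2n ltrDl//.
rewrite mulrC expr2 mulrA ler_pM2r// leNgt => /negP; apply.
apply: (@le_lt_trans _ _ (A * (cn J / (A + 1)))).
  by rewrite ler_wpM2l// ge_min lexx orbT.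
rewrite mulrA ltr_pdivrMr ?ltr_wpDl// mulrDr mulr1 mulrC ltrDl//.
Qed.

Lemma fourier_uniqueness : U !=set0 -> (forall xi, U xi -> fourier a xi = 0) -> a = fun=> 0.
Proof.
move=> [xi0 Uxi0] a0; apply/funext => y; apply/eqP; rewrite -[a y == 0]negbK; apply/negP => ay.
have v1 : vanishing (fun=> 1).
  split=> [|xi Uxi]; first exact: rsmooth_cst.
  rewrite /moment -(a0 xi Uxi) /fourier Rd_integralE; apply: eq_cintegral => t.
  by rewrite rmorph1 mul1r mulrC dotvC.
have vsum (I : Type) (r : seq I) (F : I -> E -> R) : (forall i, vanishing (F i)) ->
    vanishing (fun x => \sum_(i <- r) F i x).
  move=> vF; elim: r => [|i r IH].
    under eq_fun do rewrite big_nil; split=> [|xi _]; first exact: rsmooth_cst.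
    rewrite /moment; under eq_cintegral => t do rewrite rmorph0 mul0r mulr0.
    by apply: eq_complex_parts => /=; rewrite /Rintegral integral0.
  by under eq_fun do rewrite big_cons; exact: vanishingD.
have vhump s q : vanishing q -> vanishing (fun x => q x * hump s y x).
  move=> vq.
  have -> : (fun x => q x * hump s y x) = fun x => (1 - s * dotv y y) * q x +
      \sum_i (- s * (q x * x 0 i * x 0 i) + (s * (y 0 i) *+ 2) * (q x * x 0 i)).
    apply/funext => x; rewrite big_split/= -!mulr_sumr /hump.
    have -> : dotv (x - y) (x - y) = dotv x x - dotv x y *+ 2 + dotv y y.
      rewrite /dotv -sumrMnl -sumrB -big_split/=; apply: eq_bigr => i _.
      by rewrite !mxE; ring.
    have -> : \sum_i q x * x 0 i * x 0 i = q x * dotv x x.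
      by rewrite mulr_sumr; apply: eq_bigr => i _; rewrite mulrA.
    have -> : \sum_i s * y 0 i *+ 2 * (q x * x 0 i) = s * q x * dotv x y *+ 2.
      by rewrite mulr_sumr -sumrMnl; apply: eq_bigr => i _; ring.
    by ring.
  apply: vanishingD; first exact: vanishingZ.
  apply: vsum => i; apply: vanishingD; apply: vanishingZ; last exact: vanishing_coord.
  by apply: (vanishing_coord i (q := fun x => q x * x 0 i)); exact: vanishing_coord.
have vn s n : vanishing (fun x => hump s y x ^+ n).
  elim: n => [|n IH]; first exact: v1.
  by have := vhump s _ IH; congr vanishing; apply/funext => x; rewrite exprSr.
(* The constant factor turns the value at [y] into |a y|^2 > 0, so that the concentration argument
   can be applied to the real part. *)
pose b (x : E) : C := (a y * plane xi0 y)^* * (a x * plane xi0 x).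
have sb : smooth b.
  apply: smoothM; first exact: smooth_cst.
  by apply: smoothM; [case: ta|exact: smooth_plane].
have [cb _] := smooth_ccontinuous sb.
have [M _ aM] := test_function_support ta.
have [] := hump_concentration (y := y) (M := M) cb.
- rewrite /b mulrC ReM Re_conj Im_conj mulrN opprK -!expr2 -cn_sqr exprn_gt0//.
  rewrite cnM cn_cis mulr1 lt_neqAle cn_ge0 andbT eq_sym.
  by apply: contra ay => /eqP cy; rewrite -normr_eq0 normcE cy.
- by move=> x /aM ax; rewrite /b ax mul0r mulr0.
move=> s [n]; rewrite lt_neqAle => /andP[/eqP + _]; apply.
have [sn /(_ _ Uxi0) m0] := vn s n.
have := congr1 (fun z => complex.Re ((a y * plane xi0 y)^* * z)) m0.
rewrite mulr0 /moment -(cintegralZ _ (integrable_moment xi0 sn)).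
move=> /= <-; apply: eq_Rintegral => t _; rewrite /b.
rewrite [X in _ * (a (rowt t) * X)]mulrC [in LHS]mulrA [in LHS]mulrA -[_ * plane xi0 (rowt t)]mulrA.
by rewrite [LHS]ReM/= mulr0 subr0 mulrA.
Qed.

End uniqueness.

(** * Fourth moments of Gaussian variables *)

Section normal_moments.
Variables (R : realType) (m s : R).
Hypothesis s0 : 0 < s.
Local Notation mu := (@lebesgue_measure R).
Local Notation pdf := (normal_pdf m s).

Let sn0 : s != 0. Proof. by rewrite gt_eqF. Qed.

Lemma normal_pdf_continuous : continuous pdf.
Proof. exact: continuous_normal_pdf. Qed.

Let pdfE x : pdf x = normal_peak s * normal_fun m s x.
Proof. by rewrite normal_pdfE. Qed.

Lemma is_derive_normal_pdf (x : R) : is_derive x (1 : R) pdf (- ((x - m) / s ^+ 2) * pdf x).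
Proof.
rewrite pdfE (funext pdfE) /normal_fun.
have d1 : is_derive x (1 : R) (fun x : R => - (x - m) ^+ 2 / (s ^+ 2 *+ 2)) (- ((x - m) / s ^+ 2)).
  have d0 : is_derive x (1 : R) (fun x : R => x - m) 1.
    by apply: is_derive_eq; rewrite subr0.
  have -> : (fun x : R => - (x - m) ^+ 2 / (s ^+ 2 *+ 2)) =
      (fun x => - (s ^+ 2 *+ 2)^-1 * ((x - m) * (x - m))).
    by apply/funext => y; rewrite expr2; ring.
  have dF := is_deriveM (is_derive_cst (- (s ^+ 2 *+ 2)^-1) x (1 : R)) (is_deriveM d0 d0).
  apply: is_derive_eq dF _.
  rewrite scaler0 addr0 /GRing.scale/=; field; exact: sn0.
have d2 := is_derive1_comp (is_derive_expR _) d1.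
have d3 := is_deriveM (is_derive_cst (normal_peak s) x (1 : R)) d2.
apply: is_derive_eq d3 _.
by rewrite scaler0 addr0 /GRing.scale/=; ring.
Qed.

Definition moment_density k (x : R) : R := (x - m) ^+ k * pdf x.

(** From u^n <= n! exp(u) at u = (x - m)^2 / (2 s^2); a possibly odd power is reduced to even ones
    by |y|^k <= 1 + y^(2k). *)
Lemma moment_density_bound k : exists2 K, 0 <= K &
  forall x, `|moment_density k x| <= K * cauchy_kernel m x.
Proof.
pose c := s ^+ 2 *+ 2; have c0 : 0 < c by rewrite pmulrn_lgt0// exprn_gt0.
have p0 : 0 <= normal_peak s := normal_peak_ge0 s.
pose K0 n := n`!%:R * c ^+ n.
have B n x : (x - m) ^+ (2 * n) * pdf x <= K0 n * normal_peak s.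
  rewrite pdfE /normal_fun mulrCA mulrC ler_wpM2r//.
  have u0 : 0 <= (x - m) ^+ 2 / c by rewrite divr_ge0 ?sqr_ge0// ltW.
  have := expn_le_expR n u0; rewrite expr_div_n ler_pdivrMr ?exprn_gt0// => H.
  rewrite mulNr expRN ler_pdivrMr ?expR_gt0// exprM.
  by rewrite /K0 mulrAC; exact: H.
have K00 n : 0 <= K0 n * normal_peak s by rewrite !mulr_ge0 ?exprn_ge0 ?(ltW c0).
pose K := K0 0%N * normal_peak s + K0 1%N * normal_peak s +
  (K0 k * normal_peak s + K0 k.+1 * normal_peak s).
exists K => [|x]; first by rewrite !addr_ge0.
rewrite /cauchy_kernel ler_pdivlMr ?ltr_pwDl ?sqr_ge0//.
rewrite /moment_density normrM normrX (ger0_norm (normal_pdf_ge0 _ _ _)).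
set y := x - m; have yk : `|y| ^+ k <= 1 + y ^+ (2 * k).
  rewrite mulnC exprM -real_normK ?num_real// normrX.
  have := sqr_ge0 (`|y| ^+ k - 1); rewrite sqrrB1 => h.
  have : 0 <= `|y| ^+ k by exact: exprn_ge0.
  by nra.
have p0' : 0 <= pdf x := normal_pdf_ge0 _ _ _.
apply: (@le_trans _ _ ((1 + y ^+ (2 * k)) * pdf x * (1 + y ^+ 2))).
  rewrite ler_wpM2r ?addr_ge0 ?sqr_ge0//; exact: ler_wpM2r.
have b0 := B 0%N x; have b1 := B 1%N x; have bk := B k x; have bk1 := B k.+1 x.
rewrite -/y muln0 expr0 mul1r in b0.
rewrite -/y muln1 in b1; rewrite -/y in bk; rewrite -/y mulnS exprD in bk1.
rewrite /K; apply: (le_trans _ (lerD (lerD b0 b1) (lerD bk bk1))).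
by rewrite le_eqVlt; apply/orP; left; apply/eqP; ring.
Qed.

Lemma moment_density_continuous k : continuous (moment_density k).
Proof.
move=> x; apply: cvgM; last exact: normal_pdf_continuous.
apply: (@continuous_comp _ _ _ (fun x : R => x - m) (fun u => u ^+ k)); last exact: exprn_continuous.
by apply: cvgB; [exact: cvg_id|exact: cvg_cst].
Qed.

Lemma integrable_moment_density k : mu.-integrable setT (EFin \o moment_density k).
Proof.
have [K K0 HK] := moment_density_bound k.
have iK : mu.-integrable setT (EFin \o (fun x => K * cauchy_kernel m x)).
  exact: (integrableZl measurableT K (integrable_cauchy_kernel m)).
apply: (le_integrable measurableT _ _ iK).
  by apply/measurable_EFinP; apply: continuous_measurable_fun; exact: moment_density_continuous.
move=> x _ /=; rewrite lee_fin; apply: le_trans (HK x) _; exact: ler_norm.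
Qed.

Lemma cvg_cauchy_kernel_nat (F : R -> R) (K : R) : (forall x, `|F x| <= K * cauchy_kernel m x) ->
  F n%:R @[n --> \oo] --> (0 : R) /\ F (- n%:R) @[n --> \oo] --> (0 : R).
Proof.
move=> HF; have K0 : 0 <= K.
  have := le_trans (normr_ge0 _) (HF m).
  by rewrite /cauchy_kernel subrr expr0n addr0 invr1 mulr1.
have lim (y : nat -> R) : (forall n, `|y n| = n%:R) -> F (y n) @[n --> \oo] --> (0 : R).
  move=> yn; apply/cvgr0Pnorm_le => e e0.
  have e1 : 0 < e / (K + 1) by rewrite divr_gt0// ltr_wpDl.
  near=> n.
  apply: le_trans (HF _) _.
  have n1 : 2 * `|m| + (K + 1) / e <= n%:R by near: n; exact: nbhs_infty_ger.
  have Ke : 0 < (K + 1) / e by rewrite divr_gt0// ltr_wpDl.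
  have H : (K + 1) / e <= 1 + (y n - m) ^+ 2.
    have h1 : `|y n| - `|m| <= `|y n - m| by exact: lerB_dist.
    rewrite yn in h1.
    have h2 : 0 <= (`|y n - m| - 1) ^+ 2 by exact: sqr_ge0.
    rewrite -[(y n - m) ^+ 2]real_normK ?num_real//; rewrite sqrrB1 in h2.
    have := normr_ge0 m; lra.
  rewrite /cauchy_kernel ler_pdivrMr; last exact: lt_le_trans H.
  apply: (@le_trans _ _ (e * ((K + 1) / e))); last by rewrite ler_pM2l.
  by rewrite mulrCA divff ?gt_eqF// mulr1 lerDl.
by split; apply: lim => n; rewrite ?normrN ger0_norm.
Unshelve. all: by end_near. Qed.

(** Integration by parts: the derivative of the density is -(x - m) / s^2 times itself, so -s^2 (x -
    m)^(k+1) times the density is an antiderivative of the difference, and it vanishes at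
    infinity. *)
Lemma integral_moment_density_rec k :
  \int[mu]_x moment_density k.+2 x = k.+1%:R * s ^+ 2 * \int[mu]_x moment_density k x.
Proof.
have i0 := integrable_moment_density k; have i2 := integrable_moment_density k.+2.
apply/eqP; rewrite -subr_eq0 -RintegralZl// -RintegralB//; last first.
  exact: (integrableZl measurableT (k.+1%:R * s ^+ 2) i0).
apply/eqP; apply: (@Rintegral_FTC_T R (fun x => - s ^+ 2 * moment_density k.+1 x)
  (fun x => moment_density k.+2 x - k.+1%:R * s ^+ 2 * moment_density k x) 0).
- move=> x; rewrite /moment_density.
  have d0 : is_derive x (1 : R) (fun x : R => x - m) 1.
    by apply: is_derive_eq; rewrite subr0.
  have dk := is_deriveX k.+1 d0.
  have := is_deriveM (is_derive_cst (- s ^+ 2) x (1 : R))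
    (is_deriveM dk (is_derive_normal_pdf x)).
  have -> : (fun y => - s ^+ 2 * ((y - m) ^+ k.+1 * pdf y)) =
      cst (- s ^+ 2) * ((fun y => y - m) ^+ k.+1 * pdf).
    by apply/funext => y; rewrite !fctE.
  move=> dF; apply: is_derive_eq dF _.
  rewrite scaler0 addr0 !fctE /GRing.scale/= !exprS; field; exact: sn0.
- move=> x; apply: cvgB; first exact: moment_density_continuous.
  by apply: cvgM; [exact: cvg_cst|exact: moment_density_continuous].
- exact: (integrableB measurableT i2 (integrableZl measurableT (k.+1%:R * s ^+ 2) i0)).
- have [K K0 HK] := moment_density_bound k.+1.
  have [c1 c2] := cvg_cauchy_kernel_nat HK.
  rewrite -[X in _ --> X](subrr (- s ^+ 2 * 0)).
  by apply: cvgB; apply: cvgM => //; exact: cvg_cst.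
Qed.

Lemma integral_moment_density :
  [/\ \int[mu]_x moment_density 0 x = 1, \int[mu]_x moment_density 1 x = 0,
      \int[mu]_x moment_density 2 x = s ^+ 2 &
      \int[mu]_x moment_density 4 x = 3 * s ^+ 4].
Proof.
have e0 : \int[mu]_x moment_density 0 x = 1.
  rewrite /moment_density; under eq_Rintegral do rewrite expr0 mul1r.
  by rewrite /Rintegral integral_normal_pdf.
have e2 : \int[mu]_x moment_density 2 x = s ^+ 2.
  by rewrite integral_moment_density_rec e0 mulr1 mul1r.
split=> //; last by rewrite integral_moment_density_rec e2; ring.
apply: (@Rintegral_FTC_T R (fun x => - s ^+ 2 * moment_density 0 x) (moment_density 1) 0).
- move=> x; rewrite /moment_density.
  under [fun x => - s ^+ 2 * _]eq_fun do rewrite expr0 mul1r.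
  have dF := is_deriveM (is_derive_cst (- s ^+ 2) x (1 : R)) (is_derive_normal_pdf x).
  apply: is_derive_eq dF _.
  by rewrite scaler0 addr0 /GRing.scale/= expr1; field; exact: sn0.
- exact: moment_density_continuous.
- exact: integrable_moment_density.
- have [K K0 HK] := moment_density_bound 0.
  have [c1 c2] := cvg_cauchy_kernel_nat HK.
  rewrite -[X in _ --> X](subrr (- s ^+ 2 * 0)).
  by apply: cvgB; apply: cvgM => //; exact: cvg_cst.
Qed.

(** The change of measure formula involves a Radon-Nikodym derivative, which is identified almost
    everywhere with [normal_pdf] because both have the same integrals over measurable sets. *)
Lemma ge0_integral_normal_prob (g : R -> R) : measurable_fun setT g -> (forall x, 0 <= g x) ->
  (\int[normal_prob m s]_x (g x)%:E = \int[mu]_x (g x * pdf x)%:E)%E.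
Proof.
move=> mg g0; pose nu : {finite_measure set _ -> \bar R} := normal_prob m s.
have dom : nu `<< mu := normal_prob_dominates m s.
have mG : measurable_fun setT (EFin \o g) by exact/measurable_EFinP.
have := @Radon_Nikodym_SigmaFinite.change_of_variables _ _ _ nu mu dom (EFin \o g) setT.
move=> <- //; apply: ae_eq_integral => //.
- apply: emeasurable_funM => //; apply: measurable_int.
  exact: Radon_Nikodym_SigmaFinite.f_integrable.
- apply/measurable_EFinP; apply: measurable_funM => //; exact: measurable_normal_pdf.
- have fI := Radon_Nikodym_SigmaFinite.f_integrable dom.
  have mp : measurable_fun setT (EFin \o pdf).
    by apply/measurable_EFinP; exact: measurable_normal_pdf.
  have := integral_ae_eq measurableT fI mp.
  move=> /(_ _)/wrap[E _ mE|]; first by rewrite -Radon_Nikodym_SigmaFinite.f_integral.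
  by apply: filterS => x /= H _; rewrite EFinM -H.
Qed.

End normal_moments.

Section gaussian_moments.
Context (R : realType) (disp : measure_display) (T : measurableType disp).
Variable P : probability T R.
Implicit Types X Y : T -> R.
Local Notation mu := (@lebesgue_measure R).

Definition normal_law X m s := forall A : set R, measurable A -> P (X @^-1` A) = normal_prob m s A.

Lemma normal_law_integral X m s (g : R -> R) : measurable_fun setT X -> 0 < s ->
  normal_law X m s -> measurable_fun setT g ->
  mu.-integrable setT (EFin \o (fun x => g x * normal_pdf m s x)) ->
  P.-integrable setT (EFin \o (g \o X)) /\
  \int[P]_w g (X w) = \int[mu]_x (g x * normal_pdf m s x).
Proof.
move=> mX s0 lX mg ig.
have E (h : R -> R) : measurable_fun setT h -> (forall x, 0 <= h x) ->
    (\int[P]_w (h (X w))%:E = \int[mu]_x (h x * normal_pdf m s x)%:E)%E.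
  move=> mh h0; rewrite -ge0_integral_normal_prob//.
  transitivity (\int[pushforward P (X : T -> measurableTypeR R)]_x (h x)%:E)%E.
    rewrite ge0_integral_pushforward//; first exact/measurable_EFinP.
    by move=> y _; rewrite lee_fin.
  by apply: eq_measure_integral => A mA _; exact: lX.
have mna : measurable_fun setT (fun x => `|g x|) by exact: measurableT_comp.
have iabs : mu.-integrable setT (EFin \o (fun x => `|g x| * normal_pdf m s x)).
  have := integrable_norm ig; congr integrable; apply/funext => x /=.
  by rewrite normrM (ger0_norm (normal_pdf_ge0 _ _ _)).
have ne : (\int[P]_w `|(g (X w))%:E| = \int[mu]_x (`|g x| * normal_pdf m s x)%:E)%E.
  by rewrite -(E _ mna).
have mgX : measurable_fun setT (g \o X) by exact: measurableT_comp.
have iX : P.-integrable setT (EFin \o (g \o X)).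
  apply/integrableP; split; first exact/measurable_EFinP.
  have E2 : (\int[mu]_x `|(EFin \o (fun x => `|g x| * normal_pdf m s x)%R) x| =
      \int[mu]_x (`|g x| * normal_pdf m s x)%:E)%E.
    by apply: eq_integral => x _ /=; rewrite ger0_norm// mulr_ge0// normal_pdf_ge0.
  by rewrite ne -E2; exact: (integrableP _ _ _ iabs).2.
split=> //.
have iXn := integrable_norm iX.
(* As g = (|g| + g) - |g| is a difference of nonnegative functions, the identity [E] for nonnegative
   functions applies to both terms. *)
have -> : \int[P]_w g (X w) = \int[P]_w (`|g (X w)| + g (X w)) - \int[P]_w `|g (X w)|.
  by rewrite RintegralD// addrAC subrr add0r.
have e1 : \int[P]_w `|g (X w)| = \int[mu]_x (`|g x| * normal_pdf m s x).
  by rewrite /Rintegral (E (fun x => `|g x|)).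
have e2 : \int[P]_w (`|g (X w)| + g (X w)) = \int[mu]_x ((`|g x| + g x) * normal_pdf m s x).
  rewrite /Rintegral (E (fun x => `|g x| + g x))//; first exact: measurable_funD.
  by move=> x; have := ler_norm (- g x); rewrite normrN; lra.
rewrite e1 e2; under eq_Rintegral do rewrite mulrDl.
by rewrite RintegralD// addrAC subrr add0r.
Qed.

(** For a nondegenerate law the vanishing expectation forces m = 0, and the moments are those of the
    density. A degenerate law is almost surely the constant 0. *)
Lemma centered_gaussian_fourth_moment X : gaussian_rv P X -> \int[P]_w X w = 0 ->
  P.-integrable setT (EFin \o (fun w => X w ^+ 4)) /\
  \int[P]_w (X w ^+ 4) = 3 * (\int[P]_w (X w ^+ 2)) ^+ 2.
Proof.
move=> [mX [[m [s [s0 lX]]]|[m Xm]]] EX.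
- have [i0 i1 i2 i4] := integral_moment_density m s0.
  have j k := integrable_moment_density m s0 k.
  have m0 : m = 0.
    have i01 : mu.-integrable setT (EFin \o (fun x => x * normal_pdf m s x)).
      have := integrableD measurableT (j 1%N) (integrableZl measurableT m (j 0%N)).
      congr integrable; apply/funext => x /=; rewrite -EFinM -EFinD; congr EFin.
      by rewrite /moment_density expr0 expr1; ring.
    have [_] := @normal_law_integral X m s (fun x => x) mX s0 lX (@measurable_id _ _ setT) i01.
    rewrite EX => ->.
    transitivity (\int[mu]_x (moment_density m s 1 x + m * moment_density m s 0 x)).
      rewrite (RintegralD measurableT (j 1%N) (integrableZl measurableT m (j 0%N))).
      by rewrite RintegralZl ?(j 0%N)// i0 i1 add0r mulr1.
    by apply: eq_Rintegral => x _; rewrite /moment_density expr0 expr1; ring.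
  subst m.
  have mk k : measurable_fun setT (fun x : R => x ^+ k) by exact: measurable_funX.
  have jk k : mu.-integrable setT (EFin \o (fun x => x ^+ k * normal_pdf 0 s x)).
    by have := j k; congr integrable; apply/funext => x /=; rewrite /moment_density subr0.
  have e k : \int[mu]_x (x ^+ k * normal_pdf 0 s x) = \int[mu]_x moment_density 0 s k x.
    by apply: eq_Rintegral => x _; rewrite /moment_density subr0.
  have [h4 ->] := normal_law_integral mX s0 lX (mk 4%N) (jk 4%N).
  have [_ ->] := normal_law_integral mX s0 lX (mk 2%N) (jk 2%N).
  by split=> //; rewrite !e i4 i2; ring.
- have ae k : ae_eq P setT (EFin \o (fun w => X w ^+ k)) (cst (m ^+ k)%:E).
    by apply: filterS Xm => w /= -> _.
  have mk k : measurable_fun setT (EFin \o (fun w => X w ^+ k)).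
    by apply/measurable_EFinP; exact: measurable_funX.
  have e k : \int[P]_w (X w ^+ k) = m ^+ k.
    transitivity (fine (\int[P]_w cst (m ^+ k)%:E w)%E).
      by congr fine; apply: ae_eq_integral => //; [exact: mk|exact: ae].
    by rewrite integral_cst//= probability_setT mule1.
  have m0 : m = 0.
    by rewrite -[m]expr1 -e -[RHS]EX; apply: eq_Rintegral => w _; rewrite expr1.
  split; last by rewrite !e m0 !expr0n/= mulr0.
  have i1 : P.-integrable setT (cst (m ^+ 4)%:E).
    exact: finite_measure_integrable_cst.
  apply/integrableP; split; first exact: mk.
  rewrite (_ : (\int[P]_w _ = \int[P]_w `|cst (m ^+ 4)%:E w|)%E); first exact: (integrableP _ _ _ i1).2.
  apply: ae_eq_integral => //; last exact: ae_eq_abse (ae 4%N).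
  by apply: measurableT_comp => //; exact: mk.
Qed.

(** All products integrated below are at most quartic in the field; on a probability space this
    condition makes every one of them integrable. *)
Definition L4 X := measurable_fun setT X /\ P.-integrable setT (EFin \o (fun w => X w ^+ 4)).

Lemma L4_integrable (Z : T -> R) X Y (K : R) : L4 X -> L4 Y -> measurable_fun setT Z ->
  (forall w, `|Z w| <= K * (1 + X w ^+ 4 + Y w ^+ 4)) -> P.-integrable setT (EFin \o Z).
Proof.
move=> [mX iX] [mY iY] mZ ZK.
have iK : P.-integrable setT (EFin \o (fun w => K * (1 + X w ^+ 4 + Y w ^+ 4))).
  have i1 : P.-integrable setT (EFin \o cst (1 : R)).
    exact: (finite_measure_integrable_cst P (1 : R)).
  exact: (integrableZl measurableT K (integrableD measurableT (integrableD measurableT i1 iX) iY)).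
apply: (le_integrable measurableT _ _ iK); first exact/measurable_EFinP.
by move=> w _ /=; rewrite lee_fin; apply: le_trans (ZK w) _; exact: ler_norm.
Qed.

Lemma L4_integrableM X Y : L4 X -> L4 Y -> P.-integrable setT (EFin \o (fun w => X w * Y w)).
Proof.
move=> lX lY; apply: (L4_integrable lX lY (K := 1)) => [|w].
  by apply: measurable_funM; [case: lX|case: lY].
rewrite mul1r normrM.
have h1 := sqr_ge0 (`|X w| - `|Y w|).
have h2 := sqr_ge0 (X w ^+ 2 - 1); have h3 := sqr_ge0 (Y w ^+ 2 - 1).
have e1 : `|X w| ^+ 2 = X w ^+ 2 by rewrite real_normK ?num_real.
have e2 : `|Y w| ^+ 2 = Y w ^+ 2 by rewrite real_normK ?num_real.
by nra.
Qed.

Lemma L4_integrable_sqr X : L4 X -> P.-integrable setT (EFin \o (fun w => X w ^+ 2)).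
Proof.
by move=> lX; have := L4_integrableM lX lX; congr integrable; apply/funext => w /=; rewrite expr2.
Qed.

Lemma L4_integrable_sqrM X Y : L4 X -> L4 Y ->
  P.-integrable setT (EFin \o (fun w => X w ^+ 2 * Y w ^+ 2)).
Proof.
move=> lX lY; apply: (L4_integrable lX lY (K := 1)) => [|w].
  by apply: measurable_funM; apply: measurable_funX; [case: lX|case: lY].
have X0 := sqr_ge0 (X w); have Y0 := sqr_ge0 (Y w).
rewrite mul1r ger0_norm; last exact: mulr_ge0.
by have := sqr_ge0 (X w ^+ 2 - Y w ^+ 2); nra.
Qed.

(** Isserlis' formula, read off from (X + Y)^4 + (X - Y)^4 = 2 X^4 + 12 X^2 Y^2 + 2 Y^4 and E[Z^4] =
    3 E[Z^2]^2 for Z = X, Y, X + Y and X - Y. Only the laws of real linear combinations are used. *)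
Lemma gaussian_square_covariance X Y :
  (forall a b : R, gaussian_rv P (fun w => a * X w + b * Y w) /\
     \int[P]_w (a * X w + b * Y w) = 0) ->
  \int[P]_w (X w ^+ 2 * Y w ^+ 2) =
  \int[P]_w (X w ^+ 2) * \int[P]_w (Y w ^+ 2) + 2 * (\int[P]_w (X w * Y w)) ^+ 2.
Proof.
move=> H.
have M (a b : R) := let: conj g e := H a b in centered_gaussian_fourth_moment g e.
have L (a b : R) : L4 (fun w => a * X w + b * Y w).
  by split; [have [[]] := H a b|have [] := M a b].
have lX : L4 X.
  by have := L 1 0; congr L4; apply/funext => w; rewrite mul1r mul0r addr0.
have lY : L4 Y.
  by have := L 0 1; congr L4; apply/funext => w; rewrite mul1r mul0r add0r.
have iX2 := L4_integrable_sqr lX; have iY2 := L4_integrable_sqr lY.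
have iXY := L4_integrableM lX lY; have iX2Y2 := L4_integrable_sqrM lX lY.
have [_ iX4] := lX; have [_ iY4] := lY.
set A := \int[P]_w X w ^+ 2; set B := \int[P]_w Y w ^+ 2; set D := \int[P]_w (X w * Y w).
have second (e : R) : e ^+ 2 = 1 -> \int[P]_w (1 * X w + e * Y w) ^+ 2 = A + (2 * e) * D + B.
  move=> e2; transitivity (\int[P]_w (X w ^+ 2 + (2 * e) * (X w * Y w) + Y w ^+ 2)).
    apply: eq_Rintegral => w _.
    have -> : Y w ^+ 2 = e ^+ 2 * Y w ^+ 2 by rewrite e2 mul1r.
    by ring.
  have iZ := integrableZl measurableT (2 * e) iXY.
  by rewrite !RintegralD ?RintegralZl//; exact: (integrableD measurableT iX2 iZ).
have X4 : \int[P]_w (X w ^+ 4) = 3 * A ^+ 2.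
  have [_] := M 1 0; under eq_Rintegral do rewrite mul1r mul0r addr0.
  by under [in X in _ = X]eq_Rintegral do rewrite mul1r mul0r addr0.
have Y4 : \int[P]_w (Y w ^+ 4) = 3 * B ^+ 2.
  have [_] := M 0 1; under eq_Rintegral do rewrite mul1r mul0r add0r.
  by under [in X in _ = X]eq_Rintegral do rewrite mul1r mul0r add0r.
have [ip p4] := M 1 1; have [iq q4] := M 1 (-1).
have sum4 : \int[P]_w (1 * X w + 1 * Y w) ^+ 4 + \int[P]_w (1 * X w + -1 * Y w) ^+ 4 =
    2 * (3 * A ^+ 2) + 12 * \int[P]_w (X w ^+ 2 * Y w ^+ 2) + 2 * (3 * B ^+ 2).
  rewrite -RintegralD// -X4 -Y4.
  transitivity (\int[P]_w (2 * X w ^+ 4 + 12 * (X w ^+ 2 * Y w ^+ 2) + 2 * Y w ^+ 4)).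
    by apply: eq_Rintegral => w _; ring.
  have z1 := integrableZl measurableT 2 iX4; have z2 := integrableZl measurableT 12 iX2Y2.
  have z3 := integrableZl measurableT 2 iY4.
  by rewrite !RintegralD ?RintegralZl//; exact: (integrableD measurableT z1 z2).
rewrite p4 q4 second ?expr1n// second ?sqrrN ?expr1n// in sum4.
move: sum4; set W := \int[P]_w _; clearbody A B D W => h.
have : 12 * W = 12 * (A * B + 2 * D ^+ 2) by move: h; nra.
by move/(mulfI _) => -> //; rewrite pnatr_eq0.
Qed.

End gaussian_moments.

(** * A law of large numbers for Gaussian processes *)

Section second_moment.
Context (R : realType) (disp : measure_display) (T : measurableType disp).
Variable P : probability T R.
Local Notation mu := (@lebesgue_measure R).
Local Notation RR := (measurableTypeR R).
Variables (F : T -> R -> R) (I : R -> R) (M : R).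
Hypothesis mF : measurable_fun setT (fun p : T * RR => F p.1 p.2).
Hypotheses (iI : mu.-integrable setT (EFin \o I)) (I0 : forall r, 0 <= I r)
  (II : forall r, I r * I r = I r) (FI : forall w r, F w r = F w r * I r).
Hypothesis (L0 : 0 < \int[mu]_r I r).
Hypotheses (iF2P : forall r, P.-integrable setT (EFin \o (fun w => F w r ^+ 2)))
  (FM : forall r, \int[P]_w (F w r ^+ 2) <= M * I r)
  (iF2 : forall w, mu.-integrable setT (EFin \o (fun r : RR => F w r ^+ 2))).

Let m2 := (P \x mu)%E.

(** [I] behaves as the indicator of a set of finite measure outside which [F] vanishes; 2 |F| <= F^2
    + I then turns the square integrability of [F] into integrability. *)
Let am_gm (a b i : R) : 0 <= i -> i * i = i -> `|a * (b * i)| <= 2^-1 * (a ^+ 2 * i + b ^+ 2 * i).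
Proof.
move=> i0 ii; rewrite !normrM (ger0_norm i0) -mulrDl [leRHS]mulrA [leLHS]mulrA ler_wpM2r//.
rewrite -(real_normK (num_real a)) -(real_normK (num_real b)).
by have := sqr_ge0 (`|a| - `|b|); nra.
Qed.

Let mF2 : measurable_fun setT (fun p : T * RR => F p.1 p.2 ^+ 2).
Proof. exact: measurable_funX. Qed.

Let mFw w : measurable_fun setT (F w : RR -> R).
Proof. exact: (measurableT_comp mF (@measurable_pair1 _ _ _ _ w)). Qed.

Let mFr r : measurable_fun setT (F ^~ r).
Proof. exact: (measurableT_comp mF (@measurable_pair2 _ _ _ _ r)). Qed.

Let iF2m : m2.-integrable setT (EFin \o (fun p => F p.1 p.2 ^+ 2)).
Proof.
have mE : measurable_fun setT (EFin \o (fun p : T * RR => F p.1 p.2 ^+ 2)) by exact/measurable_EFinP.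
have [_ H] := @integrable21ltyP _ _ _ _ R P mu _ mE; apply: H => /=.
apply: (@le_lt_trans _ _ (\int[mu]_r (M * I r)%:E)%E); last first.
  have := (integrableP _ _ _ (integrableZl measurableT M iI)).2.
  apply: le_lt_trans; apply: le_trans (lee_abs _) _.
  apply: (le_abse_integral (f := fun r => (M * I r)%:E) mu measurableT).
  exact: measurable_int (integrableZl measurableT M iI).
apply: ge0_le_integral => //.
- by move=> r _; exact: integral_ge0.
- apply: (measurable_fun_fubini_tonelli_G (m1 := P) (fun p : T * RR => `|F p.1 p.2 ^+ 2|%:E)) => //.
  by apply/measurable_EFinP; exact: measurableT_comp.
- exact: measurable_int (integrableZl measurableT M iI).
- move=> r _; apply: (@le_trans _ _ (\int[P]_w (F w r ^+ 2))%:E); last by rewrite lee_fin; exact: FM.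
  have E : (\int[P]_w (F w r ^+ 2)%:E)%E \is a fin_num := integrable_fin_num measurableT (iF2P r).
  rewrite /Rintegral fineK//.
  rewrite le_eqVlt; apply/orP; left; apply/eqP; apply: eq_integral => w _.
  by rewrite ger0_norm// sqr_ge0.
Qed.

Let iP1 : P.-integrable setT (EFin \o (fun=> 1 : R)).
Proof. exact: (finite_measure_integrable_cst P (1 : R)). Qed.

Let iIm : m2.-integrable setT (EFin \o (fun p => I p.2)).
Proof.
by have := integrable_tensor iP1 iI; congr integrable; apply/funext => p /=; rewrite mul1r.
Qed.

Let iFm : m2.-integrable setT (EFin \o (fun p => F p.1 p.2)).
Proof.
apply: (le_integrable measurableT _ _ (integrableZl measurableT 2^-1 (integrableD measurableT iIm iF2m))).
  exact/measurable_EFinP.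
move=> [w r] _ /=; rewrite lee_fin [X in `|X|]FI -[F w r * I r]mul1r.
apply: le_trans (am_gm _ _ (I0 r) (II r)) _; apply: le_trans (ler_norm _) => /=.
rewrite expr1n mul1r [in leRHS]FI exprMn [I r ^+ 2]expr2 II//.
Qed.

Let iF w : mu.-integrable setT (EFin \o (F w : RR -> R)).
Proof.
apply: (le_integrable measurableT _ _ (integrableZl measurableT 2^-1 (integrableD measurableT iI (iF2 w)))).
  exact/measurable_EFinP.
move=> r _ /=; rewrite lee_fin [X in `|X|]FI -[F w r * I r]mul1r.
apply: le_trans (am_gm _ _ (I0 r) (II r)) _; apply: le_trans (ler_norm _) => /=.
rewrite expr1n mul1r [in leRHS]FI exprMn [I r ^+ 2]expr2 II//.
Qed.

Let S w := \int[mu]_r F w r.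
Let q w := \int[mu]_r (F w r ^+ 2).
Let L := \int[mu]_r I r.

Let mS : measurable_fun setT S.
Proof. exact: (measurable_Rintegral_param iFm). Qed.

Let iq : P.-integrable setT (EFin \o q).
Proof.
have := integrable_fubini_F iF2m; congr integrable; apply/funext => w /=.
have E : (\int[mu]_r (F w r ^+ 2)%:E)%E \is a fin_num := integrable_fin_num measurableT (iF2 w).
by rewrite /q /Rintegral fineK.
Qed.

(* Cauchy-Schwarz, as the nonnegativity of the integral of (L F - S I)^2. *)
Let S2q w : S w ^+ 2 <= L * q w.
Proof.
have : 0 <= \int[mu]_r ((L * F w r - S w * I r) ^+ 2) by apply: Rintegral_ge0 => r _; exact: sqr_ge0.
have -> : \int[mu]_r ((L * F w r - S w * I r) ^+ 2) =
    \int[mu]_r (L ^+ 2 * F w r ^+ 2 + (- (2 * L * S w)) * F w r + S w ^+ 2 * I r).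
  apply: eq_Rintegral => r _; rewrite -[in RHS](II r) [in X in _ + X + _]FI; ring.
have z1 := integrableZl measurableT (L ^+ 2) (iF2 w).
have z2 := integrableZl measurableT (- (2 * L * S w)) (iF w).
have z3 := integrableZl measurableT (S w ^+ 2) iI.
rewrite (RintegralD measurableT (integrableD measurableT z1 z2) z3).
rewrite (RintegralD measurableT z1 z2) !RintegralZl// -/(S w) -/(q w) -/L.
have -> : L ^+ 2 * q w + - (2 * L * S w) * S w + S w ^+ 2 * L = L * (L * q w - S w ^+ 2) by ring.
by rewrite pmulr_rge0// subr_ge0.
Qed.

Lemma integrable_square_integral : P.-integrable setT (EFin \o (fun w => S w ^+ 2)).
Proof.
apply: (le_integrable measurableT _ _ (integrableZl measurableT L iq)).
  by apply/measurable_EFinP; exact: measurable_funX.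
move=> w _ /=; rewrite lee_fin ger0_norm ?sqr_ge0//.
by apply: le_trans (S2q w) _; exact: ler_norm.
Qed.

Let iS2 := integrable_square_integral.

Let iP_le (f g : T -> R) : measurable_fun setT f -> measurable_fun setT g ->
  P.-integrable setT (EFin \o (fun w => f w ^+ 2)) ->
  P.-integrable setT (EFin \o (fun w => g w ^+ 2)) ->
  P.-integrable setT (EFin \o (fun w => f w * g w)).
Proof.
move=> mf mg i1 i2.
apply: (le_integrable measurableT _ _ (integrableZl measurableT 2^-1 (integrableD measurableT i1 i2))).
  by apply/measurable_EFinP; exact: measurable_funM.
move=> w _ /=; rewrite lee_fin -[g w]mulr1.
apply: le_trans (am_gm _ _ ler01 (mulr1 1)) _; apply: le_trans (ler_norm _) => /=.
by rewrite !mulr1.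
Qed.

Let im2_le (f : T -> R) : measurable_fun setT f ->
  P.-integrable setT (EFin \o (fun w => f w ^+ 2)) ->
  m2.-integrable setT (EFin \o (fun p => f p.1 * F p.1 p.2)).
Proof.
move=> mf i1; have i1I := integrable_tensor i1 iI.
apply: (le_integrable measurableT _ _ (integrableZl measurableT 2^-1 (integrableD measurableT i1I iF2m))).
  apply/measurable_EFinP; apply: measurable_funM => //.
  exact: (measurableT_comp mf measurable_fst).
move=> [w r] _ /=; rewrite lee_fin [X in _ * X]FI.
apply: le_trans (am_gm _ _ (I0 r) (II r)) _; apply: le_trans (ler_norm _) => /=.
by rewrite [F w r in leRHS]FI exprMn [I r ^+ 2]expr2 II.
Qed.

Let swap (f : T -> R) : measurable_fun setT f ->
  P.-integrable setT (EFin \o (fun w => f w ^+ 2)) ->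
  \int[P]_w (f w * S w) = \int[mu]_r \int[P]_w (f w * F w r) /\
  measurable_fun setT (fun r : RR => \int[P]_w (f w * F w r)).
Proof.
move=> mf i1; have iH := im2_le mf i1; split; last first.
  by apply: measurableT_comp => //; exact: (measurable_fubini_G iH).
have := Rintegral_fubini_swap iH.
move=> /(_ _ _)/wrap[w|r|]; first exact: (integrableZl measurableT (f w) (iF w)).
  exact: (iP_le mf (mFr r) i1 (iF2P r)).
move=> <-; apply: eq_Rintegral => w _.
by rewrite (RintegralZl (f w) measurableT (iF w)).
Qed.

(** Two exchanges of integrals turn the second moment of the integral into the double integral of
    E[F(r') F(r)], which is then bounded one variable at a time, by [g] and by [h]. *)
Lemma second_moment_bound (g : R -> R -> R) (h : R -> R) :
  (forall r r', 0 <= \int[P]_w (F w r' * F w r) <= g r' r) ->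
  (forall r', mu.-integrable setT (EFin \o g r')) ->
  (forall r', \int[mu]_r g r' r <= h r') ->
  mu.-integrable setT (EFin \o h) -> \int[P]_w (S w ^+ 2) <= \int[mu]_r h r.
Proof.
move=> Fg ig gh ih.
have -> : \int[P]_w (S w ^+ 2) = \int[mu]_r' \int[P]_w (S w * F w r').
  by rewrite -(swap mS iS2).1; apply: eq_Rintegral => w _; rewrite expr2.
have le_int (f k : R -> R) : measurable_fun setT (f : RR -> R) ->
    mu.-integrable setT (EFin \o k) -> (forall r, 0 <= f r <= k r) ->
    mu.-integrable setT (EFin \o f).
  move=> mf ik fk; apply: (le_integrable measurableT _ _ ik); first exact/measurable_EFinP.
  move=> r _ /=; rewrite lee_fin; have /andP[f0 fkr] := fk r.
  by rewrite ger0_norm// (le_trans fkr)// ler_norm.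
have E r' : \int[P]_w (S w * F w r') = \int[mu]_r \int[P]_w (F w r' * F w r).
  by rewrite -(swap (mFr r') (iF2P r')).1; apply: eq_Rintegral => w _; rewrite mulrC.
have i1 r' := le_int _ _ (swap (mFr r') (iF2P r')).2 (ig r') (fun r => Fg r r').
have B r' : 0 <= \int[P]_w (S w * F w r') <= h r'.
  rewrite E; apply/andP; split.
    by apply: Rintegral_ge0 => r _; have /andP[] := Fg r r'.
  apply: le_trans (gh r'); apply: le_Rintegral => // r _.
  by have /andP[] := Fg r r'.
apply: le_Rintegral => //; last by move=> r _; have /andP[] := B r.
exact: (le_int _ _ (swap mS iS2).2 ih B).
Qed.

End second_moment.

Section sandwich.
Variable R : realType.

(* A function whose increments are bounded below linearly is o(Q) as soon as it
   is o(Q) along the squares. *)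
Lemma cvg_mean_squares (s : R -> R) (V : R) : 0 <= V ->
  (forall a b, 1 <= a -> a <= b -> - (V * (b - a)) <= s b - s a) ->
  s (n.+2%:R ^+ 2) / n.+2%:R ^+ 2 @[n --> \oo] --> (0 : R) ->
  s Q / Q @[Q --> +oo] --> (0 : R).
Proof.
move=> V0 ds sn; apply/cvgr0Pnorm_le => e e0.
(* One eighth because (x + 1)^2 <= 4 x^2 for x >= 1: the error at either neighbouring square is then
   at most (e/2) x^2. *)
pose del := e / 8; have del0 : 0 < del by rewrite divr_gt0.
have /cvgr0Pnorm_le/(_ _ del0)[n0 _ Hn0] := sn.
(* Beyond this index the possible drift V (2x + 1) between the squares x^2 and (x + 1)^2 is at most
   (e/2) x^2. *)
pose n1 := Num.truncn (6 * V / e).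
near=> Q.
have Q4 : (n0 + n1).+3%:R ^+ 2 <= Q by near: Q; apply: nbhs_pinfty_ge; exact: num_real.
have Q0 : 0 < Q by apply: lt_le_trans Q4; rewrite exprn_gt0.
pose k := Num.truncn (Num.sqrt Q).
have sQ : (n0 + n1).+3%:R <= Num.sqrt Q.
  by rewrite -ler_sqr ?nnegrE ?sqrtr_ge0// sqr_sqrtr ?(ltW Q0).
have /andP[k1 k2] : k%:R <= Num.sqrt Q < k.+1%:R by apply: truncn_itv; exact: sqrtr_ge0.
have kn : ((n0 + n1).+2 < k)%N.
  by rewrite -ltnS -(ltr_nat R); exact: le_lt_trans sQ k2.
pose n := k.-2; have kE : k = n.+2 by rewrite /n; case: k kn {k1 k2 n} => [|[|k]].
rewrite kE in k1 k2 kn.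
have Qlo : n.+2%:R ^+ 2 <= Q.
  by rewrite -[leRHS](sqr_sqrtr (ltW Q0)) ler_sqr ?nnegrE ?sqrtr_ge0.
have Qhi : Q <= n.+3%:R ^+ 2.
  by rewrite -[leLHS](sqr_sqrtr (ltW Q0)) ler_sqr ?nnegrE ?sqrtr_ge0// ltW.
have n2 : 1 <= n.+2%:R ^+ 2 :> R by rewrite expr_ge1// ler1n.
have h1 := ds _ _ n2 Qlo.
have h2 := ds _ _ (le_trans n2 Qlo) Qhi.
have nn0 : (n0 <= n)%N by move: kn; rewrite !ltnS => /ltnW/(leq_trans (leq_addr n1 n0)).
have := Hn0 _ nn0; rewrite normrM normfV [`|_ ^+ 2|]ger0_norm ?exprn_ge0// ler_pdivrMr ?exprn_gt0// => a1.
have := Hn0 n.+1 (leqW nn0); rewrite normrM normfV [`|_ ^+ 2|]ger0_norm ?exprn_ge0// ler_pdivrMr ?exprn_gt0// => a2.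
have Vn : V * (2 * n.+2%:R + 1) <= e / 2 * n.+2%:R ^+ 2.
  have : 6 * V / e < n.+2%:R.
    have /andP[_] : n1%:R <= 6 * V / e < n1.+1%:R.
      by apply: truncn_itv; rewrite divr_ge0 ?mulr_ge0// ltW.
    move=> /lt_le_trans; apply; rewrite ler_nat.
    apply: leq_trans kn; rewrite ltnS; apply: leq_trans (leq_addl n0 n1) _.
    exact: leqW (leqnSn _).
  rewrite ltr_pdivrMr// => Vn.
  have x1 : 1 <= n.+2%:R :> R by rewrite ler1n.
  set x : R := n.+2%:R in Vn x1 *.
  apply: (@le_trans _ _ (V * (3 * x))); first by rewrite ler_wpM2l//; lra.
  have -> : e / 2 * x ^+ 2 = (x * e / 2) * x by rewrite expr2; ring.
  by rewrite mulrA ler_wpM2r//; lra.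
have x3 : n.+3%:R = n.+2%:R + 1 :> R by rewrite -natr1.
rewrite x3 in Qhi h2 a2.
set x : R := n.+2%:R in Qlo Qhi n2 h1 h2 a1 a2 Vn *.
have x1 : 2 <= x by rewrite ler_nat.
rewrite normrM normfV (gtr0_norm Q0) ler_pdivrMr//.
move: a1 a2; rewrite !ler_norml => /andP[a1 _] /andP[_ a2].
have x0 : 0 <= x ^+ 2 by exact: sqr_ge0.
have xx : (x + 1) ^+ 2 <= 4 * x ^+ 2 by nra.
have VQ1 : V * (Q - x ^+ 2) <= V * (2 * x + 1) by rewrite ler_wpM2l//; nra.
have VQ2 : V * ((x + 1) ^+ 2 - Q) <= V * (2 * x + 1) by rewrite ler_wpM2l//; nra.
have eQ : e * x ^+ 2 <= e * Q by rewrite ler_wpM2l// ltW.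
have dx : del * (x + 1) ^+ 2 <= e / 2 * x ^+ 2.
  by rewrite /del; have := ler_wpM2l (ltW e0) xx; lra.
have dx' : del * x ^+ 2 <= e / 2 * x ^+ 2.
  by rewrite ler_wpM2r// /del; lra.
by apply/andP; split; lra.
Unshelve. all: by end_near. Qed.

End sandwich.

Lemma measurable_second_moment (R : realType) (disp : measure_display) (T : measurableType disp)
    (P : probability T R) (A : R -> T -> R) :
  (forall w, continuous (A ^~ w)) -> (forall r, measurable_fun setT (A r)) ->
  measurable_fun setT (fun r : measurableTypeR R => \int[P]_w (A r w ^+ 2)).
Proof.
move=> cA mA; rewrite /Rintegral; apply: measurableT_comp => //.
apply: (measurable_fun_fubini_tonelli_G (m1 := P)
  (fun p : T * measurableTypeR R => (A p.2 p.1 ^+ 2)%:E)) => //.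
  apply/measurable_EFinP; apply: measurable_funX.
  by apply: (measurable_caratheodory (F := fun w r => A r w)).
by move=> p; rewrite lee_fin sqr_ge0.
Qed.

Section ergodic.
Context (R : realType) (disp : measure_display) (T : measurableType disp).
Variable P : probability T R.
Local Notation mu := (@lebesgue_measure R).
Local Notation RR := (measurableTypeR R).
Variables (A : R -> T -> R) (C Vb : R).
Hypotheses (cA : forall w, continuous (A ^~ w)) (mA : forall r, measurable_fun setT (A r)).
Hypothesis gA : forall r r' a b : R, gaussian_rv P (fun w => a * A r w + b * A r' w) /\
  \int[P]_w (a * A r w + b * A r' w) = 0.
Let V r := \int[P]_w (A r w ^+ 2).
Hypotheses (VVb : forall r, V r <= Vb) (C0 : 0 <= C).
Hypothesis covA : forall r r', 1 <= r -> 1 <= r' ->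
  (\int[P]_w (A r w * A r' w)) ^+ 2 <=
  C * (cauchy_kernel r r' + cauchy_kernel 0 r' + cauchy_kernel 0 r).

Let V0 r : 0 <= V r.
Proof. by apply: Rintegral_ge0 => w _; exact: sqr_ge0. Qed.

Let Vb0 : 0 <= Vb. Proof. exact: le_trans (V0 0) (VVb 0). Qed.

Let D r w := A r w ^+ 2 - V r.

Let lA r : L4 P (A r).
Proof.
split=> //; have [g e] := gA r r 1 0.
have [h _] := centered_gaussian_fourth_moment g e.
by move: h; congr integrable; apply/funext => w /=; rewrite mul1r mul0r addr0.
Qed.

Let iA2 r : P.-integrable setT (EFin \o (fun w => A r w ^+ 2)).
Proof. exact: L4_integrable_sqr. Qed.

Let mAj : measurable_fun setT (fun p : T * RR => A p.2 p.1).
Proof. by apply: (measurable_caratheodory (F := fun w r => A r w)). Qed.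

Let mV : measurable_fun setT (V : RR -> R).
Proof. exact: measurable_second_moment. Qed.

Let iDD r r' : P.-integrable setT (EFin \o (fun w => D r w * D r' w)) /\
  \int[P]_w (D r w * D r' w) = 2 * (\int[P]_w (A r w * A r' w)) ^+ 2.
Proof.
have i22 := L4_integrable_sqrM (lA r) (lA r').
have i1 : P.-integrable setT (EFin \o (fun=> V r * V r')).
  exact: (finite_measure_integrable_cst P (V r * V r')).
have z1 := integrableZl measurableT (- V r') (iA2 r).
have z2 := integrableZl measurableT (- V r) (iA2 r').
have E : (fun w => D r w * D r' w) = fun w => A r w ^+ 2 * A r' w ^+ 2 +
    - V r' * A r w ^+ 2 + - V r * A r' w ^+ 2 + V r * V r'.
  by apply/funext => w; rewrite /D; ring.
have i12 := integrableD measurableT i22 z1.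
have i123 := integrableD measurableT i12 z2.
rewrite E; split; first exact: (integrableD measurableT i123 i1).
rewrite (RintegralD measurableT i123 i1) (RintegralD measurableT i12 z2).
rewrite (RintegralD measurableT i22 z1) (RintegralZl (- V r') measurableT (iA2 r)).
rewrite (RintegralZl (- V r) measurableT (iA2 r')) -/(V r) -/(V r').
rewrite (gaussian_square_covariance (gA r r')) -/(V r) -/(V r').
have -> : \int[P]_w (V r * V r') = V r * V r'.
  by rewrite /Rintegral integral_cst//= probability_setT mule1.
by ring.
Qed.

Let window a b (r : R) : R := \1_`[a, b] r.

Let iwin a b : mu.-integrable setT (EFin \o window a b).
Proof. exact: integrable_indic_itv. Qed.

Let win0 a b r : 0 <= window a b r. Proof. by rewrite /window indicE. Qed.

Let win1 a b r : window a b r <= 1. Proof. by rewrite /window indicE lern1 leq_b1. Qed.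

Let winw a b r : window a b r * window a b r = window a b r.
Proof. by rewrite /window indicE -natrM; case: (_ \in _). Qed.

Let winE (a b r : R) : window a b r = (a <= r <= b)%R%:R.
Proof.
rewrite /window indicE; congr ((nat_of_bool _)%:R).
by apply/idP/idP; rewrite inE/= in_itv.
Qed.

Let Dwin a b w : mu.-integrable setT (EFin \o (fun r : RR => (D r w * window a b r) ^+ 2)).
Proof.
have cA4 : continuous (fun r => A r w ^+ 4).
  move=> r; apply: (@continuous_comp _ _ _ (A ^~ w) (fun u => u ^+ 4)); first exact: cA.
  exact: exprn_continuous.
have i4 : mu.-integrable setT (EFin \o (fun r => A r w ^+ 4 * window a b r)).
  have -> : EFin \o (fun r => A r w ^+ 4 * window a b r) =
      (EFin \o (fun r => A r w ^+ 4)) \_ `[a, b].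
    apply/funext => r /=; rewrite patchE /window indicE.
    by case: ifPn => _; rewrite ?mulr1 ?mulr0.
  by apply/(integrable_mkcond _ _).1 => //; exact: continuous_integrable_itv.
apply: (le_integrable measurableT _ _ (integrableD measurableT (integrableZl measurableT 2 i4)
  (integrableZl measurableT (2 * Vb ^+ 2) (iwin a b)))).
  apply/measurable_EFinP; apply: measurable_funX; apply: measurable_funM.
    apply: measurable_funB => //; apply: measurable_funX.
    exact: (continuous_measurable_fun (cA (w := w))).
  exact: measurable_indic.
move=> r _ /=; rewrite lee_fin ger0_norm ?sqr_ge0//; apply: le_trans (ler_norm _).
rewrite exprMn [window a b r ^+ 2]expr2 winw mulrA -mulrDl ler_wpM2r// /D.
have : V r ^+ 2 <= Vb ^+ 2 by rewrite ler_sqr ?nnegrE.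
by have := sqr_ge0 (A r w ^+ 2 + V r); nra.
Qed.

Let mD : measurable_fun setT (fun p : T * RR => D p.2 p.1).
Proof.
apply: measurable_funB; first exact: measurable_funX.
exact: (measurableT_comp mV measurable_snd).
Qed.

(** By [iDD] the covariance of D(r) and D(r') is 2 E[A(r) A(r')]^2, bounded by 2 C times three
    Cauchy kernels; each contributes at most pi (b - a) to the double integral over the window,
    hence 6 pi C. *)
Lemma variance_bound a b : 1 <= a -> a < b ->
  P.-integrable setT (EFin \o (fun w => (\int[mu]_r (D r w * window a b r)) ^+ 2)) /\
  \int[P]_w ((\int[mu]_r (D r w * window a b r)) ^+ 2) <= 6 * pi * C * (b - a).
Proof.
move=> a1 ab; pose F w r := D r w * window a b r.
have Lw : \int[mu]_r window a b r = b - a.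
  have mI : mu `[a, b]%classic = (b - a)%:E by rewrite lebesgue_measure_itv/= lte_fin ab.
  by rewrite /Rintegral integral_indic// setIT; have /= -> := mI.
have L0 : 0 < \int[mu]_r window a b r by rewrite Lw subr_gt0.
have FI w r : F w r = F w r * window a b r by rewrite /F -mulrA winw.
have mF : measurable_fun setT (fun p : T * RR => F p.1 p.2).
  apply: measurable_funM => //.
  have mw : measurable_fun setT (window a b : RR -> R) by exact: measurable_indic.
  exact: (measurableT_comp mw measurable_snd).
have FE r r' : (fun w => F w r * F w r') =
    fun w => (window a b r * window a b r') * (D r w * D r' w).
  by apply/funext => w; rewrite /F; ring.
have iFF r r' : P.-integrable setT (EFin \o (fun w => F w r * F w r')) /\
    \int[P]_w (F w r * F w r') =
    window a b r * window a b r' * (2 * (\int[P]_w (A r w * A r' w)) ^+ 2).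
  have [i1 e1] := iDD r r'; rewrite FE; split.
    exact: (integrableZl measurableT (window a b r * window a b r') i1).
  by rewrite (RintegralZl _ measurableT i1) e1.
have iF2P r : P.-integrable setT (EFin \o (fun w => F w r ^+ 2)).
  by have := (iFF r r).1; congr integrable; apply/funext => w /=; rewrite expr2.
have FM r : \int[P]_w (F w r ^+ 2) <= (2 * Vb ^+ 2) * window a b r.
  under eq_Rintegral do rewrite expr2.
  rewrite (iFF r r).2 winw mulrC ler_wpM2r// ler_pM2l//.
  under eq_Rintegral do rewrite -expr2.
  by rewrite -/(V r) ler_sqr ?nnegrE.
split; first exact: (integrable_square_integral mF (iwin a b) (win0 a b) (winw a b) FI L0 iF2P FM (Dwin a b)).
(* The two kernels that depend on r are integrated over the whole line, so their window in r is
   dropped; the third is constant in r and keeps it. *)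
pose g r' r := 2 * C * (cauchy_kernel r' r + cauchy_kernel 0 r + cauchy_kernel 0 r' * window a b r)
  * window a b r'.
pose h r := 2 * C * (2 * pi * window a b r + (b - a) * cauchy_kernel 0 r).
have ih : mu.-integrable setT (EFin \o h).
  exact: (integrableZl measurableT (2 * C) (integrableD measurableT
    (integrableZl measurableT (2 * pi) (iwin a b))
    (integrableZl measurableT (b - a) (integrable_cauchy_kernel 0)))).
have ick (c : R) : \int[mu]_r cauchy_kernel c r = pi by rewrite /Rintegral integral_cauchy_kernel.
have ig0 r' : mu.-integrable setT (EFin \o (fun r => cauchy_kernel r' r + cauchy_kernel 0 r)).
  exact: (integrableD measurableT (integrable_cauchy_kernel r') (integrable_cauchy_kernel 0)).
have ig1 r' : mu.-integrable setT (EFin \o (fun r => cauchy_kernel r' r + cauchy_kernel 0 r +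
   cauchy_kernel 0 r' * window a b r)).
  exact: (integrableD measurableT (ig0 r') (integrableZl measurableT (cauchy_kernel 0 r') (iwin a b))).
have -> : 6 * pi * C * (b - a) = \int[mu]_r h r.
  rewrite /h RintegralZl//; last first.
    exact: (integrableD measurableT (integrableZl measurableT (2 * pi) (iwin a b))
      (integrableZl measurableT (b - a) (integrable_cauchy_kernel 0))).
  rewrite (RintegralD measurableT (integrableZl measurableT (2 * pi) (iwin a b))
    (integrableZl measurableT (b - a) (integrable_cauchy_kernel 0))).
  rewrite (RintegralZl _ measurableT (iwin a b)).
  by rewrite (RintegralZl _ measurableT (integrable_cauchy_kernel 0)) ick Lw; ring.
apply: (second_moment_bound mF (iwin a b) (win0 a b) (winw a b) FI L0 iF2P FM (Dwin a b) (g := g)) => //.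
- move=> r r'; rewrite (iFF r' r).2; apply/andP; split.
    by apply: mulr_ge0; [exact: mulr_ge0|apply: mulr_ge0 => //; exact: sqr_ge0].
  rewrite /g.
  rewrite !winE; case: (boolP (a <= r' <= b)) => [/andP[r'a _]|]; last by rewrite !mul0r mulr0.
  case: (boolP (a <= r <= b)) => [/andP[ra _]|_].
    rewrite !mulr1 mul1r -mulrA ler_pM2l//.
    exact: covA (le_trans a1 r'a) (le_trans a1 ra).
  rewrite mulr0 mul0r mulr0 addr0 mulr1; apply: mulr_ge0; first by rewrite mulr_ge0.
  by apply: addr_ge0; exact: cauchy_kernel_ge0.
- move=> r'; have := integrableZl measurableT (2 * C * window a b r') (ig1 r').
  congr integrable; apply/funext => r /=; rewrite -EFinM; congr EFin; rewrite /g; ring.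
- move=> r'; have -> : \int[mu]_r g r' r =
      2 * C * window a b r' * (pi + pi + cauchy_kernel 0 r' * (b - a)).
    transitivity (\int[mu]_r (2 * C * window a b r' * (cauchy_kernel r' r + cauchy_kernel 0 r +
      cauchy_kernel 0 r' * window a b r))).
      by apply: eq_Rintegral => r _; rewrite /g; ring.
    rewrite (RintegralZl _ measurableT (ig1 r')).
    rewrite (RintegralD measurableT (ig0 r') (integrableZl measurableT (cauchy_kernel 0 r') (iwin a b))).
    rewrite (RintegralZl _ measurableT (iwin a b)) Lw.
    by rewrite (RintegralD measurableT (integrable_cauchy_kernel r') (integrable_cauchy_kernel 0)) !ick.
  have -> : 2 * C * window a b r' * (pi + pi + cauchy_kernel 0 r' * (b - a)) =
     2 * C * (2 * pi * window a b r' + window a b r' * ((b - a) * cauchy_kernel 0 r')) by ring.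
  rewrite /h ler_wpM2l ?mulr_ge0// lerD2l ler_piMl// mulr_ge0 ?cauchy_kernel_ge0//.
  by rewrite subr_ge0 ltW.
Qed.

Let S b w := \int[mu]_r (D r w * window 1 b r).

Let K := 6 * pi * C.
Let K0 : 0 <= K. Proof. by rewrite !mulr_ge0// pi_ge0. Qed.

Let Dint a b w : mu.-integrable setT (EFin \o (fun r : RR => D r w * window a b r)).
Proof.
apply: (le_integrable measurableT _ _ (integrableD measurableT (iwin a b) (Dwin a b w))).
  apply/measurable_EFinP; apply: measurable_funM; last exact: measurable_indic.
  apply: measurable_funB => //; apply: measurable_funX.
  exact: (continuous_measurable_fun (cA (w := w))).
move=> r _ /=; rewrite lee_fin; apply: le_trans (ler_norm _).
rewrite exprMn [window a b r ^+ 2]expr2 winw -[X in X + _]mul1r -mulrDl normrM.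
rewrite (ger0_norm (win0 _ _ _)) ler_wpM2r// ler_norml.
by have := sqr_ge0 (D r w - 1); have := sqr_ge0 (D r w + 1); nra.
Qed.

Let Ditv a b w : mu.-integrable `]a, b] (EFin \o D ^~ w).
Proof.
have i1 : mu.-integrable `]a, b] (EFin \o (fun r : RR => D r w * window a b r)).
  by apply: (integrableS measurableT) (Dint a b w) => //.
apply: (le_integrable _ _ _ i1) => [||r]; first exact: measurable_itv.
  apply/measurable_EFinP; apply: measurable_funTS; apply: measurable_funB => //.
  by apply: measurable_funX; exact: (continuous_measurable_fun (cA (w := w))).
by rewrite /= in_itv/= => /andP[ar rb]; rewrite lee_fin winE (ltW ar) rb/= mulr1.
Qed.

Let Sdiff a b w : 1 <= a -> a <= b -> S b w - S a w = \int[mu]_(r in `]a, b]) D r w.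
Proof.
move=> a1 ab; rewrite /S -RintegralB//; try exact: Dint.
rewrite [RHS]Rintegral_mkcond; apply: eq_Rintegral => r _.
rewrite patchE !winE -mulrBr.
have -> : (r \in `]a, b]%classic) = (a < r <= b) by apply/idP/idP; rewrite inE/= in_itv.
case: (ltP a r) => ar /=.
  rewrite (le_trans a1 (ltW ar))/=.
  by rewrite subr0; case: (r <= b); rewrite ?mulr1 ?mulr0.
by rewrite (le_trans ar ab) andbT subrr mulr0.
Qed.

(** As A^2 >= 0, the integrand is at least -V >= -Vb. This is the one-sided control of increments
    that [cvg_mean_squares] requires. *)
Let Sinc w a b : 1 <= a -> a <= b -> - (Vb * (b - a)) <= S b w - S a w.
Proof.
move=> a1 ab; rewrite Sdiff//.
have mI : mu `]a, b]%classic = (b - a)%:E.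
  rewrite lebesgue_measure_itv/= lte_fin.
  by move: ab; rewrite le_eqVlt => /predU1P[->|->//]; rewrite ltxx subrr.
have -> : - (Vb * (b - a)) = \int[mu]_(r in `]a, b]) (- Vb).
  by rewrite Rintegral_cst//; have /= -> := mI; rewrite mulNr.
apply: le_Rintegral => //.
- apply/integrableP; split; first exact: measurable_cst.
  by rewrite integral_cst//; have /= -> := mI; rewrite -EFinM ltry.
- by move=> r _; rewrite /D lerBrDl (le_trans _ (sqr_ge0 _))// subr_le0.
Qed.

Lemma cvg_mean_gaussian_squares :
  {ae P, forall w, Q^-1 * (\int[mu]_(r in `[Q, 2 * Q]) (A r w ^+ 2 - V r)) @[Q --> +oo] --> (0 : R)}.
Proof.
(* Starting at n + 2 keeps the window [1, N n] nondegenerate, as [variance_bound] requires, and (n +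
   2)^-2 <= 1/(n + 1) - 1/(n + 2) makes the second moments telescope. *)
pose N n : R := n.+2%:R ^+ 2.
have N1 n : 1 < N n by rewrite /N -natrX ltr1n.
have N0 n : 0 < N n := lt_trans ltr01 (N1 n).
pose Z n w := (S (N n) w / N n) ^+ 2.
have VB n := variance_bound (lexx 1) (N1 n).
have iZ n : P.-integrable setT (EFin \o Z n).
  have := integrableZl measurableT ((N n)^-1 ^+ 2) (VB n).1.
  by congr integrable; apply/funext => w /=; rewrite -EFinM /Z exprMn mulrC.
have EZ n : \int[P]_w Z n w <= K * (n.+1%:R^-1 - n.+2%:R^-1).
  have -> : \int[P]_w Z n w = (N n)^-1 ^+ 2 * \int[P]_w (S (N n) w ^+ 2).
    by rewrite -(RintegralZl _ measurableT (VB n).1); apply: eq_Rintegral => w _; rewrite /Z exprMn mulrC.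
  apply: (@le_trans _ _ ((N n)^-1 ^+ 2 * (K * N n))).
    rewrite ler_wpM2l ?sqr_ge0//; apply: le_trans (VB n).2 _.
    by rewrite -/K ler_wpM2l// gerBl.
  have -> : (N n)^-1 ^+ 2 * (K * N n) = K * (N n)^-1.
    by have := lt0r_neq0 (N0 n) => N00; field.
  rewrite ler_wpM2l//.
  have n1 : 0 < n.+1%:R :> R by rewrite ltr0n.
  have -> : n.+2%:R = n.+1%:R + 1 :> R by rewrite natr1.
  have -> : N n = (n.+1%:R + 1) ^+ 2 by rewrite /N natr1.
  set x : R := n.+1%:R in n1 *.
  have -> : x^-1 - (x + 1)^-1 = (x * (x + 1))^-1 by field; lra.
  by rewrite lef_pV2 ?posrE ?mulr_gt0 ?exprn_gt0//; nra.
have Z0 n w : 0 <= Z n w by exact: sqr_ge0.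
have mZ n : measurable_fun setT (Z n) by exact/measurable_EFinP/(measurable_int P)/iZ.
have iS : (\int[P]_w (\sum_(n <oo) (Z n w)%:E) < +oo)%E.
  rewrite integral_nneseries//; last first.
  - by move=> n w _; rewrite lee_fin.
  - by move=> n; exact/measurable_EFinP.
  apply: (@le_lt_trans _ _ K%:E); last exact: ltry.
  apply: lime_le; first by apply: is_cvg_nneseries => n _ _; apply: integral_ge0 => w _; rewrite lee_fin.
  apply: nearW => n.
  have -> : (\sum_(0 <= i < n) \int[P]_w (Z i w)%:E = (\sum_(0 <= i < n) \int[P]_w Z i w)%:E)%E.
    rewrite -sumEFin; apply: eq_bigr => i _;
    have fZ : (\int[P]_w (Z i w)%:E)%E \is a fin_num := integrable_fin_num measurableT (iZ i).
    by rewrite /Rintegral fineK.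
  rewrite lee_fin; apply: (@le_trans _ _ (\sum_(0 <= i < n) (K * (i.+1%:R^-1 - i.+2%:R^-1)))).
    by apply: ler_sum => i _; exact: EZ.
  rewrite -mulr_sumr ler_piMr//.
  have -> : \sum_(0 <= i < n) (i.+1%:R^-1 - i.+2%:R^-1) = 1 - n.+1%:R^-1 :> R.
    elim: n => [|n IH]; first by rewrite big_nil invr1 subrr.
    by rewrite big_nat_recr//= IH addrA subrK.
  by rewrite gerBl.
have mZs : measurable_fun setT (fun w => \sum_(n <oo) (Z n w)%:E)%E.
  apply: ge0_emeasurable_sum => [n w _ _|n _]; first by rewrite lee_fin.
  exact/measurable_EFinP.
have iZs : P.-integrable setT (fun w => \sum_(n <oo) (Z n w)%:E)%E.
  apply/integrableP; split=> //; apply: le_lt_trans iS.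
  rewrite le_eqVlt; apply/orP; left; apply/eqP; apply: eq_integral => w _.
  by rewrite gee0_abs//; apply: nneseries_ge0 => n _ _; rewrite lee_fin.
(* A series of nonnegative variables with finite expectation is almost surely finite, so its terms
   tend to 0. *)
have := integrable_ae measurableT iZs; apply: filterS => w /(_ Logic.I) fw.
have Zw : Z n w @[n --> \oo] --> (0 : R).
  apply: cvg_series_cvg_0; apply: nondecreasing_is_cvgn.
    by apply/nondecreasing_seqP => n; rewrite /series/= big_nat_recr//= lerDl.
  exists (fine (\sum_(n <oo) (Z n w)%:E)%E) => _ [n _ <-].
  rewrite -lee_fin fineK// /series/= -sumEFin.
  by apply: nneseries_lim_ge => i _ _; rewrite lee_fin.
have Sw : S (N n) w / N n @[n --> \oo] --> (0 : R).
  apply/cvgr0Pnorm_le => e e0.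
  have /cvgr0Pnorm_le/(_ (e ^+ 2)) := Zw.
  move=> /(_ (exprn_gt0 _ e0)); apply: filterS => n.
  by rewrite /Z ger0_norm ?sqr_ge0// -[X in X <= _]real_normK ?num_real// ler_sqr ?nnegrE// ltW.
have Scvg := cvg_mean_squares Vb0 (Sinc w) Sw.
have S2 : S (2 * Q) w / (2 * Q) @[Q --> +oo] --> (0 : R).
  apply: (@cvg_comp _ _ _ (fun Q : R => 2 * Q) (fun Q => S Q w / Q) _ +oo) Scvg.
  by apply: gt0_cvgMry => //; exact: cvg_id.
(* The mean over [Q, 2 Q] is a combination of the means over [1, 2 Q] and [1, Q], both of which tend
   to 0. *)
have : 2 * (S (2 * Q) w / (2 * Q)) - S Q w / Q @[Q --> +oo] --> (2 * 0 - 0 : R).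
  by apply: cvgB => //; apply: cvgMr.
rewrite mulr0 subr0; apply: cvg_trans; apply: near_eq_cvg; near=> Q.
have Q1 : 1 <= Q by near: Q; apply: nbhs_pinfty_ge; exact: num_real.
have Q0 : Q != 0 by rewrite gt_eqF// (lt_le_trans ltr01).
have -> : 2 * (S (2 * Q) w / (2 * Q)) - S Q w / Q = Q^-1 * (S (2 * Q) w - S Q w).
  by field.
rewrite Sdiff//; last by lra.
by congr (_ * _); rewrite Rintegral_itv_obnd_cbnd//; exact: Ditv.
Unshelve. all: by end_near. Qed.

End ergodic.

(** * Distributions with compact support *)

Section derivative_rules.
Variables (R : realType) (V : normedModType R).
Implicit Types (g h : V -> R).

Lemma derivsB s g h : rsmooth g -> rsmooth h ->
  derivs s (fun x => g x - h x) = fun x => derivs s g x - derivs s h x.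
Proof.
move=> sg sh; elim: s => //= v s ->; apply/funext => x.
by apply: deriveB; apply: rsmooth_derivable; exact: rsmooth_derivs.
Qed.

Lemma derivs_eq0 s g (O : set V) : open O -> (forall x, O x -> g x = 0) ->
  forall x, O x -> derivs s g x = 0.
Proof.
move=> oO g0; elim: s => //= v s IH x Ox; apply: derive_val.
have N : \near x, (cst (0 : R)) x = derivs s g x.
  have : nbhs x O by exact: open_nbhs_nbhs.
  by apply: filterS => y /IH ->.
exact: (near_eq_is_derive N (is_derive_cst (0 : R) x v)).
Qed.

Lemma derive_slice (U : normedModType R) (h : U * V -> R) (u : U) (x v : V) :
  'D_v (fun x => h (u, x)) x = 'D_((0 : U), v) h (u, x) /\
  (derivable h (u, x) (0, v) -> derivable (fun x => h (u, x)) x v).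
Proof.
have E : (fun t : R => t^-1 *: (((fun x => h (u, x)) \o shift x) (t *: v) - h (u, x))) =
    (fun t : R => t^-1 *: ((h \o shift (u, x)) (t *: ((0 : U), v)) - h (u, x))).
  apply/funext => t; rewrite [RHS](_ : _ = t^-1 *: (h (t *: 0 + u, t *: v + x) - h (u, x)))//.
  by rewrite scaler0 add0r.
by rewrite /derive /derivable E.
Qed.

Lemma derivs_slice (U : normedModType R) (s : seq V) (h : U * V -> R) (u : U) :
  derivs s (fun x => h (u, x)) = fun x => derivs [seq ((0 : U), v) | v <- s] h (u, x).
Proof.
elim: s => //= v s ->; apply/funext => x.
exact: (derive_slice (derivs [seq (0, v) | v <- s] h) u x v).1.
Qed.

Lemma rsmooth_slice (U : normedModType R) (h : U * V -> R) (u : U) :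
  rsmooth h -> rsmooth (fun x => h (u, x)).
Proof.
move=> sh; split=> s; rewrite derivs_slice; have sd := rsmooth_derivs [seq (0, v) | v <- s] sh.
split; first exact: continuous_pairl (rsmooth_continuous sd).
by move=> x v; apply: (derive_slice _ u x v).2; exact: rsmooth_derivable.
Qed.

End derivative_rules.

Section compact_support.
Variables (R : realType) (d : nat).
Local Notation E := 'rV[R]_d.

(** The tube lemma over the compact ball carrying the supports makes continuity in (u, x) uniform in
    x. *)
Lemma compact_support_uniform (U : normedModType R) (h : U * E -> R) (u0 : U) (M : R) :
  continuous h -> (\forall u \near u0, forall x, M < `|x| -> h (u, x) = 0) ->
  forall e, 0 < e -> \forall u \near u0, forall x, `|h (u, x) - h (u0, x)| <= e.
Proof.
move=> ch h0 e e0.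
have cov := (compact_near_coveringP _).1 (@compact_norm_le R d M).
have H : \forall u \near u0, [set x | `|x| <= M] `<=` [set x | `|h (u, x) - h (u0, x)| <= e].
  apply: (cov U (nbhs u0) (fun u x => `|h (u, x) - h (u0, x)| <= e)) => x xM.
  have e2 : 0 < e / 2 by rewrite divr_gt0.
  have /cvgrPdist_le/(_ _ e2) H := ch (u0, x).
  case: H => -[A B] /= [nA nB] AB; exists (B, A) => // -[x' u] [/= Bx Au].
  have a1 := AB (u, x') (conj Au Bx); have a2 := AB (u0, x') (conj (nbhs_singleton nA) Bx).
  have -> : h (u, x') - h (u0, x') = (h (u0, x) - h (u0, x')) - (h (u0, x) - h (u, x')) by ring.
  by apply: le_trans (ler_normB _ _) _; rewrite [e]splitr lerD.
have h00 := nbhs_singleton h0.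
near=> u => x; have [xM|Mx] := leP `|x| M.
  by move: x xM; near: u; exact: H.
by rewrite h00// (near h0 u)// subrr normr0 ltW.
Unshelve. all: by end_near. Qed.

Fixpoint multi_indices (N : nat) : seq (seq 'I_d) :=
  if N is n.+1 then
    multi_indices n ++ [seq i :: s | i <- enum 'I_d, s <- multi_indices n]
  else [:: [::]].

Lemma mem_multi_indices N (s : seq 'I_d) : (size s <= N)%N -> s \in multi_indices N.
Proof.
elim: N s => [|N IH] [|i s] //= sN; rewrite mem_cat; first by rewrite IH.
by apply/orP; right; apply/allpairsP; exists (i, s); split; rewrite ?mem_enum//=; exact: IH.
Qed.

Lemma near_all_seq (I : eqType) (U : Type) (F : set_system U) (l : seq I) (P : I -> U -> Prop) :
  Filter F -> (forall i, i \in l -> \forall u \near F, P i u) ->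
  \forall u \near F, forall i, i \in l -> P i u.
Proof.
move=> FF; elim: l => [|j l IH] H; first by apply: nearW.
have H1 := H j (mem_head _ _).
have H2 : \forall u \near F, forall i, i \in l -> P i u.
  by apply: IH => i il; apply: H; rewrite inE il orbT.
by apply: filterS2 H1 H2 => u Pj Pl i; rewrite inE => /orP[/eqP ->|/Pl].
Qed.

End compact_support.

Section distributions.
Variables (R : realType) (d : nat).
Local Notation C := R[i].
Local Notation E := 'rV[R]_d.
Variable T : distributions R d.

Lemma smoothB (phi psi : E -> C) : smooth phi -> smooth psi -> smooth (fun x => phi x - psi x).
Proof.
move=> /smoothE[p1 p2] /smoothE[q1 q2]; apply/smoothE; split.
  have -> : (fun y => complex.Re (phi y - psi y)) =
      fun y => complex.Re (phi y) - complex.Re (psi y).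
    by apply/funext => y; rewrite ReD ReN.
  exact: rsmoothB.
have -> : (fun y => complex.Im (phi y - psi y)) =
    fun y => complex.Im (phi y) - complex.Im (psi y).
  by apply/funext => y; rewrite ImD ImN.
exact: rsmoothB.
Qed.

Lemma pairing_linear (a : C) (phi psi : E -> C) :
  test_function setT phi -> test_function setT psi ->
  T (fun x => a * phi x + psi x) = a * T phi + T psi.
Proof. by case: T => S [/= H _]; exact: H. Qed.

Lemma pairing_bound (K : set E) : compact K ->
  exists N, exists2 B, 0 <= B & forall phi (M : R),
    smooth phi -> (forall x, ~ K x -> phi x = 0) ->
    (forall s, (size s <= N)%N -> forall x, cn (mderive s phi x) <= M) ->
    cn (T phi) <= B * M.
Proof.
case: T => S [/= _ HS] cK; have [N [B HB]] := HS _ cK; exists N, `|B| => // phi M sphi p0 pM.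
have M0 : 0 <= M by apply: le_trans (pM [::] isT 0); exact: cn_ge0.
rewrite -lec_cn; apply: le_trans (HB phi M sphi p0 _) _.
  by move=> s sN x; rewrite lec_cn; exact: pM.
by rewrite lecR ler_wpM2r// ler_norm.
Qed.

Lemma pairingB (phi psi : E -> C) : test_function setT phi -> test_function setT psi ->
  T (fun x => phi x - psi x) = T phi - T psi.
Proof.
move=> tp tq; have := pairing_linear (-1) tq tp.
by rewrite mulN1r addrC => <-; congr (T _); apply/funext => x; rewrite mulN1r addrC.
Qed.

Lemma test_function_ball (phi : E -> C) (M : R) : smooth phi -> (forall x, M < `|x| -> phi x = 0) ->
  test_function setT phi.
Proof.
move=> sp p0; split=> //; exists [set x | `|x| <= M]; split=> //; first exact: compact_norm_le.
by move=> x /negP; rewrite -ltNge => /p0.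
Qed.

Lemma mderiveE s (phi : E -> C) x : mderive s phi x =
  (derivs [seq basis_vec R i | i <- s] (fun y => complex.Re (phi y)) x +i*
   derivs [seq basis_vec R i | i <- s] (fun y => complex.Im (phi y)) x)%C.
Proof. by rewrite /mderive cderivesE. Qed.

Lemma mderiveB_bound s (phi psi : E -> C) (e : R) x : smooth phi -> smooth psi ->
  (forall part : C -> R, part = @complex.Re R \/ part = @complex.Im R ->
    `|derivs [seq basis_vec R i | i <- s] (fun y => part (phi y)) x -
      derivs [seq basis_vec R i | i <- s] (fun y => part (psi y)) x| <= e) ->
  cn (mderive s (fun y => phi y - psi y) x) <= 2 * e.
Proof.
move=> /smoothE[p1 p2] /smoothE[q1 q2] H; apply: le_trans (cn_le _) _.
rewrite mderiveE/= mulr_natl mulr2n; apply: lerD.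
  have -> : (fun y => complex.Re (phi y - psi y)) =
      fun y => complex.Re (phi y) - complex.Re (psi y).
    by apply/funext => y; rewrite ReD ReN.
  by rewrite derivsB//; apply: H; left.
have -> : (fun y => complex.Im (phi y - psi y)) =
    fun y => complex.Im (phi y) - complex.Im (psi y).
  by apply/funext => y; rewrite ImD ImN.
by rewrite derivsB//; apply: H; right.
Qed.

(** On one fixed ball the distribution is bounded by finitely many derivatives, and
    [compact_support_uniform] makes each of them converge uniformly as the parameter varies. This
    yields the continuity of the paths k -> Z(k). *)
Lemma pairing_continuous (U : normedModType R) (g : U * E -> C) (M : R) : smooth g ->
  (forall u x, M < `|x| -> g (u, x) = 0) ->
  ccontinuous (fun u => T (fun x => g (u, x))).
Proof.
move=> /smoothE[g1 g2] g0.
have sg u : smooth (fun x => g (u, x)).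
  by apply/smoothE; split; [exact: (@rsmooth_slice R E U _ u g1)|exact: (@rsmooth_slice R E U _ u g2)].
have tg u : test_function setT (fun x => g (u, x)) by apply: test_function_ball (sg u) (g0 u).
have [N [B B0 HB]] := pairing_bound (@compact_norm_le R d M).
have main u0 e : 0 < e -> \forall u \near u0,
    cn (T (fun x => g (u, x)) - T (fun x => g (u0, x))) <= e.
  move=> e0; pose e' := e / (2 * (B + 1)).
  have e'0 : 0 < e' by rewrite divr_gt0// mulr_gt0// ltr_wpDl.
  have H (part : C -> R) : part 0 = 0 -> rsmooth (fun p => part (g p)) ->
      \forall u \near u0, forall s, s \in multi_indices d N -> forall x,
      `|derivs [seq basis_vec R i | i <- s] (fun y => part (g (u, y))) x -
        derivs [seq basis_vec R i | i <- s] (fun y => part (g (u0, y))) x| <= e'.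
    move=> p0 sp; apply: near_all_seq => s _.
    pose w := [seq ((0 : U), v) | v <- [seq basis_vec R i | i <- s]].
    have := @compact_support_uniform R d U (fun p => derivs w (fun p => part (g p)) p) u0 M.
    move=> /(_ _ _ _ e'0)/wrap[||]; last first.
    - by apply: filterS => u Hu x; have := Hu x; rewrite !(derivs_slice _ (fun p => part (g p))).
    - apply: nearW => u x Mx.
      have := @derivs_eq0 R E [seq basis_vec R i | i <- s] (fun y => part (g (u, y)))
        [set x | M < `|x|].
      rewrite (derivs_slice _ (fun p => part (g p))); apply=> //.
        have -> : [set x : E | M < `|x|] = (fun x => `|x|) @^-1` [set r | M < r] by [].
        by apply: open_comp; [move=> y _; exact: norm_continuous|exact: open_gt].
      by move=> y /g0 ->.
    - exact: (rsmooth_continuous (rsmooth_derivs w sp)).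
  near=> u; rewrite -pairingB//.
  have sB := smoothB (sg u) (sg u0).
  apply: le_trans (HB _ (2 * e') sB _ _) _.
  - by move=> x /negP; rewrite -ltNge => Mx; rewrite !g0// subrr.
  - move=> s sN x; apply: (mderiveB_bound (sg u) (sg u0)) => part pE.
    have sin := mem_multi_indices sN.
    case: pE => ->; move: s sin {sN} x; near: u.
      exact: (H (@complex.Re R)).
    exact: (H (@complex.Im R)).
  - have B1 : 0 < B + 1 by rewrite ltr_wpDl.
    have -> : B * (2 * e') = B * e / (B + 1) by rewrite /e'; field; rewrite gt_eqF.
    by rewrite ler_pdivrMr// mulrDr mulr1 mulrC lerDl ltW.
split=> u0; apply/cvgrPdist_le => e e0; near=> u.
  rewrite -ReN -ReD; apply: le_trans (le_Re_cn _) _; rewrite -cnN opprB.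
  by near: u; exact: main.
rewrite -ImN -ImD; apply: le_trans (le_Im_cn _) _; rewrite -cnN opprB.
by near: u; exact: main.
Unshelve. all: by end_near. Qed.

(* The two cutoffs are compared through their product: (1 - chi0) chi1 g
   vanishes near the support. *)
Lemma compact_pairingE (K U : set E) (chi0 g : E -> C) : compact K -> supported_in T K ->
  open U -> K `<=` U -> test_function setT chi0 -> (forall x, U x -> chi0 x = 1) ->
  smooth g -> compact_pairing T g = T (fun x => chi0 x * g x).
Proof.
move=> cK TK oU KU t0 chi01 sg; rewrite /compact_pairing.
set S := [set z | _].
have S0 : S (T (fun x => chi0 x * g x)) by exists K, U, chi0.
have trunc (K' U' : set E) (c1 c2 : E -> C) : supported_in T K' -> open U' -> K' `<=` U' ->
    test_function setT c1 -> test_function setT c2 -> (forall x, U' x -> c1 x = 1) ->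
    T (fun x => c2 x * g x) = T (fun x => c1 x * c2 x * g x).
  move=> TK' oU' KU' tc1 tc2 c11; apply/eqP; rewrite -subr_eq0.
  have tg2 : test_function setT (fun x => c2 x * g x) by exact: test_functionM.
  have tg12 : test_function setT (fun x => c1 x * c2 x * g x).
    by case: tc2 => s2 _; exact: test_functionM (test_functionM tc1 s2) sg.
  rewrite -pairingB//; apply/eqP; apply: TK'.
  have [s12 [L1 [cL1 _ H1]]] := tg2; have [s12' _] := tg12.
  split; first exact: (smoothB s12 s12').
  exists (L1 `\` U'); split.
  - by rewrite setDE; apply: compact_closedI => //; exact: open_closedC.
  - by move=> x [_ nU] /KU'.
  - move=> x /not_andP[/H1 c2g|/contrapT Ux]; first by rewrite -mulrA c2g mulr0 subrr.
    by rewrite c11// mul1r subrr.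
have := xgetPex 0 (ex_intro _ _ S0); move=> [K' [U' [chi' [[_ TK'] [oU' KU'] t' chi'1 ->]]]].
rewrite (trunc K U chi0 chi')// (trunc K' U' chi' chi0)//.
by congr (T _); apply/funext => x; rewrite [chi0 x * _]mulrC.
Qed.

End distributions.

(** * Separability of the test functions and the almost sure support *)

Section separability.
Variables (R : realType) (d : nat) (r : R).
Local Notation C := R[i].
Local Notation E := 'rV[R]_d.
Implicit Types (phi psi : E -> C).

(** The functions a distribution must annihilate to be supported in the ball of radius [r]; the
    index [j] bounds their supports. *)
Definition annular (j : nat) phi :=
  [/\ smooth phi, forall x, `|x| <= r -> phi x = 0 & forall x, j%:R < `|x| -> phi x = 0].

Definition pderivs (s : seq 'I_d) (b : bool) phi : E -> R :=
  derivs [seq basis_vec R i | i <- s]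
    (fun y => if b then complex.Re (phi y) else complex.Im (phi y)).

(** A modulus of continuity at the scale 1/(n+1), common to all functions sharing [m], so that their
    derivatives are controlled by the values on a grid of mesh 1/(m+1). *)
Definition equicontinuous (N n m : nat) phi := forall s, s \in multi_indices d N ->
  forall b (x v : E), `|v| <= m.+1%:R^-1 ->
  `|pderivs s b phi (x + v) - pderivs s b phi x| <= n.+1%:R^-1.

(** Grid points of mesh 1/(m+1) covering the ball of radius j: with b = (m+1) j + 1, the integers k
    with -b <= k < b are encoded as ordinals shifted by b. *)
Definition grid_points (m j : nat) : seq E :=
  [seq gridrow R m [ffun i => (c i)%:Z - (m.+1 * j).+1%:Z] |
    c : {ffun 'I_d -> 'I_((m.+1 * j).+1 + (m.+1 * j).+1)}].

Lemma near_grid_point m j (x : E) : `|x| <= j%:R ->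
  exists2 p, p \in grid_points m j & `|x - p| <= m.+1%:R^-1.
Proof.
move=> xj; set b := (m.+1 * j).+1.
have m0 : 0 < m.+1%:R :> R by rewrite ltr0n.
have bE : b%:R = m.+1%:R * j%:R + 1 :> R by rewrite /b -natr1 natrM.
have kb i : (- b%:Z <= grid m (x 0 i) < b%:Z)%R.
  have xi : `|m.+1%:R * x 0 i| <= m.+1%:R * j%:R.
    by rewrite normrM gtr0_norm// ler_pM2l//; exact: le_trans (coord_le_norm _ _) xj.
  move: xi; rewrite ler_norml => /andP[x1 x2].
  have /andP[h1 h2] := floor_itv (m.+1%:R * x 0 i).
  apply/andP; split; [rewrite -ltzD1 -(ltr_int R)|rewrite -(ltr_int R)].
    by apply: le_lt_trans h2; rewrite mulrNz -pmulrn bE; lra.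
  by apply: le_lt_trans h1 _; rewrite -pmulrn bE; lra.
have kbn (i : 'I_d) : (absz (grid m (x 0%R i) + b%:Z)%R < b + b)%N.
  have /andP[k1 k2] := kb i; rewrite -ltz_nat gez0_abs; last by rewrite -lerBlDr sub0r.
  by rewrite PoszD ltrD2r.
pose c : {ffun 'I_d -> 'I_(b + b)} := [ffun i => Ordinal (kbn i)].
exists (gridrow R m [ffun i => (c i)%:Z - b%:Z]); first by apply/mapP; exists c => //; exact: mem_enum.
apply: norm_le_coord => [|i]; first by rewrite invr_ge0.
rewrite !mxE !ffunE/= gez0_abs; last by have /andP[k1 _] := kb i; rewrite -lerBlDr sub0r.
by rewrite addrK; exact: grid_dist.
Qed.

(* Derivatives up to order N, rounded to multiples of 1/(n+1) at finitely many
   points: functions with the same code are uniformly close in C^N. Choosing one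
   function per code makes the test functions separable. *)
Definition code (N n m j : nat) phi : seq (int * int) :=
  [seq (grid n (pderivs sp.1 true phi sp.2), grid n (pderivs sp.1 false phi sp.2)) |
    sp <- [seq (s, p) | s <- multi_indices d N, p <- grid_points m j]].

Definition representative (N n m j : nat) (c : seq (int * int)) : E -> C :=
  xget (fun=> 0) [set phi | [/\ annular j phi, equicontinuous N n m phi & code N n m j phi = c]].

Lemma annular_representative N n m j c : annular j (representative N n m j c).
Proof.
rewrite /representative; case: xgetP => [phi -> []//|_].
by split=> //; exact: smooth_cst.
Qed.

Lemma annular_test j phi : annular j phi -> test_function setT phi.
Proof. by move=> [sp _ p0]; exact: test_function_ball p0. Qed.

Lemma rsmooth_part b phi : smooth phi ->
  rsmooth (fun y => if b then complex.Re (phi y) else complex.Im (phi y)).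
Proof. by move=> /smoothE[]; case: b. Qed.

Lemma pderivs_support s b phi j : annular j phi -> forall x, j%:R < `|x| -> pderivs s b phi x = 0.
Proof.
move=> [sp _ p0]; apply: (@derivs_eq0 R E _ _ [set x : E | j%:R < `|x|]).
  have -> : [set x : E | j%:R < `|x|] = (fun x => `|x|) @^-1` [set t | j%:R < t] by [].
  by apply: open_comp; [move=> y _; exact: norm_continuous|exact: open_gt].
by move=> x /p0 ->; case: b.
Qed.

Lemma exists_modulus N n j phi : annular j phi -> exists m, equicontinuous N n m phi.
Proof.
move=> aphi; have [sp _ p0] := aphi.
have n0 : 0 < n.+1%:R^-1 :> R by rewrite invr_gt0.
have : \forall v \near (0 : E), forall s, s \in multi_indices d N -> forall b x,
    `|pderivs s b phi (x + v) - pderivs s b phi x| <= n.+1%:R^-1.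
  apply: (@near_all_seq _ _ (nbhs (0 : E)) (multi_indices d N) (fun s v => forall b x,
    `|pderivs s b phi (x + v) - pderivs s b phi x| <= n.+1%:R^-1)) => s _.
  have H b : \forall v \near (0 : E), forall x,
      `|pderivs s b phi (x + v) - pderivs s b phi x| <= n.+1%:R^-1.
    have cp : continuous (pderivs s b phi).
      exact: (rsmooth_continuous (rsmooth_derivs _ (rsmooth_part b sp))).
    have ch : continuous (fun q : E * E => pderivs s b phi (q.2 + q.1)).
      move=> q; apply: (@continuous_comp _ _ _ (fun q : E * E => q.2 + q.1)); last exact: cp.
      by apply: cvgD; [exact: cvg_snd|exact: cvg_fst].
    have := @compact_support_uniform R d E _ (0 : E) (j%:R + 1) ch.
    move=> /(_ _ _ n0)/wrap[|]; last by apply: filterS => v Hv x; have := Hv x; rewrite /= addr0.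
    have : \forall v \near (0 : E), `|v| < 1.
      have : nbhs (0 : E) (ball (0 : E) 1) by exact: nbhsx_ballx.
      by apply: filterS => v; rewrite -ball_normE/= sub0r normrN.
    apply: filterS => v v1 x jx; apply: (pderivs_support _ _ aphi) => /=.
    by have := ler_normB (x + v) v; rewrite addrK; lra.
  by apply: filterS2 (H true) (H false) => v H1 H2 [].
move=> /nbhs_ballP[del /= del0 Hdel].
have [m _ /(_ m (leqnn m)) Hm] := near_invr_le (divr_gt0 del0 (ltr0n R 2)).
exists m => s sN b x v vm; apply: (Hdel v) => //.
rewrite -ball_normE/= sub0r normrN (le_lt_trans vm)// (le_lt_trans Hm)//.
by rewrite ltr_pdivrMr// mulr_natr mulr2n ltrDl.
Qed.

Lemma grid_eq n (a b : R) : grid n a = grid n b -> `|a - b| <= 2 * n.+1%:R^-1.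
Proof.
move=> E0; have -> : a - b = (a - gridR R n (grid n a)) - (b - gridR R n (grid n b)).
  by rewrite E0; ring.
by apply: le_trans (ler_normB _ _) _; rewrite mulr_natl mulr2n lerD// grid_dist.
Qed.

Lemma representative_approx N n j phi : annular j phi -> exists m c,
  forall s, (size s <= N)%N -> forall x,
    cn (mderive s (fun y => phi y - representative N n m j c y) x) <= 8 * n.+1%:R^-1.
Proof.
move=> aphi; have [m mphi] := exists_modulus N n aphi.
pose c := code N n m j phi; exists m, c => s sN x.
have [apsi mpsi cpsi] : [set phi | [/\ annular j phi, equicontinuous N n m phi &
    code N n m j phi = c]] (representative N n m j c) by apply: xgetPex; exists phi.
set psi := representative N n m j c in apsi mpsi cpsi *.
have [sphi _ _] := aphi; have [spsi _ _] := apsi.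
have sin := mem_multi_indices sN.
(* Equal rounded values at the grid point cost 2/(n+1), and each of the two moduli 1/(n+1); the real
   and imaginary parts together then give the factor 8. *)
have K b : `|pderivs s b phi x - pderivs s b psi x| <= 4 * n.+1%:R^-1.
  have [xj|jx] := leP `|x| j%:R; last first.
    by rewrite (pderivs_support _ _ aphi)// (pderivs_support _ _ apsi)// subrr normr0.
  have [p pin xp] := near_grid_point m xj.
  have px : p = x + (p - x) by rewrite addrC subrK.
  have pxm : `|p - x| <= m.+1%:R^-1 by rewrite distrC.
  have g : grid n (pderivs s b phi p) = grid n (pderivs s b psi p).
    have /eq_in_map/(_ (s, p)) : code N n m j phi = code N n m j psi by rewrite cpsi.
    have -> : (s, p) \in [seq (s, p) | s <- multi_indices d N, p <- grid_points m j].
      by apply/allpairsP; exists (s, p).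
    by move=> /(_ isT) [g1 g2]; case: b.
  have a1 := mphi s sin b x (p - x) pxm; rewrite -px in a1.
  have a2 := mpsi s sin b x (p - x) pxm; rewrite -px in a2.
  have a3 := grid_eq g.
  have -> : pderivs s b phi x - pderivs s b psi x = (pderivs s b phi p - pderivs s b psi p) -
     (pderivs s b phi p - pderivs s b phi x) + (pderivs s b psi p - pderivs s b psi x) by ring.
  apply: le_trans (ler_normD _ _) _; have := ler_normB (pderivs s b phi p - pderivs s b psi p)
    (pderivs s b phi p - pderivs s b phi x).
  move: a1 a2 a3; set q := n.+1%:R^-1; set A := `|_|; set A' := `|_|; set A'' := `|_|.
  by clearbody q A A' A''; lra.
have -> : 8 * n.+1%:R^-1 = 2 * (4 * n.+1%:R^-1) :> R by ring.
by apply: mderiveB_bound => // part [->|->]; [exact: (K true)|exact: (K false)].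
Qed.

(** On a fixed ball [T] is bounded by finitely many derivatives, so [T phi] differs by O(1/n) from
    its value on a representative, which is 0. *)
Lemma supported_in_ball (T : distributions R d) :
  (forall N n m j c, T (representative N n m j c) = 0) -> supported_in T [set x | `|x| <= r].
Proof.
move=> T0 phi [sphi [K [cK Kr K0]]].
have [M M0 HM] := compact_norm_bound cK.
pose j := (Num.truncn M).+1.
have Mj : M <= j%:R by apply: ltW; exact: truncnS_gt.
have aphi : annular j phi.
  split=> // x xr; apply: K0 => Kx; first by have := Kr x Kx; apply.
  by move: xr; rewrite ltNge (le_trans (HM _ Kx)).
have [N [B B0 HB]] := pairing_bound T (@compact_norm_le R d j%:R).
have bound n : cn (T phi) <= B * (8 * n.+1%:R^-1).
  have [m [c Hc]] := representative_approx N n aphi.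
  have apsi := annular_representative N n m j c.
  have [spsi _ p0] := apsi; have [_ _ q0] := aphi.
  have := pairingB T (annular_test aphi) (annular_test apsi).
  rewrite T0 subr0 => <-; apply: (HB _ _ (smoothB sphi spsi)); last exact: Hc.
  by move=> x /negP; rewrite -ltNge => jx; rewrite p0// q0// subrr.
have c0 : cn (T phi) <= 0.
  rewrite leNgt; apply/negP => Tp.
  have B1 : 0 < B * 8 + 1 by rewrite ltr_wpDl// mulr_ge0.
  have [n _ /(_ n (leqnn n)) Hn] := near_invr_le (divr_gt0 Tp B1).
  have := bound n; rewrite leNgt => /negP; apply.
  rewrite mulrA; apply: (@le_lt_trans _ _ (B * 8 * (cn (T phi) / (B * 8 + 1)))).
    by rewrite ler_wpM2l// mulr_ge0.
  by rewrite mulrA ltr_pdivrMr// [ltRHS]mulrC ltr_pM2r// ltrDl.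
have cT : cn (T phi) = 0 by apply/eqP; rewrite eq_le c0 cn_ge0.
by apply/eqP; rewrite -normr_eq0 normcE cT.
Qed.

End separability.

Section random_field.
Variables (R : realType) (d : nat).
Local Notation C := R[i].
Local Notation E := 'rV[R]_d.
Context (disp : measure_display) (Omega : measurableType disp).
Variable P : probability Omega R.
Variable f : Omega -> distributions R d.
Hypotheses (gf : gaussian_field P f) (cf : centered_field P f).
Implicit Types (psi phi : E -> C).

Lemma Re_pairing_gaussian psi : test_function setT psi ->
  gaussian_rv P (fun w => complex.Re (f w psi)) /\ \int[P]_w complex.Re (f w psi) = 0.
Proof.
move=> tp; split.
  have := gf tp 1 0; congr gaussian_rv; apply/funext => w.
  by rewrite mul1r mul0r addr0.
by have := cf tp => /(congr1 (@complex.Re R)) /=; rewrite unlock.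
Qed.

Lemma Im_pairing_gaussian psi : test_function setT psi ->
  gaussian_rv P (fun w => complex.Im (f w psi)) /\ \int[P]_w complex.Im (f w psi) = 0.
Proof.
move=> tp; split.
  have := gf tp 0 1; congr gaussian_rv; apply/funext => w.
  by rewrite mul1r mul0r add0r.
by have := cf tp => /(congr1 (@complex.Im R)) /=; rewrite unlock.
Qed.

Lemma centered_gaussian_L4 (X : Omega -> R) : gaussian_rv P X -> \int[P]_w X w = 0 -> L4 P X.
Proof. by move=> g e; split; [case: g|have [] := centered_gaussian_fourth_moment g e]. Qed.

Lemma L4_Re psi : test_function setT psi -> L4 P (fun w => complex.Re (f w psi)).
Proof. by move=> /Re_pairing_gaussian[]; exact: centered_gaussian_L4. Qed.

Lemma L4_Im psi : test_function setT psi -> L4 P (fun w => complex.Im (f w psi)).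
Proof. by move=> /Im_pairing_gaussian[]; exact: centered_gaussian_L4. Qed.

Lemma cexpectationM (u v : Omega -> C) :
  L4 P (fun w => complex.Re (u w)) -> L4 P (fun w => complex.Im (u w)) ->
  L4 P (fun w => complex.Re (v w)) -> L4 P (fun w => complex.Im (v w)) ->
  cexpectation P (fun w => u w * v w) =
  ((\int[P]_w (complex.Re (u w) * complex.Re (v w)) - \int[P]_w (complex.Im (u w) * complex.Im (v w))) +i*
   (\int[P]_w (complex.Re (u w) * complex.Im (v w)) + \int[P]_w (complex.Im (u w) * complex.Re (v w))))%C.
Proof.
move=> u1 u2 v1 v2; rewrite /cexpectation unlock; congr (_ +i* _)%C.
  transitivity (\int[P]_w (complex.Re (u w) * complex.Re (v w) - complex.Im (u w) * complex.Im (v w))).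
    by apply: eq_Rintegral => w _; rewrite ReM.
  by rewrite RintegralB//; exact: L4_integrableM.
transitivity (\int[P]_w (complex.Re (u w) * complex.Im (v w) + complex.Im (u w) * complex.Re (v w))).
  by apply: eq_Rintegral => w _; rewrite ImM.
by rewrite RintegralD//; exact: L4_integrableM.
Qed.

Lemma second_moment_null (X : Omega -> R) : L4 P X -> \int[P]_w (X w ^+ 2) = 0 ->
  {ae P, forall w, X w = 0}.
Proof.
move=> lX e; have i2 := L4_integrable_sqr lX; have [mX _] := lX.
have m2 : measurable_fun setT (EFin \o (fun w => X w ^+ 2)).
  by apply/measurable_EFinP; exact: measurable_funX.
have : (\int[P]_w `|(X w ^+ 2)%:E| = 0)%E.
  have fE : (\int[P]_w (X w ^+ 2)%:E)%E \is a fin_num := integrable_fin_num measurableT i2.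
  rewrite -[RHS]/(0%:E) -e /Rintegral fineK//; apply: eq_integral => w _.
  by rewrite gee0_abs// lee_fin sqr_ge0.
move=> /(ae_eq_integral_abs _ measurableT m2); apply: filterS => w /(_ Logic.I) /= [] /eqP.
by rewrite sqrf_eq0 => /eqP.
Qed.

Variables (m : R) (D : set E) (ac : E -> C) (sigma : E -> E -> C).
Hypotheses (Hsig : isotropic_symbol m D ac sigma) (Hcov : is_psido (covariance_op P f) sigma).

Lemma test_function_conj psi : test_function setT psi -> test_function setT (fun x => (psi x)^*).
Proof.
move=> [sp [K [cK _ K0]]]; split; first exact: smooth_conj.
by exists K; split=> // x /K0 ->; rewrite conjC0.
Qed.

Lemma Rd_integral0 (g : E -> C) : (forall x, g x = 0) -> Rd_integral g = 0.
Proof.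
move=> g0; have -> : g = fun=> 0 by apply/funext.
by apply: eq_complex_parts => /=; rewrite /Rintegral integral0.
Qed.

(** The second moment of |<f, psi>| is the covariance operator at conj psi paired with psi. The
    symbol vanishes off D and psi vanishes on D, so this moment is 0. *)
Lemma pairing_null psi : test_function setT psi -> (forall x, D x -> psi x = 0) ->
  {ae P, forall w, f w psi = 0}.
Proof.
move=> tp p0; have [_ sD _ _] := Hsig.
have := Hcov (test_function_conj tp) tp.
rewrite [RHS]Rd_integral0; last first.
  move=> x; have [Dx|nDx] := pselect (D x); first by rewrite p0// mulr0.
  rewrite /psido [Rd_integral _]Rd_integral0 ?mulr0 ?mul0r// => xi.
  have [_ [K [_ KD K0]]] := sD xi; rewrite K0 ?mulr0 ?mul0r//.
  by move=> /KD.
rewrite /covariance_op.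
have -> : (fun x => ((psi x)^*)^*) = psi by apply/funext => x; rewrite conjCK.
have lR := L4_Re tp; have lI := L4_Im tp.
have lNI : L4 P (fun w => - complex.Im (f w psi)).
  have [mI iI] := lI; split; first exact: measurableT_comp.
  by move: iI; congr integrable; apply/funext => w /=; congr EFin; ring.
rewrite cexpectationM//; last 2 first.
- by move: lR; congr L4; apply/funext => w; rewrite Re_conj.
- by move: lNI; congr L4; apply/funext => w; rewrite Im_conj.
move=> /(congr1 (@complex.Re R)) /=.
under eq_Rintegral do rewrite Re_conj -expr2.
have -> : \int[P]_w (complex.Im (f w psi)^* * complex.Im (f w psi)) =
    - \int[P]_w (complex.Im (f w psi) ^+ 2).
  rewrite -mulN1r -(RintegralZl (-1) measurableT (L4_integrable_sqr lI)).
  by apply: eq_Rintegral => w _; rewrite Im_conj expr2; ring.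
rewrite opprK => S0.
have R0 : 0 <= \int[P]_w (complex.Re (f w psi) ^+ 2) by apply: Rintegral_ge0 => w _; exact: sqr_ge0.
have I0 : 0 <= \int[P]_w (complex.Im (f w psi) ^+ 2) by apply: Rintegral_ge0 => w _; exact: sqr_ge0.
have Rz : \int[P]_w (complex.Re (f w psi) ^+ 2) = 0 by lra.
have Iz : \int[P]_w (complex.Im (f w psi) ^+ 2) = 0 by lra.
apply: filterS2 (second_moment_null lR Rz) (second_moment_null lI Iz) => w w1 w2.
exact: eq_complex_parts.
Qed.

Lemma ae_countable (K : countType) (Q : K -> Omega -> Prop) :
  (forall k, {ae P, forall w, Q k w}) -> {ae P, forall w, forall k, Q k w}.
Proof.
move=> HQ.
have : {ae P, forall w, forall n, forall k : K, unpickle n = Some k -> Q k w}.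
  apply: ae_foralln => n; case En : (unpickle n) => [k|]; last by apply: aeW.
  by apply: filterS (HQ k) => w Qk k' [<-].
by apply: filterS => w H k; apply: (H (pickle k)); rewrite pickleK.
Qed.

(** The null set of [pairing_null] depends on the test function; the representatives form a
    countable family, so one null set serves for all of them, and [supported_in_ball] extends the
    conclusion to every test function. *)
Lemma supported_in_ball_ae (r : R) : (forall x, D x -> `|x| <= r) ->
  {ae P, forall w, supported_in (f w) [set x | `|x| <= r]}.
Proof.
move=> Dr.
have : {ae P, forall w, forall k : nat * nat * nat * nat * seq (int * int),
    f w (@representative R d r k.1.1.1.1 k.1.1.1.2 k.1.1.2 k.1.2 k.2) = 0}.
  apply: (@ae_countable _ (fun k w => f w (@representative R d r k.1.1.1.1 k.1.1.1.2 k.1.1.2 k.1.2 k.2) = 0)).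
  move=> k; have a := @annular_representative R d r k.1.1.1.1 k.1.1.1.2 k.1.1.2 k.1.2 k.2.
  apply: pairing_null; first exact: annular_test a.
  by case: a => _ p0 _ x /Dr /p0.
apply: filterS => w H; apply: supported_in_ball => N n mm j c.
exact: (H (N, n, mm, j, c)).
Qed.

End random_field.


(** * Ergodic means of products of jointly Gaussian processes *)

Section cesaro.
Variable R : realType.
Local Notation mu := (@lebesgue_measure R).

Lemma cvg_window_mean (e : R -> R) (l B : R) : measurable_fun setT (e : measurableTypeR R -> R) ->
  (forall r, `|e r| <= B) -> e r @[r --> +oo] --> l ->
  Q^-1 * \int[mu]_(r in `[Q, 2 * Q]) e r @[Q --> +oo] --> l.
Proof.
move=> me eB el; apply/cvgrPdist_le => eps eps0.
have /cvgrPdist_le/(_ _ eps0) [M [_ HM]] := el.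
near=> Q.
have Q0 : 0 < Q by near: Q; apply: nbhs_pinfty_gt; exact: num_real.
have QM : M < Q by near: Q; apply: nbhs_pinfty_gt; exact: num_real.
have mI : mu `[Q, 2 * Q]%classic = Q%:E.
  rewrite lebesgue_measure_itv/= lte_fin ltr_pMl// ltr1n.
  by rewrite -EFinD; congr EFin; ring.
have icst (c : R) : mu.-integrable `[Q, 2 * Q] (EFin \o cst c).
  exact: (@continuous_integrable_itv R (cst c) Q (2 * Q) (@cst_continuous _ _ _)).
have ie : mu.-integrable `[Q, 2 * Q] (EFin \o e).
  apply: (le_integrable _ _ _ (icst B)) => //.
    by apply/measurable_EFinP; exact: measurable_funTS.
  by move=> r _ /=; rewrite lee_fin (le_trans (eB r))// ler_norm.
have cE (c : R) : \int[mu]_(r in `[Q, 2 * Q]) cst c r = c * Q.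
  by rewrite Rintegral_cst//; have /= -> := mI.
have -> : l - Q^-1 * \int[mu]_(r in `[Q, 2 * Q]) e r =
    Q^-1 * \int[mu]_(r in `[Q, 2 * Q]) (l - e r).
  rewrite (RintegralB _ (icst l) ie)// cE; field; exact: lt0r_neq0.
rewrite normrM gtr0_norm ?invr_gt0// mulrC ler_pdivrMr//.
have il : mu.-integrable `[Q, 2 * Q] (EFin \o (fun r => l - e r)).
  by apply: (integrableB _ (icst l) ie); exact: measurable_itv.
apply: le_trans (le_normr_Rintegral _ il) _ => //.
apply: (@le_trans _ _ (\int[mu]_(r in `[Q, 2 * Q]) cst eps r)); last by rewrite cE.
apply: le_Rintegral; [exact: measurable_itv|exact: (integrable_norm il)|exact: icst|].
move=> r; rewrite /= in_itv/= => /andP[Qr _]; apply: HM; exact: lt_le_trans Qr.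
Unshelve. all: by end_near. Qed.

End cesaro.

Section product_ergodic.
Context (R : realType) (disp : measure_display) (T : measurableType disp).
Variable P : probability T R.
Local Notation mu := (@lebesgue_measure R).
Variables (X Y : R -> T -> R) (C l : R).
Hypotheses (cX : forall w, continuous (X ^~ w)) (cY : forall w, continuous (Y ^~ w)).
Hypotheses (X1 : forall r, X r = X (Num.max r 1)) (Y1 : forall r, Y r = Y (Num.max r 1)).
Hypothesis gXY : forall r r' a b a' b' : R,
  gaussian_rv P (fun w => a * X r w + b * Y r w + (a' * X r' w + b' * Y r' w)) /\
  \int[P]_w (a * X r w + b * Y r w + (a' * X r' w + b' * Y r' w)) = 0.
Hypothesis covXY : forall U V : R -> T -> R, (U = X \/ U = Y) -> (V = X \/ V = Y) ->
  forall r r', 1 <= r -> 1 <= r' ->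
  `|\int[P]_w (U r w * V r' w)| <= C * ((1 + `|r - r'|)^-1 + r^-1 + r'^-1).
Hypothesis limXY : \int[P]_w (X r w * Y r w) @[r --> +oo] --> l.

Let gXY4 r a b : gaussian_rv P (fun w => a * X r w + b * Y r w) /\
  \int[P]_w (a * X r w + b * Y r w) = 0.
Proof.
have [g e] := gXY r r a b 0 0.
have E : (fun w => a * X r w + b * Y r w + (0 * X r w + 0 * Y r w)) =
    fun w => a * X r w + b * Y r w by apply/funext => w; ring.
by move: g e; rewrite E.
Qed.

Let lXY r a b : L4 P (fun w => a * X r w + b * Y r w).
Proof.
have [g e] := gXY4 r a b; split; first by case: g.
by have [] := centered_gaussian_fourth_moment g e.
Qed.

Let lX r : L4 P (X r).
Proof. by have := lXY r 1 0; congr L4; apply/funext => w; ring. Qed.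

Let lY r : L4 P (Y r).
Proof. by have := lXY r 0 1; congr L4; apply/funext => w; ring. Qed.

Let C0 : 0 <= C.
Proof.
have := covXY (or_introl (erefl X)) (or_introl (erefl X)) (lexx 1) (lexx 1).
move=> /(le_trans (normr_ge0 _)); rewrite subrr normr0 addr0 invr1.
by rewrite pmulr_lge0//; lra.
Qed.

(** X + Y for [false] and X - Y for [true]; the product XY is a quarter of the difference of their
    squares. *)
Let A (s : bool) r w : R := X r w + (-1) ^+ s * Y r w.

Let EAA s r r' : \int[P]_w (A s r w * A s r' w) =
  \int[P]_w (X r w * X r' w) + (-1) ^+ s * \int[P]_w (X r w * Y r' w) +
  (-1) ^+ s * \int[P]_w (Y r w * X r' w) + \int[P]_w (Y r w * Y r' w).
Proof.
have i1 := L4_integrableM (lX r) (lX r').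
have i2 := L4_integrableM (lX r) (lY r').
have i3 := L4_integrableM (lY r) (lX r').
have i4 := L4_integrableM (lY r) (lY r').
have z2 := integrableZl measurableT ((-1) ^+ s) i2.
have z3 := integrableZl measurableT ((-1) ^+ s) i3.
have i12 := integrableD measurableT i1 z2.
have i123 := integrableD measurableT i12 z3.
rewrite -(RintegralZl _ measurableT i2) -(RintegralZl _ measurableT i3).
rewrite -(RintegralD measurableT i1 z2) -(RintegralD measurableT i12 z3).
rewrite -(RintegralD measurableT i123 i4).
apply: eq_Rintegral => w _; rewrite /A.
have s2 : (-1) ^+ s * (-1) ^+ s = 1 :> R by rewrite -expr2 sqrr_sign.
have -> : Y r w * Y r' w = ((-1) ^+ s * (-1) ^+ s) * (Y r w * Y r' w) by rewrite s2 mul1r.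
by ring.
Qed.

Let bound_AA s r r' : 1 <= r -> 1 <= r' ->
  `|\int[P]_w (A s r w * A s r' w)| <= 4 * C * ((1 + `|r - r'|)^-1 + r^-1 + r'^-1).
Proof.
move=> r1 r1'; rewrite EAA.
have h1 := covXY (or_introl (erefl X)) (or_introl (erefl X)) r1 r1'.
have h2 := covXY (or_introl (erefl X)) (or_intror (erefl Y)) r1 r1'.
have h3 := covXY (or_intror (erefl Y)) (or_introl (erefl X)) r1 r1'.
have h4 := covXY (or_intror (erefl Y)) (or_intror (erefl Y)) r1 r1'.
apply: le_trans (ler_normD _ _) _.
apply: le_trans (lerD (ler_normD _ _) h4) _.
apply: le_trans (lerD (lerD (ler_normD _ _) (lexx _)) (lexx _)) _.
rewrite !normrM !normrX !normrN !normr1 !expr1n !mul1r; lra.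
Qed.

(** Squaring makes the decay integrable. The constant is 4^2 from [bound_AA], times 3 from (a + b +
    c)^2 <= 3 (a^2 + b^2 + c^2), times 2 from x^-2 <= 2 / (1 + x^2) for x >= 1. *)
Let cov_AA s r r' : 1 <= r -> 1 <= r' ->
  (\int[P]_w (A s r w * A s r' w)) ^+ 2 <=
  96 * C ^+ 2 * (cauchy_kernel r r' + cauchy_kernel 0 r' + cauchy_kernel 0 r).
Proof.
move=> r1 r1'; have H := bound_AA s r1 r1'.
rewrite -real_normK ?num_real//.
apply: (@le_trans _ _ ((4 * C * ((1 + `|r - r'|)^-1 + r^-1 + r'^-1)) ^+ 2)).
  by rewrite ler_sqr ?nnegrE// (le_trans _ H).
have k0 a x := @cauchy_kernel_ge0 R a x.
have u : (1 + `|r - r'|)^-1 ^+ 2 <= cauchy_kernel r r'.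
  rewrite exprVn lef_pV2 ?posrE ?exprn_gt0 ?ltr_pwDl ?sqr_ge0//.
  rewrite distrC -[(r' - r) ^+ 2]real_normK ?num_real//.
  by have := normr_ge0 (r' - r); nra.
have v (x : R) : 1 <= x -> x^-1 ^+ 2 <= 2 * cauchy_kernel 0 x.
  move=> x1; have x0 : 0 < x := lt_le_trans ltr01 x1.
  have x2 : 0 < x ^+ 2 by rewrite exprn_gt0.
  rewrite /cauchy_kernel subr0 exprVn ler_pdivlMr ?ltr_wpDl// [_^-1 * _]mulrC ler_pdivrMr//.
  by nra.
have := v r r1; have := v r' r1'; move: u.
have := k0 r r'; have := k0 0 r'; have := k0 0 r.
set a := (1 + _)^-1; set b := r^-1; set c := r'^-1.
move: (cauchy_kernel _ _) (cauchy_kernel 0 r') (cauchy_kernel 0 r) => ka kb kc.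
move=> c1 c2 c3 h1 h2 h3.
have h : (a + b + c) ^+ 2 <= 3 * (ka + 2 * kb + 2 * kc).
  have := sqr_ge0 (a - b); have := sqr_ge0 (a - c); have := sqr_ge0 (b - c); nra.
rewrite exprMn; apply: (@le_trans _ _ ((4 * C) ^+ 2 * (3 * (ka + 2 * kb + 2 * kc)))).
  by rewrite ler_wpM2l ?sqr_ge0.
have C2 := sqr_ge0 C; rewrite exprMn.
have -> : 96 * C ^+ 2 * (ka + kb + kc) = C ^+ 2 * (96 * (ka + kb + kc)) by ring.
have -> : 4 ^+ 2 * C ^+ 2 * (3 * (ka + 2 * kb + 2 * kc)) =
  C ^+ 2 * (48 * (ka + 2 * kb + 2 * kc)) by ring.
by rewrite ler_wpM2l//; lra.
Qed.

Let A1 s r : A s r = A s (Num.max r 1).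
Proof. by apply/funext => w; rewrite /A X1 Y1. Qed.

Let V s r := \int[P]_w (A s r w ^+ 2).

Let VB s r : V s r <= 12 * C.
Proof.
rewrite /V A1; set t := Num.max r 1.
have t1 : 1 <= t by rewrite le_max lexx orbT.
under eq_Rintegral do rewrite expr2.
apply: le_trans (ler_norm _) _; apply: le_trans (bound_AA s t1 t1) _.
rewrite subrr normr0 addr0 invr1.
have : t^-1 <= 1 by rewrite invf_le1// (lt_le_trans ltr01).
by move=> /(ler_wpM2l C0); rewrite mulr1; lra.
Qed.

Let cA s w : continuous (A s ^~ w).
Proof.
move=> r; apply: cvgD; first exact: cX.
by apply: cvgM; [exact: cvg_cst|exact: cY].
Qed.

Let mA s r : measurable_fun setT (A s r).
Proof.
apply: measurable_funD; first by case: (lX r).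
by apply: measurable_funM; [exact: measurable_cst|case: (lY r)].
Qed.

Let gA s r r' a b : gaussian_rv P (fun w => a * A s r w + b * A s r' w) /\
  \int[P]_w (a * A s r w + b * A s r' w) = 0.
Proof.
have [g e] := gXY r r' a (a * (-1) ^+ s) b (b * (-1) ^+ s).
have E : (fun w => a * A s r w + b * A s r' w) = fun w => a * X r w + a * (-1) ^+ s * Y r w +
   (b * X r' w + b * (-1) ^+ s * Y r' w) by apply/funext => w; rewrite /A; ring.
by rewrite E.
Qed.

Let E2 r := \int[P]_w (X r w * Y r w).

Let E2E r : E2 r = 4^-1 * (V false r - V true r).
Proof.
have e s : V s r = \int[P]_w (A s r w * A s r w) by apply: eq_Rintegral => w _; rewrite expr2.
rewrite !e !EAA /=.
have -> : \int[P]_w (Y r w * X r w) = E2 r by apply: eq_Rintegral => w _; rewrite mulrC.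
by rewrite -/(E2 r) expr0 expr1; field.
Qed.

Lemma cvg_mean_gaussian_product :
  {ae P, forall w, Q^-1 * \int[mu]_(r in `[Q, 2 * Q]) (X r w * Y r w) @[Q --> +oo] --> l}.
Proof.
have C20 : 0 <= 96 * C ^+ 2 by rewrite mulr_ge0// sqr_ge0.
have H s := cvg_mean_gaussian_squares (@cA s) (@mA s) (@gA s) (@VB s) C20 (@cov_AA s).
apply: filterS2 (H false) (H true) => w H0 H1.
have mV s : measurable_fun setT (V s : measurableTypeR R -> R).
  exact: measurable_second_moment (@cA s) (@mA s).
have V0 s r : 0 <= V s r by apply: Rintegral_ge0 => w' _; exact: sqr_ge0.
have mE : measurable_fun setT (E2 : measurableTypeR R -> R).
  have -> : E2 = fun r => 4^-1 * (V false r - V true r) by apply/funext => r; exact: E2E.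
  apply: measurable_funM; first exact: measurable_cst.
  exact: measurable_funB.
have EB r : `|E2 r| <= 12 * C.
  rewrite E2E ler_norml; have := VB false r; have := VB true r.
  by have := V0 false r; have := V0 true r; lra.
have HE := cvg_window_mean mE EB limXY.
have G (f1 f2 f3 : R -> R) : f1 Q @[Q --> +oo] --> (0 : R) -> f2 Q @[Q --> +oo] --> (0 : R) ->
    f3 Q @[Q --> +oo] --> l -> 4^-1 * (f1 Q - f2 Q) + f3 Q @[Q --> +oo] --> l.
  move=> c1 c2 c3; rewrite -[l]add0r -(mulr0 4^-1) -[X in 4^-1 * X](subrr 0).
  by apply: cvgD c3; apply: cvgM; [exact: cvg_cst|exact: cvgB c1 c2].
have := G _ _ _ H0 H1 HE.
have -> // : (fun Q => 4^-1 * (Q^-1 * \int[mu]_(r in `[Q, 2 * Q]) (A false r w ^+ 2 - V false r) -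
    Q^-1 * \int[mu]_(r in `[Q, 2 * Q]) (A true r w ^+ 2 - V true r)) +
    Q^-1 * \int[mu]_(r in `[Q, 2 * Q]) E2 r) =
    fun Q => Q^-1 * \int[mu]_(r in `[Q, 2 * Q]) (X r w * Y r w).
apply/funext => Q.
have bd (e : R -> R) : measurable_fun setT (e : measurableTypeR R -> R) ->
    (forall r, `|e r| <= 12 * C) -> mu.-integrable `[Q, 2 * Q] (EFin \o e).
  move=> me eB; have ci := @continuous_integrable_itv R (cst (12 * C)) Q (2 * Q) (@cst_continuous _ _ _).
  apply: (le_integrable _ _ _ ci) => //.
    by apply/measurable_EFinP; exact: measurable_funTS.
  by move=> r _ /=; rewrite lee_fin (le_trans (eB r))// ler_norm.
have iA s : mu.-integrable `[Q, 2 * Q] (EFin \o (fun r => A s r w ^+ 2)).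
  apply: continuous_integrable_itv => r.
  apply: (@continuous_comp _ _ _ (A s ^~ w) (fun u => u ^+ 2)); first exact: cA.
  exact: exprn_continuous.
have iV s : mu.-integrable `[Q, 2 * Q] (EFin \o V s).
  by apply: bd => // r; rewrite ger0_norm.
have iE : mu.-integrable `[Q, 2 * Q] (EFin \o E2) by exact: bd.
rewrite !RintegralB//.
have -> : \int[mu]_(r in `[Q, 2 * Q]) E2 r =
    4^-1 * (\int[mu]_(r in `[Q, 2 * Q]) V false r - \int[mu]_(r in `[Q, 2 * Q]) V true r).
  rewrite -RintegralB// -RintegralZl//; last exact: (integrableB _ (iV false) (iV true)).
  by apply: eq_Rintegral => r _; rewrite E2E.
have -> : \int[mu]_(r in `[Q, 2 * Q]) (X r w * Y r w) =
    4^-1 * (\int[mu]_(r in `[Q, 2 * Q]) (A false r w ^+ 2) - \int[mu]_(r in `[Q, 2 * Q]) (A true r w ^+ 2)).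
  rewrite -RintegralB// -RintegralZl//; last exact: (integrableB _ (iA false) (iA true)).
  by apply: eq_Rintegral => r _; rewrite /A/= expr0 expr1; field.
by repeat move: (Rintegral _ _ _) => ?; ring.
Qed.

End product_ergodic.

(** * Power weights and complex limits *)

Section weights.
Variable R : realType.
Implicit Types (r s t p x : R).

Lemma powR_divK x t p : 0 < x -> 0 < t -> x `^ p = (x / t) `^ p * t `^ p.
Proof. by move=> x0 t0; rewrite -powRM ?divr_ge0 ?ltW// divfK// gt_eqF. Qed.

Lemma ler_powR2r p x t : 0 <= p -> 0 <= x -> x <= t -> x `^ p <= t `^ p.
Proof. by move=> p0 x0 xt; apply: ge0_ler_powR; rewrite ?nnegrE// (le_trans x0). Qed.

Lemma powR_le1 p x : 0 <= p -> 0 <= x -> x <= 1 -> x `^ p <= 1.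
Proof. by move=> p0 x0 x1; have := ler_powR2r p0 x0 x1; rewrite powR1. Qed.

Lemma continuous_powR_comp (h : R -> R) p : continuous h -> (forall r, 0 < h r) ->
  continuous (fun r => h r `^ p).
Proof.
move=> ch h0 r; apply: (@continuous_comp _ _ _ h (fun x => x `^ p)); first exact: ch.
exact: is_derive1_continuous (is_derive1_powR p (h0 r)).
Qed.

(* Swapping the two frequencies when m < 0 makes one bound serve both signs of m. *)
Lemma powR_half_weight m x t : 0 < x -> 0 < t -> (0 <= m -> t <= x) -> (m < 0 -> x <= t) ->
  x `^ (m / 2) * t `^ (m / 2) * x `^ (- m) <= 1.
Proof.
move=> x0 t0 hp hn.
have -> : x `^ (m / 2) * t `^ (m / 2) * x `^ (- m) = t `^ (m / 2) / x `^ (m / 2).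
  have -> : - m = - (m / 2) + - (m / 2) by field.
  have xn : x != 0 by rewrite gt_eqF.
  have xp : x `^ (m / 2) != 0 by rewrite gt_eqF// powR_gt0.
  by rewrite powRD ?xn ?implybT// powRN; field.
rewrite ler_pdivrMr ?powR_gt0// mul1r.
have [m0|m0] := leP 0 m; first by apply: ler_powR2r; [lra|exact: ltW|exact: hp].
have -> : m / 2 = - (- m / 2) by field.
rewrite !powRN lef_pV2 ?posrE ?powR_gt0//; apply: ler_powR2r; [lra|exact: ltW|exact: hn].
Qed.

(** For m >= 0 the quotient r / (r + t) is at most 1; for m < 0 its inverse is at most 1 + t because
    r >= 1. *)
Lemma powR_shift m t r : 0 <= t -> 1 <= r ->
  r `^ (m / 2) <= (1 + t) `^ (`|m| / 2) * (r + t) `^ (m / 2).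
Proof.
move=> t0 r1; have r0 : 0 < r by lra.
have rt0 : 0 < r + t by lra.
have p0 : 0 <= (r + t) `^ (m / 2) by exact: powR_ge0.
rewrite (powR_divK (m / 2) r0 rt0) ler_wpM2r//.
have q0 : 0 < r / (r + t) by rewrite divr_gt0.
have q1 : r / (r + t) <= 1 by rewrite ler_pdivrMr// mul1r; lra.
have [m0|m0] := leP 0 m.
  rewrite (ger0_norm m0); apply: (@le_trans _ _ 1); first by apply: powR_le1 => //; lra.
  have m2 : 0 <= m / 2 by lra.
  by have := ler_powR2r m2 ler01 (_ : 1 <= 1 + t); rewrite powR1; apply; lra.
rewrite (ltr0_norm m0) (_ : m / 2 = - (- m / 2)); last by field.
rewrite powRN (_ : (_ `^ _)^-1 = ((r + t) / r) `^ (- m / 2)).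
  apply: ler_powR2r; first by lra.
    by rewrite divr_ge0// ltW.
  by rewrite ler_pdivrMr//; nra.
have z0 : 0 < (r / (r + t)) `^ (- m / 2) by rewrite powR_gt0.
apply: (mulfI (lt0r_neq0 z0)); rewrite mulfV ?gt_eqF// -powRM ?ltW//; last by rewrite divr_gt0.
by rewrite (_ : r / (r + t) * ((r + t) / r) = 1) ?powR1//; field; rewrite !gt_eqF.
Qed.

Lemma cvg_powR_shift p t : 0 <= t ->
  (Num.max r 1) `^ p * (Num.max r 1 + t) `^ (- p) @[r --> +oo] --> (1 : R).
Proof.
move=> t0.
have c1 : r / (r + t) @[r --> +oo] --> (1 : R).
  have -> : (1 : R) = 1 - t * 0 by rewrite mulr0 subr0.
  have ct : (r + t)^-1 @[r --> +oo] --> (0 : R).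
    apply/cvgr0Pnorm_le => e e0; near=> r.
    have r1 : e^-1 <= r by near: r; apply: nbhs_pinfty_ge; exact: num_real.
    have e1 : 0 < e^-1 by rewrite invr_gt0.
    have rt : 0 < r + t by lra.
    rewrite gtr0_norm ?invr_gt0// -[leRHS]invrK.
    by rewrite lef_pV2 ?posrE//; lra.
  have c2 : 1 - t * (r + t)^-1 @[r --> +oo] --> 1 - t * 0.
    by apply: cvgB; [exact: cvg_cst|apply: cvgM; [exact: cvg_cst|exact: ct]].
  apply: cvg_trans c2; apply: near_eq_cvg; near=> r.
  have r1 : 1 <= r by near: r; apply: nbhs_pinfty_ge; exact: num_real.
  by rewrite /=; field; rewrite gt_eqF//; lra.
have : (r / (r + t)) `^ p @[r --> +oo] --> (1 `^ p : R).
  apply: (@cvg_comp _ _ _ (fun r => r / (r + t)) (fun x => x `^ p) _ _ _ c1).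
  exact: is_derive1_continuous (is_derive1_powR p ltr01).
rewrite powR1; apply: cvg_trans; apply: near_eq_cvg; near=> r.
have r1 : 1 <= r by near: r; apply: nbhs_pinfty_ge; exact: num_real.
rewrite /Num.max ltNge r1/= powRN (powR_divK p (x := r) (t := r + t)); [|lra|lra].
by rewrite mulfK// gt_eqF// powR_gt0; lra.
Unshelve. all: by end_near. Qed.

Lemma inv_dist_shift (t r r' k k' : R) : 0 <= t ->
  `|(`|k| - r)| <= t -> `|(`|k'| - r')| <= t ->
  (1 + `|(`|k| - `|k'|)|)^-1 <= (1 + 2 * t) * (1 + `|r - r'|)^-1.
Proof.
move=> t0 kr kr'.
have h : `|r - r'| <= `|(`|k| - `|k'|)| + 2 * t.
  have -> : r - r' = (`|k| - `|k'|) - (`|k| - r) + (`|k'| - r') by ring.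
  apply: le_trans (ler_normD _ _) _; have := ler_normB (`|k| - `|k'|) (`|k| - r); lra.
rewrite -[leLHS]mul1r ler_pdivrMr ?ltr_pwDl// mulrAC ler_pdivlMr ?ltr_pwDl// mul1r.
by have := normr_ge0 (`|k| - `|k'|); move: h; set u := `|_ - r'|; set v := `|_|; nra.
Qed.

End weights.

Section complex_limits.
Variable R : realType.
Local Notation C := R[i].
Local Notation mu := (@lebesgue_measure R).

Lemma cvg_complex (p q : R -> R) (F : R -> C) (A : C) (p0 q0 : R) :
  p Q @[Q --> +oo] --> p0 -> q Q @[Q --> +oo] --> q0 ->
  (\forall Q \near +oo, F Q = A * (p Q +i* q Q)%C) ->
  F Q @[Q --> +oo] --> (A * (p0 +i* q0)%C : C^o).
Proof.
move=> cp cq FE; apply/(@cvgrPdist_le _ C^o) => e e0.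
have eE : e = (complex.Re e)%:C%C.
  by move: e0; rewrite ltcE => /andP[/eqP ei _]; apply: eq_complex_parts.
have e1 : 0 < complex.Re e by move: e0; rewrite eE ltcR.
pose e' := complex.Re e / (2 * (cn A + 1)).
have A1 : 0 < cn A + 1 by rewrite ltr_wpDl// cn_ge0.
have e'0 : 0 < e' by rewrite divr_gt0// mulr_gt0.
near=> Q; rewrite (near FE Q)//.
rewrite eE lec_cn -mulrBr cnM.
have h1 : `|p0 - p Q| <= e' by near: Q; exact: (cvgr_dist_le _ _ cp).
have h2 : `|q0 - q Q| <= e' by near: Q; exact: (cvgr_dist_le _ _ cq).
have h : cn ((p0 +i* q0)%C - (p Q +i* q Q)%C) <= 2 * e'.
  by apply: le_trans (cn_le _) _; rewrite /=; lra.
apply: (@le_trans _ _ (cn A * (2 * e'))); first by rewrite ler_wpM2l ?cn_ge0.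
have -> : 2 * e' = complex.Re e / (cn A + 1) by rewrite /e'; field; rewrite gt_eqF.
by rewrite mulrA ler_pdivrMr// mulrC ler_pM2l// lerDl.
Unshelve. all: by end_near. Qed.

Lemma Rintegral_itv_linear (a b x y : R) (u v : R -> R) : continuous u -> continuous v ->
  \int[mu]_(t in `[a, b]) (x * u t + y * v t) =
  x * \int[mu]_(t in `[a, b]) u t + y * \int[mu]_(t in `[a, b]) v t.
Proof.
move=> cu cv.
have iZ (z : R) (h : R -> R) : continuous h ->
    \int[mu]_(t in `[a, b]) (z * h t) = z * \int[mu]_(t in `[a, b]) h t.
  by move=> ch; rewrite RintegralZl//; exact: continuous_integrable_itv.
rewrite RintegralD ?iZ//.
  by apply: continuous_integrable_itv => t; apply: cvgM; [exact: cvg_cst|exact: cu].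
by apply: continuous_integrable_itv => t; apply: cvgM; [exact: cvg_cst|exact: cv].
Qed.

Lemma cintegralZ_itv (a b : R) (A : C) (u v : R -> R) (g : R -> C) :
  continuous u -> continuous v ->
  (forall t, a <= t <= b -> g t = A * (u t +i* v t)%C) ->
  cintegral mu `[a, b]%classic g =
  A * (\int[mu]_(t in `[a, b]) u t +i* \int[mu]_(t in `[a, b]) v t)%C.
Proof.
move=> cu cv gE; apply: eq_complex_parts; rewrite ?ReM ?ImM/=.
  rewrite -mulNr -Rintegral_itv_linear//; apply: eq_Rintegral => t; rewrite inE/= in_itv/= => tI.
  by rewrite gE// ReM mulNr.
rewrite addrC -Rintegral_itv_linear//; apply: eq_Rintegral => t; rewrite inE/= in_itv/= => tI.
by rewrite gE// ImM addrC.
Qed.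

Lemma weighted_product_conj (p p1 p2 : R) (a z1 z2 : C) :
  p%:C%C * ((- a * p1%:C%C * z1) * (- a * p2%:C%C * z2)^*) =
  `|a| ^+ 2 * ((p * p1 * p2)%:C%C * (z1 * z2^*)).
Proof.
rewrite normCK (_ : (- a * p2%:C%C * z2)^* = - a^* * p2%:C%C * z2^*); last first.
  apply: eq_complex_parts; rewrite !(ReM, ImM, Re_conj, Im_conj, ReN, ImN)/=; ring.
by rewrite !rmorphM/=; ring.
Qed.

Lemma weighted_product (p p1 p2 : R) (a z1 z2 : C) :
  p%:C%C * ((- a * p1%:C%C * z1) * (- a * p2%:C%C * z2)) =
  a ^+ 2 * ((p * p1 * p2)%:C%C * (z1 * z2)).
Proof. by rewrite expr2 !rmorphM/=; ring. Qed.

End complex_limits.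

(** * The far field as a Gaussian process *)

Section far_field_process.
Variables (R : realType) (d : nat).
Local Notation C := R[i].
Local Notation E := 'rV[R]_d.
Local Notation mu := (@lebesgue_measure R).
Context (disp : measure_display) (Omega : measurableType disp).
Variable P : probability Omega R.
Variable f : Omega -> distributions R d.
Hypotheses (gf : gaussian_field P f) (cf : centered_field P f).
Variables (m : R) (D : set E) (ac ar : E -> C) (sc sr : E -> E -> C).
Hypotheses (Hc : isotropic_symbol m D ac sc) (Hcov : is_psido (covariance_op P f) sc).
Hypotheses (Hr : isotropic_symbol m D ar sr) (Hrel : is_psido (relation_op P f) sr).
Variables (c : R -> R) (M : R) (xhat : E).
Hypotheses (M0 : 0 <= M) (bc : bump_on M c) (x1 : enorm xhat = 1).
Hypothesis cD : forall x, D x -> chi c x = 1.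

Definition packet (k : R) : E -> C := fun y => chi c y * wave xhat k y.

Lemma smooth_packet k : smooth (packet k).
Proof. exact: smoothM (@smooth_chi R d c M bc) (smooth_wave xhat k). Qed.

Lemma chi_eq0 (x : E) : M < `|x| -> chi c x = 0.
Proof.
move=> Mx; rewrite /chi; have -> : \prod_i c (x 0 i) = 0; last by [].
apply/eqP/negPn/negP => H; move: Mx; rewrite ltNge => /negP; apply.
apply: norm_le_coord => // i; rewrite leNgt; apply/negP => Mi.
by move/negP: H; apply; apply/prodf_eq0; exists i => //; rewrite bc.2.
Qed.

Lemma test_packet k : test_function setT (packet k).
Proof.
apply: (test_function_ball (M := M)) (smooth_packet k) _ => x Mx.
by rewrite /packet chi_eq0// mul0r.
Qed.

Lemma packet_conj k x : (packet k x)^* = packet (- k) x.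
Proof.
rewrite /packet (_ : (chi c x * wave xhat k x)^* = (chi c x)^* * (wave xhat k x)^*); last exact: rmorphM.
congr (_ * _).
  by rewrite /chi; apply: eq_complex_parts; rewrite ?Re_conj ?Im_conj/= ?oppr0.
by rewrite /wave conj_cis mulNr.
Qed.

Definition part (b : bool) (z : C) : R := if b then complex.Re z else complex.Im z.

Definition packet_value k w : C := f w (packet k).

Lemma partE b z : part b z = complex.Re ((if b then 1 else (0 +i* -1)%C) * z).
Proof. by case: b; rewrite ReM /=; ring. Qed.

Lemma L4_part b k : L4 P (fun w => part b (packet_value k w)).
Proof. by case: b; [exact: L4_Re (test_packet k)|exact: L4_Im (test_packet k)]. Qed.

Lemma pairingZ (T : distributions R d) (a : C) phi : test_function setT phi ->
  test_function setT (fun x => a * phi x) /\ T (fun x => a * phi x) = a * T phi.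
Proof.
move=> tp; have ta : test_function setT (fun x => a * phi x).
  by have := test_functionM tp (@smooth_cst R d a); congr test_function; apply/funext => x; rewrite mulrC.
(* The linearity axiom always adds a second function, so a phi is written as (a - 1) phi + phi. *)
split=> //; have := pairing_linear T (a - 1) tp tp.
have -> : (fun x => (a - 1) * phi x + phi x) = fun x => a * phi x.
  by apply/funext => x; rewrite mulrBl mul1r subrK.
by move=> ->; rewrite mulrBl mul1r subrK.
Qed.

Lemma pairingD (T : distributions R d) phi psi : test_function setT phi -> test_function setT psi ->
  T (fun x => phi x + psi x) = T phi + T psi.
Proof.
move=> tp tq; have := pairing_linear T 1 tp tq; rewrite mul1r => <-.
by congr (T _); apply/funext => x; rewrite mul1r.
Qed.

(** Since Im z = Re(-i z), the whole real combination is the real part of a single pairing, with a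
    complex combination of packets; the definition of a Gaussian field then applies directly. *)
Lemma gaussian_combination (a1 a2 a3 a4 : R) (b1 b2 b3 b4 : bool) (k1 k2 k3 k4 : R) :
  let X w := a1 * part b1 (packet_value k1 w) + a2 * part b2 (packet_value k2 w) +
    (a3 * part b3 (packet_value k3 w) + a4 * part b4 (packet_value k4 w)) in
  gaussian_rv P X /\ \int[P]_w X w = 0.
Proof.
pose u (b : bool) : C := if b then 1 else (0 +i* -1)%C.
pose t a b k : E -> C := fun x => (a%:C%C * u b) * packet k x.
have tt a b k : test_function setT (t a b k).
  by have [] := pairingZ (f point) (a%:C%C * u b) (test_packet k).
pose t12 x := t a1 b1 k1 x + t a2 b2 k2 x; pose t34 x := t a3 b3 k3 x + t a4 b4 k4 x.
have h12 : test_function setT t12 by exact: test_functionD.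
have h34 : test_function setT t34 by exact: test_functionD.
have h : test_function setT (fun x => t12 x + t34 x) by exact: test_functionD.
have tE a b k w : complex.Re (f w (t a b k)) = a * part b (packet_value k w).
  have [_ ->] := pairingZ (f w) (a%:C%C * u b) (test_packet k).
  by rewrite -mulrA ReM/= mul0r subr0 partE.
move=> X; have -> : X = fun w => complex.Re (f w (fun x => t12 x + t34 x)).
  by apply/funext => w; rewrite pairingD// pairingD// pairingD// !ReD !tE.
exact: Re_pairing_gaussian.
Qed.

Definition packet_relation k2 k1 := relation_op P f (packet k2) (packet k1).
(* [covariance_op] conjugates the value at its first argument, and conjugating
   a packet changes the sign of its frequency: this is E[conj Z(k2) Z(k1)],
   where Z(k) is [packet_value k]. *)
Definition packet_covariance k2 k1 := covariance_op P f (packet (- k2)) (packet k1).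

(* The mixed moments of real and imaginary parts, in terms of E[Z2 Z1] and
   E[conj Z2 Z1]. *)
Definition half_sum (b2 b1 : bool) (rel cov : C) : R :=
  match b2, b1 with
  | true, true => (complex.Re rel + complex.Re cov) / 2
  | false, false => (complex.Re cov - complex.Re rel) / 2
  | true, false => (complex.Im rel + complex.Im cov) / 2
  | false, true => (complex.Im rel - complex.Im cov) / 2
  end.

Definition mixed_moment b2 b1 k2 k1 := \int[P]_w (part b2 (packet_value k2 w) * part b1 (packet_value k1 w)).

Lemma L4N (X : Omega -> R) : L4 P X -> L4 P (fun w => - X w).
Proof.
move=> [mX iX]; split; first exact: measurableT_comp.
by move: iX; congr integrable; apply/funext => w /=; congr EFin; ring.
Qed.

Lemma mixed_momentE b2 b1 k2 k1 : mixed_moment b2 b1 k2 k1 = half_sum b2 b1 (packet_relation k2 k1) (packet_covariance k2 k1).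
Proof.
have R2 := L4_part true k2; have I2 := L4_part false k2.
have R1 := L4_part true k1; have I1 := L4_part false k1.
have rE : packet_relation k2 k1 = ((mixed_moment true true k2 k1 - mixed_moment false false k2 k1) +i*
    (mixed_moment true false k2 k1 + mixed_moment false true k2 k1))%C by exact: cexpectationM.
have cE : packet_covariance k2 k1 = ((mixed_moment true true k2 k1 + mixed_moment false false k2 k1) +i*
    (mixed_moment true false k2 k1 - mixed_moment false true k2 k1))%C.
  rewrite /packet_covariance /covariance_op.
  have -> : (fun x => (packet (- k2) x)^*) = packet k2.
    by apply/funext => x; rewrite packet_conj opprK.
  rewrite (@cexpectationM _ _ _ P (fun w => (packet_value k2 w)^*) (packet_value k1)) => [|||//|//].
  - have neg (g : Omega -> R) (h : Omega -> R) : P.-integrable setT (EFin \o h) ->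
        (forall w, g w = - h w) -> \int[P]_w g w = - \int[P]_w h w.
      move=> ih gh; rewrite -mulN1r -(RintegralZl (-1) measurableT ih).
      by apply: eq_Rintegral => w _; rewrite gh mulN1r.
    congr (_ +i* _)%C; congr (_ + _).
    + by apply: eq_Rintegral => w _; rewrite Re_conj.
    + rewrite (neg _ (fun w => part false (packet_value k2 w) * part false (packet_value k1 w))) ?opprK//.
        exact: L4_integrableM.
      by move=> w; rewrite Im_conj mulNr.
    + by apply: eq_Rintegral => w _; rewrite Re_conj.
    + rewrite (neg _ (fun w => part false (packet_value k2 w) * part true (packet_value k1 w)))//.
        exact: L4_integrableM.
      by move=> w; rewrite Im_conj mulNr.
  - by move: R2; congr L4; apply/funext => w; rewrite Re_conj.
  - by move: (L4N I2); congr L4; apply/funext => w; rewrite Im_conj.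
by rewrite rE cE; case: b2; case: b1 => /=; field.
Qed.

Lemma half_sum_bound b2 b1 rel cov : `|half_sum b2 b1 rel cov| <= cn rel + cn cov.
Proof.
have h1 := le_Re_cn rel; have h2 := le_Re_cn cov.
have h3 := le_Im_cn rel; have h4 := le_Im_cn cov.
have p1 := cn_ge0 rel; have p2 := cn_ge0 cov.
move: h1 h2 h3 h4; rewrite !ler_norml => /andP[? ?] /andP[? ?] /andP[? ?] /andP[? ?].
by case: b2; case: b1; rewrite /= ?ler_norml; apply/andP; split; lra.
Qed.

Lemma half_sumB b2 b1 r1 c1 r2 c2 :
  half_sum b2 b1 (r1 - r2) (c1 - c2) = half_sum b2 b1 r1 c1 - half_sum b2 b1 r2 c2.
Proof. by case: b2; case: b1; rewrite /= ?ReD ?ReN ?ImD ?ImN; field. Qed.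

Lemma half_sumZ b2 b1 (a : R) r1 c1 :
  half_sum b2 b1 (a%:C%C * r1) (a%:C%C * c1) = a * half_sum b2 b1 r1 c1.
Proof. by case: b2; case: b1; rewrite /= ?ReM ?ImM/=; field. Qed.

Lemma packet_relation_approx : exists2 K, 0 <= K & forall k2 k1, 1 <= `|k2| ->
  cn (packet_relation k2 k1 - (`|k2| `^ (- m))%:C%C * fourier ar ((k2 + k1) *: xhat)) <= K * `|k2| `^ (- m - 1).
Proof.
have [K K0 HK] := kernel_asymptotics M0 bc x1 cD Hr; exists K => // k2 k1 k21.
by rewrite /packet_relation (Hrel (test_packet k2) (test_packet k1)); exact: HK.
Qed.

Lemma packet_covariance_approx : exists2 K, 0 <= K & forall k2 k1, 1 <= `|k2| ->
  cn (packet_covariance k2 k1 - (`|k2| `^ (- m))%:C%C * fourier ac ((k1 - k2) *: xhat)) <= K * `|k2| `^ (- m - 1).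
Proof.
have [K K0 HK] := kernel_asymptotics M0 bc x1 cD Hc; exists K => // k2 k1 k21.
rewrite /packet_covariance (Hcov (test_packet (- k2)) (test_packet k1)).
by have := HK (- k2) k1; rewrite normrN [- k2 + k1]addrC; apply.
Qed.

Lemma powRB1 (x : R) : 0 < x -> x `^ (- m - 1) = x `^ (- m) * x^-1.
Proof.
move=> x0; have xn : x != 0 by rewrite gt_eqF.
by rewrite powRD ?xn ?implybT// powR_inv1// ltW.
Qed.

(** Both |k2 + k1| and |k2 - k1| are at least the distance between |k2| and |k1|, so one bound
    serves for the relation and the covariance kernel, whatever the signs of the frequencies. *)
Lemma mixed_moment_bound : exists2 K, 0 <= K & forall b2 b1 k2 k1, 1 <= `|k2| ->
  `|mixed_moment b2 b1 k2 k1| <= K * `|k2| `^ (- m) * ((1 + `|(`|k2| - `|k1|)|)^-1 + `|k2|^-1).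
Proof.
have [K1 K10 H1] := packet_relation_approx; have [K2 K20 H2] := packet_covariance_approx.
have [_ _ tac _] := Hc; have [_ _ tar _] := Hr.
have [A1 A10 B1] := fourier_decay tar x1; have [A2 A20 B2] := fourier_decay tac x1.
exists (K1 + K2 + (A1 + A2)) => [|b2 b1 k2 k1 k21]; first by rewrite !addr_ge0.
have k20 : 0 < `|k2| by exact: lt_le_trans k21.
rewrite mixed_momentE; apply: le_trans (half_sum_bound _ _ _ _) _.
set p := `|k2| `^ (- m); have p0 : 0 <= p by exact: powR_ge0.
set q := `|k2|^-1; have q0 : 0 <= q by rewrite invr_ge0.
set v := (1 + _)^-1; have v0 : 0 <= v by rewrite invr_ge0 addr_ge0.
have dec (A s : R) : 0 <= A -> `|(`|k2| - `|k1|)| <= `|s| -> A / (1 + `|s|) <= A * v.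
  move=> A0 ks; rewrite ler_wpM2l// lef_pV2 ?posrE ?ltr_pwDl//.
  by rewrite lerD2l.
have r1 : cn (packet_relation k2 k1) <= p * (A1 * v) + K1 * (p * q).
  have -> : packet_relation k2 k1 = (p%:C%C * fourier ar ((k2 + k1) *: xhat)) +
     (packet_relation k2 k1 - p%:C%C * fourier ar ((k2 + k1) *: xhat)) by rewrite addrC subrK.
  apply: le_trans (cn_triangle _ _) _; apply: lerD; last by have := H1 k2 k1 k21; rewrite powRB1.
  rewrite cnM cn_real ger0_norm// ler_wpM2l//; apply: le_trans (B1 _) _; apply: dec => //.
  by have := ler_dist_dist k2 (- k1); rewrite normrN opprK.
have r2 : cn (packet_covariance k2 k1) <= p * (A2 * v) + K2 * (p * q).
  have -> : packet_covariance k2 k1 = (p%:C%C * fourier ac ((k1 - k2) *: xhat)) +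
     (packet_covariance k2 k1 - p%:C%C * fourier ac ((k1 - k2) *: xhat)) by rewrite addrC subrK.
  apply: le_trans (cn_triangle _ _) _; apply: lerD; last by have := H2 k2 k1 k21; rewrite powRB1.
  rewrite cnM cn_real ger0_norm// ler_wpM2l//; apply: le_trans (B2 _) _; apply: dec => //.
  by have := ler_dist_dist k2 k1; rewrite [`|k1 - k2|]distrC.
apply: le_trans (lerD r1 r2) _.
have pv : 0 <= p * v by rewrite mulr_ge0.
have pq : 0 <= p * q by rewrite mulr_ge0.
have -> : (K1 + K2 + (A1 + A2)) * p * (v + q) = p * (A1 * v) + K1 * (p * q) +
   (p * (A2 * v) + K2 * (p * q)) + ((K1 + K2) * (p * v) + (A1 + A2) * (p * q)) by ring.
by rewrite lerDl addr_ge0// mulr_ge0// addr_ge0.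
Qed.

Lemma mixed_momentC b2 b1 k2 k1 : mixed_moment b2 b1 k2 k1 = mixed_moment b1 b2 k1 k2.
Proof. by apply: eq_Rintegral => w _; rewrite mulrC. Qed.

(** The moment is symmetric, so the symbol may be expanded at either frequency: the larger one for m
    >= 0, the smaller one for m < 0. The right-hand side carries both inverse frequencies to be
    symmetric as well. *)
Lemma mixed_moment_weighted : exists2 K, 0 <= K & forall b2 b1 k2 k1, 1 <= `|k2| -> 1 <= `|k1| ->
  `|k2| `^ (m / 2) * `|k1| `^ (m / 2) * `|mixed_moment b2 b1 k2 k1| <=
  K * ((1 + `|(`|k2| - `|k1|)|)^-1 + `|k2|^-1 + `|k1|^-1).
Proof.
have [K K0 HK] := mixed_moment_bound; exists K => //.
have main b2 b1 k2 k1 : 1 <= `|k2| -> 1 <= `|k1| ->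
    (0 <= m -> `|k1| <= `|k2|) -> (m < 0 -> `|k2| <= `|k1|) ->
    `|k2| `^ (m / 2) * `|k1| `^ (m / 2) * `|mixed_moment b2 b1 k2 k1| <=
    K * ((1 + `|(`|k2| - `|k1|)|)^-1 + `|k2|^-1 + `|k1|^-1).
  move=> k21 k11 hp hn; have k20 : 0 < `|k2| by exact: lt_le_trans k21.
  have k10 : 0 < `|k1| by exact: lt_le_trans k11.
  set W := `|k2| `^ (m / 2) * _; have W0 : 0 <= W by rewrite mulr_ge0 ?powR_ge0.
  apply: le_trans (ler_wpM2l W0 (HK b2 b1 k2 k1 k21)) _.
  set v := _ + `|k2|^-1; have v0 : 0 <= v by rewrite addr_ge0 ?invr_ge0 ?addr_ge0.
  have -> : W * (K * `|k2| `^ (- m) * v) = K * v * (W * `|k2| `^ (- m)) by ring.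
  apply: (@le_trans _ _ (K * v * 1)).
    by rewrite ler_wpM2l ?mulr_ge0//; exact: powR_half_weight.
  by rewrite mulr1 ler_wpM2l// lerDl invr_ge0.
move=> b2 b1 k2 k1 k21 k11.
have sym : (0 <= m -> `|k2| <= `|k1|) -> (m < 0 -> `|k1| <= `|k2|) ->
    `|k2| `^ (m / 2) * `|k1| `^ (m / 2) * `|mixed_moment b2 b1 k2 k1| <=
    K * ((1 + `|(`|k2| - `|k1|)|)^-1 + `|k2|^-1 + `|k1|^-1).
  by move=> hp hn; have := main b1 b2 k1 k2 k11 k21 hp hn; rewrite distrC mixed_momentC addrAC [X in X * _ <= _]mulrC.
have [m0|m0] := leP 0 m.
  have m0' : m < 0 -> False by rewrite ltNge m0.
  by have [/ltW k12|k12] := ltP `|k1| `|k2|; [apply: main|apply: sym].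
have m0' : 0 <= m -> False by rewrite leNgt m0.
by have [/ltW k12|k12] := ltP `|k1| `|k2|; [apply: sym|apply: main].
Qed.

Lemma cvg_inv_pinfty : r^-1 @[r --> +oo] --> (0 : R).
Proof.
apply/cvgr0Pnorm_le => e e0; near=> r.
have e1 : 0 < e^-1 by rewrite invr_gt0.
have r1 : e^-1 <= r by near: r; apply: nbhs_pinfty_ge; exact: num_real.
have r0 : 0 < r by exact: lt_le_trans r1.
by rewrite gtr0_norm ?invr_gt0// -[leRHS]invrK lef_pV2.
Unshelve. all: by end_near. Qed.

Section weighted.
Variables (tau s eps : R).
Hypotheses (tau0 : 0 <= tau) (s0 : 0 <= s) (eps1 : `|eps| = 1).

(* Frequencies are clamped at 1 so that the paths are continuous on the whole
   line; only large frequencies matter. *)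
Definition clamp (r : R) := Num.max r 1.
(** With s = (3 - d)/2, sharing r^(m + 3 - d) and the two far-field powers between the processes
    leaves r^(m/2) for each, times the ratio (r / (r + tau))^s here (see [weightE]). The ratio is at
    most 1 and tends to 1. *)
Definition shifted_weight r := clamp r `^ (m / 2) * (clamp r `^ s * (clamp r + tau) `^ (- s)).
Definition base_weight r := clamp r `^ (m / 2).
Definition shifted_process b r w := shifted_weight r * part b (packet_value (clamp r + tau) w).
(** The sign [eps] is 1 for the covariance mean and -1 for the relation mean, where the second far
    field is taken in the direction -xhat, that is, at the frequency -r. *)
Definition base_process b r w := base_weight r * part b (packet_value (eps * clamp r) w).

Lemma clamp_ge1 r : 1 <= clamp r. Proof. by rewrite le_max lexx orbT. Qed.

Lemma clamp_gt0 r : 0 < clamp r. Proof. exact: lt_le_trans (clamp_ge1 r). Qed.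

Lemma clamp_id r : 1 <= r -> clamp r = r. Proof. by move=> r1; rewrite /clamp max_l. Qed.

Lemma continuous_clamp : continuous clamp.
Proof. by move=> r; apply: continuous_max; [exact: cvg_id|exact: cvg_cst]. Qed.

Lemma continuous_clampD : continuous (fun r => clamp r + tau).
Proof. by move=> r; apply: cvgD; [exact: continuous_clamp|exact: cvg_cst]. Qed.

Lemma continuous_base_weight : continuous base_weight.
Proof. exact: continuous_powR_comp continuous_clamp clamp_gt0. Qed.

Lemma clampD_gt0 r : 0 < clamp r + tau. Proof. exact: ltr_pwDl (clamp_gt0 r) tau0. Qed.

Lemma continuous_shifted_weight : continuous shifted_weight.
Proof.
move=> r; apply: cvgM; first exact: continuous_base_weight.
apply: cvgM; first exact: (continuous_powR_comp continuous_clamp clamp_gt0).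
exact: (continuous_powR_comp continuous_clampD clampD_gt0).
Qed.

Lemma continuous_packet_value w : ccontinuous (fun k : R => packet_value k w).
Proof.
apply: (@pairing_continuous R d (f w) R (fun p => packet p.1 p.2) M) => [|u x Mx]; last first.
  by rewrite /packet chi_eq0 ?mul0r.
have s1 : rsmooth (fun p : R * E => p.1 * dotv xhat p.2).
  apply: rsmoothM; first by apply: rsmooth_linear => [//|x]; exact: cvg_fst.
  apply: rsmooth_sum => i; apply: rsmoothM; first exact: rsmooth_cst.
  apply: rsmooth_linear => [a x y|x]; first by rewrite !mxE.
  apply: (@cvg_comp _ _ _ (fun p : R * E => p.2) (fun y => y 0 i)); first exact: cvg_snd.
  exact: coord_continuous.
have s2 : rsmooth (fun p : R * E => \prod_i c (p.2 0 i)).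
  apply: rsmooth_prod => i; apply: (rsmooth_comp (phi := c)); first by case: bc.
  apply: rsmooth_linear => [a x y|x]; first by rewrite !mxE.
  apply: (@cvg_comp _ _ _ (fun p : R * E => p.2) (fun y => y 0 i)); first exact: cvg_snd.
  exact: coord_continuous.
apply/smoothE; split.
  have -> : (fun p : R * E => complex.Re (packet p.1 p.2)) =
      fun p => \prod_i c (p.2 0 i) * cos (- (p.1 * dotv xhat p.2)).
    by apply/funext => p; rewrite ReM/= mul0r subr0.
  apply: rsmoothM => //; apply: (rsmooth_comp (phi := @cos R)); [exact: rsmooth_cos|exact: rsmoothN].
have -> : (fun p : R * E => complex.Im (packet p.1 p.2)) =
    fun p => \prod_i c (p.2 0 i) * sin (- (p.1 * dotv xhat p.2)).
  by apply/funext => p; rewrite ImM/= mul0r addr0.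
apply: rsmoothM => //; apply: (rsmooth_comp (phi := @sin R)); [exact: rsmooth_sin|exact: rsmoothN].
Qed.

Lemma continuous_part b w : continuous (fun k => part b (packet_value k w)).
Proof. by have [h1 h2] := continuous_packet_value w; case: b. Qed.

Lemma continuous_shifted_process b w : continuous (shifted_process b ^~ w).
Proof.
move=> r; apply: cvgM; first exact: continuous_shifted_weight.
apply: (@continuous_comp _ _ _ (fun r => clamp r + tau) (fun k => part b (packet_value k w))).
  exact: continuous_clampD.
exact: continuous_part.
Qed.

Lemma continuous_base_process b w : continuous (base_process b ^~ w).
Proof.
move=> r; apply: cvgM; first exact: continuous_base_weight.
apply: (@continuous_comp _ _ _ (fun r => eps * clamp r) (fun k => part b (packet_value k w))).
  by apply: cvgM; [exact: cvg_cst|exact: continuous_clamp].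
exact: continuous_part.
Qed.

Definition growth := (1 + tau) `^ (`|m| / 2).

Lemma growth_ge1 : 1 <= growth.
Proof.
have m0 : 0 <= `|m| / 2 by rewrite divr_ge0.
by have := ler_powR2r m0 ler01 (_ : 1 <= 1 + tau); rewrite powR1; apply; rewrite lerDl.
Qed.

(** What the two weighted processes have in common, so that their four covariance estimates are
    instances of [admissible_cov]. *)
Definition admissible (v k : R -> R) := forall r, 1 <= r ->
  [/\ r <= `|k r|, `|k r| <= r + tau, 0 <= v r & v r <= growth * `|k r| `^ (m / 2)].

Lemma admissible_shifted_weight : admissible shifted_weight (fun r => clamp r + tau).
Proof.
move=> r r1; have r0 : 0 < r by lra.
have nE : `|clamp r + tau| = r + tau by rewrite clamp_id// ger0_norm// addr_ge0// ltW.
rewrite nE /shifted_weight clamp_id//; split=> //; first by rewrite lerDl.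
  by rewrite !mulr_ge0 ?powR_ge0.
apply: (@le_trans _ _ (r `^ (m / 2) * 1)); last by rewrite mulr1; exact: powR_shift.
apply: ler_wpM2l; first exact: powR_ge0.
have rt0 : 0 < r + tau by rewrite ltr_wpDr.
rewrite (powR_divK s r0 rt0).
rewrite powRN mulfK ?gt_eqF ?powR_gt0//; apply: powR_le1 => //.
  by rewrite divr_ge0// ltW.
by rewrite ler_pdivrMr// mul1r lerDl.
Qed.

Lemma admissible_base_weight : admissible base_weight (fun r => eps * clamp r).
Proof.
move=> r r1; rewrite /base_weight clamp_id// normrM eps1 mul1r ger0_norm; last lra.
split=> //; [by rewrite lerDl|exact: powR_ge0|].
by rewrite ler_peMl ?powR_ge0// growth_ge1.
Qed.

Lemma admissible_cov : exists K, forall v k v' k' b b', admissible v k -> admissible v' k' ->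
  forall r r', 1 <= r -> 1 <= r' ->
  `|\int[P]_w ((v r * part b (packet_value (k r) w)) * (v' r' * part b' (packet_value (k' r') w)))| <=
  K * ((1 + `|r - r'|)^-1 + r^-1 + r'^-1).
Proof.
have [K K0 HK] := mixed_moment_weighted.
exists (growth * growth * (K * (1 + 2 * tau))) => v k v' k' b b' ha ha' r r' r1 r1'.
have [h1 h2 h3 h4] := ha r r1; have [g1 g2 g3 g4] := ha' r' r1'.
have -> : \int[P]_w ((v r * part b (packet_value (k r) w)) * (v' r' * part b' (packet_value (k' r') w))) =
    v r * v' r' * mixed_moment b b' (k r) (k' r').
  have i := L4_integrableM (L4_part b (k r)) (L4_part b' (k' r')).
  rewrite /mixed_moment -(RintegralZl (v r * v' r') measurableT i).
  by apply: eq_Rintegral => w _; ring.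
rewrite normrM ger0_norm; last by rewrite mulr_ge0.
have gr := growth_ge1.
apply: (@le_trans _ _ ((growth * `|k r| `^ (m / 2)) * (growth * `|k' r'| `^ (m / 2)) *
    `|mixed_moment b b' (k r) (k' r')|)).
  by rewrite ler_wpM2r// ler_pM.
have -> : growth * `|k r| `^ (m / 2) * (growth * `|k' r'| `^ (m / 2)) *
    `|mixed_moment b b' (k r) (k' r')| = growth * growth * (`|k r| `^ (m / 2) * `|k' r'| `^ (m / 2) *
    `|mixed_moment b b' (k r) (k' r')|) by ring.
have gg : 0 <= growth * growth by rewrite mulr_ge0//; lra.
rewrite -[leRHS]mulrA ler_wpM2l//; apply: le_trans (HK b b' (k r) (k' r') _ _) _; [lra|lra|].
rewrite -mulrA ler_wpM2l//.
have d1 : `|(`|k r| - r)| <= tau by rewrite ger0_norm; lra.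
have d2 : `|(`|k' r'| - r')| <= tau by rewrite ger0_norm; lra.
have := inv_dist_shift tau0 d1 d2.
have i1 : `|k r|^-1 <= r^-1 by rewrite lef_pV2 ?posrE; lra.
have i2 : `|k' r'|^-1 <= r'^-1 by rewrite lef_pV2 ?posrE; lra.
have p1 : 0 <= r^-1 by rewrite invr_ge0; lra.
have p2 : 0 <= r'^-1 by rewrite invr_ge0; lra.
set u := (1 + `|r - r'|)^-1 => h.
have := mulr_ge0 tau0 p1; have := mulr_ge0 tau0 p2; lra.
Qed.

Lemma mixed_moment_approx b2 b1 : exists2 K, 0 <= K & forall k2 k1, 1 <= `|k2| ->
  `|mixed_moment b2 b1 k2 k1 - `|k2| `^ (- m) * half_sum b2 b1 (fourier ar ((k2 + k1) *: xhat))
     (fourier ac ((k1 - k2) *: xhat))| <= K * `|k2| `^ (- m) * `|k2|^-1.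
Proof.
have [K1 K10 H1] := packet_relation_approx; have [K2 K20 H2] := packet_covariance_approx.
exists (K1 + K2) => [|k2 k1 k21]; first exact: addr_ge0.
rewrite mixed_momentE -half_sumZ -half_sumB; apply: le_trans (half_sum_bound _ _ _ _) _.
have k20 : 0 < `|k2| by exact: lt_le_trans k21.
apply: le_trans (lerD (H1 k2 k1 k21) (H2 k2 k1 k21)) _.
by rewrite powRB1// -mulrDl mulrA.
Qed.

Lemma half_sum_cvg b2 b1 (u v : R -> C) (rho gam : C) :
  cn (u r - rho) @[r --> +oo] --> (0 : R) -> cn (v r - gam) @[r --> +oo] --> (0 : R) ->
  half_sum b2 b1 (u r) (v r) @[r --> +oo] --> half_sum b2 b1 rho gam.
Proof.
move=> cu cv; apply/cvgrPdist_le => e e0; near=> r.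
rewrite distrC -half_sumB; apply: le_trans (half_sum_bound _ _ _ _) _.
have h1 : cn (u r - rho) <= e / 2.
  rewrite -[leLHS](ger0_norm (cn_ge0 _)).
  by near: r; apply: (cvgr0_norm_le _ cu); rewrite divr_gt0.
have h2 : cn (v r - gam) <= e / 2.
  rewrite -[leLHS](ger0_norm (cn_ge0 _)).
  by near: r; apply: (cvgr0_norm_le _ cv); rewrite divr_gt0.
lra.
Unshelve. all: by end_near. Qed.

(** For eps = 1 the two frequencies differ by tau and add up to 2r + tau, so in the application
    [rho] is 0 and [gam] is the transform of [ac] at tau xhat; for eps = -1 the roles are exchanged.
    The two weights times r^-m tend to 1, which leaves the half sum. *)
Lemma weighted_cov_cvg bX bY (rho gam : C) :
  cn (fourier ar ((eps * r + (r + tau)) *: xhat) - rho) @[r --> +oo] --> (0 : R) ->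
  cn (fourier ac ((r + tau - eps * r) *: xhat) - gam) @[r --> +oo] --> (0 : R) ->
  \int[P]_w (shifted_process bX r w * base_process bY r w) @[r --> +oo] --> half_sum bY bX rho gam.
Proof.
move=> cr cg; have [K K0 HK] := mixed_moment_approx bY bX.
pose q r := clamp r `^ s * (clamp r + tau) `^ (- s).
pose h r := half_sum bY bX (fourier ar ((eps * r + (r + tau)) *: xhat))
  (fourier ac ((r + tau - eps * r) *: xhat)).
have cq : q r @[r --> +oo] --> (1 : R) by exact: cvg_powR_shift.
have ch : h r @[r --> +oo] --> half_sum bY bX rho gam by exact: half_sum_cvg.
have cqh : q r * h r @[r --> +oo] --> half_sum bY bX rho gam.
  by rewrite -[X in _ --> X]mul1r; exact: cvgM.
have ci : q r * (K * r^-1) @[r --> +oo] --> (0 : R).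
  rewrite -(mulr0 (1 : R)); apply: cvgM => //; rewrite -(mulr0 K); apply: cvgM; first exact: cvg_cst.
  exact: cvg_inv_pinfty.
apply/cvgrPdist_le => e e0; near=> r.
have r1 : 1 <= r by near: r; apply: nbhs_pinfty_ge; exact: num_real.
have r0 : 0 < r by lra.
have -> : \int[P]_w (shifted_process bX r w * base_process bY r w) = shifted_weight r * base_weight r * mixed_moment bY bX (eps * r) (r + tau).
  have i := L4_integrableM (L4_part bY (eps * r)) (L4_part bX (r + tau)).
  rewrite /mixed_moment -(RintegralZl (shifted_weight r * base_weight r) measurableT i).
  by apply: eq_Rintegral => w _; rewrite /shifted_process /base_process clamp_id//; ring.
have k2 : `|eps * r| = r by rewrite normrM eps1 mul1r gtr0_norm.
have ww : shifted_weight r * base_weight r * r `^ (- m) = q r.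
  rewrite /shifted_weight /base_weight /q clamp_id// (_ : - m = - (m / 2) + - (m / 2)); last by field.
  have rn : r != 0 by rewrite gt_eqF.
  by rewrite powRD ?rn ?implybT// [r `^ (- (m / 2))]powRN; field; rewrite gt_eqF// powR_gt0.
have := HK (eps * r) (r + tau); rewrite k2 => /(_ r1) H.
have W0 : 0 <= shifted_weight r * base_weight r by rewrite !mulr_ge0 ?powR_ge0.
have H' : `|shifted_weight r * base_weight r * mixed_moment bY bX (eps * r) (r + tau) - q r * h r| <= q r * (K * r^-1).
  rewrite -ww -[_ * mixed_moment _ _ _ _ - _]/(_ - _ * h r) -[X in _ - X]mulrA -mulrBr normrM (ger0_norm W0).
  rewrite -[leRHS]mulrA ler_wpM2l//; apply: le_trans H _; rewrite le_eqVlt; apply/orP; left.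
  by apply/eqP; ring.
have h1 : `|half_sum bY bX rho gam - q r * h r| <= e / 2.
  by near: r; apply: (cvgr_dist_le _ _ cqh); rewrite divr_gt0.
have h2 : `|q r * (K * r^-1)| <= e / 2.
  by near: r; apply: (cvgr0_norm_le _ ci); rewrite divr_gt0.
have h3 := ler_norm (q r * (K * r^-1)).
have := ler_normB (half_sum bY bX rho gam - q r * h r)
  (shifted_weight r * base_weight r * mixed_moment bY bX (eps * r) (r + tau) - q r * h r).
rewrite opprB addrA subrK; lra.
Unshelve. all: by end_near. Qed.

Lemma weighted_mean_ae bX bY (rho gam : C) :
  cn (fourier ar ((eps * r + (r + tau)) *: xhat) - rho) @[r --> +oo] --> (0 : R) ->
  cn (fourier ac ((r + tau - eps * r) *: xhat) - gam) @[r --> +oo] --> (0 : R) ->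
  {ae P, forall w, Q^-1 * \int[mu]_(r in `[Q, 2 * Q]) (shifted_process bX r w * base_process bY r w) @[Q --> +oo] -->
    half_sum bY bX rho gam}.
Proof.
move=> cr cg; have [K HK] := admissible_cov.
apply: (@cvg_mean_gaussian_product _ _ _ P (shifted_process bX) (base_process bY) K).
- exact: continuous_shifted_process.
- exact: continuous_base_process.
- by move=> r; apply/funext => w; rewrite /shifted_process /shifted_weight [clamp (Num.max r 1)]clamp_id// clamp_ge1.
- by move=> r; apply/funext => w; rewrite /base_process /base_weight [clamp (Num.max r 1)]clamp_id// clamp_ge1.
- move=> r r' a b a' b'.
  have [] := gaussian_combination (a * shifted_weight r) (b * base_weight r) (a' * shifted_weight r') (b' * base_weight r')
    bX bY bX bY (clamp r + tau) (eps * clamp r) (clamp r' + tau) (eps * clamp r').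
  have -> // : (fun w => a * shifted_weight r * part bX (packet_value (clamp r + tau) w) +
      b * base_weight r * part bY (packet_value (eps * clamp r) w) + (a' * shifted_weight r' * part bX (packet_value (clamp r' + tau) w) +
      b' * base_weight r' * part bY (packet_value (eps * clamp r') w))) =
      fun w => a * shifted_process bX r w + b * base_process bY r w + (a' * shifted_process bX r' w + b' * base_process bY r' w).
  by apply/funext => w; rewrite !mulrA.
- have a1 := admissible_shifted_weight; have a2 := admissible_base_weight.
  move=> U V [->|->] [->|->] r r' r1 r1'.
  + exact: (HK _ _ _ _ _ _ a1 a1).
  + exact: (HK _ _ _ _ _ _ a1 a2).
  + exact: (HK _ _ _ _ _ _ a2 a1).
  + exact: (HK _ _ _ _ _ _ a2 a2).
- exact: weighted_cov_cvg.
Qed.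

End weighted.

Section means.
Variables (L0 tau : R).
Hypotheses (c1 : forall t, `|t| <= L0 + 1 -> c t = 1) (tau0 : 0 <= tau).
Hypothesis hd : d = 2%N \/ d = 3%N.
Local Notation s := ((3 - d%:R) / 2 : R).

Lemma packet_pairing (T : distributions R d) k : supported_in T [set x | `|x| <= L0] ->
  compact_pairing T (wave xhat k) = T (packet k).
Proof.
move=> TL; apply: (compact_pairingE (U := [set x : E | `|x| < L0 + 1])) TL _ _ _ _ _.
- exact: compact_norm_le.
- have -> : [set x : E | `|x| < L0 + 1] = (fun x : E => `|x|) @^-1` [set r | r < L0 + 1] by [].
  by apply: open_comp => [x _|]; [exact: norm_continuous|exact: open_lt].
- by move=> x /= xL; rewrite (le_lt_trans xL)// ltrDl.
- exact: test_function_ball (@smooth_chi R d c M bc) chi_eq0.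
- by move=> x /= xL; rewrite /chi (cutoff_eq1 c1)// ltW.
- exact: smooth_wave.
Qed.

Lemma far_field_exponent : (d%:R - 3) / 2 = - s.
Proof. by field. Qed.

Lemma far_fieldE (T : distributions R d) k : supported_in T [set x | `|x| <= L0] ->
  far_field T xhat k = - Cst R d * (k `^ (- s))%:C%C * T (packet k).
Proof. by move=> TL; rewrite /far_field far_field_exponent -packet_pairing. Qed.

Lemma far_fieldNE (T : distributions R d) k : supported_in T [set x | `|x| <= L0] ->
  far_field T (- xhat) k = - Cst R d * (k `^ (- s))%:C%C * T (packet (- k)).
Proof.
move=> TL; rewrite /far_field far_field_exponent -packet_pairing//.
congr (_ * compact_pairing _ _); apply/funext => y.
by rewrite /wave dotvC dotvNr dotvC mulrN mulNr.
Qed.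

Lemma weightE r : 1 <= r ->
  r `^ (m + 3 - d%:R) * (r + tau) `^ (- s) * r `^ (- s) = shifted_weight tau s r * base_weight r.
Proof.
move=> r1; rewrite /shifted_weight /base_weight clamp_id//; have r0 : 0 < r by exact: lt_le_trans r1.
have rn : r != 0 by rewrite gt_eqF.
have -> : m + 3 - d%:R = m / 2 + (m / 2 + (s + s)) by field.
rewrite !powRD ?rn ?implybT// [r `^ (- s)]powRN; field.
by rewrite gt_eqF// powR_gt0.
Qed.

Lemma s_ge0 : 0 <= s.
Proof. by case: hd => ->; apply: divr_ge0 => //; rewrite subr_ge0 ler_nat. Qed.

Let continuous_product eps bX bY w : continuous (fun r => shifted_process tau s bX r w * base_process eps bY r w).
Proof. by move=> r; apply: cvgM; [exact: continuous_shifted_process|exact: continuous_base_process]. Qed.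

Definition window_mean eps bX bY w Q := Q^-1 * \int[mu]_(r in `[Q, 2 * Q]) (shifted_process tau s bX r w * base_process eps bY r w).

Lemma window_mean_linear eps bX bY bX' bY' w Q x :
  Q^-1 * \int[mu]_(r in `[Q, 2 * Q])
    (1 * (shifted_process tau s bX r w * base_process eps bY r w) + x * (shifted_process tau s bX' r w * base_process eps bY' r w)) =
  window_mean eps bX bY w Q + x * window_mean eps bX' bY' w Q.
Proof. by rewrite Rintegral_itv_linear//; rewrite /window_mean; ring. Qed.

Lemma covariance_meanE w Q : 1 <= Q -> supported_in (f w) [set x | `|x| <= L0] ->
  covariance_mean m (f w) xhat tau Q = `|Cst R d| ^+ 2 *
    ((window_mean 1 true true w Q + 1 * window_mean 1 false false w Q) +i*
     (window_mean 1 false true w Q + -1 * window_mean 1 true false w Q))%C.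
Proof.
move=> Q1 TL; rewrite /covariance_mean /weighted_mean.
rewrite (@cintegralZ_itv _ _ _ (`|Cst R d| ^+ 2)
  (fun r => 1 * (shifted_process tau s true r w * base_process 1 true r w) + 1 * (shifted_process tau s false r w * base_process 1 false r w))
  (fun r => 1 * (shifted_process tau s false r w * base_process 1 true r w) + -1 * (shifted_process tau s true r w * base_process 1 false r w))).
- rewrite -!window_mean_linear mulrCA; congr (_ * _).
  by apply: eq_complex_parts; rewrite ?ReM ?ImM/= !mul0r ?subr0 ?addr0.
- by move=> r; apply: cvgD; apply: cvgM; [exact: cvg_cst|exact: continuous_product|exact: cvg_cst|exact: continuous_product].
- by move=> r; apply: cvgD; apply: cvgM; [exact: cvg_cst|exact: continuous_product|exact: cvg_cst|exact: continuous_product].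
move=> r /andP[Qr _]; have r1 : 1 <= r by exact: le_trans Qr.
rewrite !far_fieldE// weighted_product_conj weightE//; congr (_ * _).
have eX b : shifted_process tau s b r w = shifted_weight tau s r * part b (f w (packet (r + tau))) by rewrite /shifted_process clamp_id.
have eY b : base_process 1 b r w = base_weight r * part b (f w (packet r)) by rewrite /base_process clamp_id// mul1r.
rewrite !eX !eY; move: (shifted_weight _ _ r) (base_weight r) => W1 W2.
by apply: eq_complex_parts; rewrite !(ReM, ImM, Re_conj, Im_conj)/=; ring.
Qed.

Lemma relation_meanE w Q : 1 <= Q -> supported_in (f w) [set x | `|x| <= L0] ->
  relation_mean m (f w) xhat tau Q = Cst R d ^+ 2 *
    ((window_mean (-1) true true w Q + -1 * window_mean (-1) false false w Q) +i*
     (window_mean (-1) true false w Q + 1 * window_mean (-1) false true w Q))%C.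
Proof.
move=> Q1 TL; rewrite /relation_mean /weighted_mean.
rewrite (@cintegralZ_itv _ _ _ (Cst R d ^+ 2)
  (fun r => 1 * (shifted_process tau s true r w * base_process (-1) true r w) + -1 * (shifted_process tau s false r w * base_process (-1) false r w))
  (fun r => 1 * (shifted_process tau s true r w * base_process (-1) false r w) + 1 * (shifted_process tau s false r w * base_process (-1) true r w))).
- rewrite -!window_mean_linear mulrCA; congr (_ * _).
  by apply: eq_complex_parts; rewrite ?ReM ?ImM/= !mul0r ?subr0 ?addr0.
- by move=> r; apply: cvgD; apply: cvgM; [exact: cvg_cst|exact: continuous_product|exact: cvg_cst|exact: continuous_product].
- by move=> r; apply: cvgD; apply: cvgM; [exact: cvg_cst|exact: continuous_product|exact: cvg_cst|exact: continuous_product].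
move=> r /andP[Qr _]; have r1 : 1 <= r by exact: le_trans Qr.
rewrite far_fieldE// far_fieldNE// weighted_product weightE//; congr (_ * _).
have eX b : shifted_process tau s b r w = shifted_weight tau s r * part b (f w (packet (r + tau))) by rewrite /shifted_process clamp_id.
have eY b : base_process (-1) b r w = base_weight r * part b (f w (packet (- r))) by rewrite /base_process clamp_id// mulN1r.
rewrite !eX !eY; move: (shifted_weight _ _ r) (base_weight r) => W1 W2.
by apply: eq_complex_parts; rewrite !(ReM, ImM)/=; ring.
Qed.

Lemma fourier_vanish (a : E -> C) : test_function D a ->
  cn (fourier a ((r + (r + tau)) *: xhat) - 0) @[r --> +oo] --> (0 : R).
Proof.
move=> ta; have [K K0 HK] := fourier_decay ta x1.
have cK : K * r^-1 @[r --> +oo] --> (0 : R).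
  by rewrite -(mulr0 K); apply: cvgM; [exact: cvg_cst|exact: cvg_inv_pinfty].
apply/cvgr0Pnorm_le => e e0; near=> r.
have r1 : 1 <= r by near: r; apply: nbhs_pinfty_ge; exact: num_real.
have h : `|K * r^-1| <= e by near: r; exact: (cvgr0_norm_le _ cK).
rewrite subr0 ger0_norm ?cn_ge0//; apply: le_trans (HK _) _.
have r0 : 0 < r by exact: lt_le_trans r1.
apply: le_trans h; apply: le_trans (ler_norm _); rewrite ler_wpM2l// lef_pV2 ?posrE ?ltr_pwDl//.
have rr : 0 <= r + (r + tau) by rewrite !addr_ge0// ltW.
by rewrite (ger0_norm rr) addrCA lerDl addr_ge0// addr_ge0// ltW.
Unshelve. all: by end_near. Qed.

Lemma window_mean_ae eps (rho gam : C) : `|eps| = 1 ->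
  cn (fourier ar ((eps * r + (r + tau)) *: xhat) - rho) @[r --> +oo] --> (0 : R) ->
  cn (fourier ac ((r + tau - eps * r) *: xhat) - gam) @[r --> +oo] --> (0 : R) ->
  {ae P, forall w, forall b : bool * bool,
    window_mean eps b.1 b.2 w Q @[Q --> +oo] --> half_sum b.2 b.1 rho gam}.
Proof.
move=> he cr cg; apply: (@ae_countable _ _ _ P _
  (fun b w => window_mean eps b.1 b.2 w Q @[Q --> +oo] --> half_sum b.2 b.1 rho gam)) => b.
exact: (weighted_mean_ae tau0 s_ge0 he b.1 b.2 cr cg).
Qed.

Lemma far_field_means : {ae P, forall w, supported_in (f w) [set x | `|x| <= L0]} ->
  {ae P, forall w,
    (covariance_mean m (f w) xhat tau Q @[Q --> +oo] -->
       (`|Cst R d| ^+ 2 * fourier ac (tau *: xhat) : C^o)) /\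
    (relation_mean m (f w) xhat tau Q @[Q --> +oo] -->
       (Cst R d ^+ 2 * fourier ar (tau *: xhat) : C^o))}.
Proof.
move=> sae; have [_ _ tac _] := Hc; have [_ _ tar _] := Hr.
have vanish (a : E -> C) (h : R -> R) : (forall r, h r = tau) ->
    cn (fourier a (h r *: xhat) - fourier a (tau *: xhat)) @[r --> +oo] --> (0 : R).
  move=> ht; have -> : (fun r => cn (fourier a (h r *: xhat) - fourier a (tau *: xhat))) = fun=> 0.
    by apply/funext => r; rewrite ht subrr cn0.
  exact: cvg_cst.
have aP : {ae P, forall w, forall b : bool * bool,
    window_mean 1 b.1 b.2 w Q @[Q --> +oo] --> half_sum b.2 b.1 0 (fourier ac (tau *: xhat))}.
  apply: window_mean_ae; first exact: normr1.
    have -> : (fun r => cn (fourier ar ((1 * r + (r + tau)) *: xhat) - 0)) =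
        fun r => cn (fourier ar ((r + (r + tau)) *: xhat) - 0).
      by apply/funext => r; rewrite mul1r.
    exact: fourier_vanish.
  by apply: vanish => r; rewrite mul1r addrAC subrr add0r.
have aN : {ae P, forall w, forall b : bool * bool,
    window_mean (-1) b.1 b.2 w Q @[Q --> +oo] --> half_sum b.2 b.1 (fourier ar (tau *: xhat)) 0}.
  apply: window_mean_ae; first by rewrite normrN normr1.
    by apply: vanish => r; rewrite mulN1r addKr.
  have -> : (fun r => cn (fourier ac ((r + tau - -1 * r) *: xhat) - 0)) =
      fun r => cn (fourier ac ((r + (r + tau)) *: xhat) - 0).
    by apply/funext => r; rewrite mulN1r opprK [r + tau + r]addrC.
  exact: fourier_vanish.
move: sae; apply: filterS3 aP aN => w HP HN sw.
have Q1 : \forall Q \near +oo, (1 : R) <= Q by apply: nbhs_pinfty_ge; exact: num_real.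
have eta (z : C) : (complex.Re z +i* complex.Im z)%C = z by case: z.
have lin (F G : R -> R) (a b x y : R) : F Q @[Q --> +oo] --> a -> G Q @[Q --> +oo] --> b ->
    a + x * b = y -> F Q + x * G Q @[Q --> +oo] --> y.
  by move=> cF cG <-; apply: cvgD => //; apply: cvgM => //; exact: cvg_cst.
split.
  (* The four half sums recombine: the signs of Z conj Z' cancel the relation part, and those of Z
     Z' cancel the covariance part. *)
  have := @cvg_complex R _ _ (fun Q => covariance_mean m (f w) xhat tau Q) (`|Cst R d| ^+ 2)
    (complex.Re (fourier ac (tau *: xhat))) (complex.Im (fourier ac (tau *: xhat)))
    (lin _ _ _ _ 1 _ (HP (true, true)) (HP (false, false)) _)
    (lin _ _ _ _ (-1) _ (HP (false, true)) (HP (true, false)) _).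
  rewrite eta; apply => /=; [by field|by field|].
  by apply: filterS Q1 => Q Q1; exact: covariance_meanE.
have := @cvg_complex R _ _ (fun Q => relation_mean m (f w) xhat tau Q) (Cst R d ^+ 2)
  (complex.Re (fourier ar (tau *: xhat))) (complex.Im (fourier ar (tau *: xhat)))
  (lin _ _ _ _ (-1) _ (HN (true, true)) (HN (false, false)) _)
  (lin _ _ _ _ 1 _ (HN (true, false)) (HN (false, true)) _).
rewrite eta; apply => /=; [by field|by field|].
by apply: filterS Q1 => Q Q1; exact: relation_meanE.
Qed.

End means.

End far_field_process.

(** * Uniqueness and the random source *)

Section polar_coordinates.
Variables (R : realType) (d : nat).
Local Notation E := 'rV[R]_d.

Lemma continuous_enorm : continuous (@enorm R d).
Proof.
move=> x; apply: (@continuous_comp _ _ _ (fun x : E => dotv x x) (@Num.sqrt R)).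
  have s : rsmooth (fun x : E => dotv x x).
    by apply: rsmooth_sum => i; apply: rsmoothM; exact: rsmooth_coord.
  exact: (rsmooth_continuous s).
exact: sqrt_continuous.
Qed.

Lemma open_polar (V : set (R * E)) : open V ->
  open [set xi : E | 0 < enorm xi /\ V (enorm xi, (enorm xi)^-1 *: xi)].
Proof.
move=> oV; rewrite openE => xi [xi0 Vxi].
have cn : enorm y @[y --> xi] --> enorm xi by exact: continuous_enorm.
have h1 : \forall y \near xi, 0 < enorm y by exact: (cvgr_gt _ cn _ xi0).
have xn : enorm xi != 0 by rewrite gt_eqF.
have ci : (enorm y)^-1 @[y --> xi] --> (enorm xi)^-1 by exact: (cvgV xn cn).
have cg : (enorm y, (enorm y)^-1 *: y) @[y --> xi] --> (enorm xi, (enorm xi)^-1 *: xi).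
  exact: (cvg_pair cn (cvgZ ci (@cvg_id _ (nbhs xi)))).
have h2 : \forall y \near xi, V (enorm y, (enorm y)^-1 *: y).
  by apply: cg; apply: open_nbhs_nbhs; split.
by apply: filterS2 h1 h2 => y; split.
Qed.

(** The map xi -> (|xi|, xi / |xi|) is continuous off the origin, so it pulls the ambient open set
    behind [Theta] back to an open set of frequencies, as the Fourier uniqueness argument
    requires. *)
Lemma polar_open_cone (Theta : set (R * E)) :
  relatively_open [set p | 0 < p.1 /\ unit_sphere p.2] Theta -> Theta !=set0 ->
  exists U : set E, [/\ open U, U !=set0 & forall xi, U xi ->
    exists tau xhat, [/\ Theta (tau, xhat), 0 < tau, unit_sphere xhat & xi = tau *: xhat]].
Proof.
move=> [V [oV ->]] [[t x] [Vtx [/= t0 x1]]].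
exists [set xi : E | 0 < enorm xi /\ V (enorm xi, (enorm xi)^-1 *: xi)].
have nt : enorm (t *: x) = t by rewrite enormZ x1 mulr1 gtr0_norm.
split; first exact: open_polar.
  by exists (t *: x) => /=; rewrite nt scalerA mulVf ?scale1r ?gt_eqF.
move=> xi [xi0 Vxi]; exists (enorm xi), ((enorm xi)^-1 *: xi).
have xn : enorm xi != 0 by rewrite gt_eqF.
have u : enorm ((enorm xi)^-1 *: xi) = 1 by rewrite enormZ gtr0_norm ?invr_gt0// mulVf.
by split=> //; rewrite scalerA mulfV ?scale1r.
Qed.

End polar_coordinates.

Section uniqueness.
Variables (R : realType) (d : nat).
Local Notation C := R[i].
Local Notation E := 'rV[R]_d.

Lemma test_functionB (D : set E) (a b : E -> C) : test_function D a -> test_function D b ->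
  test_function D (fun x => a x - b x).
Proof.
move=> ta tb; have := test_functionD ta (test_functionM tb (@smooth_cst R d (-1))).
by congr test_function; apply/funext => x; rewrite mulrN1.
Qed.

Lemma fourierB (D : set E) (a b : E -> C) xi : test_function D a -> test_function D b ->
  fourier (fun x => a x - b x) xi = fourier a xi - fourier b xi.
Proof.
move=> ta tb; have sc : smooth (fun x : E => cis (- dotv x xi)).
  apply: smooth_cis; apply: rsmoothN; under eq_fun do rewrite dotvC; exact: rsmooth_dotv.
rewrite /fourier !Rd_integralE -cintegralB.
- by apply: eq_cintegral => t; rewrite mulrBr.
- by have := cintegrable_test ta sc; congr cintegrable; apply/funext => t; rewrite mulrC.
- by have := cintegrable_test tb sc; congr cintegrable; apply/funext => t; rewrite mulrC.
Qed.

Lemma eq_test_function_fourier (D : set E) (a b : E -> C) (U : set E) :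
  test_function D a -> test_function D b -> open U -> U !=set0 ->
  (forall xi, U xi -> fourier a xi = fourier b xi) -> a = b.
Proof.
move=> ta tb oU U0 ab; apply/funext => x; apply/eqP; rewrite -subr_eq0; apply/eqP.
have := fourier_uniqueness (test_functionB ta tb) oU U0.
move=> /(_ _)/(congr1 (fun g => g x)); apply => xi Uxi.
by rewrite (fourierB _ ta tb) ab// subrr.
Qed.

Lemma Cst_neq0 : Cst R d != 0.
Proof.
have h (x : R) (z : C) : 0 < x -> cn z = 1 -> x%:C%C * z != 0.
  move=> x0 z1; apply/eqP => /(congr1 (@cn R)); rewrite cnM cn_real z1 mulr1 cn0.
  by move/eqP; rewrite normr_eq0 gt_eqF.
have p := pi_gt0 R; rewrite /Cst; case: ifP => _.
  by apply: h; [rewrite invr_gt0 sqrtr_gt0 mulr_gt0|exact: cn_cis].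
by have := h (4 * pi)^-1 1; rewrite mulr1; apply; rewrite ?invr_gt0 ?mulr_gt0// cn_real normr1.
Qed.

End uniqueness.

Section random_source.
Context (R : realType) (d : nat) (disp : measure_display) (Omega : measurableType disp).
Variable P : probability Omega R.
Local Notation C := R[i].
Local Notation E := 'rV[R]_d.

Lemma ae_witness (Q : Omega -> Prop) : {ae P, forall w, Q w} -> exists w, Q w.
Proof.
move=> [A [mA A0 QA]]; apply: contrapT => nQ.
have AT : A = setT by apply/seteqP; split=> // w _; apply: QA => Qw; apply: nQ; exists w.
by move: A0; rewrite AT probability_setT => /eqP; rewrite onee_eq0.
Qed.

(** The limits are constants, so a single sample point common to two almost sure events identifies
    each of them with [L]. *)
Lemma ae_cvg_unique (F G : Omega -> R -> C) (L a b : C) :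
  {ae P, forall w, F w Q @[Q --> +oo] --> (a : C^o)} ->
  {ae P, forall w, G w Q @[Q --> +oo] --> (b : C^o)} ->
  {ae P, forall w, F w Q @[Q --> +oo] --> (L : C^o)} ->
  {ae P, forall w, G w Q @[Q --> +oo] --> (L : C^o)} -> a = b.
Proof.
have u (H : Omega -> R -> C) (z : C) : {ae P, forall w, H w Q @[Q --> +oo] --> (z : C^o)} ->
    {ae P, forall w, H w Q @[Q --> +oo] --> (L : C^o)} -> z = L.
  move=> h1 h2; have [w [hz hL]] := ae_witness (filterI h1 h2).
  exact: (@cvg_unique _ (@norm_hausdorff _ C^o) _ _ _ _ hz hL).
by move=> Fa Gb FL GL; rewrite (u F a Fa FL) (u G b Gb GL).
Qed.

Hypothesis hd : d = 2%N \/ d = 3%N.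
Variables (m : R) (D : set E).
Hypothesis bD : bounded_set D.

Lemma GMIG_means (f : Omega -> distributions R d) (ac ar : E -> C) (xhat : E) (tau : R) :
  GMIG P m D ac ar f -> unit_sphere xhat -> 0 <= tau ->
  {ae P, forall w,
    (covariance_mean m (f w) xhat tau Q @[Q --> +oo] -->
       (`|Cst R d| ^+ 2 * fourier ac (tau *: xhat) : C^o)) /\
    (relation_mean m (f w) xhat tau Q @[Q --> +oo] -->
       (Cst R d ^+ 2 * fourier ar (tau *: xhat) : C^o))}.
Proof.
move=> [gf cf [sc [Hc Hcov]] [sr [Hr Hrel]]] x1 tau0.
have [M0 [_ HM]] := bD; pose L0 := `|M0| + 1.
have L00 : 0 <= L0 by rewrite addr_ge0.
have DL x : D x -> `|x| <= L0.
  by apply: HM; rewrite (le_lt_trans (ler_norm M0))// ltrDl.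
(* The cutoff is 1 one unit beyond the ball of radius L0 that carries the field, hence on a
   neighbourhood of it, as [compact_pairing] demands. *)
have [c [sc' c1 c0]] := exists_plateau (L0 + 1).
have bc : bump_on (L0 + 2) c.
  by split=> // x xL; apply: c0; rewrite (_ : L0 + 1 + 1 = L0 + 2) ?ltW//; ring.
have cD x : D x -> chi c x = 1.
  move=> Dx; rewrite /chi (cutoff_eq1 c1)//; apply: le_trans (DL x Dx) _.
  by rewrite lerDl.
have L20 : 0 <= L0 + 2 by rewrite addr_ge0.
apply: (far_field_means gf cf Hc Hcov Hr Hrel L20 bc x1 cD c1 tau0 hd).
exact: (supported_in_ball_ae gf cf Hc Hcov DL).
Qed.

Lemma GMIG_covariance_mean (f : Omega -> distributions R d) (ac ar : E -> C) (xhat : E) (tau : R) :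
  GMIG P m D ac ar f -> unit_sphere xhat -> 0 <= tau ->
  {ae P, forall w, covariance_mean m (f w) xhat tau Q @[Q --> +oo] -->
    (`|Cst R d| ^+ 2 * fourier ac (tau *: xhat) : C^o)}.
Proof. by move=> Hf x1 t0; have := GMIG_means Hf x1 t0; apply: filterS => w [h _]. Qed.

Lemma GMIG_relation_mean (f : Omega -> distributions R d) (ac ar : E -> C) (xhat : E) (tau : R) :
  GMIG P m D ac ar f -> unit_sphere xhat -> 0 <= tau ->
  {ae P, forall w, relation_mean m (f w) xhat tau Q @[Q --> +oo] -->
    (Cst R d ^+ 2 * fourier ar (tau *: xhat) : C^o)}.
Proof. by move=> Hf x1 t0; have := GMIG_means Hf x1 t0; apply: filterS => w [_ h]. Qed.

End random_source.

Unset Implicit Arguments.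

Theorem theorem3p4 (R : realType) (d : nat) (hd : d = 2%N \/ d = 3%N)
    (disp : measure_display) (Omega : measurableType disp)
    (P : probability Omega R) (hP : measure_is_complete P)
    (D : set 'rV[R]_d) (hD : bounded_domain D)
    (m : R) (hm : d%:R - 4 < m /\ m <= d%:R) :
  (forall (f : Omega -> distributions R d) (ac ar : 'rV[R]_d -> R[i]),
     GMIG P m D ac ar f ->
     forall (xhat : 'rV[R]_d) (tau : R), unit_sphere xhat -> 0 <= tau ->
       {ae P, forall w,
          (covariance_mean m (f w) xhat tau Q @[Q --> +oo] -->
             (`|Cst R d| ^+ 2 * fourier ac (tau *: xhat) : R[i]^o)) /\
          (relation_mean m (f w) xhat tau Q @[Q --> +oo] -->
             (Cst R d ^+ 2 * fourier ar (tau *: xhat) : R[i]^o))})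
  /\
  (forall Theta : set (R * 'rV[R]_d),
     relatively_open [set p | 0 < p.1 /\ unit_sphere p.2] Theta ->
     Theta !=set0 ->
     forall (f1 f2 : Omega -> distributions R d)
            (ac1 ar1 ac2 ar2 : 'rV[R]_d -> R[i]),
       GMIG P m D ac1 ar1 f1 -> GMIG P m D ac2 ar2 f2 ->
       ((forall tau xhat, Theta (tau, xhat) -> exists L : R[i],
           {ae P, forall w, covariance_mean m (f1 w) xhat tau Q @[Q --> +oo] -->
                              (L : R[i]^o)} /\
           {ae P, forall w, covariance_mean m (f2 w) xhat tau Q @[Q --> +oo] -->
                              (L : R[i]^o)}) ->
        ac1 = ac2) /\
       ((forall tau xhat, Theta (tau, xhat) -> exists L : R[i],
           {ae P, forall w, relation_mean m (f1 w) xhat tau Q @[Q --> +oo] -->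
                              (L : R[i]^o)} /\
           {ae P, forall w, relation_mean m (f2 w) xhat tau Q @[Q --> +oo] -->
                              (L : R[i]^o)}) ->
        ar1 = ar2)).
Proof.
have [_ _ _ bD] := hD; split.
  by move=> f ac ar Hf xhat tau x1 tau0; exact: (GMIG_means hd bD Hf x1 tau0).
move=> Theta oT T0 f1 f2 ac1 ar1 ac2 ar2 H1 H2.
have [U [oU U0 HU]] := polar_open_cone oT T0.
have [_ _ [? [[_ _ tac1 _] _]] [? [[_ _ tar1 _] _]]] := H1.
have [_ _ [? [[_ _ tac2 _] _]] [? [[_ _ tar2 _] _]]] := H2.
have C0 : Cst R d ^+ 2 != 0 by rewrite expf_neq0// Cst_neq0.
have C1 : `|Cst R d| ^+ 2 != 0 by rewrite expf_neq0// normr_eq0 Cst_neq0.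
split=> HL.
  apply: (eq_test_function_fourier tac1 tac2 oU U0) => xi /HU[tau [xhat [Tt tau0 x1 ->]]].
  have [L [L1 L2]] := HL tau xhat Tt.
  have h1 := GMIG_covariance_mean hd bD H1 x1 (ltW tau0).
  have h2 := GMIG_covariance_mean hd bD H2 x1 (ltW tau0).
  exact: (mulfI C1 (ae_cvg_unique h1 h2 L1 L2)).
apply: (eq_test_function_fourier tar1 tar2 oU U0) => xi /HU[tau [xhat [Tt tau0 x1 ->]]].
have [L [L1 L2]] := HL tau xhat Tt.
have h1 := GMIG_relation_mean hd bD H1 x1 (ltW tau0).
have h2 := GMIG_relation_mean hd bD H2 x1 (ltW tau0).
exact: (mulfI C0 (ae_cvg_unique h1 h2 L1 L2)).
Qed.
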